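(* Let $d\ge2$, $\alpha\in(0,1)$, and let $\mu$ be an $\alpha$-stable distribution on $\mathbb{R}^d$ with no shift, characteristic exponent $|z|^\alpha V(u_z)$, and spectral spherical measure $\lambda=P\omega$ where $0\ne P\in\mathcal{P}_{q,d}$ for some $q\in\mathbb{Z}_+$. Then the Fourier transform $\hat\mu$ is integrable and the density of $\mu$ is $$g(x)=\sum_{k=1}^\infty\frac{(-2^\alpha)^k\pi^{-d/2}}{k!\,|x|^{k\alpha+d}}\sum_{j=0}^{kq}\frac{\Gamma((j+k\alpha+d)/2)}{\Gamma((j-k\alpha)/2)}S_{j,k}(u_x),\qquad x\ne0.$$ The series converges absolutely and uniformly on $\{x:|x|\ge r\}$ for every $r>0$.
   Context: Let $d\ge 2$, $\mathbb{S}^{d-1}$ the unit sphere, $\omega$ its surface measure, $u_x=x/|x|$ for $x\ne0$. $\mathcal{P}_{q,d}$ is the set of restrictions to $\mathbb{S}^{d-1}$ of polynomials of degree at most $q$; $\pi_j$ is the orthogonal projection of $L^2(\mathbb{S}^{d-1},\omega)$ onto the space of spherical harmonics of degree $j$ (restrictions of homogeneous harmonic polynomials of degree $j$). An $\alpha$-stable distribution $\mu$ ($\alpha\ne1$) with no shift has $\hat\mu(z)=\int e^{i\langle x,z\rangle}\mu(dx)=\exp\{-|z|^\alpha V(u_z)\}$, $V(u)=\int_{\mathbb{S}^{d-1}}|\langle u,v\rangle|^\alpha[1-i\tan(\pi\alpha/2)\,\mathrm{sgn}\langle u,v\rangle]\lambda(dv)$, with $\lambda$ the spectral spherical measure. For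 integer $k\ge0$, $S_{j,k}=(-i)^j\pi_j(V^k)$. $1/\Gamma$ is the entire function vanishing at nonpositive integers. The density is $g(x)=(2\pi)^{-d}\int e^{-i\langle x,z\rangle}\hat\mu(z)dz$. *)

(* Defs.v *)
From HB Require Import structures.
From mathcomp Require Import all_boot all_order all_algebra.
From mathcomp Require Import all_classical all_reals all_analysis.
From mathcomp Require Import complex.
From mathcomp Require mpoly.

Set Implicit Arguments.
Unset Strict Implicit.
Unset Printing Implicit Defensive.

Import Order.TTheory GRing.Theory Num.Theory.
Import numFieldNormedType.Exports.
Import ComplexField Normc.

Local Open Scope ring_scope.
Local Open Scope classical_set_scope.
Local Open Scope complex_scope.

Section Defs.
Variable R : realType.

Definition vec (n : nat) := n.-tuple R.

Definition dotp n (x y : vec n) : R := \sum_(i < n) tnth x i * tnth y i.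
Definition vnorm n (x : vec n) : R := Num.sqrt (dotp x x).
Definition unitv n (x : vec n) : vec n := map_tuple (fun t => t / vnorm x) x.

Fixpoint iint (n : nat) : (n.-tuple R -> \bar R) -> \bar R :=
  match n with
  | 0 => fun f => f [tuple]
  | m.+1 => fun f =>
      (\int[@lebesgue_measure R]_t iint (fun v : m.-tuple R => f (cons_tuple t v)))%E
  end.

Definition Rint n (h : vec n -> R) : R := fine (iint (fun v => (h v)%:E)).

Definition cint n (f : vec n -> R[i]) : R[i] :=
  Complex (Rint (fun v => complex.Re (f v))) (Rint (fun v => complex.Im (f v))).

Definition cabs (z : R[i]) : R := normc z.
Definition cexp (z : R[i]) : R[i] :=
  Complex (expR (complex.Re z) * cos (complex.Im z)) (expR (complex.Re z) * sin (complex.Im z)).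

(* ---------- surface measure omega on the unit sphere ----------
   omega(A) = n * Leb({t v : 0 < t <= 1, v in A})  (cone measure). *)
Definition sint n (f : vec n -> R[i]) : R[i] :=
  n%:R%:C * cint (fun x => if (0 < vnorm x <= 1) then f (unitv x) else 0).

Definition Vexp n (alpha : R) (P : vec n -> R) (u : vec n) : R[i] :=
  sint (fun v => (`|dotp u v| `^ alpha * P v)%:C *
                 (1 - 'i * (tan (pi * alpha / 2) * Num.sg (dotp u v))%:C)).

Definition hatmu n (alpha : R) (P : vec n -> R) (z : vec n) : R[i] :=
  cexp (- ((vnorm z `^ alpha)%:C * Vexp alpha P (unitv z))).

Definition density n (alpha : R) (P : vec n -> R) (x : vec n) : R[i] :=
  ((2 * pi) `^ (- n%:R))%:C *
    cint (fun z => cexp (- ('i * (dotp x z)%:C)) * hatmu alpha P z).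

Definition polyfun n (p : mpoly.mpoly n R) (x : vec n) : R :=
  mpoly.meval (fun i => tnth x i) p.

Definition harmonic n (p : mpoly.mpoly n R) : bool :=
  \sum_(i < n) mpoly.mderiv i (mpoly.mderiv i p) == 0.

(* literal unfolding of multinomials' p \is j.-homog for mdeg *)
Definition homogeneous n (j : nat) (p : mpoly.mpoly n R) : bool :=
  all [pred m | mpoly.mdeg m == j] (mpoly.msupp p).

Definition deg_le n (q : nat) (p : mpoly.mpoly n R) : bool :=
  all [pred m | (mpoly.mdeg m <= q)%N] (mpoly.msupp p).

Definition is_sph_harm n (j : nat) (h : vec n -> R[i]) : Prop :=
  exists p1 p2 : mpoly.mpoly n R,
    [/\ homogeneous j p1, homogeneous j p2, harmonic p1, harmonic p2 &
        forall x, h x = Complex (polyfun p1 x) (polyfun p2 x)].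

Definition is_proj n (j : nat) (f h : vec n -> R[i]) : Prop :=
  is_sph_harm j h /\
  forall Y, is_sph_harm j Y -> sint (fun u => (f u - h u) * conjc (Y u)) = 0.

Definition proj n (j : nat) (f : vec n -> R[i]) : vec n -> R[i] :=
  match pselect (exists h, is_proj j f h) with
  | left e => projT1 (cid e)
  | right _ => fun _ => 0
  end.

Definition Sjk n (alpha : R) (P : vec n -> R) (j k : nat) : vec n -> R[i] :=
  fun u => (- 'i) ^+ j * proj j (fun v => Vexp alpha P v ^+ k) u.

Definition Gamma (x : R) : R :=
  fine (\int[@lebesgue_measure R]_(t in `]0%R, +oo[%classic) (t `^ (x - 1) * expR (- t))%:E)%E.

(* 1/Gamma(x) = x (x+1) ... (x+N-1) / Gamma(x+N), with N > |x|;
   entire, vanishing exactly at nonpositive integers *)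
Definition rGamma (x : R) : R :=
  let N := (Num.truncn `|x|).+1 in
  (\prod_(i < N) (x + i%:R)) / Gamma (x + N%:R).

Definition term n (alpha : R) (q : nat) (P : vec n -> R) (k : nat) (x : vec n)
  : R[i] :=
  ((- 2 `^ alpha) ^+ k * pi `^ (- (n%:R / 2)) /
     (k`!%:R * vnorm x `^ (k%:R * alpha + n%:R)))%:C *
  \sum_(j < (k * q).+1)
     (Gamma ((j%:R + k%:R * alpha + n%:R) / 2) *
      rGamma ((j%:R - k%:R * alpha) / 2))%:C * Sjk alpha P j k (unitv x).

End Defs.

(* Main.v *)
Require Import Defs.
From HB Require Import structures.
From mathcomp Require Import all_boot all_order all_algebra.
From mathcomp Require Import all_classical all_reals all_analysis.
From mathcomp Require Import complex.
From mathcomp Require mpoly.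
From mathcomp Require Import measurable_realfun.
From mathcomp Require Import ring lra zify.
(** Regularise the Fourier integral of [hatmu] by the factor [exp (- e |z|^2)]
    and integrate the exponential series of [hatmu] term by term.  By the
    Funk-Hecke formula [V] agrees on the sphere with a polynomial of degree at
    most [q], so [V^k] is a sum of harmonic polynomials [H_{j,k}] with
    [j <= k q], which are the projections of [V^k].  Writing
    [|z|^(k alpha - j)] as a mixture over [s] of [|z|^(2N) exp (- s |z|^2)],
    the Bochner-Hecke formula reduces the integral of
    [|z|^(k alpha) H_{j,k}(u_z)] to a moment of a Laguerre polynomial, which
    tends to the quotient of Gamma values as [e] tends to [0].  Uniformly in
    [e] and in [|x| >= r] these integrals are at most
    [A^k k^(k alpha + C)], which is beaten by [k!] because [alpha < 1]; hence the
    limit may be taken under the sum, and the Gaussian term [k = 0] vanishes.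
    [hatmu] is integrable because [Re V] is bounded below by a positive constant:
    if it vanished at [u], the nonnegative polynomial [<u, v>^2 P v] would
    have integral zero over the sphere, hence vanish there, and so would [P]. *)

Import Order.TTheory GRing.Theory Num.Theory.
Import numFieldNormedType.Exports.
Import ComplexField Normc.
Set Implicit Arguments.
Unset Strict Implicit.
Unset Printing Implicit Defensive.
Local Open Scope ring_scope.
Local Open Scope classical_set_scope.
Local Open Scope complex_scope.

(** * Lebesgue measure on tuples and iterated integrals *)

(** The Gaussian factor is forced: the terms [|z|^(k alpha) V(u_z)^k] of the expanded exponential
    have no convergent Fourier integral, while for [e > 0] the Gaussian beats the exponential of
    [|z|^alpha |V|]. The power [|z|^(2 N)] is there because [|z|^(- 2 b)] is a Gamma mixture of
    Gaussians only for [b > 0]; the exponent that is wanted, [(j - k alpha) / 2], is often negative,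
    so it is raised by some [N > k alpha / 2 + 1]. The resulting [1 / Gamma b] and the [N] linear
    factors of the Laguerre moment then combine to the value of [rGamma] at the wanted exponent.
    Rotations of the sphere are nowhere used. Gaussian integrals of polynomials are determined by
    one integration by parts identity in each coordinate; Bochner-Hecke, the orthogonality of
    harmonics, their sup bounds and Funk-Hecke are all drawn from it, with polar coordinates
    carrying them to the sphere. *)

Section tuple_measure.
Context {R : realType}.

Definition lebR : {sigma_finite_measure set (measurableTypeR R) -> \bar R} :=
  [the sigma_finite_measure _ _ of @lebesgue_measure R].

Definition tuple_cons n (tv : measurableTypeR R * n.-tuple R) : n.+1.-tuple R :=
  cons_tuple tv.1 tv.2.

Definition tuple_uncons n (v : n.+1.-tuple R) :
  measurableTypeR R * n.-tuple R :=
  (thead v, [tuple of behead v]).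

Lemma tuple_consK n : cancel (@tuple_cons n) (@tuple_uncons n).
Proof.
by case=> t v; rewrite /tuple_uncons /tuple_cons theadE; congr pair; apply/val_inj.
Qed.

Lemma measurable_tuple_cons n : measurable_fun setT (@tuple_cons n).
Proof. exact: measurable_cons measurable_fst measurable_snd. Qed.

Lemma measurable_tuple_uncons n : measurable_fun setT (@tuple_uncons n).
Proof.
apply/measurable_fun_pairP; split; last exact: measurable_behead.
exact: measurable_tnth.
Qed.

Lemma measurable_cons_tuple n (t : R) :
  measurable_fun [set: n.-tuple R] (fun v => cons_tuple t v).
Proof. exact: measurable_cons (@measurable_cst _ _ _ _ _ _) (@measurable_id _ _ _). Qed.

Section step.
Variables (n : nat) (m : {sigma_finite_measure set (n.-tuple R) -> \bar R}).

(** The image of the product measure under [tuple_cons], written as a set function so that it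
    receives its own sigma-finite structure, which the recursion in [lebn] has to return. *)
Definition tuple_measureS (A : set (n.+1.-tuple R)) : \bar R :=
  (lebR \x m)%E (@tuple_cons n @^-1` A).

Let mpre A : measurable A -> measurable (@tuple_cons n @^-1` A).
Proof.
by move=> mA; rewrite -[X in measurable X]setTI; exact: measurable_tuple_cons.
Qed.

Let tuple_measureS0 : tuple_measureS set0 = 0.
Proof. by rewrite /tuple_measureS preimage_set0 measure0. Qed.

Let tuple_measureS_ge0 A : (0 <= tuple_measureS A)%E.
Proof. exact: measure_ge0. Qed.

Let tuple_measureS_sigma_additive : semi_sigma_additive tuple_measureS.
Proof.
move=> F mF tF mUF; rewrite /tuple_measureS preimage_bigcup.
apply: measure_semi_sigma_additive.
- by move=> k; exact: mpre.
- apply/trivIsetP => /= i j _ _ ij; rewrite -preimage_setI.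
  by move/trivIsetP : tF => /(_ _ _ _ _ ij) ->//; rewrite preimage_set0.
- by rewrite -preimage_bigcup; exact: mpre.
Qed.

HB.instance Definition _ := isMeasure.Build _ _ _ tuple_measureS
  tuple_measureS0 tuple_measureS_ge0 tuple_measureS_sigma_additive.

Let tuple_measureS_sigma_finite : sigma_finite setT tuple_measureS.
Proof.
have /sigma_finiteP[F [TF ndF Foo]] := sigma_finiteT lebR.
have /sigma_finiteP[G [TG ndG Goo]] := sigma_finiteT m.
exists (fun k => @tuple_uncons n @^-1` (F k `*` G k)).
  rewrite -preimage_bigcup (_ : \bigcup_k _ = setT) ?preimage_setT//.
  rewrite -setXTT TF TG predeqE => -[x y]; split.
    by move=> [k _ []/= ? ?]; split; exists k.
  move=> [/= [a _ Fax] [b _ Gby]]; exists (maxn a b) => //; split.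
  - by move: x Fax; exact/subsetPset/ndF/leq_maxl.
  - by move: y Gby; exact/subsetPset/ndG/leq_maxr.
move=> k; have [mF Fk] := Foo k; have [mG Gk] := Goo k.
have mFG : measurable (F k `*` G k) by exact: measurableX.
split; first by rewrite -[X in measurable X]setTI; exact: measurable_tuple_uncons.
rewrite /tuple_measureS -comp_preimage (_ : _ @^-1` _ = F k `*` G k); last first.
  suff -> : @tuple_uncons n \o @tuple_cons n = id by [].
  by apply/funext => x; exact: tuple_consK.
by rewrite product_measure1E// lte_mul_pinfty// ge0_fin_numE.
Qed.

HB.instance Definition _ := Measure_isSigmaFinite.Build _ _ _ tuple_measureS
  tuple_measureS_sigma_finite.

End step.

(** The recursion runs parallel to that of [iint]; Fubini then turns the iterated integrals of the
    statement into integrals against one measure, where dominated convergence and changes of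
    variable are available. *)
Fixpoint lebn n : {sigma_finite_measure set (n.-tuple R) -> \bar R} :=
  if n is n'.+1 then [the sigma_finite_measure _ _ of tuple_measureS (lebn n')]
  else [the sigma_finite_measure _ _ of @dirac _ (0.-tuple R) [tuple] R].

Lemma ge0_integral_lebnS n (f : n.+1.-tuple R -> \bar R) :
  measurable_fun [set: n.+1.-tuple R] f -> (forall v, 0 <= f v)%E ->
  (\int[lebn n.+1]_v f v =
   \int[lebR]_t \int[lebn n]_v f (tuple_cons (t, v)))%E.
Proof.
move=> mf f0.
rewrite (eq_measure_integral (pushforward (lebR \x lebn n)%E (@tuple_cons n)))//.
  exact: measurable_tuple_cons.
move=> mc; rewrite ge0_integral_pushforward//.
rewrite preimage_setT /= fubini_tonelli1//.
exact: measurableT_comp (@measurable_tuple_cons n).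
Qed.

Lemma ge0_iintE n (f : n.-tuple R -> \bar R) :
  measurable_fun [set: n.-tuple R] f -> (forall v, 0 <= f v)%E ->
  iint f = (\int[lebn n]_v f v)%E.
Proof.
elim: n f => [|n IH] f mf f0.
  by rewrite /= integral_dirac//= diracT mul1e.
rewrite ge0_integral_lebnS//=; apply: eq_integral => t _; rewrite IH//.
exact: (measurableT_comp mf (measurable_cons_tuple t)).
Qed.

(** Tonelli gives measurability for nonnegative integrands, so the integral is split into its two
    parts; their difference is measurable also where both are infinite. *)
Lemma measurable_integral_section d (T : measurableType d)
    (f : T * measurableTypeR R -> \bar R) :
  measurable_fun setT f -> measurable_fun setT (fun x => \int[lebR]_t f (x, t))%E.
Proof.
move=> mf; rewrite [X in measurable_fun _ X](_ : _ =
   (fun x => \int[lebR]_t (f^\+ (x, t)) - \int[lebR]_t (f^\- (x, t)))%E); last first.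
  apply/funext => x; rewrite [LHS]integralE.
  under eq_integral do rewrite funepos_comp/=.
  by under [X in (_ - X)%E = _]eq_integral do rewrite funeneg_comp/=.
apply: emeasurable_funB.
- by apply: measurable_fun_fubini_tonelli_F => //; exact: measurable_funepos.
- by apply: measurable_fun_fubini_tonelli_F => //; exact: measurable_funeneg.
Qed.

(** The parameter space [T] is arbitrary because each inductive step moves one coordinate from the
    tuple into the parameter. The lemma serves [iintE], where the inner integrals agree only almost
    everywhere and both sides must be known to be measurable. *)
Lemma measurable_iint n d (T : measurableType d) (f : T * n.-tuple R -> \bar R) :
  measurable_fun setT f -> measurable_fun setT (fun x => iint (fun v => f (x, v))).
Proof.
elim: n d T f => [|n IH] d T f mf /=.
  apply: (measurableT_comp mf); exact: measurable_fun_pair.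
apply: (@measurable_integral_section _ _ (fun xt => iint (fun v => f (xt.1, cons_tuple xt.2 v)))).
apply: (IH _ _ (fun xtv : (T * measurableTypeR R) * n.-tuple R => f (xtv.1.1, cons_tuple xtv.1.2 xtv.2))).
apply: (measurableT_comp mf); apply: measurable_fun_pair.
  exact: (measurableT_comp measurable_fst measurable_fst).
apply: (@measurable_cons _ _ _ _ (fun xtv : (T * measurableTypeR R) * n.-tuple R => xtv.1.2)) => //.
exact: (measurableT_comp measurable_snd measurable_fst).
Qed.

Lemma integrable_lebnS n (f : n.+1.-tuple R -> \bar R) :
  (lebn n.+1).-integrable setT f ->
  (lebR \x lebn n)%E.-integrable setT (f \o @tuple_cons n).
Proof.
move=> /integrableP[mf foo]; apply/integrableP; split.
  exact: (measurableT_comp mf (@measurable_tuple_cons n)).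
move: foo; rewrite ge0_integral_lebnS//; last exact: measurableT_comp.
rewrite -(fubini_tonelli1 (fun tv => `|f (tuple_cons tv)|)%E)//.
apply: measurableT_comp => //; exact: (measurableT_comp mf (@measurable_tuple_cons n)).
Qed.

Lemma integral_lebnS n (f : n.+1.-tuple R -> \bar R) :
  (lebn n.+1).-integrable setT f ->
  (\int[lebn n.+1]_v f v =
   \int[lebR]_t \int[lebn n]_v f (tuple_cons (t, v)))%E.
Proof.
move=> intf; have mf := measurable_int _ intf.
have ic := integrable_lebnS intf.
rewrite (eq_measure_integral (pushforward (lebR \x lebn n)%E (@tuple_cons n)))//.
  exact: measurable_tuple_cons.
move=> mc; rewrite integral_pushforward//.
by rewrite preimage_setT -(integral12_prod_meas1 ic).
Qed.

Lemma iintE n (f : n.-tuple R -> \bar R) :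
  (lebn n).-integrable setT f -> iint f = (\int[lebn n]_v f v)%E.
Proof.
elim: n f => [|n IH] f intf; have mf := measurable_int _ intf.
  by rewrite /= integral_dirac//= diracT mul1e.
have ic := integrable_lebnS intf.
rewrite integral_lebnS//=; apply: ae_eq_integral => //.
- apply: (@measurable_iint _ _ _ (f \o @tuple_cons n)).
  exact: (measurableT_comp mf (@measurable_tuple_cons n)).
- exact: (measurable_fubini_F ic).
- apply: filterS (ae_integrable1 ic) => t it _.
  by rewrite IH.
Qed.

End tuple_measure.

(** * Complex-valued integrals *)

Section complex_modulus.
Context {R : realType}.
Implicit Types z w : R[i].
Local Notation Re := (@complex.Re R).
Local Notation Im := (@complex.Im R).

Lemma cReD z w : Re (z + w) = Re z + Re w. Proof. by case: z; case: w. Qed.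
Lemma cImD z w : Im (z + w) = Im z + Im w. Proof. by case: z; case: w. Qed.
Lemma cReN z : Re (- z) = - Re z. Proof. by case: z. Qed.
Lemma cImN z : Im (- z) = - Im z. Proof. by case: z. Qed.
Lemma cReB z w : Re (z - w) = Re z - Re w. Proof. by rewrite cReD cReN. Qed.
Lemma cImB z w : Im (z - w) = Im z - Im w. Proof. by rewrite cImD cImN. Qed.
Lemma cReM z w : Re (z * w) = Re z * Re w - Im z * Im w.
Proof. by case: z; case: w. Qed.
Lemma cImM z w : Im (z * w) = Re z * Im w + Im z * Re w.
Proof. by case: z => a b; case: w => c e. Qed.
Lemma cRe_sum I (r : seq I) (F : I -> R[i]) :
  Re (\sum_(i <- r) F i) = \sum_(i <- r) Re (F i).
Proof. by apply: (big_morph Re cReD). Qed.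
Lemma cIm_sum I (r : seq I) (F : I -> R[i]) :
  Im (\sum_(i <- r) F i) = \sum_(i <- r) Im (F i).
Proof. by apply: (big_morph Im cImD). Qed.
Lemma eqC z w : Re z = Re w -> Im z = Im w -> z = w.
Proof. by case: z => a b; case: w => c e /= -> ->. Qed.

Lemma cabsE z : cabs z = Num.sqrt (Re z ^+ 2 + Im z ^+ 2).
Proof. by case: z. Qed.
Lemma cabs_ge0 z : 0 <= cabs z. Proof. by rewrite cabsE sqrtr_ge0. Qed.
Lemma cabsM z w : cabs (z * w) = cabs z * cabs w. Proof. exact: normcM. Qed.
Lemma cabsD z w : cabs (z + w) <= cabs z + cabs w. Proof. exact: le_normcD. Qed.
Lemma cabsN z : cabs (- z) = cabs z. Proof. exact: normcN. Qed.
Lemma cabs0 : cabs (0 : R[i]) = 0. Proof. exact: normc0. Qed.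
Lemma cabs1 : cabs (1 : R[i]) = 1. Proof. exact: normc1. Qed.
Lemma cabsB z w : cabs (z - w) = cabs (w - z). Proof. by rewrite -cabsN opprB. Qed.
Lemma cabs_real (r : R) : cabs r%:C = `|r|.
Proof. by rewrite cabsE /= expr0n /= addr0 sqrtr_sqr. Qed.
Lemma cabsX z n : cabs (z ^+ n) = cabs z ^+ n.
Proof. by elim: n => [|n IH]; rewrite ?expr0 ?cabs1// !exprS cabsM IH. Qed.
Lemma cabs_sum I (r : seq I) (F : I -> R[i]) :
  cabs (\sum_(i <- r) F i) <= \sum_(i <- r) cabs (F i).
Proof.
elim/big_rec2: _ => [|i y x _ h]; first by rewrite cabs0.
by apply: (le_trans (cabsD _ _)); rewrite lerD2l.
Qed.
Lemma cabs_eq0 z : cabs z = 0 -> z = 0. Proof. exact: eq0_normc. Qed.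
Lemma le_Re_cabs z : `|Re z| <= cabs z.
Proof. by rewrite cabsE -sqrtr_sqr ler_wsqrtr// lerDl sqr_ge0. Qed.
Lemma le_Im_cabs z : `|Im z| <= cabs z.
Proof. by rewrite cabsE -sqrtr_sqr ler_wsqrtr// lerDr sqr_ge0. Qed.
Lemma cabs_le_ReIm z : cabs z <= `|Re z| + `|Im z|.
Proof.
rewrite cabsE -[leRHS]ger0_norm ?addr_ge0// -[leRHS]sqrtr_sqr ler_wsqrtr//.
rewrite sqrrD !real_normK ?num_real// -addrA lerD2l lerDr mulrn_wge0//.
Qed.

Lemma cabs_sqr z : (cabs z ^+ 2)%:C = z * conjc z.
Proof.
case: z => a b; rewrite cabsE sqr_sqrtr ?addr_ge0 ?sqr_ge0//.
by apply: eqC; rewrite ?cReM ?cImM /=; ring.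
Qed.
Lemma cabs_conj z : cabs (conjc z) = cabs z.
Proof. by case: z => a b; rewrite !cabsE /= sqrrN. Qed.

Lemma cexpD z w : cexp (z + w) = cexp z * cexp w.
Proof.
apply: eqC; rewrite /cexp /= cReD cImD expRD ?cosD ?sinD; first by ring.
by ring.
Qed.
Lemma cabs_cexp z : cabs (cexp z) = expR (Re z).
Proof.
rewrite cabsE /= !exprMn -mulrDr cos2Dsin2 mulr1 sqrtr_sqr.
by rewrite ger0_norm ?expR_ge0.
Qed.
Lemma cexp0 : cexp (0 : R[i]) = 1.
Proof. by rewrite /cexp /= expR0 cos0 sin0 mulr1 mulr0. Qed.
Lemma cvg_cabs0 (u : nat -> R[i]) :
  (Re (u n) @[n --> \oo] --> (0 : R)) -> (Im (u n) @[n --> \oo] --> (0 : R)) ->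
  (cabs (u n) @[n --> \oo] --> (0 : R)).
Proof.
move=> hr hi.
have h : (`|Re (u n)| + `|Im (u n)|) @[n --> \oo] --> (0 : R).
  rewrite -[X in _ --> X](addr0 (0:R)); apply: cvgD.
    by rewrite -(@normr0 _ R); apply: cvg_norm.
  by rewrite -(@normr0 _ R); apply: cvg_norm.
apply: (squeeze_cvgr _ _ h); last exact: cvg_cst.
by apply: nearW => n; rewrite cabs_ge0 cabs_le_ReIm.
Qed.

Lemma cvg_cabs0_Re (u : nat -> R[i]) (l : R[i]) :
  (cabs (u n - l) @[n --> \oo] --> (0 : R)) -> Re (u n) @[n --> \oo] --> Re l.
Proof.
move=> h; apply/cvgrPdist_le => /= e e0.
move/cvgrPdist_le : h => /(_ e e0); apply: filterS => n.
rewrite sub0r normrN ger0_norm ?cabs_ge0//; apply: le_trans.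
by rewrite distrC -cReB le_Re_cabs.
Qed.

Lemma cvg_cabs0_Im (u : nat -> R[i]) (l : R[i]) :
  (cabs (u n - l) @[n --> \oo] --> (0 : R)) -> Im (u n) @[n --> \oo] --> Im l.
Proof.
move=> h; apply/cvgrPdist_le => /= e e0.
move/cvgrPdist_le : h => /(_ e e0); apply: filterS => n.
rewrite sub0r normrN ger0_norm ?cabs_ge0//; apply: le_trans.
by rewrite distrC -cImB le_Im_cabs.
Qed.

End complex_modulus.

Section complex_integral.
Context d (T : measurableType d) {R : realType}.
Local Notation Re := (@complex.Re R).
Local Notation Im := (@complex.Im R).
Implicit Types f g : T -> R[i].

Definition cmeasurable f :=
  measurable_fun setT (fun x => Re (f x)) /\ measurable_fun setT (fun x => Im (f x)).

Lemma cmeasurable_cst (c : R[i]) : cmeasurable (fun=> c).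
Proof. by split; exact: measurable_cst. Qed.

Lemma cmeasurableD f g : cmeasurable f -> cmeasurable g ->
  cmeasurable (fun x => f x + g x).
Proof.
move=> [f1 f2] [g1 g2]; split.
  by under eq_fun do rewrite cReD; exact: measurable_funD.
by under eq_fun do rewrite cImD; exact: measurable_funD.
Qed.

Lemma cmeasurableN f : cmeasurable f -> cmeasurable (fun x => - f x).
Proof.
move=> [f1 f2]; split.
  by under eq_fun do rewrite cReN; exact: measurableT_comp.
by under eq_fun do rewrite cImN; exact: measurableT_comp.
Qed.

Lemma cmeasurableM f g : cmeasurable f -> cmeasurable g ->
  cmeasurable (fun x => f x * g x).
Proof.
move=> [f1 f2] [g1 g2]; split.
  under eq_fun do rewrite cReM.
  by apply: measurable_funB; exact: measurable_funM.
under eq_fun do rewrite cImM.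
by apply: measurable_funD; exact: measurable_funM.
Qed.

Lemma cmeasurableX f n : cmeasurable f -> cmeasurable (fun x => f x ^+ n).
Proof.
move=> mf; elim: n => [|n IH].
  by under eq_fun do rewrite expr0; exact: cmeasurable_cst.
by under eq_fun do rewrite exprS; exact: cmeasurableM.
Qed.

Lemma cmeasurable_sum I (r : seq I) (F : I -> T -> R[i]) :
  (forall i, cmeasurable (F i)) -> cmeasurable (fun x => \sum_(i <- r) F i x).
Proof.
move=> mF; elim: r => [|i r IH].
  by under eq_fun do rewrite big_nil; exact: cmeasurable_cst.
by under eq_fun do rewrite big_cons; exact: cmeasurableD.
Qed.

Lemma cmeasurable_real (h : T -> R) :
  measurable_fun setT h -> cmeasurable (fun x => (h x)%:C).
Proof. by move=> mh; split => //=; exact: measurable_cst. Qed.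

Lemma cmeasurable_conj f : cmeasurable f -> cmeasurable (fun x => conjc (f x)).
Proof.
move=> [f1 f2]; split.
  by rewrite (_ : (fun _ => _) = (fun x => Re (f x)))//; apply/funext=> x; case: (f x).
rewrite (_ : (fun _ => _) = (fun x => - Im (f x))); first exact: measurableT_comp.
by apply/funext=> x; case: (f x).
Qed.

Lemma cmeasurable_cexp f : cmeasurable f -> cmeasurable (fun x => cexp (f x)).
Proof.
move=> [f1 f2]; split => /=.
  by apply: measurable_funM; [exact: measurableT_comp|apply: measurableT_comp => //;
    exact: (continuous_measurable_fun (@continuous_cos R))].
by apply: measurable_funM; [exact: measurableT_comp|apply: measurableT_comp => //;
    exact: (continuous_measurable_fun (@continuous_sin R))].
Qed.

Lemma measurable_cabs f : cmeasurable f -> measurable_fun setT (fun x => cabs (f x)).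
Proof.
move=> [f1 f2]; under eq_fun do rewrite cabsE.
apply: measurableT_comp.
  exact: (continuous_measurable_fun (@sqrt_continuous R)).
by apply: measurable_funD; exact: measurable_funX.
Qed.

Variable mu : {measure set T -> \bar R}.

Definition cintegrable f :=
  mu.-integrable setT (fun x => (Re (f x))%:E) /\
  mu.-integrable setT (fun x => (Im (f x))%:E).

Definition cintegral f : R[i] :=
  Complex (\int[mu]_x Re (f x)) (\int[mu]_x Im (f x)).

Lemma cintegrable_cmeasurable f : cintegrable f -> cmeasurable f.
Proof.
by move=> [/measurable_int/measurable_EFinP ? /measurable_int/measurable_EFinP].
Qed.

Lemma le_cintegrable f (g : T -> R) : cmeasurable f ->
  mu.-integrable setT (fun x => (g x)%:E) -> (forall x, cabs (f x) <= g x) ->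
  cintegrable f.
Proof.
move=> [f1 f2] ig fg.
split; apply: (le_integrable _ _ _ ig) => //.
- exact/measurable_EFinP.
- move=> x _ /=; rewrite lee_fin (le_trans (le_Re_cabs _))// (le_trans (fg _))//.
  exact: ler_norm.
- exact/measurable_EFinP.
- move=> x _ /=; rewrite lee_fin (le_trans (le_Im_cabs _))// (le_trans (fg _))//.
  exact: ler_norm.
Qed.

Lemma cintegrable_cabs f : cintegrable f ->
  mu.-integrable setT (fun x => (cabs (f x))%:E).
Proof.
move=> if_; have [i1 i2] := if_; have mf := cintegrable_cmeasurable if_.
apply: (@le_integrable _ _ _ _ _ measurableT _ (fun x => `|(Re (f x))%:E| + `|(Im (f x))%:E|)%E).
- by apply/measurable_EFinP; exact: measurable_cabs.
- move=> x _ /=; rewrite lee_fin ger0_norm ?cabs_ge0// ger0_norm ?addr_ge0//.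
  exact: cabs_le_ReIm.
- by apply: integrableD => //; exact: integrable_abse.
Qed.

Lemma eq_cintegral f g : (forall x, f x = g x) -> cintegral f = cintegral g.
Proof. by move=> fg; congr cintegral; apply/funext. Qed.

Lemma cintegrable0 : cintegrable (fun=> 0).
Proof. by split; exact: integrable0. Qed.

Lemma cintegrableD f g : cintegrable f -> cintegrable g ->
  cintegrable (fun x => f x + g x).
Proof.
move=> [f1 f2] [g1 g2]; split.
  by under eq_fun do rewrite cReD EFinD; exact: integrableD.
by under eq_fun do rewrite cImD EFinD; exact: integrableD.
Qed.

Lemma cintegrableZ (c : R[i]) f : cintegrable f -> cintegrable (fun x => c * f x).
Proof.
move=> [f1 f2]; split.
  under eq_fun do rewrite cReM EFinB !EFinM.
  by apply: integrableB => //; exact: integrableZl.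
under eq_fun do rewrite cImM EFinD !EFinM.
by apply: integrableD => //; exact: integrableZl.
Qed.

Lemma cintegralD f g : cintegrable f -> cintegrable g ->
  cintegral (fun x => f x + g x) = cintegral f + cintegral g.
Proof.
move=> [f1 f2] [g1 g2]; apply: eqC => /=.
  by under eq_Rintegral do rewrite cReD; rewrite RintegralD.
by under eq_Rintegral do rewrite cImD; rewrite RintegralD.
Qed.

Lemma cintegralZ (c : R[i]) f : cintegrable f ->
  cintegral (fun x => c * f x) = c * cintegral f.
Proof.
move=> [f1 f2].
have iZ (a : R) (p : R[i] -> R) : mu.-integrable setT (fun x => (p (f x))%:E) ->
    mu.-integrable setT (EFin \o (fun x => a * p (f x))).
  by move=> ip; rewrite /comp; under eq_fun do rewrite EFinM; exact: integrableZl.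
apply: eqC.
  rewrite cReM /=; under eq_Rintegral do rewrite cReM.
  by rewrite RintegralB ?RintegralZl//; exact: iZ.
rewrite cImM /=; under eq_Rintegral do rewrite cImM.
by rewrite RintegralD ?RintegralZl//; exact: iZ.
Qed.

Lemma cintegralZr (c : R[i]) f : cintegrable f ->
  cintegral (fun x => f x * c) = cintegral f * c.
Proof.
by move=> if_; rewrite mulrC -cintegralZ//; apply: eq_cintegral => x; rewrite mulrC.
Qed.

Lemma cintegrableN f : cintegrable f -> cintegrable (fun x => - f x).
Proof.
by move=> h; have := cintegrableZ (-1) h; under eq_fun do rewrite mulN1r.
Qed.

Lemma cintegralN f : cintegrable f -> cintegral (fun x => - f x) = - cintegral f.
Proof.
by move=> h; rewrite -mulN1r -cintegralZ//; apply: eq_cintegral => x; rewrite mulN1r.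
Qed.

Lemma cintegrableB f g : cintegrable f -> cintegrable g ->
  cintegrable (fun x => f x - g x).
Proof. by move=> h1 h2; apply: cintegrableD => //; exact: cintegrableN. Qed.

Lemma cintegralB f g : cintegrable f -> cintegrable g ->
  cintegral (fun x => f x - g x) = cintegral f - cintegral g.
Proof.
by move=> h1 h2; rewrite cintegralD ?cintegralN//; exact: cintegrableN.
Qed.

Lemma cintegral0 : cintegral (fun=> 0) = 0.
Proof. by apply: eqC; rewrite /= Rintegral_cst// mul0r. Qed.

Lemma cintegrable_sum I (r : seq I) (F : I -> T -> R[i]) :
  (forall i, cintegrable (F i)) -> cintegrable (fun x => \sum_(i <- r) F i x).
Proof.
move=> iF; elim: r => [|i r IH].
  by under eq_fun do rewrite big_nil; exact: cintegrable0.
by under eq_fun do rewrite big_cons; exact: cintegrableD.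
Qed.

Lemma cintegral_sum I (r : seq I) (F : I -> T -> R[i]) :
  (forall i, cintegrable (F i)) ->
  cintegral (fun x => \sum_(i <- r) F i x) = \sum_(i <- r) cintegral (F i).
Proof.
move=> iF; elim: r => [|i r IH].
  by rewrite big_nil -[RHS]cintegral0; apply: eq_cintegral => x; rewrite big_nil.
rewrite big_cons -IH -cintegralD//; last exact: cintegrable_sum.
by apply: eq_cintegral => x; rewrite big_cons.
Qed.

(** The factor 2 comes from bounding the real and the imaginary part separately; it only enlarges
    constants later on. *)
Lemma cabs_cintegral_le f (g : T -> R) : cintegrable f ->
  mu.-integrable setT (fun x => (g x)%:E) -> (forall x, cabs (f x) <= g x) ->
  cabs (cintegral f) <= 2 * \int[mu]_x g x.
Proof.
move=> [f1 f2] ig fg.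
apply: (le_trans (cabs_le_ReIm _)) => /=; rewrite mulr2n mulrDl mul1r.
by apply: lerD; apply: (le_trans (le_normr_Rintegral _ _)) => //;
  apply: le_Rintegral => //;
  [exact: (integrable_abse f1)|move=> x _; exact: (le_trans (le_Re_cabs _))
  |exact: (integrable_abse f2)|move=> x _; exact: (le_trans (le_Im_cabs _))].
Qed.

Lemma cintegral_real (h : T -> R) : mu.-integrable setT (fun x => (h x)%:E) ->
  cintegral (fun x => (h x)%:C) = (\int[mu]_x h x)%:C.
Proof. by move=> ih; apply: eqC => //=; rewrite Rintegral_cst// mul0r. Qed.

Lemma cintegrable_real (h : T -> R) : mu.-integrable setT (fun x => (h x)%:E) ->
  cintegrable (fun x => (h x)%:C).
Proof. by move=> ih; split=> //=; exact: integrable0. Qed.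

Lemma cdominated_convergence (f_ : nat -> T -> R[i]) f (g : T -> R) :
  (forall n, cmeasurable (f_ n)) -> cmeasurable f ->
  (forall x, cabs (f_ n x - f x) @[n --> \oo] --> (0 : R)) ->
  mu.-integrable setT (fun x => (g x)%:E) ->
  (forall n x, cabs (f_ n x) <= g x) ->
  cabs (cintegral (f_ n) - cintegral f) @[n --> \oo] --> (0 : R).
Proof.
move=> mf_ mf cf ig fg.
have key (p : R[i] -> R) : (forall z, `|p z| <= cabs z) ->
    (forall n, measurable_fun setT (fun x => p (f_ n x))) ->
    measurable_fun setT (fun x => p (f x)) ->
    (forall x, p (f_ n x) @[n --> \oo] --> p (f x)) ->
    (\int[mu]_x p (f_ n x) - \int[mu]_x p (f x)) @[n --> \oo] --> (0 : R).
  move=> pc mp mpf cp.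
  have [|||||i _ h] := @dominated_convergence _ _ _ mu _ measurableT
    (fun n x => (p (f_ n x))%:E) (fun x => (p (f x))%:E) (fun x => (g x)%:E).
  - by move=> n; exact/measurable_EFinP.
  - exact/measurable_EFinP.
  - by apply: aeW => x _; apply: cvg_EFin; [exact: nearW|exact: cp].
  - exact: ig.
  - by apply: aeW => x n _; rewrite lee_fin (le_trans (pc _)).
  rewrite -[X in _ --> X](subrr (\int[mu]_x p (f x))).
  apply: cvgB; last exact: cvg_cst.
  apply: fine_cvg; rewrite fineK//; exact: integrable_fin_num.
apply: cvg_cabs0 => /=.
  apply: (key Re) => //; [exact: le_Re_cabs|by move=> n; case: (mf_ n)|by case: mf|].
  by move=> x; exact: cvg_cabs0_Re.
apply: (key Im) => //; [exact: le_Im_cabs|by move=> n; case: (mf_ n)|by case: mf|].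
by move=> x; exact: cvg_cabs0_Im.
Qed.

End complex_integral.

Section complex_Fubini.
Context d1 d2 (T1 : measurableType d1) (T2 : measurableType d2) {R : realType}.
Local Notation Re := (@complex.Re R).
Local Notation Im := (@complex.Im R).
Variable m1 : {sigma_finite_measure set T1 -> \bar R}.
Variable m2 : {sigma_finite_measure set T2 -> \bar R}.

(** Integrability passes from the modulus to the real and imaginary parts. Real integrals being
    [fine] of extended ones, the inner integrals are compared only at almost every point, where the
    sections are integrable. *)
Lemma cFubini (f : T1 * T2 -> R[i]) :
  cmeasurable f -> (\int[m1]_x \int[m2]_y (cabs (f (x, y)))%:E < +oo)%E ->
  cintegral m1 (fun x => cintegral m2 (fun y => f (x, y))) =
  cintegral m2 (fun y => cintegral m1 (fun x => f (x, y))).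
Proof.
move=> mf foo.
have key (p : R[i] -> R) : (forall z, `|p z| <= cabs z) ->
    measurable_fun setT (fun x => p (f x)) ->
    (m1 \x m2)%E.-integrable setT (fun z => (p (f z))%:E).
  move=> pc mp; apply/integrable12ltyP; first exact/measurable_EFinP.
  apply: le_lt_trans foo; apply: ge0_le_integral => //.
  - by move=> x _; exact: integral_ge0.
  - apply: (measurable_fun_fubini_tonelli_F (fun z => `|(p (f z))%:E|%E)) => //.
    by apply: measurableT_comp => //; exact/measurable_EFinP.
  - apply: (measurable_fun_fubini_tonelli_F (fun z => (cabs (f z))%:E)) => //.
      by apply/measurable_EFinP; exact: measurable_cabs.
    by move=> z; rewrite lee_fin cabs_ge0.
  - move=> x _; apply: ge0_le_integral => //.
    + apply: measurableT_comp => //; apply/measurable_EFinP.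
      by apply: (measurableT_comp mp); exact: measurable_pair1.
    + apply/measurable_EFinP; apply: (measurableT_comp (measurable_cabs mf)).
      exact: measurable_pair1.
    + by move=> y _; rewrite lee_fin.
have key2 (p : R[i] -> R) : (m1 \x m2)%E.-integrable setT (fun z => (p (f z))%:E) ->
  \int[m1]_x \int[m2]_y p (f (x, y)) = \int[m2]_y \int[m1]_x p (f (x, y)).
  move=> ip; rewrite /Rintegral; congr fine.
  transitivity (\int[m1]_x \int[m2]_y (p (f (x, y)))%:E)%E.
    apply: ae_eq_integral => //.
    - apply/measurable_EFinP; apply: measurableT_comp => //.
      exact: (measurable_fubini_F ip).
    - exact: (measurable_fubini_F ip).
    - apply: filterS (ae_integrable1 ip) => x ix _; rewrite fineK//.
      exact: integrable_fin_num.
  rewrite (Fubini ip); apply: ae_eq_integral => //.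
    - exact: (measurable_fubini_G ip).
    - apply/measurable_EFinP; apply: measurableT_comp => //.
      exact: (measurable_fubini_G ip).
    - apply: filterS (ae_integrable2 ip) => x ix _; rewrite fineK//.
      exact: integrable_fin_num.
apply: eqC => /=; apply: key2; apply: key.
- exact: le_Re_cabs.
- by case: mf.
- exact: le_Im_cabs.
- by case: mf.
Qed.

End complex_Fubini.

(** * Affine changes of variable for Lebesgue measure *)

Section lebesgue_affine.
Context {R : realType}.

Section affine.
Variables (c a : R).
Hypothesis c0 : 0 < c.

Let phi (x : measurableTypeR R) : measurableTypeR R := c * x + a.

Let mphi : measurable_fun setT phi.
Proof. by apply: measurable_funD => //; exact: measurable_funM. Qed.

Let preim (x y : R) : phi @^-1` `]x, y]%classic = `](x - a) / c, (y - a) / c]%classic.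
Proof.
apply/seteqP; split=> t; rewrite /preimage /= !in_itv /= /phi;
  by rewrite ltr_pdivrMr// ler_pdivlMr// ltrBlDr lerBrDr mulrC.
Qed.

(** Lebesgue measure is the only measure that gives half-open intervals their length, and [c] times
    its image under [phi] does so too. *)
Lemma ge0_integral_affine (f : R -> \bar R) :
  measurable_fun setT f -> (forall x, 0 <= f x)%E ->
  (\int[lebR]_x f (c * x + a)%R = c^-1%:E * \int[lebR]_x f x)%E.
Proof.
move=> mf f0.
have cV : 0 <= c^-1 by rewrite invr_ge0 ltW.
have E A : measurable A ->
    pushforward (@lebesgue_measure R) phi A = mscale (NngNum cV) (@lebesgue_measure R) A.
  move=> mA.
  have h := @lebesgue_measure_unique R (mscale (NngNum (ltW c0)) (pushforward (@lebesgue_measure R) phi)).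
  rewrite /mscale /= h//; last first.
    move=> X oX; have {X oX}[[x y] _ <-] := oX.
    transitivity (c%:E * @lebesgue_measure R (phi @^-1` `]x, y]%classic))%E; last by [].
    rewrite preim !lebesgue_measure_itv /=.
    rewrite !lte_fin ltr_pM2r ?invr_gt0// ltrD2r; case: ifPn => _; last by rewrite mule0.
    by rewrite -!EFinB -EFinM; congr EFin; field; rewrite gt_eqF.
  by rewrite /mscale /= muleA -EFinM mulVf ?gt_eqF// mul1e.
transitivity (\int[pushforward (@lebesgue_measure R) phi]_x f x)%E.
  by rewrite ge0_integral_pushforward.
rewrite (eq_measure_integral (mscale (NngNum cV) (@lebesgue_measure R))).
  by rewrite ge0_integral_mscale.
by move=> A mA _; exact: E.
Qed.

End affine.

Lemma ge0_integral_scaleR (c : R) (f : R -> \bar R) : 0 < c ->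
  measurable_fun setT f -> (forall x, 0 <= f x)%E ->
  (\int[lebR]_x f (c * x)%R = c^-1%:E * \int[lebR]_x f x)%E.
Proof.
move=> c0 mf f0; rewrite -(ge0_integral_affine 0)//.
by apply: eq_integral => x _; rewrite addr0.
Qed.

Lemma integral_shiftR (a : R) (f : R -> R) :
  lebR.-integrable setT (fun x => (f x)%:E) ->
  \int[lebR]_x f (x + a) = \int[lebR]_x f x.
Proof.
move=> itf; have mf := measurable_int _ itf.
rewrite /Rintegral integralE [in RHS]integralE; congr (fine (_ - _)).
  rewrite -[RHS]mul1e -[1%E]/(1%:E) -[X in X%:E](invr1) -(ge0_integral_affine a)//.
    by apply: eq_integral => x _; rewrite !funeposE mul1r.
  exact: measurable_funepos.
rewrite -[RHS]mul1e -[1%E]/(1%:E) -[X in X%:E](invr1) -(ge0_integral_affine a)//.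
  by apply: eq_integral => x _; rewrite !funenegE mul1r.
exact: measurable_funeneg.
Qed.

Definition scalev n (c : R) (v : n.-tuple R) : n.-tuple R := map_tuple (fun t => c * t) v.

Lemma tnth_scalev n c (v : n.-tuple R) i : tnth (scalev c v) i = c * tnth v i.
Proof. by rewrite tnth_map. Qed.

Lemma measurable_scalev n (c : R) :
  measurable_fun [set: n.-tuple R] (@scalev n c).
Proof.
apply/measurable_fun_tnthP => i.
rewrite (_ : _ \o _ = (fun v => c * tnth v i)); last first.
  by apply/funext => v /=; rewrite tnth_scalev.
by apply: measurable_funM => //; exact: measurable_tnth.
Qed.

Lemma ge0_integral_scalev n (c : R) (f : n.-tuple R -> \bar R) : 0 < c ->
  measurable_fun [set: n.-tuple R] f -> (forall v, 0 <= f v)%E ->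
  (\int[lebn n]_v f (scalev c v) = (c ^- n)%:E * \int[lebn n]_v f v)%E.
Proof.
move=> c0; elim: n f => [|n IH] f mf f0.
  rewrite expr0 invr1 mul1e; apply: eq_integral => v _; congr f.
  by apply: eq_from_tnth => -[].
rewrite ge0_integral_lebnS//; last exact: (measurableT_comp mf (@measurable_scalev _ c)).
rewrite [in RHS]ge0_integral_lebnS//.
pose g t := (\int[lebn n]_v f (tuple_cons (t, v)))%E.
have mfc : measurable_fun setT (f \o @tuple_cons R n).
  exact: (measurableT_comp mf (@measurable_tuple_cons R n)).
have mg : measurable_fun setT g.
  by apply: (measurable_fun_fubini_tonelli_F (f \o @tuple_cons R n)) => // x; exact: f0.
transitivity (\int[lebR]_t ((c ^- n)%:E * g (c * t)%R))%E.
  apply: eq_integral => t _; rewrite -IH//; last first.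
    exact: (measurableT_comp mf (measurable_cons_tuple (c * t))).
  by apply: eq_integral => v _; congr f; apply/val_inj.
rewrite ge0_integralZl; [|by []|..]; last 3 first.
- by apply: (measurableT_comp mg); exact: measurable_funM.
- by move=> t _; exact: integral_ge0.
- by rewrite lee_fin invr_ge0 exprn_ge0// ltW.
rewrite ge0_integral_scaleR//; last by move=> t; exact: integral_ge0.
by rewrite muleA -EFinM exprSr invfM mulrC.
Qed.

End lebesgue_affine.

(** * Integrals of products over the coordinates *)

Section tuple_products.
Context {R : realType}.

Lemma tnth_tuple_consS n t (v : n.-tuple R) i :
  tnth (tuple_cons (t, v)) (lift ord0 i) = tnth v i.
Proof. by rewrite tnthS. Qed.

Lemma integral_lebn0 (f : 0.-tuple R -> \bar R) : (\int[lebn 0]_v f v = f [tuple])%E.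
Proof.
rewrite (_ : f = cst (f [tuple])); last first.
  by apply/funext => v; rewrite /= [v]tuple0.
by rewrite /= integral_dirac//= diracT mul1e.
Qed.

Lemma measurable_prod_tnth n (h : 'I_n -> R -> R) :
  (forall i, measurable_fun setT (h i)) ->
  measurable_fun [set: n.-tuple R] (fun v => \prod_(i < n) h i (tnth v i)).
Proof.
move=> mh; apply: measurable_prod => i _.
exact: (measurableT_comp (mh i) (@measurable_tnth _ _ _ _)).
Qed.

Lemma ge0_integral_prod_tnth n (h : 'I_n -> R -> R) :
  (forall i, measurable_fun setT (h i)) -> (forall i t, 0 <= h i t) ->
  (\int[lebn n]_v (\prod_(i < n) h i (tnth v i))%:E =
   \prod_(i < n) \int[lebR]_t (h i t)%:E)%E.
Proof.
elim: n h => [|n IH] h mh h0.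
  by rewrite integral_lebn0 !big_ord0.
rewrite ge0_integral_lebnS//; last 2 first.
- by apply/measurable_EFinP; exact: measurable_prod_tnth.
- by move=> v; rewrite lee_fin prodr_ge0.
rewrite big_ord_recl -IH//.
transitivity (\int[lebR]_t ((h ord0 t)%:E *
    \int[lebn n]_v (\prod_(i < n) h (lift ord0 i) (tnth v i))%:E))%E.
  apply: eq_integral => t _; rewrite -ge0_integralZl//.
  - apply: eq_integral => v _; rewrite big_ord_recl -EFinM; congr (_ * _)%:E.
    by apply: eq_bigr => i _; rewrite tnth_tuple_consS.
  - apply/measurable_EFinP.
    exact: (@measurable_prod_tnth n (fun i => h (lift ord0 i))).
  - by move=> v _; rewrite lee_fin prodr_ge0.
  - by rewrite lee_fin.
rewrite ge0_integralZr//.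
- by apply/measurable_EFinP; exact: mh.
- by move=> t _; rewrite lee_fin.
- by apply: integral_ge0 => v _; rewrite lee_fin prodr_ge0.
Qed.

Lemma integrable_prod_tnth n (h : 'I_n -> R -> R) :
  (forall i t, 0 <= h i t) ->
  (forall i, lebR.-integrable setT (fun t => (h i t)%:E)) ->
  (lebn n).-integrable setT (fun v => (\prod_(i < n) h i (tnth v i))%:E).
Proof.
move=> h0 ih.
have mh i : measurable_fun setT (h i).
  by have /measurable_EFinP := measurable_int _ (ih i).
apply/integrableP; split.
  by apply/measurable_EFinP; exact: measurable_prod_tnth.
under eq_integral do rewrite gee0_abs ?lee_fin ?prodr_ge0//.
rewrite ge0_integral_prod_tnth//.
rewrite ltey_eq; apply/orP; left; elim/big_ind : _ => // [x y|i _].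
  exact: fin_numM.
exact: integrable_fin_num.
Qed.

Lemma cintegral_lebnS n (f : n.+1.-tuple R -> R[i]) : cintegrable (lebn n.+1) f ->
  cintegral (lebn n.+1) f =
  cintegral lebR (fun t => cintegral (lebn n) (fun v => f (tuple_cons (t, v)))).
Proof.
have key (p : R[i] -> R) : (lebn n.+1).-integrable setT (fun v => (p (f v))%:E) ->
    \int[lebn n.+1]_v p (f v) = \int[lebR]_t \int[lebn n]_v p (f (tuple_cons (t, v))).
  move=> ip; rewrite /Rintegral integral_lebnS//; congr fine.
  have ic := integrable_lebnS ip.
  apply: ae_eq_integral => //.
  - exact: (measurable_fubini_F ic).
  - apply/measurable_EFinP; apply: measurableT_comp => //.
    exact: (measurable_fubini_F ic).
  - apply: filterS (ae_integrable1 ic) => x ix _; rewrite fineK//.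
    exact: integrable_fin_num.
by move=> [i1 i2]; apply: eqC => /=; exact: key.
Qed.

Lemma cmeasurable_comp d1 d2 (T1 : measurableType d1) (T2 : measurableType d2)
    (f : T2 -> R[i]) (g : T1 -> T2) :
  cmeasurable f -> measurable_fun setT g -> cmeasurable (fun x => f (g x)).
Proof. by move=> [m1 m2] mg; split; [exact: (measurableT_comp m1 mg)|exact: (measurableT_comp m2 mg)]. Qed.

Lemma cmeasurable_prod d (T : measurableType d) I (r : seq I) (F : I -> T -> R[i]) :
  (forall i, cmeasurable (F i)) -> cmeasurable (fun x => \prod_(i <- r) F i x).
Proof.
move=> mF; elim: r => [|i r IH].
  by under eq_fun do rewrite big_nil; exact: cmeasurable_cst.
by under eq_fun do rewrite big_cons; exact: cmeasurableM.
Qed.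

Lemma cabs_prod I (r : seq I) (F : I -> R[i]) :
  cabs (\prod_(i <- r) F i) = \prod_(i <- r) cabs (F i).
Proof. by apply: (big_morph (@cabs R)); [exact: cabsM|exact: cabs1]. Qed.

Lemma cintegrable_prod_tnth n (F : 'I_n -> R -> R[i]) :
  (forall i, cintegrable lebR (F i)) ->
  cintegrable (lebn n) (fun v => \prod_(i < n) F i (tnth v i)).
Proof.
move=> iF; apply: (@le_cintegrable _ _ _ _ _ (fun v => \prod_(i < n) cabs (F i (tnth v i)))).
- apply: cmeasurable_prod => i.
  by apply: (cmeasurable_comp (cintegrable_cmeasurable (iF i))); exact: measurable_tnth.
- apply: (@integrable_prod_tnth n (fun i t => cabs (F i t))) => // [i t|i].
    exact: cabs_ge0.
  exact: cintegrable_cabs.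
- by move=> v; rewrite cabs_prod.
Qed.

Lemma cintegral_prod_tnth n (F : 'I_n -> R -> R[i]) :
  (forall i, cintegrable lebR (F i)) ->
  cintegral (lebn n) (fun v => \prod_(i < n) F i (tnth v i)) =
  \prod_(i < n) cintegral lebR (F i).
Proof.
elim: n F => [|n IH] F iF.
  by rewrite /cintegral /Rintegral !integral_lebn0 !big_ord0.
rewrite cintegral_lebnS; last exact: cintegrable_prod_tnth.
rewrite big_ord_recl -IH// -cintegralZr//.
apply: eq_cintegral => t; rewrite -cintegralZ; last first.
  exact: (@cintegrable_prod_tnth n (fun i => F (lift ord0 i))).
apply: eq_cintegral => v; rewrite big_ord_recl; congr (_ * _).
by apply: eq_bigr => i _; rewrite tnth_tuple_consS.
Qed.

End tuple_products.

(** * Gaussian moments *)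

Section gauss_moments.
Context {R : realType}.

(** The inequality [x / n <= expR (x / n)], raised to the power [n]. *)
Lemma exprn_le_expR (x : R) n : 0 <= x -> x ^+ n <= n%:R ^+ n * expR x.
Proof.
move=> x0; case: n => [|n]; first by rewrite !expr0 mul1r -expR0 ler_expR.
have -> : expR x = expR (x / n.+1%:R) ^+ n.+1.
  by rewrite -expRM_natl; congr expR; rewrite mulrC divfK// pnatr_eq0.
rewrite -exprMn lerXn2r ?nnegrE ?mulr_ge0 ?expR_ge0//.
rewrite -ler_pdivrMl ?ltr0n// mulrC.
by apply: le_trans (expR_ge1Dx _); rewrite lerDr.
Qed.

Lemma gauss_scaleE (s : R) : 0 < s ->
  (\int[lebR]_t (expR (- (s * t ^+ 2)))%:E = (Num.sqrt (pi / s))%:E)%E.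
Proof.
move=> s0; have q0 : 0 < Num.sqrt s by rewrite sqrtr_gt0.
have := @ge0_integral_scaleR R (Num.sqrt s) (fun t => (gauss_fun t)%:E) q0.
have -> : (\int[lebR]_x (gauss_fun (Num.sqrt s * x))%:E =
           \int[lebR]_t (expR (- (s * t ^+ 2)))%:E)%E.
  apply: eq_integral => t _; rewrite /gauss_fun exprMn sqr_sqrtr//; exact: ltW.
move=> ->.
- rewrite integralT_gauss -EFinM; congr EFin.
  by rewrite sqrtrM ?pi_ge0// [RHS]mulrC; congr (_ * _); rewrite sqrtrV// ltW.
- by apply/measurable_EFinP; exact: measurable_gauss_fun.
- by move=> x; rewrite lee_fin gauss_fun_ge0.
Qed.

Lemma measurable_gauss (s : R) : measurable_fun setT (fun t : R => expR (- (s * t ^+ 2))).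
Proof.
apply: measurableT_comp => //; apply: measurableT_comp => //.
by apply: measurable_funM => //; exact: measurable_funX.
Qed.

Lemma integrable_gauss (s : R) : 0 < s ->
  lebR.-integrable setT (fun t => (expR (- (s * t ^+ 2)))%:E).
Proof.
move=> s0; apply/integrableP; split.
  by apply/measurable_EFinP; exact: measurable_gauss.
under eq_integral do rewrite gee0_abs ?lee_fin ?expR_ge0//.
by rewrite gauss_scaleE// ltry.
Qed.

Lemma pow_gauss_le (s : R) n : 0 < s -> exists2 C : R, 0 <= C &
  forall t, `|t| ^+ n * expR (- (s * t ^+ 2)) <= C * expR (- (s / 2 * t ^+ 2)).
Proof.
move=> s0; exists (1 + (2 / s) ^+ n * n%:R ^+ n).
  by rewrite addr_ge0// mulr_ge0 ?exprn_ge0// divr_ge0// ltW.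
move=> t.
have -> : expR (- (s * t ^+ 2)) = expR (- (s / 2 * t ^+ 2)) * expR (- (s / 2 * t ^+ 2)).
  by rewrite -expRD; congr expR; field.
rewrite mulrA ler_wpM2r ?expR_ge0// expRN ler_pdivrMr ?expR_gt0//.
set y := s / 2 * t ^+ 2.
have y0 : 0 <= y by rewrite mulr_ge0 ?sqr_ge0// divr_ge0// ltW.
have e1 : 1 <= expR y by rewrite -expR0 ler_expR.
have t2 : (`|t| ^+ n) ^+ 2 = (2 / s) ^+ n * y ^+ n.
  rewrite -exprMn -exprM mulnC exprM real_normK ?num_real//; congr (_ ^+ _).
  by rewrite /y; field; rewrite gt_eqF.
have h := exprn_le_expR n y0.
rewrite mulrDl mul1r.
(* Passing to [|t|^(2 n)] gives a power of [t^2], which half of the Gaussian exponent can absorb. *)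
have : `|t| ^+ n <= 1 + (`|t| ^+ n) ^+ 2.
  have := sqr_ge0 (`|t| ^+ n - 1); rewrite sqrrB1.
  by have := exprn_ge0 n (normr_ge0 t); nra.
move=> /le_trans; apply; apply: lerD => //.
by rewrite t2 -mulrA ler_wpM2l// exprn_ge0// divr_ge0// ltW.
Qed.

Lemma integrable_pow_gauss (s : R) n : 0 < s ->
  lebR.-integrable setT (fun t => (`|t| ^+ n * expR (- (s * t ^+ 2)))%:E).
Proof.
move=> s0; have [C C0 hC] := pow_gauss_le n s0.
have s20 : 0 < s / 2 by rewrite divr_gt0.
apply: (le_integrable measurableT _ _ (@integrableZl _ _ _ _ _ measurableT C _ (integrable_gauss s20))).
  apply/measurable_EFinP; apply: measurable_funM; last exact: measurable_gauss.
  by apply: (@measurable_funX _ _ _ _ (fun x : R => `|x|)); exact: normr_measurable.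
move=> t _ /=; rewrite lee_fin ger0_norm ?mulr_ge0 ?exprn_ge0 ?expR_ge0//.
exact: le_trans (hC t) (ler_norm _).
Qed.

(** Integration by parts on the line without boundary terms: the fundamental theorem on growing
    symmetric intervals, with dominated convergence for the integral and decay of [f] at both
    ends. *)
Lemma integral_derivative0 (f f' : R -> R) :
  (forall x : R, is_derive x (1 : R) f (f' x)) -> continuous f' ->
  lebR.-integrable setT (fun t => (f' t)%:E) ->
  (f n.+1%:R @[n --> \oo] --> (0 : R)) -> (f (- n.+1%:R) @[n --> \oo] --> (0 : R)) ->
  \int[lebR]_t f' t = 0.
Proof.
move=> df cf' if' fp fm.
(* The endpoints are [n.+1] so that no interval is reduced to a point. *)
pose I n := `[(- n.+1%:R : R), n.+1%:R]%classic.
have mf' : measurable_fun setT f' by exact: continuous_measurable_fun.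
have FTC n : \int[lebR]_(t in I n) f' t = f n.+1%:R - f (- n.+1%:R).
  rewrite /Rintegral /I (@continuous_FTC2 _ f' f)//.
  - by rewrite -subr_gt0 opprK addr_gt0 ?ltr0n.
  - exact: continuous_subspaceT.
  - have cf : continuous f.
      move=> x; apply: differentiable_continuous; apply/derivable1_diffP.
      exact: (@ex_derive _ _ _ _ _ _ _ (df x)).
    split.
    + by move=> x _; exact: (@ex_derive _ _ _ _ _ _ _ (df x)).
    + exact: cvg_at_right_filter (cf _).
    + exact: cvg_at_left_filter (cf _).
  - by move=> x _; rewrite derive1E (@derive_val _ _ _ _ _ _ _ (df x)).
have c1 : (\int[lebR]_(t in I n) f' t) @[n --> \oo] --> (0 : R).
  rewrite (_ : (fun _ => _) = (fun n => f n.+1%:R - f (- n.+1%:R))); last first.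
    by apply/funext => n; rewrite FTC.
  by rewrite -[X in _ --> X](subrr (0 : R)); apply: cvgB.
have c2 : (\int[lebR]_(t in I n) f' t) @[n --> \oo] --> (\int[lebR]_t f' t).
  have [|||||_ _ h] := @dominated_convergence _ _ _ lebR _ measurableT
    (fun n t => ((f' \_ (I n)) t)%:E) (fun t => (f' t)%:E) (fun t => `|(f' t)%:E|)%E.
  - move=> n; apply/measurable_EFinP.
    exact: ((measurable_restrictT f' (measurable_itv _)).1 (measurable_funTS mf')).
  - exact/measurable_EFinP.
  - apply: aeW => t _; apply: cvg_near_cst.
    near=> n; have It : I n t.
      rewrite /I /= in_itv /= -ler_norml.
      near: n; exists (Num.truncn `|t|) => // n /= tn.
      by apply: le_trans (ltW (truncnS_gt _)) _; rewrite ler_nat.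
    by rewrite patchE mem_set.
  - exact: integrable_abse.
  - apply: aeW => t n _; rewrite lee_fin patchE; case: ifP => //.
    by rewrite normr0.
  rewrite (_ : (fun _ => _) = fine \o (fun n => (\int[lebR]_t ((f' \_ (I n)) t)%:E))%E); last first.
    by apply/funext => n; rewrite Rintegral_mkcond.
  apply: fine_cvg; rewrite fineK//; exact: integrable_fin_num.
exact: (cvg_unique _ c2 c1).
Unshelve. all: by end_near.
Qed.

Definition gpow (s : R) n (t : R) := t ^+ n * expR (- (s * t ^+ 2)).

Lemma measurable_gpow s n : measurable_fun setT (gpow s n).
Proof.
by apply: measurable_funM; [exact: measurable_funX|exact: measurable_gauss].
Qed.

Lemma norm_gpow s n t : `|gpow s n t| = `|t| ^+ n * expR (- (s * t ^+ 2)).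
Proof. by rewrite normrM normrX (ger0_norm (expR_ge0 _)). Qed.

Lemma measurable_cosM (xi : R) : measurable_fun setT (fun t : R => cos (xi * t)).
Proof.
apply: (measurableT_comp (continuous_measurable_fun (@continuous_cos R))).
exact: measurable_funM.
Qed.

Lemma measurable_sinM (xi : R) : measurable_fun setT (fun t : R => sin (xi * t)).
Proof.
apply: (measurableT_comp (continuous_measurable_fun (@continuous_sin R))).
exact: measurable_funM.
Qed.

Lemma integrable_gpow_bounded s n (h : R -> R) : 0 < s ->
  measurable_fun setT h -> (forall t, `|h t| <= 1) ->
  lebR.-integrable setT (fun t => (gpow s n t * h t)%:E).
Proof.
move=> s0 mh h1; apply: (le_integrable measurableT _ _ (integrable_pow_gauss n s0)).
  by apply/measurable_EFinP; apply: measurable_funM => //; exact: measurable_gpow.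
move=> t _ /=; rewrite lee_fin normrM norm_gpow [leRHS]ger0_norm; last first.
  by rewrite mulr_ge0 ?exprn_ge0 ?expR_ge0.
by rewrite ler_piMr// mulr_ge0 ?exprn_ge0 ?expR_ge0.
Qed.

Lemma norm_cos_le1 (x : R) : `|cos x| <= 1.
Proof. by rewrite ler_norml cos_geN1 cos_le1. Qed.

Lemma norm_sin_le1 (x : R) : `|sin x| <= 1.
Proof. by rewrite ler_norml sin_geN1 sin_le1. Qed.

(** The sequence [u] is left free up to sign so that one statement serves both ends of the line. *)
Lemma cvg_gpow_bounded (s : R) n (h : R -> R) (u : nat -> R) : 0 < s ->
  (forall t, `|h t| <= 1) -> (forall k, `|u k| = k.+1%:R) ->
  gpow s n (u k) * h (u k) @[k --> \oo] --> (0 : R).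
Proof.
move=> s0 h1 uk; have [C C0 hC] := pow_gauss_le n s0.
have c1 : (C * (2 / s) / k.+1%:R) @[k --> \oo] --> (0 : R).
  rewrite -[X in _ --> X](mulr0 (C * (2 / s))); apply: cvgM; first exact: cvg_cst.
  exact: (@cvg_harmonic R).
apply: norm_cvg0; apply: (squeeze_cvgr _ (cvg_cst 0) c1).
apply: nearW => k; rewrite normr_ge0 /= normrM norm_gpow.
apply: le_trans (_ : `|u k| ^+ n * expR (- (s * u k ^+ 2)) <= _).
  by rewrite ler_piMr// mulr_ge0 ?exprn_ge0 ?expR_ge0.
have u2 : u k ^+ 2 = k.+1%:R ^+ 2 by rewrite -(uk k) real_normK ?num_real.
have y0 : 0 < s / 2 * k.+1%:R by rewrite mulr_gt0 ?divr_gt0 ?ltr0n.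
apply: (le_trans (hC _)); rewrite expRN -[leRHS]mulrA ler_wpM2l//.
have -> : 2 / s / k.+1%:R = (s / 2 * k.+1%:R)^-1.
  by rewrite invfM invf_div.
rewrite lef_pV2 ?posrE ?expR_gt0//.
apply: le_trans (expR_ge1Dx _); rewrite u2.
apply: (@le_trans _ _ (s / 2 * k.+1%:R ^+ 2)); last by rewrite lerDr.
by rewrite ler_wpM2l ?divr_ge0 ?(ltW s0)// ler_eXnr// ler1n.
Qed.

Lemma is_derive_mul (f g : R -> R) (x df dg : R) :
  is_derive x (1 : R) f df -> is_derive x (1 : R) g dg ->
  is_derive x (1 : R) (fun t => f t * g t) (df * g x + f x * dg).
Proof.
move=> hf hg; have := is_deriveM hf hg.
by rewrite addrC [_ *: df]mulrC.
Qed.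

Lemma is_derive_powR_nat n (x : R) : is_derive x (1 : R) (fun t => t ^+ n) (n%:R * x ^+ n.-1).
Proof.
have := @is_deriveX _ _ id n x 1 1 (is_derive_id x 1).
by rewrite exprfctE [_ *: _]mulr1.
Qed.

Lemma is_derive_gauss (s x : R) : is_derive x (1 : R) (fun t => expR (- (s * t ^+ 2)))
  (- (2 * s * x) * expR (- (s * x ^+ 2))).
Proof.
have d1 : is_derive x (1 : R) (fun t : R => - (s * t ^+ 2)) (- (2 * s * x)).
  have h := is_deriveN (is_deriveZ s (is_derive_powR_nat 2 x)).
  by apply: (is_derive_eq h); rewrite /= expr1 /GRing.scale /=; ring.
have := @is_derive1_comp R expR (fun t => - (s * t ^+ 2)) x _ _ (is_derive_expR _) d1.
by rewrite mulrC.
Qed.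

Lemma is_derive_gpow s n (x : R) : is_derive x (1 : R) (gpow s n)
  (n%:R * gpow s n.-1 x - 2 * s * gpow s n.+1 x).
Proof.
have := is_derive_mul (is_derive_powR_nat n x) (is_derive_gauss s x).
move=> h; apply: (is_derive_eq h).
by rewrite /gpow (exprS x n); ring.
Qed.

Lemma is_derive_cosM (xi x : R) :
  is_derive x (1 : R) (fun t => cos (xi * t)) (- (xi * sin (xi * x))).
Proof.
have d1 : is_derive x (1 : R) (fun t : R => xi * t) xi.
  by have := is_deriveZ xi (is_derive_id x (1 : R)); rewrite [_ *: _]mulr1.
have := @is_derive1_comp R cos (fun t => xi * t) x _ _ (is_derive_cos _) d1.
by move=> h; apply: (is_derive_eq h); ring.
Qed.

Lemma is_derive_sinM (xi x : R) :
  is_derive x (1 : R) (fun t => sin (xi * t)) (xi * cos (xi * x)).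
Proof.
have d1 : is_derive x (1 : R) (fun t : R => xi * t) xi.
  by have := is_deriveZ xi (is_derive_id x (1 : R)); rewrite [_ *: _]mulr1.
have := @is_derive1_comp R sin (fun t => xi * t) x _ _ (is_derive_sin _) d1.
by move=> h; apply: (is_derive_eq h); ring.
Qed.

Lemma continuous_is_derive (f f' : R -> R) :
  (forall x : R, is_derive x (1 : R) f (f' x)) -> continuous f.
Proof.
move=> df x; apply: differentiable_continuous; apply/derivable1_diffP.
exact: (@ex_derive _ _ _ _ _ _ _ (df x)).
Qed.

Lemma continuous_gpow s n : continuous (gpow s n).
Proof. exact: continuous_is_derive (is_derive_gpow s n). Qed.

Lemma continuous_cosM xi : continuous (fun t : R => cos (xi * t)).
Proof. exact: continuous_is_derive (is_derive_cosM xi). Qed.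

Lemma continuous_sinM xi : continuous (fun t : R => sin (xi * t)).
Proof. exact: continuous_is_derive (is_derive_sinM xi). Qed.

Definition gcos s n xi := \int[lebR]_t (gpow s n t * cos (xi * t)).
Definition gsin s n xi := \int[lebR]_t (gpow s n t * sin (xi * t)).

Lemma integrable_gcos s n xi : 0 < s ->
  lebR.-integrable setT (fun t => (gpow s n t * cos (xi * t))%:E).
Proof.
by move=> s0; apply: integrable_gpow_bounded => // [|t];
  [exact: measurable_cosM|exact: norm_cos_le1].
Qed.

Lemma integrable_gsin s n xi : 0 < s ->
  lebR.-integrable setT (fun t => (gpow s n t * sin (xi * t))%:E).
Proof.
by move=> s0; apply: integrable_gpow_bounded => // [|t];
  [exact: measurable_sinM|exact: norm_sin_le1].
Qed.

Lemma integral_lin3 (a b c : R) (f g h : R -> R) :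
  lebR.-integrable setT (fun t => (f t)%:E) ->
  lebR.-integrable setT (fun t => (g t)%:E) ->
  lebR.-integrable setT (fun t => (h t)%:E) ->
  lebR.-integrable setT (fun t => (a * f t + b * g t + c * h t)%:E) /\
  \int[lebR]_t (a * f t + b * g t + c * h t) =
  a * \int[lebR]_t f t + b * \int[lebR]_t g t + c * \int[lebR]_t h t.
Proof.
move=> if_ ig ih.
have iZ (r : R) (k : R -> R) : lebR.-integrable setT (fun t => (k t)%:E) ->
    lebR.-integrable setT (fun t => (r * k t)%:E).
  by move=> ik; under eq_fun do rewrite EFinM; exact: integrableZl.
have iD (k1 k2 : R -> R) : lebR.-integrable setT (fun t => (k1 t)%:E) ->
    lebR.-integrable setT (fun t => (k2 t)%:E) ->
    lebR.-integrable setT (fun t => (k1 t + k2 t)%:E).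
  by move=> i1 i2; under eq_fun do rewrite EFinD; exact: integrableD.
split; first by apply: (iD (fun t => a * f t + b * g t)); [apply: iD|]; exact: iZ.
rewrite RintegralD//; last 2 first.
- by apply: (iD (fun t => a * f t)); exact: iZ.
- exact: iZ.
rewrite RintegralD//; last 2 first.
- exact: iZ.
- exact: iZ.
by rewrite !RintegralZl.
Qed.

(** The derivative of [t^n exp (- s t^2) cos (xi t)] has integral zero. For [n = 0] the truncated
    index [n.-1] is harmless, being multiplied by 0. *)
Lemma gcosS s n xi : 0 < s ->
  2 * s * gcos s n.+1 xi = n%:R * gcos s n.-1 xi - xi * gsin s n xi.
Proof.
move=> s0.
have [i1 i2] := integral_lin3 n%:R (- (2 * s)) (- xi)
   (integrable_gcos n.-1 xi s0) (integrable_gcos n.+1 xi s0) (integrable_gsin n xi s0).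
pose f t := gpow s n t * cos (xi * t).
have df (x : R) : is_derive x (1 : R) f (n%:R * (gpow s n.-1 x * cos (xi * x)) +
    - (2 * s) * (gpow s n.+1 x * cos (xi * x)) + - xi * (gpow s n x * sin (xi * x))).
  have := is_derive_mul (is_derive_gpow s n x) (is_derive_cosM xi x).
  by move=> h; apply: (is_derive_eq h); ring.
have := integral_derivative0 df.
rewrite i2 -/(gcos _ _ _) -/(gcos _ _ _) -/(gsin _ _ _) => h.
have : n%:R * gcos s n.-1 xi + - (2 * s) * gcos s n.+1 xi + - xi * gsin s n xi = 0.
  apply: h => //.
  - move=> x; apply: cvgD; first apply: cvgD.
    + apply: cvgM; [exact: cvg_cst|apply: cvgM; [exact: continuous_gpow|exact: continuous_cosM]].
    + apply: cvgM; [exact: cvg_cst|apply: cvgM; [exact: continuous_gpow|exact: continuous_cosM]].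
    + apply: cvgM; [exact: cvg_cst|apply: cvgM; [exact: continuous_gpow|exact: continuous_sinM]].
  - apply: (@cvg_gpow_bounded s n (fun t => cos (xi * t)) (fun k => k.+1%:R)) => // t.
      exact: norm_cos_le1.
    by rewrite ger0_norm.
  - apply: (@cvg_gpow_bounded s n (fun t => cos (xi * t)) (fun k => - k.+1%:R)) => // t.
      exact: norm_cos_le1.
    by rewrite normrN ger0_norm.
by move=> /eqP; rewrite mulNr mulNr subr_eq0 subr_eq addrC -subr_eq => /eqP <-.
Qed.

Lemma gsinS s n xi : 0 < s ->
  2 * s * gsin s n.+1 xi = n%:R * gsin s n.-1 xi + xi * gcos s n xi.
Proof.
move=> s0.
have [i1 i2] := integral_lin3 n%:R (- (2 * s)) xi
   (integrable_gsin n.-1 xi s0) (integrable_gsin n.+1 xi s0) (integrable_gcos n xi s0).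
pose f t := gpow s n t * sin (xi * t).
have df (x : R) : is_derive x (1 : R) f (n%:R * (gpow s n.-1 x * sin (xi * x)) +
    - (2 * s) * (gpow s n.+1 x * sin (xi * x)) + xi * (gpow s n x * cos (xi * x))).
  have := is_derive_mul (is_derive_gpow s n x) (is_derive_sinM xi x).
  by move=> h; apply: (is_derive_eq h); ring.
have := integral_derivative0 df.
rewrite i2 -/(gsin _ _ _) -/(gsin _ _ _) -/(gcos _ _ _) => h.
have : n%:R * gsin s n.-1 xi + - (2 * s) * gsin s n.+1 xi + xi * gcos s n xi = 0.
  apply: h => //.
  - move=> x; apply: cvgD; first apply: cvgD.
    + apply: cvgM; [exact: cvg_cst|apply: cvgM; [exact: continuous_gpow|exact: continuous_sinM]].
    + apply: cvgM; [exact: cvg_cst|apply: cvgM; [exact: continuous_gpow|exact: continuous_sinM]].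
    + apply: cvgM; [exact: cvg_cst|apply: cvgM; [exact: continuous_gpow|exact: continuous_cosM]].
  - apply: (@cvg_gpow_bounded s n (fun t => sin (xi * t)) (fun k => k.+1%:R)) => // t.
      exact: norm_sin_le1.
    by rewrite ger0_norm.
  - apply: (@cvg_gpow_bounded s n (fun t => sin (xi * t)) (fun k => - k.+1%:R)) => // t.
      exact: norm_sin_le1.
    by rewrite normrN ger0_norm.
by move=> /eqP; rewrite mulNr addrAC subr_eq0 => /eqP <-.
Qed.

Lemma is_derive_under_integral (f : R -> R -> R) (f' : R -> R -> R) (G : R -> R) (a : R) :
  (forall x : R, lebR.-integrable setT (fun t => (f x t)%:E)) ->
  (forall x t : R, is_derive x (1 : R) (f ^~ t) (f' x t)) ->
  (forall t, 0 <= G t) -> lebR.-integrable setT (fun t => (G t)%:E) ->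
  (forall x t, `|f' x t| <= G t) ->
  is_derive a (1 : R) (fun x => \int[lebR]_t f x t) (\int[lebR]_t f' a t).
Proof.
move=> itf df G0 iG fG.
have Ia : `]a - 1, a + 1[%classic a by rewrite /= in_itv /= ltrBlDr ltrDl ltr01.
have d1 x t : partial1of2 f x t = f' x t.
  by rewrite partial1of2E (@derive_val _ _ _ _ _ _ _ (df x t)).
have itf' x : `]a - 1, a + 1[%classic x -> lebR.-integrable setT (EFin \o f x).
  by move=> _; exact: itf.
have der x t : `]a - 1, a + 1[%classic x -> setT t -> derivable (f ^~ t) x 1.
  by move=> _ _; exact: (@ex_derive _ _ _ _ _ _ _ (df x t)).
have ub x t : `]a - 1, a + 1[%classic x -> setT t -> `|partial1of2 f x t| <= G t.
  by move=> _ _; rewrite d1.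
apply: DeriveDef.
  exact: (derivable_under_integral measurableT Ia itf' der G0 iG ub).
rewrite -derive1E (differentiation_under_integral measurableT Ia itf' der G0 iG ub).
by apply: eq_Rintegral => t _; rewrite d1.
Qed.

Lemma is_derive_gcos0 s xi : 0 < s ->
  is_derive xi (1 : R) (gcos s 0) (- gsin s 1 xi).
Proof.
move=> s0.
have := @is_derive_under_integral (fun x t => gpow s 0 t * cos (x * t))
  (fun x t => - 1 * (gpow s 1 t * sin (x * t))) (fun t => `|t| ^+ 1 * expR (- (s * t ^+ 2))) xi.
rewrite RintegralZl ?mulN1r//; last exact: integrable_gsin.
apply.
- by move=> x; exact: integrable_gcos.
- move=> x t.
  have -> : (fun x0 => gpow s 0 t * cos (x0 * t)) = (fun x0 => gpow s 0 t * cos (t * x0)).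
    by apply/funext => y; rewrite (mulrC t).
  have := is_derive_mul (is_derive_cst (gpow s 0 t) x (1 : R)) (is_derive_cosM t x).
  by move=> h; apply: (is_derive_eq h); rewrite /cst /gpow !expr0 !expr1 (mulrC t x); ring.
- by move=> t; rewrite mulr_ge0 ?exprn_ge0 ?expR_ge0.
- exact: integrable_pow_gauss.
- move=> x t; rewrite mulN1r normrN normrM norm_gpow.
  by rewrite ler_piMr ?norm_sin_le1// mulr_ge0 ?exprn_ge0 ?expR_ge0.
Qed.

Lemma is_derive_gsin0 s xi : 0 < s ->
  is_derive xi (1 : R) (gsin s 0) (gcos s 1 xi).
Proof.
move=> s0.
have := @is_derive_under_integral (fun x t => gpow s 0 t * sin (x * t))
  (fun x t => gpow s 1 t * cos (x * t)) (fun t => `|t| ^+ 1 * expR (- (s * t ^+ 2))) xi.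
apply.
- by move=> x; exact: integrable_gsin.
- move=> x t.
  have -> : (fun x0 => gpow s 0 t * sin (x0 * t)) = (fun x0 => gpow s 0 t * sin (t * x0)).
    by apply/funext => y; rewrite (mulrC t).
  have := is_derive_mul (is_derive_cst (gpow s 0 t) x (1 : R)) (is_derive_sinM t x).
  by move=> h; apply: (is_derive_eq h); rewrite /cst /gpow !expr0 !expr1 (mulrC t x); ring.
- by move=> t; rewrite mulr_ge0 ?exprn_ge0 ?expR_ge0.
- exact: integrable_pow_gauss.
- move=> x t; rewrite normrM norm_gpow.
  by rewrite ler_piMr ?norm_cos_le1// mulr_ge0 ?exprn_ge0 ?expR_ge0.
Qed.

(** [y] divided by the expected Gaussian has zero derivative. For the cosine transform this gives
    its value; the sine transform solves the same equation and vanishes at 0, hence everywhere. *)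
Lemma gauss_ode (s : R) (y : R -> R) xi : 0 < s ->
  (forall x : R, is_derive x (1 : R) y (- (x / (2 * s)) * y x)) ->
  y xi = y 0 * expR (- (xi ^+ 2 / (4 * s))).
Proof.
move=> s0 dy.
(* The growing exponential is written as a Gaussian of negative parameter so that [is_derive_gauss]
   applies to it. *)
pose F x := y x * expR (- (- (4 * s)^-1 * x ^+ 2)).
have dF (x : R) : is_derive x (1 : R) F 0.
  have := is_derive_mul (dy x) (is_derive_gauss (- (4 * s)^-1) x).
  by move=> h; apply: (is_derive_eq h); field; rewrite gt_eqF.
have := is_derive_0_is_cst xi 0 dF; rewrite /F.
have -> : expR (- (- (4 * s)^-1 * 0 ^+ 2)) = 1 :> R by rewrite expr0n /= mulr0 oppr0 expR0.
rewrite mulr1 => <-; rewrite -mulrA -expRD.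
have -> : - (- (4 * s)^-1 * xi ^+ 2) + - (xi ^+ 2 / (4 * s)) = 0 by ring.
by rewrite expR0 mulr1.
Qed.

Lemma gcos0E s xi : 0 < s ->
  gcos s 0 xi = Num.sqrt (pi / s) * expR (- (xi ^+ 2 / (4 * s))).
Proof.
move=> s0.
have dy (x : R) : is_derive x (1 : R) (gcos s 0) (- (x / (2 * s)) * gcos s 0 x).
  have h := is_derive_gcos0 x s0; apply: (is_derive_eq h).
  have := gsinS 0 x s0; rewrite mul0r add0r => e.
  have s2 : 2 * s != 0 by rewrite mulf_neq0// gt_eqF.
  by apply: (mulfI s2); rewrite mulrN e; field; rewrite gt_eqF.
rewrite (gauss_ode xi s0 dy); congr (_ * _); rewrite /gcos /Rintegral.
under eq_integral do rewrite /gpow mul0r cos0 mulr1 expr0 mul1r.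
by rewrite gauss_scaleE.
Qed.

Lemma gsin0E s xi : 0 < s -> gsin s 0 xi = 0.
Proof.
move=> s0.
have dy (x : R) : is_derive x (1 : R) (gsin s 0) (- (x / (2 * s)) * gsin s 0 x).
  have h := is_derive_gsin0 x s0; apply: (is_derive_eq h).
  have := gcosS 0 x s0; rewrite mul0r add0r => e.
  have s2 : 2 * s != 0 by rewrite mulf_neq0// gt_eqF.
  by apply: (mulfI s2); rewrite e; field; rewrite gt_eqF.
rewrite (gauss_ode xi s0 dy) /gsin.
under eq_Rintegral do rewrite mul0r sin0 mulr0.
by rewrite Rintegral_cst// !mul0r.
Qed.

Lemma cexpNi (x : R) : cexp (- ('i * x%:C)) = Complex (cos x) (- sin x).
Proof.
have -> : - ('i * x%:C) = Complex 0 (- x).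
  by apply: eqC; rewrite ?cReN ?cImN ?cReM ?cImM /=; ring.
by rewrite /cexp /= expR0 !mul1r cosN sinN.
Qed.

Definition gker s n xi t : R[i] := (gpow s n t)%:C * cexp (- ('i * (xi * t)%:C)).
Definition gmom s n xi : R[i] := cintegral lebR (gker s n xi).

Lemma gkerE s n xi t :
  gker s n xi t = Complex (gpow s n t * cos (xi * t)) (- (gpow s n t * sin (xi * t))).
Proof.
by rewrite /gker cexpNi; apply: eqC; rewrite ?cReM ?cImM /=; ring.
Qed.

Lemma cintegrable_gker s n xi : 0 < s -> cintegrable lebR (gker s n xi).
Proof.
move=> s0; split; under eq_fun do rewrite gkerE /=; first exact: integrable_gcos.
under eq_fun do rewrite -mulN1r EFinM.
by apply: integrableZl => //; exact: integrable_gsin.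
Qed.

Lemma gmomE s n xi : 0 < s -> gmom s n xi = Complex (gcos s n xi) (- gsin s n xi).
Proof.
move=> s0; rewrite /gmom (_ : gker s n xi = (fun t =>
  Complex (gpow s n t * cos (xi * t)) (- (gpow s n t * sin (xi * t))))); last first.
  by apply/funext => t; rewrite gkerE.
apply: eqC; rewrite //= /gsin -[RHS]mulN1r -RintegralZl//; last exact: integrable_gsin.
by apply: eq_Rintegral => t _; rewrite mulN1r.
Qed.

(** The real and imaginary parts are [gcosS] and [gsinS]. This is the one-dimensional identity on
    which all Gaussian integrals of polynomials rest. *)
Lemma gmomS s n xi : 0 < s ->
  gmom s n.+1 xi = ((2 * s)^-1)%:C * (n%:R * gmom s n.-1 xi + (- 'i * xi%:C) * gmom s n xi).
Proof.
move=> s0; rewrite !gmomE//.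
have s2 : 2 * s != 0 by rewrite mulf_neq0// gt_eqF.
have nC : (n%:R : R[i]) = (n%:R : R)%:C by rewrite rmorph_nat.
apply: eqC; rewrite nC ?cReM ?cImM ?cReD ?cImD ?cReM ?cImM /=.
  by apply: (mulfI s2); rewrite gcosS//; field; rewrite gt_eqF.
by apply: (mulfI s2); rewrite mulrN gsinS//; field; rewrite gt_eqF.
Qed.

Lemma gmom0 s xi : 0 < s ->
  gmom s 0 xi = (Num.sqrt (pi / s) * expR (- (xi ^+ 2 / (4 * s))))%:C.
Proof. by move=> s0; rewrite gmomE// gcos0E// gsin0E// oppr0. Qed.

End gauss_moments.

(** * Homogeneous and harmonic polynomials *)

Section mpoly_harmonic.
Import -(notations) mpoly.
Variables (F : numFieldType) (n : nat).
Local Notation poly := (mpoly.mpoly n F).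
Local Notation "''x_' i" := (@mpoly.mpolyX n F (mpoly.mnm1 i)) (at level 8, i at level 2, format "''x_' i").
Local Notation D := (@mpoly.mderiv n F).
Implicit Types (p q h : poly) (i : 'I_n).

Definition lap p : poly := \sum_(i < n) D i (D i p).
Definition homog (j : nat) p : bool := all [pred m | mpoly.mdeg m == j] (mpoly.msupp p).
Definition sqn : poly := \sum_(i < n) 'x_i ^+ 2.

Lemma homogE j p : homog j p = (p \is @mpoly.ishomog1 n F j (mpoly.mdeg)).
Proof. by rewrite mpoly.dhomogE. Qed.

Lemma homogP j p : reflect {in mpoly.msupp p, forall m, mpoly.mdeg m = j} (homog j p).
Proof. by rewrite homogE; exact: mpoly.dhomogP. Qed.

Lemma homog0 j : homog j 0. Proof. by rewrite homogE mpoly.dhomog0. Qed.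

Lemma homogD j p q : homog j p -> homog j q -> homog j (p + q).
Proof. by rewrite !homogE => hp hq; apply: mpoly.dhomogD. Qed.

Lemma homogZ j c p : homog j p -> homog j (c *: p).
Proof. by rewrite !homogE => hp; apply: mpoly.dhomogZ. Qed.

Lemma homogB j p q : homog j p -> homog j q -> homog j (p - q).
Proof. by move=> hp hq; rewrite -scaleN1r; apply: homogD => //; exact: homogZ. Qed.

Lemma homogM j k p q : homog j p -> homog k q -> homog (j + k) (p * q).
Proof. by rewrite !homogE => hp hq; apply: mpoly.dhomogM. Qed.

Lemma homog_sum I (r : seq I) (P : pred I) j (G : I -> poly) :
  (forall k, P k -> homog j (G k)) -> homog j (\sum_(i <- r | P i) G i).
Proof.
by move=> hG; elim/big_rec: _ => [|i y Pi hy]; [exact: homog0|apply: homogD => //; exact: hG].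
Qed.

Lemma homogXU i : homog 1 'x_i.
Proof. by rewrite homogE mpoly.dhomogX; apply/eqP; exact: mpoly.mdeg1. Qed.

Lemma homog_sqn : homog 2 sqn.
Proof. by apply: homog_sum => i _; rewrite expr2; apply: (@homogM 1 1); exact: homogXU. Qed.

Lemma homog_sqnX N : homog (2 * N) (sqn ^+ N).
Proof.
elim: N => [|N IH]; first by rewrite expr0 muln0 homogE; exact: mpoly.dhomog1.
by rewrite exprS mulnS; apply: homogM => //; exact: homog_sqn.
Qed.

Lemma derivX_neq i k : D i 'x_k = (i == k)%:R.
Proof.
rewrite mpoly.mderivX mpoly.mnm1E eq_sym; case: eqVneq => [->|_]; last by rewrite scale0r.
by rewrite scale1r -{1}[mnm1 k]mpoly.add0m mpoly.addmK mpoly.mpolyX0.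
Qed.

Lemma euler_monomial m : \sum_(i < n) 'x_i * D i (mpolyX F m) = (mdeg m)%:R *: mpolyX F m.
Proof.
rewrite mpoly.mdegE natr_sum scaler_suml; apply: eq_bigr => i _.
rewrite mpoly.mderivX -scalerAr -mpoly.mpolyXD.
have [->|mi] := eqVneq (m i) 0%N; first by rewrite !scale0r.
rewrite mpoly.addmC mpoly.submK//; apply/mpoly.mnm_lepP => l; rewrite mpoly.mnm1E.
by case: eqVneq => // <-; rewrite lt0n.
Qed.

Lemma euler j p : homog j p -> \sum_(i < n) 'x_i * D i p = j%:R *: p.
Proof.
move=> /homogP hp.
transitivity (\sum_(m <- msupp p) mcoeff m p *: \sum_(i < n) 'x_i * D i (mpolyX F m)).
  under [RHS]eq_bigr do rewrite scaler_sumr.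
  rewrite exchange_big /=; apply: eq_bigr => i _.
  rewrite {1}[p]mpoly.mpolyE raddf_sum mulr_sumr; apply: eq_bigr => m _.
  by rewrite /= mpoly.mderivZ scalerAr.
rewrite {3}[p]mpoly.mpolyE scaler_sumr; apply: eq_big_seq => m mp.
by rewrite euler_monomial (hp m mp) !scalerA mulrC.
Qed.

Lemma lapD p q : lap (p + q) = lap p + lap q.
Proof. by rewrite /lap -big_split; apply: eq_bigr => i _; rewrite !raddfD. Qed.

Lemma lapZ c p : lap (c *: p) = c *: lap p.
Proof. by rewrite /lap scaler_sumr; apply: eq_bigr => i _; rewrite !mpoly.mderivZ. Qed.

Lemma lap0 : lap 0 = 0.
Proof. by rewrite /lap big1// => i _; rewrite !mpoly.mderiv0. Qed.

Lemma lapB p q : lap (p - q) = lap p - lap q.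
Proof. by rewrite -scaleN1r lapD lapZ scaleN1r. Qed.

Lemma lap_sum I (r : seq I) (P : pred I) (G : I -> poly) :
  lap (\sum_(i <- r | P i) G i) = \sum_(i <- r | P i) lap (G i).
Proof. by apply: (big_morph lap lapD lap0). Qed.

Lemma lap_deriv i p : lap (D i p) = D i (lap p).
Proof.
rewrite /lap raddf_sum; apply: eq_bigr => k _ /=.
by rewrite (mpoly.mderiv_comm i k) (mpoly.mderiv_comm i k).
Qed.

Lemma deriv_sqn i : D i sqn = 2%:R *: 'x_i.
Proof.
rewrite /sqn raddf_sum (bigD1 i)//= big1 ?addr0.
  rewrite expr2 mpoly.mderivM derivX_neq eqxx mul1r mulr1.
  by rewrite -mulr2n -scaler_nat.
move=> k ki; rewrite expr2 mpoly.mderivM derivX_neq eq_sym (negbTE ki).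
by rewrite mul0r mulr0 addr0.
Qed.

(** The product rule, with the cross terms summed by Euler's identity. *)
Lemma lap_sqnM j p : homog j p ->
  lap (sqn * p) = (2 * n + 4 * j)%:R *: p + sqn * lap p.
Proof.
move=> hp; rewrite /lap mulr_sumr.
have E i : D i (D i (sqn * p)) =
    2%:R *: p + 4%:R *: ('x_i * D i p) + sqn * D i (D i p).
  rewrite mpoly.mderivM deriv_sqn !mpoly.mderivD !mpoly.mderivM deriv_sqn.
  rewrite mpoly.mderivZ derivX_neq eqxx.
  rewrite -!scalerAl mul1r.
  rewrite addrA -(addrA (2%:R *: p)) -scalerDl -natrD.
  by [].
rewrite (eq_bigr _ (fun i _ => E i)) !big_split /=; congr (_ + _).
have -> : \sum_(i < n) 4%:R *: ('x_i * D i p) = 4%:R *: (j%:R *: p).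
  by rewrite -scaler_sumr (euler hp).
rewrite sumr_const card_ord -scaler_nat !scalerA -scalerDl.
by rewrite natrD !natrM [n%:R * _]mulrC.
Qed.

Lemma lap_sqnXM l N h : homog l h -> lap h = 0 ->
  lap (sqn ^+ N.+1 * h) = (2 * N.+1 * (2 * N + 2 * l + n))%:R *: (sqn ^+ N * h).
Proof.
move=> hh lh; elim: N => [|N IH].
  rewrite expr1 expr0 mul1r (lap_sqnM hh) lh mulr0 addr0; congr (_%:R *: _).
  by rewrite muln0 add0n muln1 mulnDr addnC mulnA.
have hN : homog (2 * N.+1 + l) (sqn ^+ N.+1 * h) by apply: homogM => //; exact: homog_sqnX.
rewrite exprS -mulrA (lap_sqnM hN) IH -scalerAr mulrA -exprS -scalerDl -natrD.
by congr (_%:R *: _); nia.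
Qed.

Lemma homog_deriv j i p : homog j.+1 p -> homog j (D i p).
Proof.
move=> /homogP hp; apply/homogP => m.
rewrite mcoeff_msupp mpoly.mcoeff_mderiv => h.
have : (mnm_add m (mnm1 i)) \in msupp p.
  by rewrite mcoeff_msupp; apply: contraNN h => /eqP ->; rewrite mul0rn.
by move=> /hp; rewrite mpoly.mdegD mpoly.mdeg1 addn1 => -[].
Qed.

Lemma homog0_const p : homog 0 p -> p = mpolyC n (mcoeff (@mnm0 n) p).
Proof.
move=> /homogP hp; apply/mpoly.mpolyP => m; rewrite mpoly.mcoeffC.
case: eqVneq => [->|m0]; first by rewrite mulr1.
rewrite mulr0; apply/eqP; apply: contraNT m0; rewrite -mcoeff_msupp => /hp /eqP.
by rewrite mpoly.mdeg_eq0.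
Qed.

Lemma deriv_homog0 i p : homog 0 p -> D i p = 0.
Proof. by move=> /homog0_const ->; rewrite mpoly.mderivC. Qed.

Lemma lap_homog j p : homog j.+2 p -> homog j (lap p).
Proof. by move=> hp; apply: homog_sum => i _; do 2 apply: homog_deriv. Qed.

Lemma lap_homog_small j p : (j < 2)%N -> homog j p -> lap p = 0.
Proof.
case: j => [|[|//]] _ hp; apply: big1 => i _.
  by rewrite (deriv_homog0 i hp) mpoly.mderiv0.
by rewrite (deriv_homog0 i (homog_deriv i hp)).
Qed.

(** By induction on the degree: [lap p] is decomposed, and each summand [sqn^k g_k] is lifted to a
    multiple of [sqn^(k + 1) g_k] whose Laplacian it is. The sum of the lifts has Laplacian [lap p],
    so [p] minus that sum is harmonic and becomes the component of index 0. The clause on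
    [m < 2 * k] neutralises the truncated subtraction in the degrees. *)
Lemma harmonic_decomposition : (0 < n)%N -> forall m p, homog m p ->
  exists h : nat -> poly,
    [/\ forall k, (2 * k <= m)%N -> homog (m - 2 * k) (h k),
        forall k, (m < 2 * k)%N -> h k = 0,
        forall k, lap (h k) = 0 &
        p = \sum_(k < m.+1) sqn ^+ k * h k].
Proof.
move=> n0; elim/ltn_ind => m IH p hp.
have [m2|m2] := ltnP m 2.
  exists (fun k => if k == 0%N then p else 0); split.
  - by case=> [_|k _] /=; [rewrite muln0 subn0|exact: homog0].
  - by case=> [|k] //; rewrite muln0.
  - by case=> [|k] /=; [exact: lap_homog_small hp|exact: lap0].
  - rewrite big_ord_recl big1 ?addr0 ?expr0 ?mul1r//.
    by move=> i _; rewrite mulr0.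
have [e em] : exists e, m = e.+2 by exists m.-2; case: m m2 {IH hp} => [|[]].
rewrite em in IH hp *.
have [|g [g1 g2 g3 g4]] := IH e _ (lap p) (lap_homog hp); first by rewrite ltnS leqnSn.
(* Inverse of the factor in [lap_sqnXM], with [l = e - 2 k] the degree of [g k]; it is nonzero
   because [0 < n]. *)
pose c k : F := ((2 * k.+1 * (2 * k + 2 * (e - 2 * k) + n))%:R)^-1.
have lapg (k : nat) : lap (c k *: (sqn ^+ k.+1 * g k)) = sqn ^+ k * g k.
  have [ke|ke] := leqP (2 * k) e; last by rewrite g2// !mulr0 scaler0 lap0.
  rewrite lapZ (lap_sqnXM _ (g1 _ ke) (g3 k)) scalerA mulVf ?scale1r//.
  by rewrite pnatr_eq0 !muln_eq0 /= addn_eq0 negb_and (gtn_eqF n0) orbT.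
pose r := \sum_(k < e.+1) c k *: (sqn ^+ k.+1 * g k).
have hr : homog e.+2 r.
  apply: homog_sum => k _; apply: homogZ.
  have [ke|ke] := leqP (2 * k) e; last by rewrite g2// mulr0; exact: homog0.
  have -> : e.+2 = (2 * k.+1 + (e - 2 * k))%N by lia.
  by apply: homogM; [exact: homog_sqnX|exact: g1].
exists (fun k => if k is k'.+1 then c k' *: g k' else p - r); split.
- case=> [_|k ke]; first by rewrite muln0 subn0; exact: homogB.
  have -> : (e.+2 - 2 * k.+1 = e - 2 * k)%N by lia.
  by apply: homogZ; apply: g1; lia.
- by case=> [|k] // ke; rewrite g2 ?scaler0//; lia.
- case=> [|k]; last by rewrite lapZ g3 scaler0.
  rewrite lapB [X in _ - X](_ : _ = lap p) ?subrr// /r lap_sum g4.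
  by apply: eq_bigr => k _; exact: lapg.
- rewrite big_ord_recl expr0 mul1r big_ord_recr /= (g2 e.+1) ?scaler0 ?mulr0 ?addr0; last by lia.
  rewrite (_ : \sum_(_ < _) _ = r) ?subrK//; apply: eq_bigr => k _.
  by rewrite scalerAr.
Qed.

Definition on_sphere (x : 'I_n -> F) := \sum_(i < n) x i ^+ 2 = 1.

Lemma meval_sqn x : meval x sqn = \sum_(i < n) x i ^+ 2.
Proof.
rewrite /sqn raddf_sum; apply: eq_bigr => i _ /=.
by rewrite expr2 mpoly.mevalM mpoly.mevalXU expr2.
Qed.

Lemma meval_sqnX x N : meval x (sqn ^+ N) = (\sum_(i < n) x i ^+ 2) ^+ N.
Proof.
elim: N => [|N IH]; first by rewrite !expr0 mpoly.meval1.
by rewrite !exprS mpoly.mevalM IH meval_sqn.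
Qed.

(** On the sphere [sqn] equals 1, so its powers drop out and the harmonic summands are merely
    regrouped by degree. *)
Lemma sphere_decomposition_homog (q m : nat) p : (0 < n)%N -> (m <= q)%N -> homog m p ->
  exists H : nat -> poly,
    [/\ forall j, homog j (H j), forall j, lap (H j) = 0 &
     forall x, on_sphere x -> meval x p = \sum_(j < q.+1) meval x (H j)].
Proof.
move=> n0 mq hp; have [h [h1 h2 h3 h4]] := harmonic_decomposition n0 hp.
exists (fun j => \sum_(k < m.+1 | (2 * k <= m)%N && (m - 2 * k == j)%N) h k); split.
- by move=> j; apply: homog_sum => k /andP[km /eqP <-]; exact: h1.
- by move=> j; rewrite lap_sum big1.
- move=> x ox; rewrite [in LHS]h4 raddf_sum.
  transitivity (\sum_(k < m.+1 | (2 * k <= m)%N) meval x (h k)).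
    rewrite [RHS]big_mkcond /=; apply: eq_bigr => k _.
    rewrite mpoly.mevalM meval_sqnX ox expr1n mul1r.
    by case: leqP => // mk; rewrite h2// mpoly.meval0.
  rewrite (partition_big (fun k : 'I_m.+1 => inord (m - 2 * k) : 'I_q.+1) xpredT)//=.
  apply: eq_bigr => j _; rewrite raddf_sum; apply: eq_bigl => k.
  congr (_ && _); rewrite -val_eqE /= inordK// ltnS.
  by apply: leq_trans mq; exact: leq_subr.
Qed.

Lemma sphere_decomposition (q : nat) p : (0 < n)%N ->
  all [pred m | (mdeg m <= q)%N] (msupp p) ->
  exists H : nat -> poly,
    [/\ forall j, homog j (H j), forall j, lap (H j) = 0 &
     forall x, on_sphere x -> meval x p = \sum_(j < q.+1) meval x (H j)].
Proof.
move=> n0 /allP hp.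
have /choice[G hG] : forall m : nat, exists H : nat -> poly, (m <= q)%N ->
    [/\ forall j, homog j (H j), forall j, lap (H j) = 0 &
     forall x, on_sphere x -> meval x (mpoly.pihomog mdeg m p) = \sum_(j < q.+1) meval x (H j)].
  move=> m; have [mq|mq] := leqP m q; last by exists (fun=> 0).
  have hm : homog m (mpoly.pihomog mdeg m p) by rewrite homogE; exact: mpoly.pihomogP.
  by have [H hH] := sphere_decomposition_homog n0 mq hm; exists H.
exists (fun j => \sum_(m < q.+1) G m j); split.
- by move=> j; apply: homog_sum => m _; have [] := hG m (ltn_ord m).
- by move=> j; rewrite lap_sum big1// => m _; have [_ ->] := hG m (ltn_ord m).
- move=> x ox.
  have sp : (msize p <= q.+1)%N.
    by rewrite mpoly.msizeE; apply/bigmax_leqP_seq => m mp _; rewrite ltnS; exact: hp.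
  rewrite {1}(mpoly.pihomog_partitionE sp) raddf_sum.
  under [RHS]eq_bigr do rewrite raddf_sum.
  rewrite exchange_big /=; apply: eq_bigr => m _.
  by have [_ _ ->] := hG m (ltn_ord m).
Qed.

Lemma euler_meval j p (x : 'I_n -> F) : homog j p ->
  \sum_(i < n) x i * meval x (D i p) = j%:R * meval x p.
Proof.
move=> /euler /(congr1 (meval x)); rewrite mpoly.mevalZ => <-.
by rewrite raddf_sum; apply: eq_bigr => i _; rewrite /= mpoly.mevalM mpoly.mevalXU.
Qed.

Lemma meval_homogZ j p (x : 'I_n -> F) c : homog j p ->
  meval (fun i => c * x i) p = c ^+ j * meval x p.
Proof.
move=> /homogP hp; rewrite !mpoly.mevalE mulr_sumr; apply: eq_big_seq => m mp.
rewrite mulrCA; congr (_ * _).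
have -> : \prod_(i < n) (c * x i) ^+ m i = \prod_(i < n) (c ^+ m i * x i ^+ m i).
  by apply: eq_bigr => i _; rewrite exprMn.
by rewrite big_split /= -expr_sum -mpoly.mdegE (hp m mp).
Qed.

Section gaussian_functional.
Variables (A : poly -> F) (k : F) (z : 'I_n -> F).
Hypothesis AD : forall p q, A (p + q) = A p + A q.
Hypothesis AZ : forall c p, A (c *: p) = c * A p.
Hypothesis AX : forall i p, A ('x_i * p) = k * (A (D i p) + z i * A p).

Let A0 : A 0 = 0.
Proof. by rewrite -(scale0r 0) AZ mul0r. Qed.

Let Asum I (r : seq I) (P : pred I) (G : I -> poly) :
  A (\sum_(i <- r | P i) G i) = \sum_(i <- r | P i) A (G i).
Proof. by apply: (big_morph A AD A0). Qed.

Let AC c : A (mpolyC n c) = c * A 1.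
Proof. by rewrite -AZ -mpoly.mul_mpolyC mulr1. Qed.

Let A_euler j p : homog j p ->
  j%:R * A p = k * (A (lap p) + \sum_(i < n) z i * A (D i p)).
Proof.
move=> hp; rewrite -AZ -(euler hp) Asum /lap Asum -big_split mulr_sumr.
by apply: eq_bigr => i _; rewrite AX.
Qed.

(** Bochner-Hecke in algebraic form, for any functional that obeys the integration by parts rule
    [AX]. Euler's identity expresses [j * A h] through [A (lap h)], which vanishes, and the
    [A (D i h)], where [D i h] is harmonic of lower degree; so induction on the degree applies. *)
Lemma functional_harmonic j h : homog j h -> lap h = 0 ->
  A h = meval (fun i => k * z i) h * A 1.
Proof.
elim: j h => [|j IH] h hh lh.
  by rewrite (homog0_const hh) AC mpoly.mevalC.
have j0 : (j.+1%:R : F) != 0 by rewrite pnatr_eq0.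
apply: (mulfI j0); rewrite A_euler// lh A0 add0r mulrA -(euler_meval _ hh) mulr_suml mulr_sumr.
apply: eq_bigr => i _; rewrite (IH (D i h)) ?homog_deriv//; first by rewrite !mulrA.
by rewrite lap_deriv lh mpoly.mderiv0.
Qed.

(** [AX] is applied to each factor of [x_i^2] in turn, and Euler's identity evaluates the mixed
    sums. *)
Lemma functional_sqn j p : homog j p ->
  A (sqn * p) = k * ((n%:R + 2 * j%:R + k * \sum_(i < n) z i ^+ 2) * A p - k * A (lap p)).
Proof.
move=> hp.
have zX : \sum_(i < n) z i * A ('x_i * p) =
    j%:R * A p - k * A (lap p) + k * (\sum_(i < n) z i ^+ 2) * A p.
  rewrite A_euler// [k * (_ + _)]mulrDr [k * A _ + _]addrC addrK.
  rewrite mulr_sumr mulr_sumr mulr_suml -big_split; apply: eq_bigr => i _ /=.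
  by rewrite AX; ring.
rewrite /sqn mulr_suml Asum.
transitivity (\sum_(i < n) k * (A p + A ('x_i * D i p) + z i * A ('x_i * p))).
  apply: eq_bigr => i _; rewrite expr2 -mulrA AX mpoly.mderivM derivX_neq eqxx mul1r.
  by rewrite AD.
rewrite -mulr_sumr !big_split /= zX sumr_const card_ord -Asum (euler hp) AZ -mulr_natl.
by ring.
Qed.

End gaussian_functional.

(** At frequency zero, [j * A (p * q)] is [k] times the sum of the [A (D i p * D i q)] when [p] is
    harmonic. That sum is symmetric in [p] and [q], so [j] and [l] give the same multiple of
    [A (p * q)]. *)
Lemma functional_orthogonal (A : poly -> F) (k : F) :
  (forall p q, A (p + q) = A p + A q) -> (forall c p, A (c *: p) = c * A p) ->
  (forall i p, A ('x_i * p) = k * A (D i p)) ->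
  forall j l p q, homog j p -> homog l q -> lap p = 0 -> lap q = 0 -> j != l ->
  A (p * q) = 0.
Proof.
move=> AD AZ AX j l p q hp hq lp lq jl.
have A0 : A 0 = 0 by rewrite -(scale0r 0) AZ mul0r.
have Asum I (r : seq I) (P : pred I) (G : I -> poly) :
    A (\sum_(i <- r | P i) G i) = \sum_(i <- r | P i) A (G i).
  by apply: (big_morph A AD A0).
have key j' p' q' : homog j' p' -> lap p' = 0 ->
    j'%:R * A (p' * q') = k * \sum_(i < n) A (D i p' * D i q').
  move=> hp' lp'; rewrite -AZ scalerAl -(euler hp') mulr_suml Asum.
  have e0 : \sum_(i < n) A (D i (D i p') * q') = 0.
    by rewrite -Asum -mulr_suml -/(lap p') lp' mul0r A0.
  transitivity (k * (\sum_(i < n) A (D i (D i p') * q') + \sum_(i < n) A (D i p' * D i q')));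
    last by rewrite e0 add0r.
  rewrite -big_split mulr_sumr.
  by apply: eq_bigr => i _; rewrite -mulrA AX mpoly.mderivM AD.
have : j%:R * A (p * q) = l%:R * A (p * q).
  rewrite key// [p * q]mulrC key//; congr (_ * _); apply: eq_bigr => i _.
  by rewrite mulrC.
move=> /eqP; rewrite -subr_eq0 -mulrBl mulf_eq0 subr_eq0 eqr_nat (negbTE jl) /=.
by move=> /eqP.
Qed.

End mpoly_harmonic.

Section real_complex_embedding.
Context {R : realType}.
Implicit Types a b : R.

Lemma rcM a b : (a * b)%:C = a%:C * b%:C. Proof. exact: (rmorphM (real_complex R)). Qed.
Lemma rcD a b : (a + b)%:C = a%:C + b%:C. Proof. exact: (rmorphD (real_complex R)). Qed.
Lemma rcB a b : (a - b)%:C = a%:C - b%:C. Proof. exact: (rmorphB (real_complex R)). Qed.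
Lemma rcN a : (- a)%:C = - a%:C. Proof. exact: (rmorphN (real_complex R)). Qed.
Lemma rcX a k : (a ^+ k)%:C = a%:C ^+ k. Proof. exact: (rmorphXn (real_complex R)). Qed.
Lemma rcV a : (a^-1)%:C = (a%:C)^-1. Proof. exact: (fmorphV (real_complex R)). Qed.
Lemma rc_nat k : (k%:R : R)%:C = k%:R. Proof. exact: (rmorph_nat (real_complex R)). Qed.
Lemma rc_sum I (r : seq I) (P : pred I) (G : I -> R) :
  (\sum_(i <- r | P i) G i)%:C = \sum_(i <- r | P i) (G i)%:C.
Proof. exact: (rmorph_sum (real_complex R)). Qed.
Lemma rc_eq0 a : (a%:C == 0) = (a == 0). Proof. exact: (fmorph_eq0 (real_complex R)). Qed.

End real_complex_embedding.

(** * Gaussian Fourier integrals of polynomials and the Bochner-Hecke formula *)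

Section bochner_hecke.
Import -(notations) mpoly.
Context {R : realType}.
Variable n : nat.
Local Notation C := R[i].
Local Notation poly := (mpoly.mpoly n R[i]).
Local Notation "''x_' i" := (@mpoly.mpolyX n C (mpoly.mnm1 i)) (at level 8, i at level 2, format "''x_' i").
Local Notation D := (@mpoly.mderiv n C).

Definition cvec (v : vec R n) (i : 'I_n) : C := (tnth v i)%:C.
Definition cpoly (p : poly) (v : vec R n) : C := meval (cvec v) p.

Lemma cpolyD p q v : cpoly (p + q) v = cpoly p v + cpoly q v. Proof. exact: mevalD. Qed.
Lemma cpolyZ c p v : cpoly (c *: p) v = c * cpoly p v. Proof. exact: mevalZ. Qed.
Lemma cpolyM p q v : cpoly (p * q) v = cpoly p v * cpoly q v. Proof. exact: mevalM. Qed.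
Lemma cpoly_sum I (r : seq I) (P : pred I) (G : I -> poly) v :
  cpoly (\sum_(i <- r | P i) G i) v = \sum_(i <- r | P i) cpoly (G i) v.
Proof. by rewrite /cpoly raddf_sum. Qed.
Lemma cpoly1 v : cpoly 1 v = 1. Proof. exact: meval1. Qed.
Lemma cpolyX_nat p k v : cpoly (p ^+ k) v = cpoly p v ^+ k.
Proof. by elim: k => [|k IH]; rewrite ?expr0 ?cpoly1// !exprS cpolyM IH. Qed.
Lemma cpoly_monomial m v : cpoly (mpolyX C m) v = \prod_(i < n) cvec v i ^+ m i.
Proof. by rewrite /cpoly mevalX. Qed.
Lemma cpolyE p v : cpoly p v = \sum_(m <- msupp p) mcoeff m p * \prod_(i < n) cvec v i ^+ m i.
Proof. exact: mevalE. Qed.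
Lemma cpoly_sqn v : cpoly (sqn C n) v = (dotp v v)%:C.
Proof.
rewrite /cpoly meval_sqn /dotp rmorph_sum; apply: eq_bigr => i _.
by rewrite /cvec expr2 rmorphM.
Qed.

Lemma cmeasurable_cpoly p : cmeasurable (cpoly p : n.-tuple R -> C).
Proof.
rewrite (_ : cpoly p = fun v => \sum_(m <- msupp p) mcoeff m p * \prod_(i < n) cvec v i ^+ m i); last first.
  by apply/funext => v; rewrite cpolyE.
apply: cmeasurable_sum => m; apply: cmeasurableM; first exact: cmeasurable_cst.
apply: cmeasurable_prod => i; apply: cmeasurableX; apply: cmeasurable_real.
exact: measurable_tnth.
Qed.

Lemma measurable_dotp (x : vec R n) : measurable_fun setT (fun v : n.-tuple R => dotp x v).
Proof.
apply: measurable_sum => i; apply: measurable_funM => //.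
exact: measurable_tnth.
Qed.

Lemma measurable_dotpp : measurable_fun setT (fun v : n.-tuple R => dotp v v).
Proof.
by apply: measurable_sum => i; apply: measurable_funM; exact: measurable_tnth.
Qed.

Definition gfun (s : R) (x : vec R n) (p : poly) (v : n.-tuple R) : C :=
  cpoly p v * ((expR (- (s * dotp v v)))%:C * cexp (- ('i * (dotp x v)%:C))).

Lemma cexp_sum I (r : seq I) (F : I -> C) :
  cexp (\sum_(i <- r) F i) = \prod_(i <- r) cexp (F i).
Proof. by apply: (big_morph (@cexp R) (@cexpD R) (@cexp0 R)). Qed.

Lemma gfun_monomial s x m v :
  gfun s x (mpolyX C m) v = \prod_(i < n) gker s (m i) (tnth x i) (tnth v i).
Proof.
rewrite /gfun cpoly_monomial.
have -> : (expR (- (s * dotp v v)))%:C =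
    \prod_(i < n) (expR (- (s * tnth v i ^+ 2)))%:C.
  rewrite -rmorph_prod -expR_sum; congr (expR _)%:C.
  rewrite /dotp mulr_sumr -sumrN; apply: eq_bigr => i _; by rewrite expr2.
have -> : cexp (- ('i * (dotp x v)%:C)) =
    \prod_(i < n) cexp (- ('i * (tnth x i * tnth v i)%:C)).
  rewrite -cexp_sum; congr cexp.
  by rewrite /dotp rmorph_sum mulr_sumr -sumrN.
rewrite -!big_split; apply: eq_bigr => i _ /=.
by rewrite /gker /gpow /cvec rcM rcX !mulrA.
Qed.

Variables (s : R) (x : vec R n).
Hypothesis s0 : 0 < s.

Lemma cintegrable_gfun_monomial m : cintegrable (lebn n) (gfun s x (mpolyX C m)).
Proof.
rewrite (_ : gfun s x _ = fun v => \prod_(i < n) gker s (m i) (tnth x i) (tnth v i)); last first.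
  by apply/funext => v; rewrite gfun_monomial.
apply: (@cintegrable_prod_tnth _ _ (fun i => gker s (m i) (tnth x i))) => i.
exact: cintegrable_gker.
Qed.

Lemma gfunD p q v : gfun s x (p + q) v = gfun s x p v + gfun s x q v.
Proof. by rewrite /gfun cpolyD mulrDl. Qed.

Lemma gfunZ c p v : gfun s x (c *: p) v = c * gfun s x p v.
Proof. by rewrite /gfun cpolyZ -mulrA. Qed.

Lemma gfun_sum I (r : seq I) (G : I -> poly) v :
  gfun s x (\sum_(i <- r) G i) v = \sum_(i <- r) gfun s x (G i) v.
Proof. by rewrite /gfun cpoly_sum mulr_suml. Qed.

Lemma cintegrable_gfun p : cintegrable (lebn n) (gfun s x p).
Proof.
rewrite [p]mpolyE.
rewrite (_ : gfun s x _ = fun v => \sum_(m <- msupp p) mcoeff m p * gfun s x (mpolyX C m) v); last first.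
  by apply/funext => v; rewrite gfun_sum; apply: eq_bigr => m _; rewrite gfunZ.
apply: cintegrable_sum => m; apply: cintegrableZ; exact: cintegrable_gfun_monomial.
Qed.

Definition gint p : C := cintegral (lebn n) (gfun s x p).

Lemma gintD p q : gint (p + q) = gint p + gint q.
Proof.
rewrite /gint -cintegralD; [|exact: cintegrable_gfun..].
by apply: eq_cintegral => v; rewrite gfunD.
Qed.

Lemma gintZ c p : gint (c *: p) = c * gint p.
Proof.
rewrite /gint -cintegralZ; last exact: cintegrable_gfun.
by apply: eq_cintegral => v; rewrite gfunZ.
Qed.

Lemma gint_sum I (r : seq I) (G : I -> poly) :
  gint (\sum_(i <- r) G i) = \sum_(i <- r) gint (G i).
Proof.
apply: (big_morph gint gintD).
by rewrite -(scale0r 0) gintZ mul0r.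
Qed.

Lemma gint_monomial m : gint (mpolyX C m) = \prod_(i < n) gmom s (m i) (tnth x i).
Proof.
rewrite /gint /gmom -cintegral_prod_tnth; last by move=> i; exact: cintegrable_gker.
by apply: eq_cintegral => v; rewrite gfun_monomial.
Qed.

Let k : C := ((2 * s)^-1)%:C.
Let z i : C := - 'i * (tnth x i)%:C.

(** By linearity it is enough to treat monomials, whose integral is a product of one-dimensional
    moments; only the factor of index [i] changes, and it changes by [gmomS]. *)
Lemma gintX i p : gint ('x_i * p) = k * (gint (D i p) + z i * gint p).
Proof.
rewrite [p]mpolyE mulr_sumr raddf_sum !gint_sum mulr_sumr -big_split mulr_sumr.
apply: eq_bigr => m _ /=; rewrite mderivZ -scalerAr !gintZ.
rewrite mulrCA -mulrDr mulrCA; congr (_ * _).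
rewrite -mpolyXD mderivX gintZ !gint_monomial.
rewrite (bigD1 i)//= [in X in X * _]mnmDE mnm1E eqxx add1n gmomS// -/k -/(z i).
have rest (F1 F2 : 'I_n -> C) : (forall l, l != i -> F1 l = F2 l) ->
    \prod_(l < n | l != i) F1 l = \prod_(l < n | l != i) F2 l by move=> h; apply: eq_bigr.
set P := \prod_(_ < n | _) _.
rewrite [X in _ = k * (_ * X + _)](bigD1 i)//= [X in _ = k * (_ + _ * X)](bigD1 i)//=.
rewrite [X in _ = k * (_ + _ * (_ * X))](_ : _ = P); last first.
  by apply: rest => l li; rewrite mnmDE mnm1E eq_sym (negbTE li).
rewrite [X in _ = k * (_ * (_ * X) + _)](_ : _ = P); last first.
  by apply: rest => l li; rewrite mnmDE mnmBE mnm1E eq_sym (negbTE li) subn0.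
by rewrite mnmBE mnm1E eqxx subn1; ring.
Qed.

Lemma gint1 : gint 1 = ((Num.sqrt (pi / s)) ^+ n * expR (- (dotp x x / (4 * s))))%:C.
Proof.
rewrite -(@mpolyX0 n C) gint_monomial.
under eq_bigr do rewrite mnm0E gmom0//.
rewrite -rmorph_prod big_split /= prodr_const card_ord -expR_sum; congr (_ * expR _)%:C.
by rewrite sumrN /dotp mulr_suml; congr (- _); apply: eq_bigr => i _; rewrite expr2.
Qed.

Lemma sum_z2 : \sum_(i < n) z i ^+ 2 = - (dotp x x)%:C.
Proof.
rewrite /dotp rmorph_sum -sumrN; apply: eq_bigr => i _.
by rewrite /z exprMn sqrrN sqr_i mulN1r rmorphM expr2.
Qed.

Lemma cpoly_homogZ j p c v : homog j p -> 
  meval (fun i => c * cvec v i) p = c ^+ j * cpoly p v.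
Proof. exact: meval_homogZ. Qed.

Lemma bochner_hecke j h : homog j h -> lap h = 0 ->
  gint h = (- 'i * ((2 * s)^-1)%:C) ^+ j * cpoly h x * gint 1.
Proof.
move=> hh lh; rewrite (functional_harmonic gintD gintZ gintX hh lh); congr (_ * _).
rewrite -cpoly_homogZ//; apply: meval_eq => i; rewrite /z /k /cvec.
by ring.
Qed.

Lemma gint_sqn j p : homog j p ->
  gint (sqn C n * p) = k * ((n%:R + 2 * j%:R - k * (dotp x x)%:C) * gint p - k * gint (lap p)).
Proof.
by move=> hp; rewrite (functional_sqn gintD gintZ gintX hp) sum_z2 mulrN.
Qed.

End bochner_hecke.

(** * Laguerre polynomials from powers of the squared norm *)

Section laguerre.
Import -(notations) mpoly.
Context {R : realType}.

(* With [m = j + n/2], [lag m N] is [N!] times the generalised Laguerre polynomial of degree [N] and parameter [m - 1]. *)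
Fixpoint lag (m : R) (N : nat) (y : R) : R :=
  if N is N1.+1 then
    if N1 is N2.+1 then
      (2 * N1%:R + m - y) * lag m N1 y - N1%:R * (N2%:R + m) * lag m N2 y
    else m - y
  else 1.

Lemma lagSS m N y : lag m N.+2 y =
  (2 * N.+1%:R + m - y) * lag m N.+1 y - N.+1%:R * (N%:R + m) * lag m N y.
Proof. by []. Qed.

(** Multiplication by [sqn] brings in the Laplacian, and [lap (sqn^(N + 1) h)] is a multiple of
    [sqn^N h]. This makes a three-term recursion, which is that of [lag]; hence the induction on two
    consecutive values of [N]. *)
Lemma gint_sqnX n (s : R) (x : vec R n) j (h : mpoly.mpoly n R[i]) N : 0 < s ->
  homog j h -> lap h = 0 ->
  gint s x (sqn _ n ^+ N * h) =
  (s ^- N * lag (j%:R + n%:R / 2) N (dotp x x / 4 / s))%:C * gint s x h.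
Proof.
move=> s0 hh lh.
have s1 : s != 0 by rewrite gt_eqF.
set m := j%:R + n%:R / 2; set y := dotp x x / 4 / s.
suff : gint s x (sqn _ n ^+ N * h) = (s ^- N * lag m N y)%:C * gint s x h /\
       gint s x (sqn _ n ^+ N.+1 * h) = (s ^- N.+1 * lag m N.+1 y)%:C * gint s x h by case.
elim: N => [|N [IH1 IH2]].
  rewrite expr0 mul1r invr1 !mul1r; split=> //.
  rewrite expr1 (gint_sqn x s0 hh) lh.
  have -> : gint s x 0 = 0 by rewrite -(scale0r 0) gintZ// mul0r.
  rewrite mulr0 subr0 mulrA; congr (_ * _).
  have -> : n%:R + 2 * j%:R = (n%:R + 2 * j%:R : R)%:C by rewrite rcD rcM !rc_nat.
  rewrite -rcM -rcB -rcM; congr (_%:C).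
  by rewrite [lag m 1 y]/= /m /y expr1; field.
split=> //.
have hN : homog (2 * N.+1 + j) (sqn _ n ^+ N.+1 * h) by apply: homogM => //; exact: homog_sqnX.
rewrite exprS -mulrA (gint_sqn x s0 hN) (lap_sqnXM _ hh lh) gintZ// IH1 IH2 !mulrA -mulrBl.
rewrite mulrA; congr (_ * _).
have -> : n%:R + 2 * (2 * N.+1 + j)%:R = (n%:R + 2 * (2 * N.+1 + j)%:R : R)%:C.
  by rewrite rcD rcM !rc_nat.
have -> : (2 * N.+1 * (2 * N + 2 * j + n))%:R = ((2 * N.+1 * (2 * N + 2 * j + n))%:R : R)%:C.
  by rewrite rc_nat.
rewrite -!rcM -rcB -!rcM -rcB -rcM lagSS; congr (_%:C).
rewrite /y /m !exprS !natrM !natrD !natrM.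
by field; rewrite s1 expf_neq0.
Qed.

End laguerre.

(** * The Gamma function and the measure [dt/t] *)

Section haar.
Context {R : realType}.
Implicit Types f g h : R -> R.

Lemma measurable_pos_if d (T : measurableType d) (u : T -> R) (h : T -> R) :
  measurable_fun setT u -> measurable_fun setT h ->
  measurable_fun setT (fun t => if 0 < u t then h t else 0).
Proof.
move=> mu mh; apply: measurable_fun_ifT => //.
exact: measurable_fun_ltr.
Qed.

Lemma posint_mkcond h :
  (\int[lebR]_(t in `]0%R, +oo[) (h t)%:E = \int[lebR]_t (if 0 < t then h t else 0)%:E)%E.
Proof.
rewrite integral_mkcond; apply: eq_integral => t _; rewrite patchE.
have -> : (t \in `]0%R, +oo[%classic) = (0 < t).
  by rewrite /= mem_setE /= in_itv /= andbT.
by case: ifP.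
Qed.

(** Integration against [dt / t], the invariant measure of the multiplicative half-line. The radial
    integrals below are put in this form because rescaling leaves it unchanged. The integrand is 0
    off the half-line, and the value is an extended real. *)
Definition haar f : \bar R := (\int[lebR]_t (if (0 < t)%R then f t / t else 0)%:E)%E.

Lemma eq_haar f g : (forall t, 0 < t -> f t = g t) -> haar f = haar g.
Proof.
move=> fg; apply: eq_integral => t _.
by case: ifP => // t0; rewrite fg.
Qed.

Lemma measurable_inv : measurable_fun setT (fun t : R => t^-1).
Proof.
rewrite (_ : (fun t => t^-1) = (fun t : R => if 0 < t then t `^ (-1) else (if 0 < - t then - ((- t) `^ (-1)) else 0))).
  apply: measurable_fun_ifT; [exact: measurable_fun_ltr|exact: measurable_powR|].
  apply: measurable_pos_if; first exact: oppr_measurable.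
  apply: (measurableT_comp (@oppr_measurable R setT)).
  apply: (measurableT_comp (measurable_powR _)).
  exact: oppr_measurable.
apply/funext => t; case: ltP => t0; first by rewrite powR_inv1// ltW.
rewrite oppr_gt0; case: ltP => t1; first by rewrite powR_inv1 ?oppr_ge0// invrN opprK.
by rewrite (_ : t = 0) ?invr0//; apply/eqP; rewrite eq_le t0.
Qed.

Lemma measurable_haar_fun f : measurable_fun setT f ->
  measurable_fun setT (fun t : R => if 0 < t then f t / t else 0).
Proof.
move=> mf; apply: measurable_pos_if => //; apply: measurable_funM => //.
exact: measurable_inv.
Qed.

Lemma haar_fun_ge0 f t : (forall t, 0 < t -> 0 <= f t) -> 0 <= (if 0 < t then f t / t else 0).
Proof. by move=> f0; case: ifP => // t0; rewrite divr_ge0 ?f0// ltW. Qed.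

Lemma haar_ge0 f : (forall t, 0 < t -> 0 <= f t) -> (0 <= haar f)%E.
Proof. by move=> f0; apply: integral_ge0 => t _; rewrite lee_fin haar_fun_ge0. Qed.

Lemma haar_scale c f : 0 < c -> measurable_fun setT f -> (forall t, 0 < t -> 0 <= f t) ->
  haar (fun t => f (c * t)) = haar f.
Proof.
move=> c0 mf f0; rewrite /haar.
transitivity (\int[lebR]_t (c%:E * (if (0 < c * t)%R then f (c * t) / (c * t) else 0)%:E))%E.
  apply: eq_integral => t _; rewrite pmulr_rgt0//; case: ifP => t0; last by rewrite mule0.
  by rewrite -EFinM; congr EFin; field; rewrite !gt_eqF.
rewrite ge0_integralZl//; last 3 first.
- apply/measurable_EFinP.
  apply: (@measurableT_comp _ _ _ _ _ _ (fun t : R => if 0 < t then f t / t else 0)).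
    exact: measurable_haar_fun.
  exact: measurable_funM.
- by move=> t _; rewrite lee_fin haar_fun_ge0.
- by rewrite lee_fin ltW.
rewrite (@ge0_integral_scaleR _ c (fun t : R => (if 0 < t then f t / t else 0)%:E))//.
- by rewrite muleA -EFinM divff ?gt_eqF// mul1e.
- by apply/measurable_EFinP; exact: measurable_haar_fun.
- by move=> t; rewrite lee_fin haar_fun_ge0.
Qed.

Lemma haarZ c f : 0 <= c -> measurable_fun setT f -> (forall t, 0 < t -> 0 <= f t) ->
  haar (fun t => c * f t) = (c%:E * haar f)%E.
Proof.
move=> c0 mf f0; rewrite /haar -ge0_integralZl//.
- by apply: eq_integral => t _; case: ifP => _; rewrite ?mule0// -EFinM mulrA.
- by apply/measurable_EFinP; exact: measurable_haar_fun.
- by move=> t _; rewrite lee_fin haar_fun_ge0.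
Qed.

Lemma haar_swap (K : R -> R -> R) :
  measurable_fun setT (fun st : measurableTypeR R * measurableTypeR R => K st.1 st.2) ->
  (forall s t, 0 < s -> 0 < t -> 0 <= K s t) ->
  (\int[lebR]_s \int[lebR]_t (if (0 < s) && (0 < t) then K s t / (s * t) else 0)%:E =
   \int[lebR]_t \int[lebR]_s (if (0 < s) && (0 < t) then K s t / (s * t) else 0)%:E)%E.
Proof.
move=> mK K0.
apply: (@fubini_tonelli _ _ _ _ R lebR lebR (fun st : measurableTypeR R * measurableTypeR R =>
  (if (0 < st.1) && (0 < st.2) then K st.1 st.2 / (st.1 * st.2) else 0)%:E)).
- apply/measurable_EFinP; apply: measurable_fun_ifT => //.
    apply: measurable_and; first exact: measurable_fun_ltr.
    exact: measurable_fun_ltr.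
  apply: measurable_funM => //; apply: (measurableT_comp measurable_inv).
  exact: measurable_funM.
- move=> [s t] /=; case: ifP => // /andP[s0 t0].
  by rewrite lee_fin divr_ge0 ?K0// mulr_ge0// ltW.
Qed.

Lemma integral_if_cond (b : bool) (u : R -> R) :
  (\int[lebR]_t (if b && (0 < t)%R then u t else 0)%:E =
   if b then \int[lebR]_t (if (0 < t)%R then u t else 0)%:E else 0)%E.
Proof.
case: b => //=; by rewrite integral_cst// mul0e.
Qed.

Lemma haar_haar (K : R -> R -> R) :
  (forall s, 0 < s -> measurable_fun setT (K s)) ->
  (forall s t, 0 < s -> 0 < t -> 0 <= K s t) ->
  (\int[lebR]_s \int[lebR]_t (if (0 < s)%R && (0 < t)%R then K s t / (s * t) else 0)%:E =
   \int[lebR]_s (if (0 < s)%R then (s^-1)%:E * haar (K s) else 0))%E.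
Proof.
move=> mK K0; apply: eq_integral => s _.
rewrite integral_if_cond; case: ifP => // s0.
rewrite /haar -ge0_integralZl//.
- apply: eq_integral => t _; case: ifP => t0; last by rewrite mule0.
  by rewrite -EFinM; congr EFin; field; rewrite !gt_eqF.
- by apply/measurable_EFinP; apply: measurable_haar_fun; exact: mK.
- by move=> t _; rewrite lee_fin haar_fun_ge0// => u u0; exact: K0.
- by rewrite lee_fin invr_ge0 ltW.
Qed.

Lemma integral_expRN (a : R) :
  (\int[lebR]_(t in `[a, +oo[) (expR (- t))%:E = (expR (- a))%:E)%E.
Proof.
have := @ge0_continuous_FTC2y R (fun t => expR (- t)) (fun t => - expR (- t)) a 0.
rewrite -EFinB sub0r opprK; apply.
- by move=> x _; exact: expR_ge0.
- apply: continuous_subspaceT => x; apply: continuous_comp; first exact: opp_continuous.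
  exact: continuous_expR.
- rewrite -oppr0; apply: cvgN; exact: cvgr_expR.
- by move=> x _; apply: ex_derive.
- apply: cvg_at_right_filter; apply: cvgN; apply: continuous_comp; first exact: opp_continuous.
  exact: continuous_expR.
- move=> x _; rewrite derive1E derive_val.
  by rewrite /GRing.scale /=; ring.
Qed.

Lemma haar_expRN : haar (fun t => t * expR (- t)) = 1%E.
Proof.
transitivity (\int[@lebR R]_(t in `]0%R, +oo[) (expR (- t))%:E)%E.
  rewrite posint_mkcond; apply: eq_integral => t _; case: ifP => // t0.
  by congr EFin; field; rewrite gt_eqF.
rewrite integral_itv_obnd_cbnd ?integral_expRN ?oppr0 ?expR0//.
by apply/measurable_EFinP; apply: measurable_funTS; apply: measurableT_comp.
Qed.

(** Derived from scaling invariance alone. The factor [haar g = 1] is inserted, giving a double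
    integral of [F (t / s) * g s]; rescaling [s] by [t] turns it into one of [f s * g (t * s)], and
    integrating over [t] first removes [g] again. *)
Lemma haar_inv f : measurable_fun setT f -> (forall t, 0 < t -> 0 <= f t) ->
  haar (fun t => f t^-1) = haar f.
Proof.
move=> mf f0; pose g (t : R) := t * expR (- t).
have g0 t : 0 < t -> 0 <= g t by move=> t0; rewrite mulr_ge0 ?expR_ge0// ltW.
have mg : measurable_fun setT g.
  by apply: measurable_funM => //; apply: measurableT_comp => //; exact: oppr_measurable.
have mV := @measurable_inv; pose F t := f t^-1.
have mF : measurable_fun setT F by exact: (measurableT_comp mf mV).
have F0 t : 0 < t -> 0 <= F t by move=> t0; rewrite f0// invr_gt0.
have mM (c : R) : measurable_fun setT (fun t : R => c * t) by exact: measurable_funM.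
transitivity (\int[lebR]_s \int[lebR]_t
    (if (0 < s)%R && (0 < t)%R then F (s^-1 * t) * g s / (s * t) else 0)%:E)%E.
  rewrite (@haar_haar (fun s t => F (s^-1 * t) * g s)); last 2 first.
  - by move=> s s0; apply: measurable_funM => //; exact: (measurableT_comp mF (mM _)).
  - move=> s t s0 t0; rewrite mulr_ge0 ?g0// F0// mulr_gt0// invr_gt0//.
  rewrite -[LHS]mul1e -[in LHS](@haar_expRN) /haar -ge0_integralZr//; last 3 first.
  - by apply/measurable_EFinP; exact: (measurable_haar_fun mg).
  - by move=> t _; rewrite lee_fin; exact: (@haar_fun_ge0 g).
  - exact: (@haar_ge0 F).
  apply: eq_integral => s _; case: ifP => s0; last by rewrite mul0e.
  rewrite -/(haar _) -/(haar _).
  rewrite [X in (_ = _ * X)%E](_ : _ = haar (fun t => g s * F (s^-1 * t))); last first.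
    by apply: eq_haar => t _; rewrite mulrC.
  rewrite haarZ ?g0//; last 2 first.
  - exact: (measurableT_comp mF (mM _)).
  - by move=> t t0; rewrite F0// mulr_gt0// invr_gt0.
  by rewrite haar_scale ?invr_gt0// muleA -EFinM mulrC.
rewrite (@haar_swap (fun s t => F (s^-1 * t) * g s)); last 2 first.
- apply: measurable_funM; last exact: (measurableT_comp mg measurable_fst).
  apply: (measurableT_comp mF); apply: measurable_funM => //.
  exact: (measurableT_comp mV measurable_fst).
- by move=> s t s0 t0; rewrite mulr_ge0 ?g0// F0// mulr_gt0// invr_gt0.
transitivity (\int[lebR]_t \int[lebR]_s
    (if (0 < t)%R && (0 < s)%R then F (s^-1 * t) * g s / (t * s) else 0)%:E)%E.
  by apply: eq_integral => t _; apply: eq_integral => s _; rewrite andbC [s * t]mulrC.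
have mK t : measurable_fun setT (fun s : R => F (s^-1 * t) * g s).
  apply: measurable_funM => //; apply: (measurableT_comp mF).
  exact: measurable_funM.
rewrite (@haar_haar (fun t s => F (s^-1 * t) * g s)); last 2 first.
- by move=> t t0.
- by move=> t s t0 s0; rewrite mulr_ge0 ?g0// F0// mulr_gt0// invr_gt0.
have E t : 0 < t -> haar (fun s => F (s^-1 * t) * g s) = haar (fun s => f s * g (t * s)).
  move=> t0; rewrite -(@haar_scale t (fun s => F (s^-1 * t) * g s))//; last first.
    by move=> s s0; rewrite mulr_ge0 ?g0// F0// mulr_gt0// invr_gt0.
  apply: eq_haar => s s0; rewrite /F; congr (f _ * _).
  by field; rewrite !gt_eqF.
rewrite (_ : (fun t : R => _) = (fun t : R => if (0 < t)%R then ((t^-1)%:E * haar (fun s : R => (f s * g (t * s))%R))%E else 0%E)); last first.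
  by apply/funext => t; case: ifPn => [/E ->|_].
rewrite -(@haar_haar (fun t s => f s * g (t * s))); last 2 first.
- by move=> t t0; apply: measurable_funM => //; exact: (measurableT_comp mg (mM _)).
- by move=> t s t0 s0; rewrite mulr_ge0 ?f0// g0// mulr_gt0.
rewrite (@haar_swap (fun t s => f s * g (t * s))); last 2 first.
- apply: measurable_funM; first exact: (measurableT_comp mf measurable_snd).
  by apply: (measurableT_comp mg); exact: measurable_funM.
- by move=> s t s0 t0; rewrite mulr_ge0 ?f0// g0// mulr_gt0.
transitivity (\int[lebR]_s \int[lebR]_t
    (if (0 < s)%R && (0 < t)%R then f s * g (s * t) / (s * t) else 0)%:E)%E.
  by apply: eq_integral => s _; apply: eq_integral => t _; rewrite andbC [t * s]mulrC.
rewrite (@haar_haar (fun s t => f s * g (s * t))); last 2 first.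
- by move=> t t0; apply: measurable_funM => //; exact: (measurableT_comp mg (mM _)).
- by move=> t s t0 s0; rewrite mulr_ge0 ?f0// g0// mulr_gt0.
apply: eq_integral => s _; case: ifP => // s0.
rewrite haarZ ?f0//; last 2 first.
- exact: (measurableT_comp mg (mM _)).
- by move=> t t0; rewrite g0// mulr_gt0.
by rewrite haar_scale// haar_expRN mule1 -EFinM mulrC.
Qed.

Lemma le_haar f g : measurable_fun setT f -> measurable_fun setT g ->
  (forall t, 0 < t -> 0 <= f t <= g t) -> (haar f <= haar g)%E.
Proof.
move=> mf mg fg; apply: ge0_le_integral => //.
- move=> t _; rewrite lee_fin; apply: haar_fun_ge0 => u u0.
  by have /andP[] := fg u u0.
- by apply/measurable_EFinP; exact: measurable_haar_fun.
- by apply/measurable_EFinP; exact: measurable_haar_fun.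
- move=> t _; rewrite lee_fin; case: ifP => // t0.
  by rewrite ler_wpM2r ?invr_ge0 ?(ltW t0)//; have /andP[] := fg t t0.
Qed.

Lemma haarD f g : measurable_fun setT f -> measurable_fun setT g ->
  (forall t, 0 < t -> 0 <= f t) -> (forall t, 0 < t -> 0 <= g t) ->
  haar (fun t => f t + g t) = (haar f + haar g)%E.
Proof.
move=> mf mg f0 g0; rewrite /haar -ge0_integralD//.
- by apply: eq_integral => t _; case: ifP => _; rewrite -EFinD ?addr0// mulrDl.
- by move=> t _; rewrite lee_fin haar_fun_ge0.
- by apply/measurable_EFinP; exact: measurable_haar_fun.
- by move=> t _; rewrite lee_fin haar_fun_ge0.
- by apply/measurable_EFinP; exact: measurable_haar_fun.
Qed.

Lemma haar_tonelli (K : R -> R -> R) (A B : R -> R) :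
  measurable_fun setT (fun st : measurableTypeR R * measurableTypeR R => K st.1 st.2) ->
  (forall s t, 0 < s -> 0 < t -> 0 <= K s t) ->
  (forall s, 0 < s -> haar (K s) = (A s)%:E) ->
  (forall t, 0 < t -> haar (K^~ t) = (B t)%:E) ->
  haar A = haar B.
Proof.
move=> mK K0 hA hB.
have mKl s : measurable_fun setT (K s).
  exact: (@measurableT_comp _ _ _ _ _ _ _ _ (fun t : measurableTypeR R => (s, t)) mK (measurable_pair1 s)).
have mKr t : measurable_fun setT (K^~ t).
  exact: (@measurableT_comp _ _ _ _ _ _ _ _ (fun s : measurableTypeR R => (s, t)) mK (measurable_pair2 t)).
transitivity (\int[lebR]_s \int[lebR]_t (if (0 < s)%R && (0 < t)%R then K s t / (s * t) else 0)%:E)%E.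
  rewrite haar_haar//; apply: eq_integral => s _; case: ifP => // s0.
  by rewrite hA// -EFinM mulrC.
rewrite haar_swap//.
transitivity (\int[lebR]_t \int[lebR]_s (if (0 < t)%R && (0 < s)%R then K s t / (t * s) else 0)%:E)%E.
  by apply: eq_integral => t _; apply: eq_integral => s _; rewrite andbC [s * t]mulrC.
rewrite (@haar_haar (fun t s => K s t))//; last by move=> s t s0 t0; exact: K0.
by apply: eq_integral => t _; case: ifP => // t0; rewrite hB// -EFinM mulrC.
Qed.

Lemma haar_tail (x a : R) : 0 < x -> 0 < a ->
  haar (fun t => if a <= t then t `^ (- x) else 0) = (a `^ (- x) / x)%:E.
Proof.
move=> x0 a0.
transitivity (\int[@lebR R]_(t in `[a, +oo[) (t `^ (- x - 1))%:E)%E.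
  rewrite integral_mkcond; apply: eq_integral => t _; rewrite patchE.
  have -> : (t \in `[a, +oo[%classic) = (a <= t) by rewrite mem_setE /= in_itv /= andbT.
  case: ltP => t0; last by rewrite leNgt (le_lt_trans t0 a0).
  case: ifP => _; last by rewrite mul0r.
  by rewrite powRB ?powRr1 ?(ltW t0)// (gt_eqF t0) implybT.
have d (t : R) : 0 < t -> is_derive t (1 : R) (fun t : R => - x^-1 * t `^ (- x)) (t `^ (- x - 1)).
  move=> t0; have h := is_deriveZ (- x^-1) (is_derive1_powR (- x) t0).
  apply: (is_derive_eq h); rewrite /GRing.scale /= mulrA mulrNN mulVf ?mul1r//.
  by rewrite gt_eqF.
have := @ge0_continuous_FTC2y R (fun t => t `^ (- x - 1)) (fun t => - x^-1 * t `^ (- x)) a 0.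
rewrite -EFinB sub0r mulNr opprK mulrC; apply.
- by move=> t _; exact: powR_ge0.
- apply: derivable_within_continuous => t; rewrite in_itv /= andbT => at_.
  by apply: derivable_powR; rewrite in_itv /= andbT (lt_le_trans a0).
- rewrite -[X in _ --> X](mulr0 (- x^-1)); apply: cvgM; first exact: cvg_cst.
  apply/cvgrPdist_le => /= e e0.
  have M0 : 0 < e `^ (- x^-1) by rewrite powR_gt0.
  near=> t.
  have Mt : e `^ (- x^-1) <= t by near: t; exact: nbhs_pinfty_ge.
  have t0 : 0 < t by exact: lt_le_trans Mt.
  rewrite sub0r normrN ger0_norm ?powR_ge0// powRN -[leRHS]invrK lef_pV2 ?posrE ?powR_gt0 ?invr_gt0//.
  have -> : e^-1 = (e `^ (- x^-1)) `^ x.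
    by rewrite -powRrM mulNr mulVf ?gt_eqF// powR_inv1// ltW.
  by apply: ge0_ler_powR; rewrite ?nnegrE ?(ltW x0) ?(ltW M0) ?(ltW t0).
- by move=> t at_; have := d t (lt_trans a0 at_) => h; exact: (@ex_derive _ _ _ _ _ _ _ h).
- have c : {for a, continuous (fun t : R => - x^-1 * t `^ (- x))}.
    apply: differentiable_continuous; apply/derivable1_diffP.
    exact: (@ex_derive _ _ _ _ _ _ _ (d a a0)).
  apply: cvg_at_right_filter; rewrite (_ : - (a `^ (- x) / x) = - x^-1 * a `^ (- x)); last by ring.
  exact: c.
- move=> t; rewrite in_itv /= andbT => at_.
  by rewrite derive1E (@derive_val _ _ _ _ _ _ _ (d t (lt_trans a0 at_))).
Unshelve. all: by end_near.
Qed.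

End haar.

(** * The Gamma function as an integral against [dt / t] *)

Section gamma_function.
Context {R : realType}.
Implicit Types x y : R.

Definition gam x (t : R) := t `^ x * expR (- t).

Lemma measurable_gam x : measurable_fun setT (gam x).
Proof.
apply: measurable_funM; first exact: measurable_powR.
by apply: measurableT_comp => //; exact: oppr_measurable.
Qed.

Lemma gam_ge0 x t : 0 <= gam x t.
Proof. by rewrite mulr_ge0 ?powR_ge0 ?expR_ge0. Qed.

Lemma Gamma_haar x : Gamma x = fine (haar (gam x)).
Proof.
rewrite /Gamma -/(lebR) posint_mkcond; congr fine; apply: eq_integral => t _.
case: ifP => // t0; rewrite powRB ?powRr1 ?(ltW t0)//.
  by rewrite /gam mulrAC.
by rewrite (gt_eqF t0) implybT.
Qed.

(** From [t / (2 x) <= expR (t / (2 x))]. Only [expR (t / 2)] is spent, so that against [expR (- t)]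
    half of the decay survives. *)
Lemma powR_le_expR x t : 0 < x -> 0 <= t -> t `^ x <= (2 * x) `^ x * expR (t / 2).
Proof.
move=> x0 t0.
have x20 : 0 < 2 * x by rewrite mulr_gt0.
have -> : t `^ x = (2 * x) `^ x * (t / (2 * x)) `^ x.
  by rewrite -powRM ?divr_ge0 ?(ltW x20)//; congr (_ `^ _); rewrite mulrC divfK ?gt_eqF.
rewrite ler_wpM2l ?powR_ge0//.
have -> : expR (t / 2) = expR (t / (2 * x)) `^ x.
  rewrite /powR gt_eqF ?expR_gt0// expRK; congr expR.
  by field; rewrite gt_eqF.
apply: ge0_ler_powR; rewrite ?nnegrE ?divr_ge0 ?expR_ge0 ?(ltW x0) ?(ltW x20)//.
by apply: le_trans (expR_ge1Dx _); rewrite lerDr.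
Qed.

Lemma haar_head x a : 0 < x -> 0 < a ->
  haar (fun t => if t <= a then t `^ x else 0) = (a `^ x / x)%:E.
Proof.
move=> x0 a0.
have := @haar_tail R x a^-1 x0; rewrite invr_gt0 => /(_ a0).
have -> : a^-1 `^ (- x) = a `^ x.
  by rewrite -powR_inv1 ?(ltW a0)// -powRrM mulrN mulN1r opprK.
move=> <-.
rewrite -haar_inv; last 2 first.
- apply: measurable_fun_ifT; [exact: measurable_fun_ler|exact: measurable_powR|exact: measurable_cst].
- by move=> t t0; case: ifP => // _; exact: powR_ge0.
have e (t : R) : 0 < t -> (t <= a) = (a^-1 <= t^-1) by move=> t0; rewrite lef_pV2 ?posrE.
apply: eq_haar => t t0; rewrite e ?invr_gt0// invrK; case: ifP => // _.
by rewrite -powR_inv1 ?(ltW t0)// -powRrM mulN1r.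
Qed.

Lemma haar_gam_lty x : 0 < x -> (haar (gam x) < +oo)%E.
Proof.
move=> x0.
have mh1 : measurable_fun setT (fun t : R => if t <= 1 then t `^ x else 0).
  by apply: measurable_fun_ifT; [exact: measurable_fun_ler|exact: measurable_powR|exact: measurable_cst].
(* Beyond 1 the integrand is at most [c t exp (- t / 2)], whose integral is [2 c] by rescaling
   [t exp (- t)]. *)
pose c := (2 * (x + 1)) `^ (x + 1).
have mh2 : measurable_fun setT (fun t : R => c * 2 * (2^-1 * t * expR (- (2^-1 * t)))).
  apply: measurable_funM => //; apply: measurable_funM => //.
  by apply: measurableT_comp => //; apply: measurableT_comp => //; exact: measurable_funM.
have c0 : 0 <= c * 2 by rewrite mulr_ge0 ?powR_ge0.
have mg2 : measurable_fun setT (fun t : R => t * expR (- t)).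
  by apply: measurable_funM => //; apply: measurableT_comp => //; exact: oppr_measurable.
apply: (@le_lt_trans _ _ (haar (fun t : R => (if t <= 1 then t `^ x else 0) +
   c * 2 * (2^-1 * t * expR (- (2^-1 * t)))))).
  apply: le_haar; [exact: measurable_gam|exact: measurable_funD|] => t t0.
  rewrite gam_ge0 andTb; case: (leP t 1) => t1.
    rewrite -[leLHS]addr0 lerD//.
      rewrite /gam ler_piMr ?powR_ge0// -expR0 ler_expR oppr_le0 ltW//.
    by rewrite !mulr_ge0 ?expR_ge0 ?powR_ge0 ?(ltW t0).
  rewrite add0r /gam.
  have -> : expR (- t) = expR (- (2^-1 * t)) * expR (- (t / 2)).
    by rewrite -expRD; congr expR; field.
  have h : t `^ x <= t `^ (x + 1) by apply: ler_powR; [exact: ltW|rewrite lerDl].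
  have h2 : t `^ (x + 1) <= c * expR (t / 2) by apply: powR_le_expR; [rewrite addr_gt0|exact: ltW].
  have e1 := expR_gt0 (- (2^-1 * t)); have e2 := expR_gt0 (t / 2).
  rewrite (expRN (t / 2)).
  have : t `^ x / expR (t / 2) <= c by rewrite ler_pdivrMr// (le_trans h).
  have -> : t `^ x * (expR (- (2^-1 * t)) / expR (t / 2)) =
      t `^ x / expR (t / 2) * expR (- (2^-1 * t)) by ring.
  move=> h3; apply: (@le_trans _ _ (c * expR (- (2^-1 * t)))).
    by rewrite ler_wpM2r// ltW.
  have -> : c * 2 * (2^-1 * t * expR (- (2^-1 * t))) = c * expR (- (2^-1 * t)) * t by field.
  by rewrite ler_peMr ?mulr_ge0 ?powR_ge0 ?expR_ge0 ?(ltW t1).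
rewrite haarD//; last 2 first.
- by move=> t t0; case: ifP => // _; exact: powR_ge0.
- by move=> t t0; rewrite !mulr_ge0 ?expR_ge0 ?powR_ge0 ?(ltW t0).
rewrite haar_head// haarZ//; last 2 first.
- apply: measurable_funM; first exact: measurable_funM.
  by apply: measurableT_comp => //; apply: measurableT_comp => //; exact: measurable_funM.
- by move=> t t0; rewrite !mulr_ge0 ?expR_ge0 ?(ltW t0).
rewrite (@haar_scale _ 2^-1 (fun t => t * expR (- t)))//; last first.
  by move=> t t0; rewrite mulr_ge0 ?expR_ge0 ?(ltW t0).
by rewrite haar_expRN mule1 -EFinD ltry.
Qed.

Lemma haar_gam x : 0 < x -> haar (gam x) = (Gamma x)%:E.
Proof.
move=> x0; rewrite Gamma_haar fineK// ge0_fin_numE ?haar_gam_lty//.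
by apply: haar_ge0 => t _; exact: gam_ge0.
Qed.

Lemma Gamma_ge0 x : 0 <= Gamma x.
Proof.
by rewrite Gamma_haar; apply: fine_ge0; apply: haar_ge0 => t _; exact: gam_ge0.
Qed.

Lemma haar_expRN_tail (a : R) : 0 < a ->
  haar (fun t => if a <= t then t * expR (- t) else 0) = (expR (- a))%:E.
Proof.
move=> a0; rewrite -integral_expRN integral_mkcond; apply: eq_integral => t _; rewrite patchE.
have -> : (t \in `[a, +oo[%classic) = (a <= t) by rewrite mem_setE /= in_itv /= andbT.
case: ltP => t0; last by rewrite leNgt (le_lt_trans t0 a0).
case: ifP => _; last by rewrite mul0r.
by rewrite mulrAC divff ?gt_eqF// mul1r.
Qed.

(** Tonelli for [x s^x t exp (- t)] on the region [s <= t]: integrating over [t] first gives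
    [x * gam x s], integrating over [s] first gives [gam (x + 1) t]. *)
Lemma GammaS x : 0 < x -> Gamma (x + 1) = x * Gamma x.
Proof.
move=> x0; have x10 : 0 < x + 1 by rewrite addr_gt0.
apply: (@EFin_inj R); rewrite EFinM -!haar_gam// -haarZ ?(ltW x0)//; last 2 first.
- exact: measurable_gam.
- by move=> t _; exact: gam_ge0.
rewrite -(@haar_tonelli _ (fun s t => x * s `^ x * (if s <= t then t * expR (- t) else 0))
    (fun t => x * gam x t)).
- by [].
- apply: measurable_funM.
    apply: measurable_funM => //.
    exact: (@measurableT_comp _ _ _ _ _ _ (fun t : R => t `^ x) _ fst (measurable_powR x) measurable_fst).
  apply: measurable_fun_ifT; [exact: measurable_fun_ler| |exact: measurable_cst].
  apply: measurable_funM => //; apply: measurableT_comp => //.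
  by apply: (measurableT_comp (@oppr_measurable R setT)); exact: measurable_snd.
- move=> s t s0 t0; rewrite mulr_ge0 ?mulr_ge0 ?powR_ge0 ?(ltW x0)//.
  by case: ifP => // _; rewrite mulr_ge0 ?expR_ge0 ?ltW.
- move=> s s0; rewrite haarZ ?mulr_ge0 ?powR_ge0 ?(ltW x0)//; last 2 first.
  + apply: measurable_fun_ifT; [exact: measurable_fun_ler| |exact: measurable_cst].
    by apply: measurable_funM => //; apply: measurableT_comp => //; exact: oppr_measurable.
  + by move=> t t0; case: ifP => // _; rewrite mulr_ge0 ?expR_ge0 ?ltW.
  by rewrite haar_expRN_tail// -EFinM /gam mulrA.
- move=> t t0; have c0 : 0 <= x * (t * expR (- t)) by rewrite !mulr_ge0 ?expR_ge0 ?ltW.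
  rewrite (@eq_haar _ _ (fun s => x * (t * expR (- t)) * (if s <= t then s `^ x else 0))); last first.
    by move=> s s0; case: ifP => _; rewrite ?mulr0//; ring.
  rewrite haarZ//; last 2 first.
  + by apply: measurable_fun_ifT; [exact: measurable_fun_ler|exact: measurable_powR|exact: measurable_cst].
  + by move=> s s0; case: ifP => // _; exact: powR_ge0.
  rewrite haar_head// -EFinM /gam powRD ?(gt_eqF t0) ?implybT// powRr1 ?(ltW t0)//.
  by congr EFin; field; rewrite gt_eqF.
Qed.

Lemma Gamma_gt0 x : 0 < x -> 0 < Gamma x.
Proof.
move=> x0; have : (0 < haar (gam x))%E.
  apply: (@lt_le_trans _ _ (haar (fun t => expR (- 1) * (if t <= 1 then t `^ x else 0)))).
    rewrite haarZ ?expR_ge0//; last 2 first.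
    - by apply: measurable_fun_ifT; [exact: measurable_fun_ler|exact: measurable_powR|exact: measurable_cst].
    - by move=> s s0; case: ifP => // _; exact: powR_ge0.
    by rewrite haar_head// -EFinM lte_fin mulr_gt0 ?expR_gt0// divr_gt0 ?powR_gt0.
  apply: le_haar; last 1 first.
  - move=> t t0; case: ifP => t1; last by rewrite mulr0 lexx gam_ge0.
    rewrite mulr_ge0 ?expR_ge0 ?powR_ge0//= /gam mulrC ler_wpM2l ?powR_ge0//.
    by rewrite ler_expR lerN2.
  - apply: measurable_funM => //.
    by apply: measurable_fun_ifT; [exact: measurable_fun_ler|exact: measurable_powR|exact: measurable_cst].
  - exact: measurable_gam.
by rewrite haar_gam// lte_fin.
Qed.

Lemma Gamma_prod x n : 0 < x -> Gamma (x + n%:R) = (\prod_(i < n) (x + i%:R)) * Gamma x.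
Proof.
move=> x0; elim: n => [|n IH]; first by rewrite addr0 big_ord0 mul1r.
rewrite -natr1 addrA GammaS ?IH; last by rewrite ltr_wpDr.
by rewrite big_ord_recr /= [in RHS]mulrAC mulrC.
Qed.

(** Extra factors are absorbed by the functional equation, so the cut-off built into [rGamma] can be
    exchanged for the one that the radial integral brings along. *)
Lemma rGammaE x n : 0 < x + n%:R -> rGamma x = (\prod_(i < n) (x + i%:R)) / Gamma (x + n%:R).
Proof.
have aux m k : 0 < x + m%:R -> (\prod_(i < (m + k)%N) (x + i%:R)) / Gamma (x + (m + k)%:R) =
    (\prod_(i < m) (x + i%:R)) / Gamma (x + m%:R).
  move=> m0; rewrite natrD addrA (Gamma_prod _ m0).
  rewrite big_split_ord /=.
  rewrite (eq_bigr (fun i : 'I_k => x + m%:R + i%:R)); last by move=> i _; rewrite natrD addrA.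
  have p0 : \prod_(i < k) (x + m%:R + i%:R) != 0.
    by apply/prodf_neq0 => i _; rewrite gt_eqF// ltr_wpDr.
  have g0 := Gamma_gt0 m0.
  by field; rewrite p0 gt_eqF.
move=> n0; rewrite /rGamma; set N := (Num.truncn `|x|).+1.
have N0 : 0 < x + N%:R.
  have : `|x| < N%:R by exact: truncnS_gt.
  by rewrite ltr_norml => /andP[+ _]; rewrite ltrNl => ?; rewrite addrC -ltrBlDr sub0r.
have [/subnKC <-|/ltnW/subnKC <-] := leqP n N; first by rewrite aux.
by rewrite -/N aux.
Qed.

(** Takes the place of Stirling's formula. In the integral of [t^(x + y) exp (- t)], half of the
    exponential bounds [t^y] by [(2 y)^y], and the other half leaves [Gamma x] rescaled by [2^x]. *)
Lemma Gamma_add_le x y : 0 < x -> 0 < y ->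
  Gamma (x + y) <= (2 * y) `^ y * 2 `^ x * Gamma x.
Proof.
move=> x0 y0; have xy0 : 0 < x + y by rewrite addr_gt0.
rewrite -lee_fin EFinM -!haar_gam//.
have mg := @measurable_gam x; have g0 := @gam_ge0 x.
have ms : measurable_fun setT (fun t : R => gam x (2^-1 * t)).
  by apply: (measurableT_comp mg); exact: measurable_funM.
rewrite -(@haar_scale _ 2^-1 (gam x)) ?invr_gt0//.
rewrite -haarZ ?mulr_ge0 ?powR_ge0//.
apply: le_haar; [exact: measurable_gam|exact: measurable_funM|] => t t0.
rewrite gam_ge0 andTb /gam powRD ?(gt_eqF t0) ?implybT// [(2^-1 * t) `^ x]powRM ?invr_ge0 ?(ltW t0)//.
have -> : (2 : R) `^ x = ((2 : R)^-1 `^ x)^-1 by rewrite -powRN -powR_inv1// -powRrM mulrNN mul1r.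

have h := @powR_le_expR y t y0 (ltW t0).
have -> : expR (- t) = expR (- (2^-1 * t)) / expR (t / 2).
  by rewrite -expRN -expRD; congr expR; field.
have e1 := expR_gt0 (- (2^-1 * t)); have e2 := expR_gt0 (t / 2).
have p0 : 0 < (2 : R)^-1 `^ x by rewrite powR_gt0.
have -> : (2 * y) `^ y / 2^-1 `^ x * (2^-1 `^ x * t `^ x * expR (- (2^-1 * t))) =
   t `^ x * expR (- (2^-1 * t)) * ((2 * y) `^ y) by field; rewrite gt_eqF.
have -> : t `^ x * t `^ y * (expR (- (2^-1 * t)) / expR (t / 2)) =
   t `^ x * expR (- (2^-1 * t)) * (t `^ y / expR (t / 2)) by ring.
by rewrite ler_wpM2l ?mulr_ge0 ?powR_ge0 ?(ltW e1)// ler_pdivrMr.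
Qed.

Lemma haar_powR_expN x c : 0 < x -> 0 < c ->
  haar (fun t => t `^ x * expR (- (t * c))) = (c `^ (- x) * Gamma x)%:E.
Proof.
move=> x0 c0; rewrite EFinM -haar_gam//.
rewrite -(@haar_scale _ c (gam x))//; last 2 first.
- exact: measurable_gam.
- by move=> t _; exact: gam_ge0.
rewrite -haarZ ?powR_ge0//; last 2 first.
- by apply: (measurableT_comp (measurable_gam x)); exact: measurable_funM.
- by move=> t _; exact: gam_ge0.
apply: eq_haar => t t0; rewrite /gam powRM ?(ltW c0) ?(ltW t0)// powRN [c * t]mulrC.
have p0 : 0 < c `^ x by rewrite powR_gt0.
by field; rewrite gt_eqF.
Qed.

Lemma haar_powRN_expV x c : 0 < x -> 0 < c ->
  haar (fun t => t `^ (- x) * expR (- (c / t))) = (c `^ (- x) * Gamma x)%:E.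
Proof.
move=> x0 c0; rewrite -(haar_powR_expN x0 c0) -(@haar_inv _ (fun t => t `^ x * expR (- (t * c)))).
- apply: eq_haar => t t0; congr (_ * expR (- _)); last by rewrite mulrC.
  by rewrite -powR_inv1 ?(ltW t0)// -powRrM mulN1r.
- apply: measurable_funM; first exact: measurable_powR.
  apply: measurableT_comp => //; apply: measurableT_comp => //; exact: measurable_funM.
- by move=> t t0; rewrite mulr_ge0 ?powR_ge0 ?expR_ge0.
Qed.

End gamma_function.

(** * Polar coordinates and the sphere *)

Section euclidean_space.
Context {R : realType} {n : nat}.
Implicit Types (u v w : vec R n) (c : R).

Lemma dotp_ge0 v : 0 <= dotp v v.
Proof. by apply: sumr_ge0 => i _; rewrite -expr2 sqr_ge0. Qed.

Lemma dotpC u v : dotp u v = dotp v u.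
Proof. by apply: eq_bigr => i _; rewrite mulrC. Qed.

Lemma dotp_scalel c u v : dotp (scalev c u) v = c * dotp u v.
Proof. by rewrite /dotp mulr_sumr; apply: eq_bigr => i _; rewrite tnth_scalev mulrA. Qed.

Lemma dotp_scaler c u v : dotp u (scalev c v) = c * dotp u v.
Proof. by rewrite dotpC dotp_scalel dotpC. Qed.

Lemma vnorm_ge0 v : 0 <= vnorm v. Proof. exact: sqrtr_ge0. Qed.

Lemma vnorm_sqr v : vnorm v ^+ 2 = dotp v v.
Proof. by rewrite sqr_sqrtr ?dotp_ge0. Qed.

Lemma vnorm_scalev c v : vnorm (scalev c v) = `|c| * vnorm v.
Proof.
by rewrite /vnorm dotp_scalel dotp_scaler mulrA -expr2 sqrtrM ?sqr_ge0// sqrtr_sqr.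
Qed.

Lemma unitvE v : unitv v = scalev (vnorm v)^-1 v.
Proof. by apply: eq_from_tnth => i; rewrite tnth_scalev tnth_map mulrC. Qed.

Lemma scalevA c e v : scalev c (scalev e v) = scalev (c * e) v.
Proof. by apply: eq_from_tnth => i; rewrite !tnth_scalev mulrA. Qed.

Lemma scalev1 v : scalev 1 v = v.
Proof. by apply: eq_from_tnth => i; rewrite !tnth_scalev mul1r. Qed.

Lemma unitv_scalev c v : 0 < c -> unitv (scalev c v) = unitv v.
Proof.
move=> c0; rewrite !unitvE scalevA vnorm_scalev gtr0_norm// invfM mulrAC.
by rewrite mulVf ?gt_eqF// mul1r.
Qed.

Lemma vnorm_unitv v : 0 < vnorm v -> vnorm (unitv v) = 1.
Proof.
move=> v0; rewrite unitvE vnorm_scalev gtr0_norm ?invr_gt0//.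
by rewrite mulVf ?gt_eqF.
Qed.

Lemma scalev_unitv v : 0 < vnorm v -> scalev (vnorm v) (unitv v) = v.
Proof. by move=> v0; rewrite unitvE scalevA mulfV ?gt_eqF// scalev1. Qed.

Lemma vnorm0_eq v : vnorm v = 0 -> forall i, tnth v i = 0.
Proof.
move=> v0 i; have : dotp v v = 0 by rewrite -vnorm_sqr v0 expr0n.
move/eqP; rewrite psumr_eq0 => [/allP/(_ i)|k _]; last by rewrite -expr2 sqr_ge0.
by rewrite mem_index_enum -expr2 sqrf_eq0 => /(_ isT)/eqP.
Qed.

Lemma dotp_le_vnorm u v : `|dotp u v| <= vnorm u * vnorm v.
Proof.
have key (a b : vec R n) : vnorm a = 1 -> vnorm b = 1 -> dotp a b <= 1.
  move=> a1 b1; have da : dotp a a = 1 by rewrite -vnorm_sqr a1 expr1n.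
  have db : dotp b b = 1 by rewrite -vnorm_sqr b1 expr1n.
  have : 0 <= \sum_(i < n) (tnth a i - tnth b i) ^+ 2 by apply: sumr_ge0 => i _; rewrite sqr_ge0.
  have -> : \sum_(i < n) (tnth a i - tnth b i) ^+ 2 = dotp a a + dotp b b - 2 * dotp a b.
    rewrite /dotp mulr_sumr -big_split -sumrB; apply: eq_bigr => i _ /=; ring.
  by rewrite da db; lra.
have [u0|u0] := eqVneq (vnorm u) 0.
  by rewrite u0 mul0r /dotp big1 ?normr0// => i _; rewrite vnorm0_eq// mul0r.
have [v0|v0] := eqVneq (vnorm v) 0.
  by rewrite v0 mulr0 /dotp big1 ?normr0// => i _; rewrite (vnorm0_eq v0) mulr0.
have {}u0 : 0 < vnorm u by rewrite lt_neqAle eq_sym u0 vnorm_ge0.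
have {}v0 : 0 < vnorm v by rewrite lt_neqAle eq_sym v0 vnorm_ge0.
rewrite -(scalev_unitv u0) -(scalev_unitv v0) dotp_scalel dotp_scaler !vnorm_scalev.
rewrite !vnorm_unitv// !mulr1 !normrM [`|vnorm u|]gtr0_norm// [`|vnorm v|]gtr0_norm// mulrA.
rewrite ler_piMr ?mulr_ge0 ?vnorm_ge0// ler_norml key ?vnorm_unitv// andbT.
have := key (scalev (-1) (unitv u)) (unitv v).
rewrite vnorm_scalev normrN1 mul1r !vnorm_unitv// dotp_scalel mulN1r => /(_ erefl erefl).
by rewrite lerNl.
Qed.

Lemma measurable_vnorm : measurable_fun setT (fun v : n.-tuple R => vnorm v).
Proof.
apply: (@measurableT_comp _ _ _ _ _ _ (fun t : R => Num.sqrt t)); last exact: measurable_dotpp.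
exact: continuous_measurable_fun (@sqrt_continuous R).
Qed.

Lemma measurable_unitv : measurable_fun [set: n.-tuple R] (@unitv R n).
Proof.
apply/measurable_fun_tnthP => i.
rewrite (_ : _ \o _ = (fun v => (vnorm v)^-1 * tnth v i)); last first.
  by apply/funext => v /=; rewrite unitvE tnth_scalev.
apply: measurable_funM; last exact: measurable_tnth.
exact: (measurableT_comp measurable_inv measurable_vnorm).
Qed.

End euclidean_space.

Section gaussn.
Import -(notations) mpoly.
Context {R : realType} {n : nat}.

Lemma integrable_gaussn (s : R) : 0 < s ->
  (lebn n).-integrable setT (fun v : n.-tuple R => (expR (- (s * dotp v v)))%:E).
Proof.
move=> s0; have := cintegrable_cabs (cintegrable_gfun [tuple of nseq n 0] s0 (1 : mpoly.mpoly n R[i])).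
apply: eq_integrable => // v _; congr EFin.
rewrite /gfun cpoly1 mul1r cabsM cabs_real ger0_norm ?expR_ge0// cabs_cexp.
by rewrite cReN cReM /= mulr0 mul0r subr0 oppr0 expR0 mulr1.
Qed.

End gaussn.

Section polar.
Context {R : realType} {n : nat}.
Local Notation V := (n.-tuple R).
Hypothesis n0 : (0 < n)%N.

Lemma measurable_sphere_ext d (T : measurableType d) (g : T -> V) (h : T -> R) (r : T -> R) :
  measurable_fun setT g -> measurable_fun setT h -> measurable_fun setT r ->
  measurable_fun setT (fun t => if 0 < vnorm (g t) <= r t then h t else 0).
Proof.
move=> mg mh mr; have mn := measurableT_comp measurable_vnorm mg.
apply: measurable_fun_ifT => //; apply: measurable_and.
  exact: measurable_fun_ltr.
exact: measurable_fun_ler.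
Qed.

(** No parametrisation of the sphere, only the cone measure behind [sint]. Since [dt / t] is scale
    invariant, [phi t] may be replaced by [phi (t |v|)] for [v] in the ball; substituting [v / t]
    for [v] then leaves the integral of [t^(- n) dt / t] over [t >= |v|], which is [|v|^(- n) / n]
    and cancels the factor [n]. *)
Lemma ge0_polar (f : V -> R) (phi : R -> R) :
  measurable_fun setT f -> (forall v, 0 <= f v) ->
  measurable_fun setT phi -> (forall t, 0 <= phi t) ->
  (n%:R%:E * (haar phi * \int[lebn n]_v (if (0 < vnorm v <= 1)%R then f (unitv v) else 0)%:E) =
  \int[lebn n]_v (if (0 < vnorm v)%R then f (unitv v) * (phi (vnorm v) / vnorm v ^+ n) else 0)%:E)%E.
Proof.
move=> mf f0 mphi phi0.
have mfu : measurable_fun setT (fun v : V => f (unitv v)).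
  exact: (measurableT_comp mf measurable_unitv).
have nR0 : 0 < n%:R :> R by rewrite ltr0n.
pose h v := if 0 < vnorm v <= 1 then f (unitv v) else 0.
have h0 v : 0 <= h v by rewrite /h; case: ifP.
have mh : measurable_fun setT h by exact: measurable_sphere_ext.
have mphis c : measurable_fun setT (fun t : R => phi (t * c)).
  by apply: (measurableT_comp mphi); exact: measurable_funM.
have mV := @measurable_inv R.
have -> : (haar phi * \int[lebn n]_v (h v)%:E =
    \int[lebn n]_v \int[lebR]_t (if (0 < t)%R then h v * phi (t * vnorm v) / t else 0)%:E)%E.
  rewrite -ge0_integralZl//; last 3 first.
  - exact/measurable_EFinP.
  - by move=> v _; rewrite lee_fin.
  - exact: haar_ge0.
  apply: eq_integral => v _; rewrite -/(haar (fun t => h v * phi (t * vnorm v))) haarZ//.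
  rewrite /h; case: ifPn => [/andP[v0 _]|_]; last by rewrite mul0e mule0.
  rewrite muleC; congr (_ * _)%E; rewrite -(haar_scale v0)//.
  by apply: eq_haar => t _; rewrite mulrC.
rewrite (@fubini_tonelli _ _ _ _ R (lebn n) lebR (fun vt : V * measurableTypeR R =>
  (if 0 < vt.2 then h vt.1 * phi (vt.2 * vnorm vt.1) / vt.2 else 0)%:E)); last 2 first.
- apply/measurable_EFinP; apply: measurable_pos_if; first exact: measurable_snd.
  apply: measurable_funM; last exact: (measurableT_comp mV measurable_snd).
  apply: measurable_funM; first exact: (measurableT_comp mh measurable_fst).
  apply: (measurableT_comp mphi); apply: measurable_funM; first exact: measurable_snd.
  exact: (measurableT_comp measurable_vnorm measurable_fst).
- move=> [v t] /=; rewrite lee_fin; case: ifP => // t0.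
  by rewrite !mulr_ge0 ?invr_ge0 ?(ltW t0).
pose G t v := if 0 < vnorm v <= t then f (unitv v) * phi (vnorm v) else 0.
have G0 t v : 0 <= G t v by rewrite /G; case: ifP => // _; rewrite mulr_ge0.
have mphin : measurable_fun setT (fun v : V => phi (vnorm v)).
  exact: (measurableT_comp mphi measurable_vnorm).
have mG t : measurable_fun setT (G t).
  by apply: measurable_sphere_ext => //; exact: measurable_funM.
have hG t v : 0 < t -> h v * phi (t * vnorm v) = G t (scalev t v).
  move=> t0; rewrite /h /G vnorm_scalev gtr0_norm// unitv_scalev//.
  rewrite pmulr_rgt0// ger_pMr//.
  by case: ifP; rewrite ?mul0r.
transitivity (n%:R%:E * \int[lebR]_t \int[lebn n]_v
    (if (0 < t)%R then G t v * t ^- n / t else 0)%:E)%E.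
  congr (_ * _)%E; apply: eq_integral => t _ /=; have [t0|t0] := ltP 0 t; last first.
    by rewrite !integral0_eq// => v _; rewrite ltNge t0.
  transitivity (\int[lebn n]_v ((t^-1)%:E * (G t (scalev t v))%:E))%E.
    by apply: eq_integral => v _; rewrite -EFinM -hG// mulrC.
  rewrite ge0_integralZl//; last 3 first.
  - apply/measurable_EFinP; apply: (measurableT_comp (mG t)); exact: measurable_scalev.
  - by move=> v _; rewrite lee_fin.
  - by rewrite lee_fin invr_ge0 ltW.
  rewrite (@ge0_integral_scalev _ _ t (fun v => (G t v)%:E))//; last 2 first.
  - exact/measurable_EFinP.
  - by move=> v; rewrite lee_fin.
  rewrite muleA -EFinM -ge0_integralZl//; last 3 first.
  - exact/measurable_EFinP.
  - by move=> v _; rewrite lee_fin.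
  - by rewrite lee_fin mulr_ge0 ?invr_ge0 ?exprn_ge0 ?(ltW t0).
  by apply: eq_integral => v _; rewrite -EFinM; congr EFin; rewrite mulrC [t^-1 * _]mulrC mulrA.
have mGG : measurable_fun setT (fun vt : V * measurableTypeR R =>
  (if 0 < vt.2 then G vt.2 vt.1 * vt.2 ^- n / vt.2 else 0)%:E).
  apply/measurable_EFinP; apply: measurable_pos_if; first exact: measurable_snd.
  apply: measurable_funM; last exact: (measurableT_comp mV measurable_snd).
  apply: measurable_funM.
    apply: measurable_sphere_ext; [exact: measurable_fst| |exact: measurable_snd].
    by apply: measurable_funM; [exact: (measurableT_comp mfu measurable_fst)|exact: (measurableT_comp mphin measurable_fst)].
  by apply: (measurableT_comp mV); apply: measurable_funX; exact: measurable_snd.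
rewrite -(@fubini_tonelli _ _ _ _ R (lebn n) lebR _ mGG); last first.
  move=> [v t] /=; rewrite lee_fin; case: ifP => // t0.
  by rewrite !mulr_ge0 ?invr_ge0 ?exprn_ge0 ?(ltW t0).
rewrite -ge0_integralZl//; last 2 first.
- exact: (measurable_integral_section mGG).
- move=> v _; apply: integral_ge0 => t _ /=; rewrite lee_fin; case: ifP => // t0.
  by rewrite !mulr_ge0 ?invr_ge0 ?exprn_ge0 ?(ltW t0).
apply: eq_integral => v _ /=.
case: ltP => v0; last first.
  rewrite integral0_eq ?mule0// => t _; case: ifP => // t0.
  by rewrite /G ltNge v0 !mul0r.
transitivity (n%:R%:E * haar (fun t : R => (f (unitv v) * phi (vnorm v) *
    (if vnorm v <= t then t `^ (- n%:R) else 0))%R))%E.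
  congr (_ * _)%E; apply: eq_integral => t _; case: ifP => t0 //.
  rewrite /G v0 /=; case: ifP => _; rewrite ?mulr0 ?mul0r//.
  by rewrite powRN powR_mulrn// ltW.
rewrite haarZ ?mulr_ge0//; last 2 first.
- by apply: measurable_fun_ifT; [exact: measurable_fun_ler|exact: measurable_powR|exact: measurable_cst].
- by move=> s s0; case: ifP => // _; exact: powR_ge0.
rewrite haar_tail// -!EFinM powRN powR_mulrn ?(ltW v0)//.
by congr EFin; field; rewrite !gt_eqF// exprn_gt0.
Qed.

Implicit Types f g : vec R n -> R[i].

Definition ball_fun f (v : V) : R[i] := if 0 < vnorm v <= 1 then f (unitv v) else 0.

Definition sph_bounded (M : R) f := forall u, vnorm u = 1 -> cabs (f u) <= M.

Lemma eq_sint f g : (forall u, vnorm u = 1 -> f u = g u) -> sint f = sint g.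
Proof.
move=> fg; rewrite /sint; congr (_ * cint _); apply/funext => v.
by case: ifP => // /andP[v0 _]; rewrite fg// vnorm_unitv.
Qed.

Lemma cmeasurable_if d (T : measurableType d) (b : T -> bool) (f1 f2 : T -> R[i]) :
  measurable_fun setT b -> cmeasurable f1 -> cmeasurable f2 ->
  cmeasurable (fun t => if b t then f1 t else f2 t).
Proof.
move=> mb [r1 i1] [r2 i2]; split.
  rewrite (_ : (fun _ => _) = (fun t => if b t then complex.Re (f1 t) else complex.Re (f2 t))).
    exact: measurable_fun_ifT.
  by apply/funext => t; case: ifP.
rewrite (_ : (fun _ => _) = (fun t => if b t then complex.Im (f1 t) else complex.Im (f2 t))).
  exact: measurable_fun_ifT.
by apply/funext => t; case: ifP.
Qed.

Lemma measurable_ball : measurable_fun setT (fun v : V => 0 < vnorm v <= 1).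
Proof.
have mn := @measurable_vnorm R n.
by apply: measurable_and; [exact: measurable_fun_ltr|exact: measurable_fun_ler].
Qed.

Lemma cmeasurable_unitv f : cmeasurable (f : V -> _) -> cmeasurable (fun v : V => f (unitv v)).
Proof. by move=> mf; apply: (cmeasurable_comp mf); exact: measurable_unitv. Qed.

Lemma cmeasurable_ball_fun f : cmeasurable (f : V -> _) -> cmeasurable (ball_fun f).
Proof.
move=> mf; apply: cmeasurable_if; first exact: measurable_ball.
  exact: cmeasurable_unitv.
exact: cmeasurable_cst.
Qed.

Lemma cintegrable_ball_fun f M : cmeasurable (f : V -> _) -> sph_bounded M f ->
  cintegrable (lebn n) (ball_fun f).
Proof.
move=> mf fM; pose K := Num.max M 0 * expR 1.
apply: (@le_cintegrable _ _ _ _ _ (fun v => K * expR (- (1 * dotp v v)))).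
- exact: cmeasurable_ball_fun.
- under eq_fun do rewrite EFinM; apply: integrableZl => //.
  exact: integrable_gaussn.
- move=> v; have K0 : 0 <= K * expR (- (1 * dotp v v)).
    by rewrite !mulr_ge0 ?expR_ge0// le_max lexx orbT.
  rewrite /ball_fun; case: ifPn => [/andP[v0 v1]|_]; last by rewrite cabs0.
  apply: (@le_trans _ _ (Num.max M 0)).
    by rewrite le_max fM// vnorm_unitv.
  rewrite /K -mulrA -expRD ler_peMr//; first by rewrite le_max lexx orbT.
  rewrite -[leLHS]expR0 ler_expR mul1r subr_ge0 -vnorm_sqr.
  by rewrite expr_le1 ?vnorm_ge0.
Qed.

Lemma sintE f M : cmeasurable (f : V -> _) -> sph_bounded M f ->
  sint f = n%:R%:C * cintegral (lebn n) (ball_fun f).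
Proof.
move=> mf fM; have [i1 i2] := cintegrable_ball_fun mf fM.
by congr (_ * Complex _ _); [exact: (congr1 fine (iintE i1))|exact: (congr1 fine (iintE i2))].
Qed.

Lemma ge0_integrable_polar (f : V -> R) (phi : R -> R) (c M : R) :
  measurable_fun setT f -> (forall v, 0 <= f v) -> (forall u, vnorm u = 1 -> f u <= M) ->
  measurable_fun setT phi -> (forall t, 0 <= phi t) -> haar phi = c%:E ->
  (lebn n).-integrable setT (fun v : V =>
     (if (0 < vnorm v)%R then f (unitv v) * (phi (vnorm v) / vnorm v ^+ n) else 0)%:E) /\
  \int[lebn n]_v (if 0 < vnorm v then f (unitv v) * (phi (vnorm v) / vnorm v ^+ n) else 0) =
  c * (n%:R * \int[lebn n]_v (if 0 < vnorm v <= 1 then f (unitv v) else 0)).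
Proof.
move=> mf f0 fM mphi phi0 hphi.
have mfu : measurable_fun setT (fun v : V => f (unitv v)).
  exact: (measurableT_comp mf measurable_unitv).
have mn := @measurable_vnorm R n.
have [ib _] : cintegrable (lebn n) (ball_fun (fun u => (f u)%:C)).
  apply: (@cintegrable_ball_fun _ M); first exact: cmeasurable_real.
  by move=> u u1; rewrite cabs_real ger0_norm// fM.
have {}ib : (lebn n).-integrable setT
    (fun v : V => (if (0 < vnorm v <= 1)%R then f (unitv v) else 0)%:E).
  by apply: eq_integrable ib => // v _; rewrite /ball_fun; case: ifP.
have P := ge0_polar mf f0 mphi phi0; rewrite hphi in P.
have E : (\int[lebn n]_v (if (0 < vnorm v <= 1)%R then f (unitv v) else 0)%:E =
  (\int[lebn n]_v (if 0 < vnorm v <= 1 then f (unitv v) else 0)%R)%:E)%E.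
  by rewrite fineK//; exact: integrable_fin_num.
rewrite E -!EFinM in P.
split; last by rewrite [LHS]/Rintegral -P /= mulrCA.
apply/integrableP; split.
  apply/measurable_EFinP; apply: measurable_pos_if => //; apply: measurable_funM => //.
  apply: measurable_funM; first exact: (measurableT_comp mphi).
  by apply: (measurableT_comp (@measurable_inv R)); exact: measurable_funX.
rewrite (eq_integral (fun v : V =>
    (if (0 < vnorm v)%R then f (unitv v) * (phi (vnorm v) / vnorm v ^+ n) else 0)%:E)); last first.
  move=> v _; rewrite gee0_abs ?lee_fin//.
  by case: ifP => // v0; rewrite !mulr_ge0 ?invr_ge0 ?exprn_ge0 ?(ltW v0).
by rewrite -P ltry.
Qed.

Lemma real_polar (f : V -> R) (phi : R -> R) (c M : R) :
  measurable_fun setT f -> (forall v, `|f v| <= M) ->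
  measurable_fun setT phi -> (forall t, 0 <= phi t) -> haar phi = c%:E ->
  (lebn n).-integrable setT (fun v : V =>
     (if (0 < vnorm v)%R then f (unitv v) * (phi (vnorm v) / vnorm v ^+ n) else 0)%:E) /\
  \int[lebn n]_v (if 0 < vnorm v then f (unitv v) * (phi (vnorm v) / vnorm v ^+ n) else 0) =
  c * (n%:R * \int[lebn n]_v (if 0 < vnorm v <= 1 then f (unitv v) else 0)).
Proof.
move=> mf fM mphi phi0 hphi.
have mfu : measurable_fun setT (fun v : V => f (unitv v)).
  exact: (measurableT_comp mf measurable_unitv).
(* A bounded real function is the difference of two nonnegative ones, [f + M] and the constant
   [M]. *)
have mfM : measurable_fun setT (fun v : V => f v + M) by exact: measurable_funD.
have M0 : 0 <= M by exact: le_trans (fM [tuple of nseq n 0]).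
have fM1 v : 0 <= f v + M by have := fM v; rewrite ler_norml => /andP[]; lra.
have fM2 v : f v + M <= M + M by have := fM v; rewrite ler_norml => /andP[]; lra.
have [i1 e1] := ge0_integrable_polar mfM fM1 (fun u _ => fM2 u) mphi phi0 hphi.
have [i2 e2] := ge0_integrable_polar (@measurable_cst _ _ V R setT M) (fun=> M0)
  (fun _ _ => lexx M) mphi phi0 hphi.
have ib (g : V -> R) : measurable_fun setT g -> (forall v, `|g v| <= M + M) ->
    (lebn n).-integrable setT (fun v : V => (if (0 < vnorm v <= 1)%R then g (unitv v) else 0)%:E).
  move=> mg gM; have [ib _] : cintegrable (lebn n) (ball_fun (fun u => (g u)%:C)).
    apply: (@cintegrable_ball_fun _ (M + M)); first exact: cmeasurable_real.
    by move=> u u1; rewrite cabs_real.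
  by apply: eq_integrable ib => // v _; rewrite /ball_fun; case: ifP.
have ib1 := ib _ mfM; have ib2 := ib _ (@measurable_cst _ _ V R setT M).
set F := fun v : V => (if 0 < vnorm v then f (unitv v) * (phi (vnorm v) / vnorm v ^+ n) else 0)%R.
set B := fun v : V => (if 0 < vnorm v <= 1 then f (unitv v) else 0)%R.
have EF v : F v = (if 0 < vnorm v then (f (unitv v) + M) * (phi (vnorm v) / vnorm v ^+ n) else 0)
     - (if 0 < vnorm v then M * (phi (vnorm v) / vnorm v ^+ n) else 0).
  by rewrite /F; case: ifP; rewrite ?subr0// mulrDl addrK.
have EB v : B v = (if 0 < vnorm v <= 1 then (f (unitv v) + M) else 0)
     - (if 0 < vnorm v <= 1 then M else 0).
  by rewrite /B; case: ifP; rewrite ?subr0// addrK.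
split.
  have := integrableB measurableT i1 i2; apply: eq_integrable => // v _.
  by rewrite -EFinB; congr EFin; exact: esym (EF v).
rewrite (_ : \int[lebn n]_v F v = \int[lebn n]_v ((if 0 < vnorm v then (f (unitv v) + M) * (phi (vnorm v) / vnorm v ^+ n) else 0)
     - (if 0 < vnorm v then M * (phi (vnorm v) / vnorm v ^+ n) else 0))); last first.
  by apply: eq_Rintegral => v _; rewrite EF.
rewrite (_ : \int[lebn n]_v B v = \int[lebn n]_v ((if 0 < vnorm v <= 1 then (f (unitv v) + M) else 0)
     - (if 0 < vnorm v <= 1 then M else 0))); last first.
  by apply: eq_Rintegral => v _; rewrite EB.
have RB (g1 g2 : V -> R) : (lebn n).-integrable setT (EFin \o g1) ->
    (lebn n).-integrable setT (EFin \o g2) ->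
    \int[lebn n]_v (g1 v - g2 v) = \int[lebn n]_v g1 v - \int[lebn n]_v g2 v.
  by move=> *; exact: RintegralB.
transitivity (c * (n%:R * \int[lebn n]_v (if 0 < vnorm v <= 1 then (f (unitv v) + M) else 0)) -
   c * (n%:R * \int[lebn n]_v (if 0 < vnorm v <= 1 then M else 0))).
  by rewrite -e1 -e2; exact: (RB _ _ i1 i2).
rewrite -mulrBr -mulrBr; congr (_ * (_ * _)); apply/esym; apply: RB.
- by apply: ib1 => v; rewrite ger0_norm.
- by apply: ib2 => v; rewrite ger0_norm// lerDl.
Qed.

Lemma cpolar f (phi : R -> R) (c M : R) :
  cmeasurable (f : V -> _) -> (forall v, cabs (f v) <= M) ->
  measurable_fun setT phi -> (forall t, 0 <= phi t) -> haar phi = c%:E ->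
  cintegrable (lebn n) (fun v : V =>
     if (0 < vnorm v)%R then f (unitv v) * (phi (vnorm v) / vnorm v ^+ n)%:C else 0) /\
  cintegral (lebn n) (fun v : V =>
     if (0 < vnorm v)%R then f (unitv v) * (phi (vnorm v) / vnorm v ^+ n)%:C else 0) =
  c%:C * sint f.
Proof.
move=> mf fM mphi phi0 hphi; rewrite (sintE mf (fun u _ => fM u)); case: mf => mr mi.
have [i1 e1] := real_polar mr (fun v => le_trans (le_Re_cabs _) (fM v)) mphi phi0 hphi.
have [i2 e2] := real_polar mi (fun v => le_trans (le_Im_cabs _) (fM v)) mphi phi0 hphi.
have ER v : complex.Re (if (0 < vnorm v)%R then f (unitv v) * (phi (vnorm v) / vnorm v ^+ n)%:C else 0)
  = if (0 < vnorm v)%R then complex.Re (f (unitv v)) * (phi (vnorm v) / vnorm v ^+ n) else 0.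
  by case: ifP => // _; rewrite cReM /= mulr0 subr0.
have EI v : complex.Im (if (0 < vnorm v)%R then f (unitv v) * (phi (vnorm v) / vnorm v ^+ n)%:C else 0)
  = if (0 < vnorm v)%R then complex.Im (f (unitv v)) * (phi (vnorm v) / vnorm v ^+ n) else 0.
  by case: ifP => // _; rewrite cImM /= mulr0 add0r.
split.
  by split; [apply: eq_integrable i1|apply: eq_integrable i2] => // v _; rewrite ?ER ?EI.
rewrite mulrA -rcM; apply: eqC.
  rewrite cReM [complex.Re _%:C]/= [complex.Im _%:C]/= mul0r subr0 -mulrA.
  etransitivity; first (apply: eq_Rintegral => v _; exact: ER).
  rewrite e1; by congr (_ * (_ * _)); apply: eq_Rintegral => v _; rewrite /ball_fun; case: ifP.
rewrite cImM [complex.Re _%:C]/= [complex.Im _%:C]/= mul0r addr0 -mulrA.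
etransitivity; first (apply: eq_Rintegral => v _; exact: EI).
rewrite e2; by congr (_ * (_ * _)); apply: eq_Rintegral => v _; rewrite /ball_fun; case: ifP.
Qed.

End polar.

Section haar_signed.
Context {R : realType}.
Implicit Types f g : R -> R.

Lemma haarE f : haar f =
  (haar (fun t => Num.max (f t) 0%R) - haar (fun t => Num.max (- f t)%R 0%R))%E.
Proof.
rewrite [in LHS]/haar integralE; congr (_ - _)%E; apply: eq_integral => t _.
  rewrite funeposE /=; case: ifP => t0; last by rewrite maxxx.
  by rewrite -EFin_max; congr EFin; rewrite maxr_pMl ?mul0r// invr_ge0 ltW.
rewrite funenegE /=; case: ifP => t0; last by rewrite /= oppr0 maxxx.
by rewrite -EFin_max; congr EFin; rewrite maxr_pMl ?mul0r ?mulNr// invr_ge0 ltW.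
Qed.

Lemma haar_scale_signed c f : 0 < c -> measurable_fun setT f ->
  haar (fun t => f (c * t)) = haar f.
Proof.
move=> c0 mf; rewrite haarE [in RHS]haarE; congr (_ - _)%E.
  apply: (@haar_scale _ c (fun t => Num.max (f t) 0)) => //.
    by apply: measurable_maxr.
  by move=> t _; rewrite le_max lexx orbT.
apply: (@haar_scale _ c (fun t => Num.max (- f t) 0)) => //.
  by apply: measurable_maxr => //; exact: measurableT_comp.
by move=> t _; rewrite le_max lexx orbT.
Qed.

(** A nonnegative integrand with zero integral vanishes almost everywhere, whereas the unit interval
    has positive measure. *)
Lemma haar_gt0 f : measurable_fun setT f -> (forall t, 0 < t -> 0 <= f t) ->
  (forall t, 0 < t <= 1 -> 0 < f t) -> (0 < haar f)%E.
Proof.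
move=> mf f0 f1; rewrite lt_neqAle haar_ge0// andbT; apply/negP => /eqP h0.
have mh := measurable_haar_fun mf.
have : (\int[lebR]_t `|(if (0 < t)%R then f t / t else 0)%:E| = 0)%E.
  rewrite h0; apply: eq_integral => t _; rewrite gee0_abs// lee_fin.
  exact: haar_fun_ge0.
have mhE : measurable_fun setT (fun t : R => (if (0 < t)%R then f t / t else 0)%:E).
  by apply/measurable_EFinP; exact: mh.
move/(@ae_eq_integral_abs _ _ _ lebR _ measurableT _ mhE) => [N [mN N0 sub]].
have : (lebR `]0%R, 1%R]%classic <= lebR N)%E.
  apply: le_measure; rewrite ?inE//=; apply: subset_trans sub => t /=.
  rewrite in_itv /= => t01; move=> /(_ I); have /andP[t0 t1] := t01.
  rewrite t0 => -[] /eqP; apply/negP; rewrite gt_eqF// divr_gt0// f1//.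
rewrite [X in (_ <= X)%E]N0 /lebR /= lebesgue_measure_itv /= lte01 oppr0 addr0.
by rewrite lee_fin ler10.
Qed.

End haar_signed.

(** * Linearity and polar coordinates for sphere integrals *)

Section sphere_calculus.
Context {R : realType} {n : nat}.
Hypothesis n0 : (0 < n)%N.
Local Notation V := (n.-tuple R).
Implicit Types f g : vec R n -> R[i].

(** Boundedness is asked on the unit sphere only, so that polynomials qualify. The class is closed
    under the algebraic operations, and [sint] is linear on it. *)
Definition sph_ok f := cmeasurable (f : V -> _) /\ exists M, sph_bounded M f.

Lemma sph_ok_cst (c : R[i]) : sph_ok (fun=> c).
Proof. by split; [exact: cmeasurable_cst|exists (cabs c)]. Qed.

Lemma sph_okD f g : sph_ok f -> sph_ok g -> sph_ok (fun u => f u + g u).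
Proof.
move=> [mf [M fM]] [mg [N gN]]; split; first exact: cmeasurableD.
exists (M + N) => u u1; apply: le_trans (cabsD _ _) _.
by rewrite lerD ?fM ?gN.
Qed.

Lemma sph_okM f g : sph_ok f -> sph_ok g -> sph_ok (fun u => f u * g u).
Proof.
move=> [mf [M fM]] [mg [N gN]]; split; first exact: cmeasurableM.
exists (M * N) => u u1; rewrite cabsM.
by apply: ler_pM; rewrite ?cabs_ge0 ?fM ?gN.
Qed.

Lemma sph_ok_conj f : sph_ok f -> sph_ok (fun u => conjc (f u)).
Proof.
move=> [mf [M fM]]; split; first exact: cmeasurable_conj.
by exists M => u u1; rewrite cabs_conj fM.
Qed.

Lemma sph_okZ c f : sph_ok f -> sph_ok (fun u => c * f u).
Proof. by move=> okf; apply: sph_okM => //; exact: sph_ok_cst. Qed.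

Lemma sph_okB f g : sph_ok f -> sph_ok g -> sph_ok (fun u => f u - g u).
Proof.
move=> okf okg; have := sph_okD okf (sph_okZ (-1) okg).
by under [X in sph_ok X]eq_fun do rewrite mulN1r.
Qed.

Lemma sph_ok_sum I (r : seq I) (F : I -> vec R n -> R[i]) :
  (forall i, sph_ok (F i)) -> sph_ok (fun u => \sum_(i <- r) F i u).
Proof.
move=> okF; elim: r => [|i r IH].
  by under [X in sph_ok X]eq_fun do rewrite big_nil; exact: sph_ok_cst.
by under [X in sph_ok X]eq_fun do rewrite big_cons; exact: sph_okD.
Qed.

Lemma sph_okX f k : sph_ok f -> sph_ok (fun u => f u ^+ k).
Proof.
move=> okf; elim: k => [|k IH].
  by under [X in sph_ok X]eq_fun do rewrite expr0; exact: sph_ok_cst.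
by under [X in sph_ok X]eq_fun do rewrite exprS; exact: sph_okM.
Qed.

Lemma sph_ok_sintE f : sph_ok f -> sint f = n%:R%:C * cintegral (lebn n) (ball_fun f).
Proof. by move=> [mf [M fM]]; exact: sintE mf fM. Qed.

Lemma sph_ok_integrable f : sph_ok f -> cintegrable (lebn n) (ball_fun f).
Proof. by move=> [mf [M fM]]; exact: cintegrable_ball_fun mf fM. Qed.

Lemma sintD f g : sph_ok f -> sph_ok g -> sint (fun u => f u + g u) = sint f + sint g.
Proof.
move=> okf okg; rewrite !sph_ok_sintE//; last exact: sph_okD.
rewrite -mulrDr -cintegralD; [|exact: sph_ok_integrable..].
congr (_ * _); apply: eq_cintegral => v; rewrite /ball_fun.
by case: ifP; rewrite ?addr0.
Qed.

Lemma sintZ c f : sph_ok f -> sint (fun u => c * f u) = c * sint f.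
Proof.
move=> okf; rewrite !sph_ok_sintE//; last exact: sph_okZ.
rewrite mulrCA -(cintegralZ c (sph_ok_integrable okf)).
congr (_ * _); apply: eq_cintegral => v; rewrite /ball_fun.
by case: ifP; rewrite ?mulr0.
Qed.

Lemma sintB f g : sph_ok f -> sph_ok g -> sint (fun u => f u - g u) = sint f - sint g.
Proof.
move=> okf okg; rewrite -mulN1r -sintZ// -sintD//; last exact: sph_okZ.
by congr sint; apply/funext => u; rewrite mulN1r.
Qed.

Lemma sint0 : sint (fun _ : vec R n => 0) = 0.
Proof.
by have := sintZ 0 (sph_ok_cst 0); rewrite mul0r => ->; rewrite mul0r.
Qed.

Lemma sint_sum I (r : seq I) (F : I -> vec R n -> R[i]) : (forall i, sph_ok (F i)) ->
  sint (fun u => \sum_(i <- r) F i u) = \sum_(i <- r) sint (F i).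
Proof.
move=> okF; elim: r => [|i r IH].
  rewrite big_nil (_ : (fun _ => _) = fun=> 0) ?sint0//.
  by apply/funext => u; rewrite big_nil.
rewrite big_cons -IH -sintD//; last exact: sph_ok_sum.
by congr sint; apply/funext => u; rewrite big_cons.
Qed.

Lemma sph_ok_real (h : vec R n -> R) (M : R) : measurable_fun setT (h : V -> R) ->
  (forall u, vnorm u = 1 -> `|h u| <= M) -> sph_ok (fun u => (h u)%:C).
Proof.
move=> mh hM; split; first exact: cmeasurable_real.
by exists M => u u1; rewrite cabs_real hM.
Qed.

Lemma sint_real_ge0 (h : vec R n -> R) : sph_ok (fun u => (h u)%:C) ->
  (forall u, vnorm u = 1 -> 0 <= h u) ->
  0 <= complex.Re (sint (fun u => (h u)%:C)) /\ complex.Im (sint (fun u => (h u)%:C)) = 0.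
Proof.
move=> okh h0; rewrite sph_ok_sintE// cReM cImM /= !mul0r subr0 addr0.
split.
  rewrite mulr_ge0//; apply: Rintegral_ge0 => v _; rewrite /ball_fun.
  by case: ifP => //= /andP[v0 _]; rewrite h0// vnorm_unitv.
rewrite [X in _ * X](_ : _ = 0) ?mulr0// [X in Rintegral _ _ X](_ : _ = (fun=> 0)).
  by rewrite Rintegral_cst ?mul0r.
by apply/funext => v; rewrite /ball_fun; case: ifP.
Qed.

Lemma sph_polar f (phi : R -> R) (c : R) :
  sph_ok f -> measurable_fun setT phi -> (forall t, 0 <= phi t) -> haar phi = c%:E ->
  cintegrable (lebn n) (fun v : V =>
     if (0 < vnorm v)%R then f (unitv v) * (phi (vnorm v) / vnorm v ^+ n)%:C else 0) /\
  cintegral (lebn n) (fun v : V =>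
     if (0 < vnorm v)%R then f (unitv v) * (phi (vnorm v) / vnorm v ^+ n)%:C else 0) =
  c%:C * sint f.
Proof.
move=> [mf [M fM]] mphi phi0 hphi.
(* [cpolar] wants a bound on the whole space, so [f] is cut off outside the unit sphere. *)
pose g u := if vnorm u == 1 then f u else 0.
have mg : cmeasurable (g : V -> _).
  apply: (@cmeasurable_if R _ V (fun v => vnorm v == 1) f (fun=> 0)) => //.
    by apply: measurable_fun_eqr => //; exact: measurable_vnorm.
have gM v : cabs (g v) <= Num.max M 0.
  rewrite /g; case: eqP => [/fM h|_]; first by rewrite le_max h.
  by rewrite cabs0 le_max lexx orbT.
have [i e] := cpolar n0 mg gM mphi phi0 hphi.
have E : (fun v : V => if (0 < vnorm v)%R then f (unitv v) * (phi (vnorm v) / vnorm v ^+ n)%:C else 0)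
   = (fun v : V => if (0 < vnorm v)%R then g (unitv v) * (phi (vnorm v) / vnorm v ^+ n)%:C else 0).
  by apply/funext => v; case: ifP => // v0; rewrite /g vnorm_unitv ?eqxx.
rewrite E; split => //; rewrite e; congr (_ * _).
by apply: eq_sint => u u1; rewrite /g u1 eqxx.
Qed.

End sphere_calculus.

(** * The Funk-Hecke formula and spherical harmonics *)

Section haar_estimates.
Context {R : realType}.

Lemma haar_lty_fin (f : R -> R) : (forall t, 0 < t -> 0 <= f t) -> (haar f < +oo)%E ->
  exists2 c : R, 0 <= c & haar f = c%:E.
Proof.
move=> f0 foo; have h0 : (0 <= haar f)%E by exact: haar_ge0.
exists (fine (haar f)); first exact: fine_ge0.
by rewrite fineK// ge0_fin_numE.
Qed.

Lemma integrable_haar_fun (f g : R -> R) : measurable_fun setT f -> measurable_fun setT g ->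
  (haar g < +oo)%E -> (forall t, 0 < t -> `|f t| <= g t) ->
  lebR.-integrable setT (fun t : R => (if (0 < t)%R then f t / t else 0)%:E).
Proof.
move=> mf mg goo fg; apply/integrableP; split.
  by apply/measurable_EFinP; exact: measurable_haar_fun.
apply: le_lt_trans goo; apply: ge0_le_integral => //.
- apply: measurableT_comp => //; apply/measurable_EFinP; exact: measurable_haar_fun.
- by apply/measurable_EFinP; exact: measurable_haar_fun.
- move=> t _; rewrite abse_EFin lee_fin; case: ifP => t0; last by rewrite normr0.
  by rewrite normrM [`|t^-1|]gtr0_norm ?invr_gt0// ler_wpM2r ?fg// invr_ge0 ltW.
Qed.

Lemma measurable_powR_gauss (x s : R) :
  measurable_fun setT (fun t : R => t `^ x * expR (- (s * t ^+ 2))).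
Proof.
by apply: measurable_funM; [exact: measurable_powR|exact: measurable_gauss].
Qed.

Lemma haar_gauss (x s : R) : 0 < x -> 0 < s ->
  exists2 c : R, 0 < c & haar (fun t => t `^ x * expR (- (s * t ^+ 2))) = c%:E.
Proof.
move=> x0 s0.
have g0 t : 0 < t -> 0 <= t `^ x * expR (- (s * t ^+ 2)) by rewrite mulr_ge0 ?powR_ge0 ?expR_ge0.
have p : (0 < haar (fun t : R => (t `^ x * expR (- (s * t ^+ 2)))%R))%E.
  apply: haar_gt0 => //; first exact: measurable_powR_gauss.
  by move=> t /andP[t0 _]; rewrite mulr_gt0 ?powR_gt0 ?expR_gt0.
have [|c c0 e] := haar_lty_fin g0.
  (* Completing the square gives [- s t^2 <= 1 / (4 s) - t], which reduces finiteness to a Gamma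
     integral. *)
  apply: (@le_lt_trans _ _ (haar (fun t => expR (s^-1 / 4) * (t `^ x * expR (- (t * 1)))))).
    apply: le_haar; first exact: measurable_powR_gauss.
      apply: measurable_funM => //; apply: measurable_funM; first exact: measurable_powR.
      by apply: measurableT_comp => //; apply: measurableT_comp => //; exact: measurable_funM.
    move=> t t0; rewrite g0// andTb [leRHS]mulrCA ler_wpM2l ?powR_ge0// -expRD ler_expR.
    have -> : s^-1 / 4 - t * 1 = - (s * t ^+ 2) + s * (t - s^-1 / 2) ^+ 2.
      by field; rewrite gt_eqF.
    by rewrite lerDl mulr_ge0 ?sqr_ge0 ?ltW.
  rewrite haarZ ?expR_ge0//; last 2 first.
  - apply: measurable_funM; first exact: measurable_powR.
    by apply: measurableT_comp => //; apply: measurableT_comp => //; exact: measurable_funM.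
  - by move=> t t0; rewrite mulr_ge0 ?powR_ge0 ?expR_ge0.
  by rewrite haar_powR_expN// -EFinM ltry.
by exists c => //; rewrite e lte_fin in p.
Qed.

Lemma measurable_min1 : measurable_fun setT (fun t : R => Num.min 1 t).
Proof. by apply: measurable_minr. Qed.

(** Majorant, up to constants, for the kernels [1 - cos] and [sin], which are bounded and vanish at
    least to first order at 0. Convergence at 0 rests on [a < 1], convergence at infinity on
    [0 < a]. *)
Lemma haar_min_lty (a : R) : 0 < a < 1 -> (haar (fun t : R => (t `^ (- a) * Num.min 1 t)%R) < +oo)%E.
Proof.
move=> /andP[a0 a1]; have b0 : 0 < 1 - a by rewrite subr_gt0.
have m1 : measurable_fun setT (fun t : R => if t <= 1 then t `^ (1 - a) else 0).
  by apply: measurable_fun_ifT; [exact: measurable_fun_ler|exact: measurable_powR|exact: measurable_cst].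
have m2 : measurable_fun setT (fun t : R => if 1 <= t then t `^ (- a) else 0).
  by apply: measurable_fun_ifT; [exact: measurable_fun_ler|exact: measurable_powR|exact: measurable_cst].
apply: (@le_lt_trans _ _ (haar (fun t => (if t <= 1 then t `^ (1 - a) else 0) +
   (if 1 <= t then t `^ (- a) else 0)))).
  apply: le_haar; [|exact: measurable_funD|].
    by apply: measurable_funM; [exact: measurable_powR|exact: measurable_min1].
  move=> t t0; rewrite mulr_ge0 ?powR_ge0 ?le_min ?ler01 ?(ltW t0)//=.
  have [t1|t1] := leP t 1.
    rewrite -[X in _ * X <= _]powRr1 ?(ltW t0)// -powRD ?(gt_eqF t0) ?implybT//.
    by rewrite [- a + 1]addrC lerDl; case: ifP => // _; exact: powR_ge0.
  by rewrite mulr1 (ltW t1) add0r.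
rewrite haarD//; last 2 first.
- by move=> t t0; case: ifP => // _; exact: powR_ge0.
- by move=> t t0; case: ifP => // _; exact: powR_ge0.
by rewrite haar_head// haar_tail// -EFinD ltry.
Qed.

End haar_estimates.

(** * The Funk-Hecke formula by superposition of plane waves *)

Section funk_hecke.
Import -(notations) mpoly.
Context {R : realType} {n : nat}.
Local Notation C := R[i].
Local Notation V := (n.-tuple R).
Local Notation poly := (mpoly.mpoly n R[i]).
Hypothesis n0 : (0 < n)%N.
Variable alpha : R.
Hypothesis alpha01 : 0 < alpha < 1.
Implicit Types (H : poly) (u v : vec R n) (k : R -> R).

Let a0 : 0 < alpha. Proof. by case/andP: alpha01. Qed.
Let a1 : alpha < 1. Proof. by case/andP: alpha01. Qed.

Lemma cpoly_scalev H j c v : homog j H -> cpoly H (scalev c v) = c%:C ^+ j * cpoly H v.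
Proof.
move=> hH; rewrite -cpoly_homogZ//; apply: meval_eq => i.
by rewrite /cvec tnth_scalev rcM.
Qed.

Lemma cabs_gfun s x p v : cabs (gfun s x p v) = cabs (cpoly p v) * expR (- (s * dotp v v)).
Proof.
rewrite /gfun !cabsM cabs_real ger0_norm ?expR_ge0// cabs_cexp; congr (_ * _).
by rewrite cReN cReM [complex.Re 'i]/= [complex.Im _%:C]/= mul0r mulr0 subr0 oppr0 expR0 mulr1.
Qed.

(** The factor [1 + 1 + sqn] dominates [1 + |<u, v>|] for a unit vector [u], so this function, known
    to be integrable, serves as majorant for kernels of linear growth in [<u, v>]. *)
Lemma cabs_gfun_sqn x H v : cabs (gfun 1 x ((1 + 1 + sqn C n) * H) v) =
  (1 + 1 + dotp v v) * (cabs (cpoly H v) * expR (- (1 * dotp v v))).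
Proof.
rewrite cabs_gfun cpolyM cpolyD cpoly_sqn cpolyD cpoly1 cabsM mulrA; congr (_ * _ * _).
have -> : 1 + 1 + (dotp v v)%:C = (1 + 1 + dotp v v)%:C :> C by rewrite !rcD.
by rewrite cabs_real ger0_norm// !addr_ge0 ?dotp_ge0.
Qed.

Lemma tnth_sph u i : vnorm u = 1 -> `|tnth u i| <= 1.
Proof.
move=> u1; rewrite -(@ler_pXn2r _ 2)// ?nnegrE// expr1n real_normK ?num_real//.
have <- : dotp u u = 1 by rewrite -vnorm_sqr u1 expr1n.
rewrite /dotp (bigD1 i)//= -expr2 lerDl; apply: sumr_ge0 => l _.
by rewrite -expr2 sqr_ge0.
Qed.

Lemma sph_ok_cpoly p : sph_ok (cpoly p : vec R n -> C).
Proof.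
split; first exact: cmeasurable_cpoly.
exists (\sum_(m <- msupp p) cabs (mcoeff m p)) => u u1; rewrite cpolyE.
apply: le_trans (cabs_sum _ _) _; apply: ler_sum => m _.
rewrite cabsM ler_piMr ?cabs_ge0// cabs_prod; apply: prodr_ile1 => i _.
by rewrite cabs_ge0 cabsX cabs_real exprn_ile1 ?tnth_sph.
Qed.

(** The factor in Bochner-Hecke for Gaussian parameter 1 and frequency [t u], with [u] a unit
    vector; [2 * 1] and [4 * 1] are left as they come out of that formula. *)
Definition wave_coef (j : nat) (t : R) : C :=
  (- 'i * ((2 * 1)^-1)%:C) ^+ j * t%:C ^+ j *
  (Num.sqrt (pi / 1) ^+ n * expR (- (t ^+ 2 / (4 * 1))))%:C.

Lemma gint_wave j H u t : homog j H -> lap H = 0 -> vnorm u = 1 ->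
  gint 1 (scalev t u) H = wave_coef j t * cpoly H u.
Proof.
move=> hH lH u1; rewrite (bochner_hecke _ ltr01 hH lH) gint1// (cpoly_scalev _ _ hH).
rewrite /wave_coef dotp_scalel dotp_scaler -vnorm_sqr u1 expr1n mulr1 -expr2.
by rewrite mulrA mulrAC.
Qed.

Definition gwave (k : R -> R) H u t : C := cintegral (lebn n) (fun v : V =>
  cpoly H v * ((expR (- (1 * dotp v v)))%:C * (k (t * dotp u v))%:C)).

Definition sin_coef j t : C := (- 'i / 2) * (wave_coef j (- t) - wave_coef j t).
Definition cos_coef j t : C := wave_coef j 0 - 2^-1 * (wave_coef j t + wave_coef j (- t)).

Lemma half_C : (2^-1 : C) = Complex (2^-1 : R) 0.
Proof. by rewrite -(rc_nat 2) -rcV. Qed.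

Lemma sin_cexp (y : R) :
  (sin y)%:C = (- 'i / 2) * (cexp (- ('i * (- y)%:C)) - cexp (- ('i * y%:C))) :> C.
Proof.
by rewrite !cexpNi cosN sinN half_C; apply: eqC; rewrite ?(cReM, cImM, cReB, cImB, cReN, cImN) /=; field.
Qed.

Lemma cos_cexp (y : R) :
  (1 - cos y)%:C = cexp (- ('i * 0%:C)) - 2^-1 * (cexp (- ('i * y%:C)) + cexp (- ('i * (- y)%:C))) :> C.
Proof.
rewrite !cexpNi cosN sinN cos0 sin0 half_C.
by apply: eqC; rewrite ?(cReM, cImM, cReB, cImB, cReN, cImN, cReD, cImD) /=; field.
Qed.

Lemma gwave_sin j H u t : homog j H -> lap H = 0 -> vnorm u = 1 ->
  gwave (@sin R) H u t = sin_coef j t * cpoly H u.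
Proof.
move=> hH lH u1; have -> : sin_coef j t * cpoly H u =
    (- 'i / 2) * (wave_coef j (- t) * cpoly H u - wave_coef j t * cpoly H u) by rewrite /sin_coef; ring.
rewrite -!gint_wave//.
have ig x := cintegrable_gfun x (@ltr01 R) H.
rewrite /gint -(cintegralB (ig _) (ig _)) -cintegralZ; last exact: cintegrableB.
apply: eq_cintegral => v; rewrite sin_cexp /gfun !dotp_scalel [- t * _]mulNr.
ring.
Qed.

Lemma gwave_cos j H u t : homog j H -> lap H = 0 -> vnorm u = 1 ->
  gwave (fun y => 1 - cos y) H u t = cos_coef j t * cpoly H u.
Proof.
move=> hH lH u1; have -> : cos_coef j t * cpoly H u = wave_coef j 0 * cpoly H u -
    2^-1 * (wave_coef j t * cpoly H u + wave_coef j (- t) * cpoly H u) by rewrite /cos_coef; ring.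
rewrite -!gint_wave//.
have ig x := cintegrable_gfun x (@ltr01 R) H.
rewrite /gint -(cintegralD (ig _) (ig _)) -cintegralZ; last exact: cintegrableD.
rewrite -cintegralB//; last by apply: cintegrableZ; exact: cintegrableD.
apply: eq_cintegral => v; rewrite cos_cexp /gfun !dotp_scalel mulNr mul0r.
ring.
Qed.

Variables (k sigma : R -> R) (coef : nat -> R -> C).
Hypothesis mk : measurable_fun setT k.
Hypothesis kb1 : forall t, `|k t| <= 2.
Hypothesis kb2 : forall t, `|k t| <= `|t|.
Hypothesis k_sigma : forall t y, k (t * y) = sigma y * k (t * `|y|).
Hypothesis msigma : measurable_fun setT sigma.
Hypothesis sigmab : forall y, `|sigma y| <= 1.
Hypothesis sigma_pos : forall r y, 0 < r -> sigma (r * y) = sigma y.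
Hypothesis gwaveE : forall j H u t, homog j H -> lap H = 0 -> vnorm u = 1 ->
  gwave k H u t = coef j t * cpoly H u.

Let K (y : R) : R := `|y| `^ alpha * sigma y.
(** The constant in [K y * c = integral of t^(- alpha) k (t y) dt / t], which writes the homogeneous
    kernel [K] as a superposition of waves. The wave [k] will be [1 - cos] for the even kernel and
    [sin] for the odd one; subtracting the cosine from 1 is what makes the integral converge at
    0. *)
Definition wave_const : R := fine (haar (fun t => t `^ (- alpha) * k t)).
Let c := wave_const.

Let kernel_bound t y : 0 < t ->
  `|t `^ (- alpha) * k (t * y)| <= 2 * (1 + `|y|) * (t `^ (- alpha) * Num.min 1 t).
Proof.
move=> t0; rewrite normrM ger0_norm ?powR_ge0// mulrCA ler_wpM2l ?powR_ge0//.
have y0 := normr_ge0 y.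
have := kb1 (t * y); have := kb2 (t * y); rewrite normrM gtr0_norm// => h1 h2.
rewrite /Num.min; case: ifP => t1.
  by rewrite mulr1; apply: (le_trans h2); lra.
by apply: (le_trans h1); nra.
Qed.

Let mkernel y : measurable_fun setT (fun t : R => t `^ (- alpha) * k (t * y)).
Proof.
apply: measurable_funM; first exact: measurable_powR.
by apply: (measurableT_comp mk); exact: measurable_funM.
Qed.

Let bound_lty (y : R) : (haar (fun t : R => (2 * (1 + `|y|) * (t `^ (- alpha) * Num.min 1 t))%R) < +oo)%E.
Proof.
have m : measurable_fun setT (fun t : R => t `^ (- alpha) * Num.min 1 t).
  by apply: measurable_funM; [exact: measurable_powR|exact: measurable_min1].
have g0 (t : R) : 0 < t -> 0 <= t `^ (- alpha) * Num.min 1 t.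
  by move=> t0; rewrite mulr_ge0 ?powR_ge0// le_min ler01 ltW.
have [w _ e] := haar_lty_fin g0 (haar_min_lty alpha01).
by rewrite haarZ// ?e -?EFinM ?ltry// mulr_ge0 ?addr_ge0.
Qed.

Let mbound (y : R) : measurable_fun setT (fun t : R => 2 * (1 + `|y|) * (t `^ (- alpha) * Num.min 1 t)).
Proof.
apply: measurable_funM => //.
by apply: measurable_funM; [exact: measurable_powR|exact: measurable_min1].
Qed.

Let ikernel y : lebR.-integrable setT (fun t : R =>
  (if (0 < t)%R then (t `^ (- alpha) * k (t * y)) / t else 0)%:E).
Proof.
apply: (@integrable_haar_fun _ (fun t => t `^ (- alpha) * k (t * y))).
- exact: mkernel.
- exact: (mbound y).
- exact: bound_lty.
- by move=> t; exact: kernel_bound.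
Qed.

Let haar_kernel y : haar (fun t => t `^ (- alpha) * k (t * y)) = (K y * c)%:E.
Proof.
have k0 : k 0 = 0 by apply/eqP; rewrite -normr_le0; have := kb2 0; rewrite normr0.
have [->|y0] := eqVneq y 0.
  rewrite /K normr0 powR0 ?gt_eqF// !mul0r -[RHS](@integral0 _ _ _ lebR setT).
  by apply: eq_integral => t _; rewrite mulr0 k0 mulr0 mul0r if_same.
have {}y0 : 0 < `|y| by rewrite normr_gt0.
have cE : haar (fun t => t `^ (- alpha) * k t) = c%:E.
  rewrite /c /wave_const fineK//.
  have := integrable_fin_num measurableT (ikernel 1).
  by under eq_integral do rewrite mulr1.
transitivity ((K y)%:E * haar (fun t : R => ((`|y| * t) `^ (- alpha) * k (`|y| * t))%R))%E; last first.
  rewrite (@haar_scale_signed _ `|y| (fun t => t `^ (- alpha) * k t))//.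
    by rewrite cE EFinM.
  by apply: measurable_funM => //; exact: measurable_powR.
rewrite /haar -integralZl//; last first.
  have := integrableZl measurableT (`|y| `^ (- alpha)) (ikernel `|y|).
  apply: eq_integrable => // t _; rewrite -EFinM; congr EFin.
  case: ifP => t0; last by rewrite mulr0.
  by rewrite powRM ?(ltW t0)// [t * `|y|]mulrC; ring.
apply: eq_integral => t _; rewrite -EFinM; congr EFin.
case: ifP => t0; last by rewrite mulr0.
rewrite k_sigma /K powRM ?(ltW t0)// !powRN [t * `|y|]mulrC.
by field; rewrite !gt_eqF ?powR_gt0.
Qed.

Lemma measurable_kernel : measurable_fun setT K.
Proof.
apply: measurable_funM => //; apply: (measurableT_comp (measurable_powR alpha)).
exact: normr_measurable.
Qed.

Lemma cintegrable_gauss_kernel H u : vnorm u = 1 -> cintegrable (lebn n) (fun v : V =>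
     cpoly H v * ((expR (- (1 * dotp v v)))%:C * (K (dotp u v))%:C)).
Proof.
move=> u1.
apply: (@le_cintegrable _ _ _ _ _ (fun v => cabs (gfun 1 [tuple of nseq n 0%R] ((1 + 1 + sqn C n) * H) v))).
- apply: cmeasurableM; first exact: cmeasurable_cpoly.
  apply: cmeasurableM; apply: cmeasurable_real.
    apply: measurableT_comp => //; apply: measurableT_comp => //; apply: measurable_funM => //.
    exact: measurable_dotpp.
  exact: (measurableT_comp measurable_kernel (@measurable_dotp R n u)).
- by apply: cintegrable_cabs; exact: cintegrable_gfun.
- move=> v; rewrite cabs_gfun_sqn !cabsM !cabs_real [`|expR _|]ger0_norm ?expR_ge0//.
  rewrite mulrA [leRHS]mulrC ler_wpM2l ?mulr_ge0 ?cabs_ge0 ?expR_ge0//.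
  rewrite /K normrM ger0_norm ?powR_ge0//.
  apply: (@le_trans _ _ (`|dotp u v| `^ alpha)); first by rewrite ler_piMr ?powR_ge0.
  set y := dotp u v.
  have yv : 1 + `|y| <= 1 + 1 + dotp v v.
    have : `|y| <= vnorm v by have := dotp_le_vnorm u v; rewrite u1 mul1r.
    by rewrite -vnorm_sqr; have := sqr_ge0 (vnorm v - 1); nra.
  apply: (le_trans _ yv).
  have [y1|y1] := leP `|y| 1.
    apply: (@le_trans _ _ 1); last by rewrite lerDl.
    have e1 : (1 : R) `^ alpha = 1 by rewrite powR1.
    by rewrite -[leRHS]e1; apply: ge0_ler_powR => //; rewrite ?nnegrE ?(ltW a0).
  apply: (@le_trans _ _ (`|y| `^ 1)); last by rewrite powRr1// lerDr.
  by apply: ler_powR; exact: ltW.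
Qed.

(** For each scale [t], Bochner-Hecke evaluates the integral over [v]. What remains on the right
    depends on [u] only through [cpoly H u]. *)
Lemma wave_fubini j H u : homog j H -> lap H = 0 -> vnorm u = 1 ->
  c%:C * cintegral (lebn n) (fun v : V =>
     cpoly H v * ((expR (- (1 * dotp v v)))%:C * (K (dotp u v))%:C)) =
  cintegral lebR (fun t => if 0 < t then coef j t * cpoly H u * (t `^ (- alpha) / t)%:C else 0).
Proof.
move=> hH lH u1.
pose F (vt : V * measurableTypeR R) : C := if 0 < vt.2 then
  cpoly H vt.1 * ((expR (- (1 * dotp vt.1 vt.1)))%:C * (k (vt.2 * dotp u vt.1))%:C) *
  (vt.2 `^ (- alpha) / vt.2)%:C else 0.
have mF : cmeasurable F.
  apply: cmeasurable_if; last exact: cmeasurable_cst.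
    by apply: measurable_fun_ltr => //; exact: measurable_snd.
  apply: cmeasurableM; last first.
    apply: cmeasurable_real; apply: measurable_funM.
      exact: (measurableT_comp (measurable_powR _) measurable_snd).
    exact: (measurableT_comp (@measurable_inv R) measurable_snd).
  apply: cmeasurableM; first exact: (cmeasurable_comp (cmeasurable_cpoly H) measurable_fst).
  apply: cmeasurableM; apply: cmeasurable_real.
    apply: measurableT_comp => //; apply: measurableT_comp => //; apply: measurable_funM => //.
    exact: (measurableT_comp (@measurable_dotpp R n) measurable_fst).
  apply: (measurableT_comp mk); apply: measurable_funM; first exact: measurable_snd.
  exact: (measurableT_comp (@measurable_dotp R n u) measurable_fst).
have FE v t : F (v, t) = (cpoly H v * (expR (- (1 * dotp v v)))%:C) *
   (if 0 < t then t `^ (- alpha) * k (t * dotp u v) / t else 0)%:C.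
  rewrite /F /=; case: ifP => _; last by rewrite mulr0.
  by rewrite !rcM; ring.
have [w w0 we] : exists2 w, 0 <= w & haar (fun t => t `^ (- alpha) * Num.min 1 t) = w%:E.
  apply: haar_lty_fin (haar_min_lty alpha01) => t t0.
  by rewrite mulr_ge0 ?powR_ge0// le_min ler01 ltW.
have mmin : measurable_fun setT (fun t : R => t `^ (- alpha) * Num.min 1 t).
  by apply: measurable_funM; [exact: measurable_powR|exact: measurable_min1].
have foo : (\int[lebn n]_v \int[lebR]_t (cabs (F (v, t)))%:E < +oo)%E.
  apply: (@le_lt_trans _ _ (\int[lebn n]_v
     (2 * w * cabs (gfun 1 [tuple of nseq n 0%R] ((1 + 1 + sqn C n) * H) v))%:E)%E); last first.
    have := cintegrable_cabs (cintegrable_gfun [tuple of nseq n 0%R] (@ltr01 R) ((1 + 1 + sqn C n) * H)).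
    move=> /(integrableZl measurableT (2 * w)) ii.
    have := integrable_lty measurableT ii.
    by [].
  apply: ge0_le_integral => //.
  - by move=> v _; apply: integral_ge0 => t _; rewrite lee_fin cabs_ge0.
  - apply: (measurable_fun_fubini_tonelli_F (fun z => (cabs (F z))%:E)) => //.
      by apply/measurable_EFinP; exact: measurable_cabs.
    by move=> z; rewrite lee_fin cabs_ge0.
  - apply/measurable_EFinP; apply: measurable_funM => //.
    apply: measurable_cabs; apply: cintegrable_cmeasurable; exact: cintegrable_gfun.
  move=> v _; set y := dotp u v.
  apply: (@le_trans _ _ (haar (fun t => cabs (cpoly H v) * expR (- (1 * dotp v v)) *
      (2 * (1 + `|y|) * (t `^ (- alpha) * Num.min 1 t))))).
    apply: ge0_le_integral => //.
    - by move=> t _; rewrite lee_fin cabs_ge0.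
    - apply/measurable_EFinP; apply: (measurableT_comp (measurable_cabs mF)).
      exact: measurable_pair1.
    - apply/measurable_EFinP; apply: measurable_haar_fun; apply: measurable_funM => //.
    move=> t _; rewrite lee_fin FE !cabsM !cabs_real ger0_norm ?expR_ge0//.
    case: ifP => t0; last by rewrite normr0 mulr0.
    rewrite -[leRHS]mulrA ler_wpM2l ?mulr_ge0 ?cabs_ge0 ?expR_ge0//.
    rewrite normrM [`|t^-1|]gtr0_norm ?invr_gt0// ler_wpM2r ?invr_ge0 ?(ltW t0)//.
    exact: kernel_bound.
  rewrite haarZ ?mulr_ge0 ?cabs_ge0 ?expR_ge0//; last first.
    by move=> t t0; rewrite !mulr_ge0 ?addr_ge0 ?powR_ge0// le_min ler01 ltW.
  rewrite haarZ ?mulr_ge0 ?addr_ge0//; last first.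
    by move=> t t0; rewrite mulr_ge0 ?powR_ge0// le_min ler01 ltW.
  rewrite we -!EFinM lee_fin cabs_gfun_sqn.
  have yv : 1 + `|y| <= 1 + 1 + dotp v v.
    have : `|y| <= vnorm v by have := dotp_le_vnorm u v; rewrite u1 mul1r.
    by rewrite -vnorm_sqr; have := sqr_ge0 (vnorm v - 1); nra.
  have cw : 0 <= cabs (cpoly H v) * expR (- (1 * dotp v v)) by rewrite mulr_ge0 ?cabs_ge0 ?expR_ge0.
  rewrite [leLHS](_ : _ = 2 * w * ((1 + `|y|) * (cabs (cpoly H v) * expR (- (1 * dotp v v))))); last by ring.
  by rewrite ler_wpM2l ?mulr_ge0// ler_wpM2r.
have := cFubini mF foo.
rewrite [X in X = _ -> _](_ : _ = c%:C * cintegral (lebn n) (fun v : V =>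
     cpoly H v * ((expR (- (1 * dotp v v)))%:C * (K (dotp u v))%:C))); last first.
  have cK v : cintegral lebR (fun t => F (v, t)) =
      c%:C * (cpoly H v * ((expR (- (1 * dotp v v)))%:C * (K (dotp u v))%:C)).
    have iR := ikernel (dotp u v).
    rewrite (eq_cintegral _ (FE v)) cintegralZ; last exact: cintegrable_real.
    rewrite cintegral_real//.
    rewrite (_ : Rintegral _ _ _ = K (dotp u v) * c); last first.
      exact: (congr1 fine (haar_kernel (dotp u v))).
    by rewrite rcM; ring.
  rewrite (eq_cintegral _ cK) cintegralZ//; exact: cintegrable_gauss_kernel.
move=> ->; apply: eq_cintegral => t; rewrite /F /=.
case: ifP => t0; last exact: cintegral0.
rewrite -(gwaveE t hH lH u1) /gwave -cintegralZr//.
apply: (@le_cintegrable _ _ _ _ _ (fun v => 2 * cabs (gfun 1 [tuple of nseq n 0%R] H v))).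
- apply: cmeasurableM; first exact: cmeasurable_cpoly.
  apply: cmeasurableM; apply: cmeasurable_real.
    apply: measurableT_comp => //; apply: measurableT_comp => //; apply: measurable_funM => //.
    exact: measurable_dotpp.
  apply: (measurableT_comp mk); apply: measurable_funM => //.
  exact: measurable_dotp.
- under eq_fun do rewrite EFinM; apply: integrableZl => //.
  by apply: cintegrable_cabs; exact: cintegrable_gfun.
- move=> v; rewrite cabs_gfun !cabsM !cabs_real ger0_norm ?expR_ge0//.
  by rewrite mulrA mulrC ler_wpM2r ?mulr_ge0 ?cabs_ge0 ?expR_ge0.
Qed.

Lemma sph_ok_kernel u : vnorm u = 1 -> sph_ok (fun v => (K (dotp u v))%:C).
Proof.
move=> u1; apply: (@sph_ok_real _ _ _ 1).
  exact: (measurableT_comp measurable_kernel (@measurable_dotp R n u)).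
move=> v v1; have := dotp_le_vnorm u v; rewrite u1 v1 mulr1 => h.
rewrite /K normrM ger0_norm ?powR_ge0// mulr_ile1 ?powR_ge0//.
have e1 : (1 : R) `^ alpha = 1 by rewrite powR1.
by rewrite -[leRHS]e1; apply: ge0_ler_powR => //; rewrite ?nnegrE ?(ltW a0).
Qed.

(** Apart from the Gaussian the integrand is homogeneous of degree [j + alpha], so polar coordinates
    split off a radial factor [g] that is the same for all [u]. *)
Lemma gauss_polar j H : homog j H -> exists2 g : R, 0 < g &
  forall u, vnorm u = 1 -> cintegral (lebn n) (fun v : V =>
     cpoly H v * ((expR (- (1 * dotp v v)))%:C * (K (dotp u v))%:C)) =
  g%:C * sint (fun v => (K (dotp u v))%:C * cpoly H v).
Proof.
move=> hH; have x0 : 0 < j%:R + n%:R + alpha by rewrite ltr_wpDl// addr_ge0.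
have [g g0 ge] := haar_gauss x0 (@ltr01 R).
exists g => // u u1.
have ok : sph_ok (fun v => (K (dotp u v))%:C * cpoly H v).
  by apply: sph_okM; [exact: sph_ok_kernel|exact: sph_ok_cpoly].
have mg := @measurable_powR_gauss R (j%:R + n%:R + alpha) 1.
have [] := sph_polar n0 ok mg _ ge.
  by move=> t; rewrite mulr_ge0 ?powR_ge0 ?expR_ge0.
move=> _ <-; apply: eq_cintegral => v.
have [v0|v0] := ltP 0 (vnorm v); last first.
  have {}v0 : vnorm v = 0 by apply/eqP; rewrite eq_le v0 vnorm_ge0.
  have -> : dotp u v = 0 by rewrite /dotp big1// => i _; rewrite (vnorm0_eq v0) mulr0.
  by rewrite /K normr0 powR0 ?gt_eqF// mul0r !mulr0.
rewrite -{1 2 3 4}(scalev_unitv v0) (cpoly_scalev _ _ hH) !dotp_scaler dotp_scalel.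
have -> : dotp (unitv v) (unitv v) = 1 by rewrite -vnorm_sqr vnorm_unitv// expr1n.
rewrite /K normrM gtr0_norm// powRM ?vnorm_ge0// sigma_pos// !powRD ?(gt_eqF v0) ?implybT//.
rewrite !powR_mulrn ?vnorm_ge0// mulr1 -expr2.
rewrite -[_ / vnorm v ^+ n](_ : vnorm v ^+ j * vnorm v `^ alpha * expR (- (1 * vnorm v ^+ 2)) = _).
  by rewrite !rcM rcX; ring.
by field; rewrite expf_neq0 ?gt_eqF.
Qed.

(** Instead of evaluating the right side of [wave_fubini], two points are compared: with [H] scaled
    by [cpoly H u'] at [u] and by [cpoly H u] at [u'], the right sides coincide. Hence
    [cpoly H u' * F u = cpoly H u * F u'], and dividing at a point where [H] does not vanish yields
    the multiplier. *)
Lemma funk_hecke j H : c != 0 -> homog j H -> lap H = 0 -> exists kap : C,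
  forall u, vnorm u = 1 -> sint (fun v => (K (dotp u v))%:C * cpoly H v) = kap * cpoly H u.
Proof.
move=> c0 hH lH.
pose F u := sint (fun v => (K (dotp u v))%:C * cpoly H v).
have ok u : vnorm u = 1 -> sph_ok (fun v => (K (dotp u v))%:C * cpoly H v).
  by move=> u1; apply: sph_okM; [exact: sph_ok_kernel|exact: sph_ok_cpoly].
have [g g0 gP] := gauss_polar hH.
have key u u' : vnorm u = 1 -> vnorm u' = 1 -> cpoly H u' * F u = cpoly H u * F u'.
  move=> u1 u1'.
  have step b w : vnorm w = 1 -> c%:C * (g%:C * (b * F w)) = cintegral lebR
      (fun t => if 0 < t then coef j t * (b * cpoly H w) * (t `^ (- alpha) / t)%:C else 0).
    move=> w1; have hb : homog j (b *: H) by exact: homogZ.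
    have lb : lap (b *: H) = 0 by rewrite lapZ lH scaler0.
    have := wave_fubini hb lb w1; rewrite cpolyZ => <-; congr (_ * _).
    rewrite mulrCA -(gP _ w1) -cintegralZ; last exact: cintegrable_gauss_kernel.
    by apply: eq_cintegral => v; rewrite cpolyZ mulrA.
  have cg : c%:C * g%:C != 0 by rewrite mulf_neq0 ?rc_eq0// gt_eqF.
  have s1 := step (cpoly H u') u u1; have s2 := step (cpoly H u) u' u1'.
  rewrite [cpoly H u' * cpoly H u]mulrC -s2 in s1.
  by apply: (mulfI cg); rewrite -2!mulrA; exact: s1.
have [[u0 [u01 Hu0]]|] := pselect (exists u0, vnorm u0 = 1 /\ cpoly H u0 != 0).
  exists (F u0 / cpoly H u0) => u u1; rewrite -/(F u).
  have := key u u0 u1 u01 => e; apply: (mulfI Hu0); rewrite e.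
  by move: (F u0) (cpoly H u) (cpoly H u0) Hu0 => f h h0 h1; field.
move=> no; exists 0 => u u1; rewrite mul0r.
have Hz w : vnorm w = 1 -> cpoly H w = 0.
  by move=> w1; apply/eqP/negPn/negP => hw; apply: no; exists w.
rewrite (eq_sint (g := fun=> 0)) ?sint0// => w w1.
by rewrite Hz ?mulr0.
Qed.

End funk_hecke.

Section measurable_sign.
Context {R : realType}.

Lemma measurable_sg : measurable_fun setT (Num.sg : R -> R).
Proof.
rewrite (_ : Num.sg = fun t : R => if 0 < t then 1 else (if 0 < - t then -1 else 0)).
  apply: measurable_fun_ifT => //; first exact: measurable_fun_ltr.
  by apply: measurable_pos_if => //; exact: oppr_measurable.
by apply/funext => t; rewrite oppr_gt0; case: sgrP.
Qed.

End measurable_sign.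
Arguments measurable_sg R : clear implicits.

Section funk_hecke_kernels.
Import -(notations) mpoly.
Context {R : realType} {n : nat}.
Local Notation C := R[i].
Hypothesis n0 : (0 < n)%N.
Variable alpha : R.
Hypothesis alpha01 : 0 < alpha < 1.

Let a0 : 0 < alpha. Proof. by case/andP: alpha01. Qed.

Lemma lipschitz1 (f f' : R -> R) y : (forall x : R, is_derive x (1 : R) f (f' x)) ->
  (forall x, `|f' x| <= 1) -> `|f y - f 0| <= `|y|.
Proof.
move=> df f1; have cf := continuous_is_derive df.
have [y0|y0] := leP 0 y.
  have [x _ ->] := MVT_segment y0 (fun x _ => df x) (continuous_subspaceT cf).
  by rewrite subr0 normrM ler_piMl.
have [x _ e] := MVT_segment (ltW y0) (fun x _ => df x) (continuous_subspaceT cf).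
by rewrite distrC e sub0r normrM normrN ler_piMl.
Qed.

Let kcos (y : R) : R := 1 - cos y.

Let kcos1 y : `|kcos y| <= 2.
Proof.
rewrite /kcos; apply: (le_trans (ler_normB _ _)); rewrite normr1.
by have := norm_cos_le1 y; lra.
Qed.

Let kcos2 y : `|kcos y| <= `|y|.
Proof.
rewrite /kcos distrC -cos0; apply: (@lipschitz1 _ (fun x => - sin x)) => x.
by rewrite normrN norm_sin_le1.
Qed.

Let ksin2 (y : R) : `|sin y| <= `|y|.
Proof.
rewrite -[sin y]subr0 -sin0; apply: (@lipschitz1 _ (fun x => cos x)) => x.
exact: norm_cos_le1.
Qed.

Let mcos : measurable_fun setT kcos.
Proof.
apply: measurable_funB => //; apply: continuous_measurable_fun; exact: continuous_cos.
Qed.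

Let msin : measurable_fun setT (@sin R).
Proof. apply: continuous_measurable_fun; exact: continuous_sin. Qed.

Lemma wave_const_cos : wave_const alpha kcos != 0.
Proof.
have m : measurable_fun setT (fun t => t `^ (- alpha) * kcos t).
  by apply: measurable_funM => //; exact: measurable_powR.
have k0 y : 0 <= kcos y by rewrite subr_ge0 cos_le1.
have g0 (t : R) : 0 < t -> 0 <= t `^ (- alpha) * kcos t by rewrite mulr_ge0 ?powR_ge0.
have p : (0 < haar (fun t => t `^ (- alpha) * kcos t)%R)%E.
  apply: haar_gt0 => // t /andP[t0 t1]; rewrite mulr_gt0 ?powR_gt0//.
  rewrite subr_gt0 -cos0 ltr_cos ?in_itv /= ?lexx ?pi_ge0 ?(ltW t0)//=.
  by rewrite (le_trans t1)// (le_trans _ (pi_ge2 R))// ler1n.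
have [|w _ e] := haar_lty_fin g0.
  have mb : measurable_fun setT (fun t : R => 2 * (t `^ (- alpha) * Num.min 1 t)).
    apply: measurable_funM => //; apply: measurable_funM; first exact: measurable_powR.
    exact: measurable_min1.
  apply: (@le_lt_trans _ _ (haar (fun t : R => 2 * (t `^ (- alpha) * Num.min 1 t))%R)).
    apply: le_haar => // t t0; rewrite g0//= mulrCA ler_wpM2l ?powR_ge0//.
    rewrite /Num.min; case: ifP => _.
      by rewrite mulr1 -[leLHS]ger0_norm.
    rewrite -[leLHS]ger0_norm//; apply: (le_trans (kcos2 t)); rewrite gtr0_norm//.
    by rewrite ler_peMl ?ler1n ?ltW.
  have mp : measurable_fun setT (fun t : R => t `^ (- alpha) * Num.min 1 t).
    by apply: measurable_funM; [exact: measurable_powR|exact: measurable_min1].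
  have p0 (t : R) : 0 < t -> 0 <= t `^ (- alpha) * Num.min 1 t.
    by move=> t0; rewrite mulr_ge0 ?powR_ge0// le_min ler01 ltW.
  have [w _ e] := haar_lty_fin p0 (haar_min_lty alpha01).
  by rewrite haarZ// e -EFinM ltry.
by rewrite /wave_const e /= gt_eqF//; rewrite e lte_fin in p.
Qed.

Let i0 : 'I_n := Ordinal n0.
Let e0 : vec R n := [tuple (i == i0)%:R | i < n].

Let vnorm_e0 : vnorm e0 = 1.
Proof.
rewrite /vnorm /dotp (bigD1 i0)//= big1 => [|i ii]; rewrite !tnth_mktuple.
  by rewrite eqxx mulr1 addr0 sqrtr1.
by rewrite (negbTE ii) mul0r.
Qed.

Let ksin_sg (t y : R) : sin (t * y) = Num.sg y * sin (t * `|y|).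
Proof.
case: (ltgtP 0 y) => y0.
- by rewrite gtr0_sg// gtr0_norm// mul1r.
- by rewrite ltr0_sg// ltr0_norm// mulrN sinN mulN1r opprK.
- by rewrite -y0 sgr0 mul0r mulr0 sin0.
Qed.

Let sgb (y : R) : `|Num.sg y| <= 1.
Proof. by rewrite normr_sg; case: (y != 0). Qed.

Let sg_pos (r y : R) : 0 < r -> Num.sg (r * y) = Num.sg y.
Proof. by move=> r0; rewrite sgrM gtr0_sg// mul1r. Qed.

Let ksin1 (y : R) : `|sin y| <= 2.
Proof. by apply: (le_trans (norm_sin_le1 y)); rewrite ler1n. Qed.

(** The sine integrand changes sign, so positivity cannot be read off as for the cosine. Instead
    [wave_fubini] is applied to a coordinate function: if the constant were zero, the right side
    would be zero, but that side is a positive Gaussian moment. *)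
Lemma wave_const_sin : wave_const alpha (@sin R) != 0.
Proof.
apply/negP => /eqP c0.
have hX : homog 1 (@mpolyX n C (mnm1 i0)) by exact: homogXU.
have lX : lap (@mpolyX n C (mnm1 i0)) = 0 by exact: (lap_homog_small (j := 1)).
have := wave_fubini alpha01 msin ksin1 ksin2 ksin_sg (measurable_sg R) sgb (@gwave_sin R n) hX lX vnorm_e0.
rewrite c0 mul0r.
have X1 : cpoly (@mpolyX n C (mnm1 i0)) e0 = 1.
  by rewrite /cpoly mevalXU /cvec tnth_mktuple eqxx.
(* [sin_coef 1 t] equals [G * t * exp (- t^2 / 4)]. *)
pose G := Num.sqrt (pi / 1) ^+ n / 2 : R.
have G0 : 0 < G by rewrite divr_gt0// exprn_gt0// sqrtr_gt0 divr_gt0// pi_gt0.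
pose h (t : R) := G * (t `^ (1 - alpha) * expR (- (4^-1 * t ^+ 2))).
have b0 : 0 < 1 - alpha by rewrite subr_gt0; case/andP: alpha01.
have [g g0 ge] := @haar_gauss R (1 - alpha) 4^-1 b0 ltac:(by rewrite invr_gt0).
have p0 (t : R) : 0 < t -> 0 <= t `^ (1 - alpha) * expR (- (4^-1 * t ^+ 2)).
  by move=> t0; rewrite mulr_ge0 ?powR_ge0 ?expR_ge0.
have hh : haar h = (G * g)%:E.
  by rewrite /h haarZ ?(ltW G0)// ?ge//; exact: measurable_powR_gauss.
have mh : measurable_fun setT h by apply: measurable_funM => //; exact: measurable_powR_gauss.
have ih : lebR.-integrable setT (fun t : R => (if (0 < t)%R then h t / t else 0)%:E).
  apply: (@integrable_haar_fun _ h h) => //; first by rewrite hh ltry.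
  by move=> t t0; rewrite ger0_norm// mulr_ge0 ?(ltW G0)// p0.
rewrite [X in _ = X](_ : _ = (G * g)%:C).
  move/esym/eqP; rewrite rc_eq0 gt_eqF// mulr_gt0//.
rewrite -[in RHS](_ : \int[lebR]_t (if 0 < t then h t / t else 0) = G * g); last first.
  exact: (congr1 fine hh).
rewrite -cintegral_real//; apply: eq_cintegral => t.
case: ifP => // t0; rewrite X1 mulr1 /h /sin_coef /wave_coef !expr1 sqrrN.
have -> : t `^ (1 - alpha) = t * t `^ (- alpha).
  by rewrite powRD ?(gt_eqF t0) ?implybT// powRr1// ltW.
have -> : 4^-1 * t ^+ 2 = t ^+ 2 / (4 * 1) by field.
set E := expR _; rewrite /G half_C rcN.
set S := _ ^+ n; move: (t `^ (- alpha)) S E => tp S E; apply: eqC; rewrite ?(cReM, cImM, cReB, cImB, cReN, cImN) /=; field; rewrite gt_eqF//.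
Qed.

Lemma funk_hecke_abs j (H : mpoly.mpoly n C) : homog j H -> lap H = 0 -> exists kap : C,
  forall u, vnorm u = 1 ->
  sint (fun v => (`|dotp u v| `^ alpha)%:C * cpoly H v) = kap * cpoly H u.
Proof.
move=> hH lH.
have [||||kap kP] := funk_hecke n0 alpha01 mcos kcos1 kcos2
  (sigma := fun=> 1) _ _ _ _ (@gwave_cos R n) wave_const_cos hH lH.
- move=> t y; rewrite mul1r /kcos; congr (1 - _).
  by case: (ger0P y) => // y0; rewrite mulrN cosN.
- exact: measurable_cst.
- by move=> y; rewrite normr1.
- by [].
by exists kap => u u1; rewrite -kP//; congr sint; apply/funext => v; rewrite mulr1.
Qed.

Lemma funk_hecke_sgn j (H : mpoly.mpoly n C) : homog j H -> lap H = 0 -> exists kap : C,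
  forall u, vnorm u = 1 ->
  sint (fun v => (`|dotp u v| `^ alpha * Num.sg (dotp u v))%:C * cpoly H v) = kap * cpoly H u.
Proof.
move=> hH lH; exact: (funk_hecke n0 alpha01 msin ksin1 ksin2 ksin_sg (measurable_sg R) sgb sg_pos
  (@gwave_sin R n) wave_const_sin hH lH).
Qed.

End funk_hecke_kernels.

(** * Polynomials with complex coefficients and their real and imaginary parts *)

Section complexification.
Import -(notations) mpoly.
Context {R : realType} {n : nat}.
Local Notation C := R[i].
Local Notation cpol := (mpoly.mpoly n R[i]).
Local Notation rpol := (mpoly.mpoly n R).

Definition dle (q : nat) (p : cpol) : bool := all [pred m | (mdeg m <= q)%N] (msupp p).

Lemma dleP q p : reflect (forall m, (q < mdeg m)%N -> mcoeff m p = 0) (dle q p).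
Proof.
apply: (iffP allP) => [h m qm|h m].
  by apply: memN_msupp_eq0; apply/negP => /h /=; rewrite leqNgt qm.
rewrite mcoeff_msupp /=; apply: contraR; rewrite -ltnNge => /h ->.
by rewrite eqxx.
Qed.

Lemma dle0 q : dle q 0. Proof. by apply/dleP => m _; rewrite mcoeff0. Qed.

Lemma dleD q p1 p2 : dle q p1 -> dle q p2 -> dle q (p1 + p2).
Proof.
move=> /dleP h1 /dleP h2; apply/dleP => m qm.
by rewrite mcoeffD h1// h2// addr0.
Qed.

Lemma dleZ q c p : dle q p -> dle q (c *: p).
Proof. by move=> /dleP h; apply/dleP => m qm; rewrite mcoeffZ h// mulr0. Qed.

Lemma dle_sum I (r : seq I) q (G : I -> cpol) :
  (forall i, dle q (G i)) -> dle q (\sum_(i <- r) G i).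
Proof.
move=> h; elim: r => [|i r IH]; first by rewrite big_nil dle0.
by rewrite big_cons dleD.
Qed.

Lemma dle_ordsum N q (G : 'I_N -> cpol) :
  (forall i, dle q (G i)) -> dle q (\sum_(i < N) G i).
Proof. by move=> h; exact: dle_sum. Qed.

Lemma dleM q1 q2 p1 p2 : dle q1 p1 -> dle q2 p2 -> dle (q1 + q2) (p1 * p2).
Proof.
move=> /allP h1 /allP h2; apply/allP => m /msuppM_le /allpairsP[[m1 m2] /= [m1p m2p ->]].
by rewrite mdegD leq_add//; [exact: h1|exact: h2].
Qed.

Lemma dleX q p k : dle q p -> dle (k * q) (p ^+ k).
Proof.
move=> h; elim: k => [|k IH]; last by rewrite exprS mulSn dleM.
rewrite expr0; apply/dleP => m; rewrite mul0n mcoeff1 lt0n mdeg_eq0.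
by case: (m == _).
Qed.

Lemma dle_homog j q p : (j <= q)%N -> homog j p -> dle q p.
Proof. by move=> jq /allP h; apply/allP => m /h /= /eqP ->. Qed.

Definition complexify (p : rpol) : cpol := locked (map_mpoly (real_complex R)) p.
Definition poly_re (p : cpol) : rpol := locked (map_mpoly (@complex.Re R)) p.
Definition poly_im (p : cpol) : rpol := locked (map_mpoly (@complex.Im R)) p.

Lemma mcoeff_complexify m p : mcoeff m (complexify p) = (mcoeff m p)%:C.
Proof. by rewrite /complexify -lock (mcoeff_map_mpoly (real_complex R)). Qed.
Lemma mcoeff_poly_re m p : mcoeff m (poly_re p) = complex.Re (mcoeff m p).
Proof. by rewrite /poly_re -lock (mcoeff_map_mpoly (@complex.Re R)). Qed.
Lemma mcoeff_poly_im m p : mcoeff m (poly_im p) = complex.Im (mcoeff m p).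
Proof. by rewrite /poly_im -lock (mcoeff_map_mpoly (@complex.Im R)). Qed.

Lemma complexify0 : complexify 0 = 0.
Proof. by apply/mpolyP => m; rewrite mcoeff_complexify !mcoeff0. Qed.
Lemma poly_re0 : poly_re 0 = 0.
Proof. by apply/mpolyP => m; rewrite mcoeff_poly_re !mcoeff0. Qed.
Lemma poly_im0 : poly_im 0 = 0.
Proof. by apply/mpolyP => m; rewrite mcoeff_poly_im !mcoeff0. Qed.

Lemma polyC_split p : p = complexify (poly_re p) + 'i *: complexify (poly_im p).
Proof.
apply/mpolyP => m; rewrite mcoeffD mcoeffZ !mcoeff_complexify mcoeff_poly_re mcoeff_poly_im.
by case: (mcoeff m p) => a b; apply: eqC; rewrite ?(cReD, cImD, cReM, cImM) /=; ring.
Qed.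

Lemma cpoly_complexify p v : cpoly (complexify p) v = (polyfun p v)%:C.
Proof.
rewrite /cpoly /polyfun !mevalE rc_sum.
rewrite (perm_big (msupp p)) /=; last first.
  by rewrite /complexify -lock; exact: (msupp_map_mpoly p (@fmorph_inj _ _ (real_complex R))).
apply: eq_bigr => m _; rewrite mcoeff_complexify rcM; congr (_ * _).
rewrite (rmorph_prod (real_complex R)); apply: eq_bigr => i _.
by rewrite /cvec -rcX.
Qed.

Lemma cpoly_split p v : cpoly p v = Complex (polyfun (poly_re p) v) (polyfun (poly_im p) v).
Proof.
rewrite {1}[p]polyC_split cpolyD cpolyZ !cpoly_complexify.
by apply: eqC; rewrite ?(cReD, cImD, cReM, cImM) /=; ring.
Qed.

Lemma dle_complexify q p : deg_le q p -> dle q (complexify p).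
Proof.
move=> /allP h; apply/dleP => m qm; rewrite mcoeff_complexify memN_msupp_eq0//.
by apply/negP => /h /=; rewrite leqNgt qm.
Qed.

Lemma homogPz (F : numFieldType) j (p : mpoly.mpoly n F) :
  (forall m, mdeg m != j -> mcoeff m p = 0) <-> homog j p.
Proof.
split=> [h|/allP h m mj].
  apply/allP => m /=; rewrite mcoeff_msupp; apply: contraR => /h ->.
  by rewrite eqxx.
by apply: memN_msupp_eq0; apply: contra mj => /h.
Qed.

Lemma homog_complexify j p : homog j (complexify p) = homog j p.
Proof.
apply/idP/idP => /homogPz h; apply/homogPz => m /h; rewrite mcoeff_complexify.
  by move/eqP; rewrite rc_eq0 => /eqP.
by move=> ->.
Qed.

Lemma homog_poly_re j p : homog j p -> homog j (poly_re p).
Proof. by move=> /homogPz h; apply/homogPz => m /h; rewrite mcoeff_poly_re => ->. Qed.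
Lemma homog_poly_im j p : homog j p -> homog j (poly_im p).
Proof. by move=> /homogPz h; apply/homogPz => m /h; rewrite mcoeff_poly_im => ->. Qed.

Lemma mcoeff_lap (F : numFieldType) m (p : mpoly.mpoly n F) :
  mcoeff m (lap p) = \sum_(i < n) mcoeff (mnm_add (mnm_add m (mnm1 i)) (mnm1 i)) p
     *+ (mnm_add m (mnm1 i) i).+1 *+ (m i).+1.
Proof.
by rewrite /lap raddf_sum; apply: eq_bigr => i _ /=; rewrite !mcoeff_mderiv.
Qed.

Lemma lap_complexify p : lap (complexify p) = complexify (lap p).
Proof.
apply/mpolyP => m; rewrite mcoeff_complexify !mcoeff_lap rc_sum.
by apply: eq_bigr => i _; rewrite mcoeff_complexify !(rmorphMn (real_complex R)).
Qed.

Lemma lap_poly_re p : lap (poly_re p) = poly_re (lap p).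
Proof.
apply/mpolyP => m; rewrite mcoeff_poly_re !mcoeff_lap (raddf_sum (@complex.Re R)).
by apply: eq_bigr => i _; rewrite mcoeff_poly_re !(raddfMn (@complex.Re R)).
Qed.

Lemma lap_poly_im p : lap (poly_im p) = poly_im (lap p).
Proof.
apply/mpolyP => m; rewrite mcoeff_poly_im !mcoeff_lap (raddf_sum (@complex.Im R)).
by apply: eq_bigr => i _; rewrite mcoeff_poly_im !(raddfMn (@complex.Im R)).
Qed.

(** Lets a spherical harmonic be handled as one harmonic polynomial with complex coefficients, the
    form in which Bochner-Hecke applies, instead of a pair of real ones. *)
Lemma is_sph_harmP j (h : vec R n -> C) :
  is_sph_harm j h <-> exists H : cpol, [/\ homog j H, lap H = 0 & forall v, h v = cpoly H v].
Proof.
split=> [[p1 [p2 [h1 h2 /eqP l1 /eqP l2 e]]]|[H [hH lH e]]].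
  exists (complexify p1 + 'i *: complexify p2); split.
  - by apply: homogD; [|apply: homogZ]; rewrite homog_complexify.
  - rewrite lapD lapZ !lap_complexify (_ : lap p1 = 0)// (_ : lap p2 = 0)//.
    by rewrite !complexify0 scaler0 addr0.
  - move=> v; rewrite e cpolyD cpolyZ !cpoly_complexify.
    by apply: eqC; rewrite ?(cReD, cImD, cReM, cImM) /=; ring.
exists (poly_re H), (poly_im H); split.
- exact: homog_poly_re.
- exact: homog_poly_im.
- by apply/eqP; rewrite -/(lap _) lap_poly_re lH poly_re0.
- by apply/eqP; rewrite -/(lap _) lap_poly_im lH poly_im0.
- by move=> v; rewrite e cpoly_split.
Qed.

Definition poly_conj (p : cpol) : cpol := complexify (poly_re p) - 'i *: complexify (poly_im p).

Lemma cpoly_conj p v : conjc (cpoly p v) = cpoly (poly_conj p) v.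
Proof.
rewrite cpoly_split /poly_conj -scaleNr cpolyD cpolyZ !cpoly_complexify.
by apply: eqC; rewrite ?(cReD, cImD, cReM, cImM) /=; ring.
Qed.

Lemma homog_conj j p : homog j p -> homog j (poly_conj p).
Proof.
move=> hp; apply: homogB; [|apply: homogZ]; rewrite homog_complexify.
  exact: homog_poly_re.
exact: homog_poly_im.
Qed.

Lemma lap_conj p : lap p = 0 -> lap (poly_conj p) = 0.
Proof.
move=> lp; rewrite /poly_conj lapB lapZ !lap_complexify lap_poly_re lap_poly_im lp.
by rewrite poly_re0 poly_im0 !complexify0 scaler0 subr0.
Qed.

End complexification.

(** * The exponent as a polynomial on the sphere *)

Section exponent_polynomial.
Import -(notations) mpoly.
Context {R : realType} {n : nat}.
Local Notation C := R[i].
Hypothesis n0 : (0 < n)%N.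
Variable alpha : R.
Hypothesis alpha01 : 0 < alpha < 1.

Lemma on_sphere_cvec (u : vec R n) : vnorm u = 1 -> on_sphere (cvec u).
Proof.
move=> u1; rewrite /on_sphere -meval_sqn -[LHS]/(cpoly _ u) cpoly_sqn -vnorm_sqr u1.
by rewrite expr1n.
Qed.

(** Funk-Hecke acts on each harmonic component of [P] as multiplication by a constant, for the even
    and for the odd part of the kernel separately, so the degree is not raised. *)
Lemma Vexp_polynomial (P : mpoly.mpoly n R) q : deg_le q P ->
  exists Q : mpoly.mpoly n C, dle q Q /\
    forall u, vnorm u = 1 -> Vexp alpha (polyfun P) u = cpoly Q u.
Proof.
move=> /dle_complexify dP.
have [H [hH lH HP]] := sphere_decomposition n0 dP.
have [k1 k1P] := choice (fun j => funk_hecke_abs n0 alpha01 (hH j) (lH j)).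
have [k2 k2P] := choice (fun j => funk_hecke_sgn n0 alpha01 (hH j) (lH j)).
pose T : C := - 'i * (tan (pi * alpha / 2))%:C.
exists (\sum_(j < q.+1) (k1 j + T * k2 j) *: H j); split.
  apply: dle_ordsum => j; apply: dleZ; apply: dle_homog (hH j).
  by rewrite -ltnS.
move=> u u1; rewrite /Vexp.
have a0 : 0 < alpha by case/andP: alpha01.
have ok1 : sph_ok (fun v => (`|dotp u v| `^ alpha)%:C).
  rewrite (_ : (fun v => _) = (fun v => (`|dotp u v| `^ alpha * 1)%:C)); last first.
    by apply/funext => v; rewrite mulr1.
  apply: (@sph_ok_kernel R n alpha alpha01 (fun=> 1)) => //.
  by move=> y; rewrite normr1.
have sgb (y : R) : `|Num.sg y| <= 1 by rewrite normr_sg; case: (y != 0).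
have ok2 := @sph_ok_kernel R n alpha alpha01 Num.sg (measurable_sg R) sgb u u1.
rewrite (eq_sint (g := fun v => \sum_(j < q.+1)
   ((`|dotp u v| `^ alpha)%:C * cpoly (H j) v +
     T * ((`|dotp u v| `^ alpha * Num.sg (dotp u v))%:C * cpoly (H j) v)))); last first.
  move=> v v1; rewrite rcM -cpoly_complexify -[cpoly _ v]/(meval _ _).
  rewrite (HP _ (on_sphere_cvec v1)) mulr_sumr mulr_suml; apply: eq_bigr => j _.
  by rewrite -[meval _ _]/(cpoly _ v) /T !rcM; ring.
have okH (j : 'I_q.+1) : sph_ok (cpoly (H j) : vec R n -> C) by exact: sph_ok_cpoly.
rewrite sint_sum//; last first.
  move=> j; apply: sph_okD; first exact: sph_okM.
  by apply: sph_okZ; exact: sph_okM.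
rewrite cpoly_sum; apply: eq_bigr => j _; rewrite sintD//; last 2 first.
- exact: sph_okM.
- by apply: sph_okZ; exact: sph_okM.
rewrite sintZ//; last exact: sph_okM.
by rewrite k1P// k2P// cpolyZ; ring.
Qed.

End exponent_polynomial.

(** * Orthogonality, sup bounds and projections of spherical harmonics *)

Section spherical_harmonics.
Import -(notations) mpoly.
Context {R : realType} {n : nat}.
Local Notation C := R[i].
Local Notation V := (n.-tuple R).
Local Notation cpol := (mpoly.mpoly n R[i]).
Hypothesis n0 : (0 < n)%N.
Let z0 : vec R n := [tuple of nseq n 0].

Lemma vnorm_le0 (v : vec R n) : vnorm v <= 0 -> v = z0.
Proof.
move=> v0; have {}v0 : vnorm v = 0 by apply/eqP; rewrite eq_le v0 vnorm_ge0.
by apply: eq_from_tnth => i; rewrite (vnorm0_eq v0) tnth_nseq.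
Qed.

Let origin (v : V) : R := if 0 < vnorm v then 0 else 1.

Let origin_ge0 v : 0 <= origin v. Proof. by rewrite /origin; case: ifP. Qed.

Let measurable_origin : measurable_fun setT origin.
Proof.
apply: measurable_fun_ifT => //; apply: measurable_fun_ltr => //.
exact: measurable_vnorm.
Qed.

Let integrable_origin : (lebn n).-integrable setT (fun v => (origin v)%:E).
Proof.
apply: le_integrable (integrable_gaussn (n := n) (@ltr01 R)) => //.
- exact/measurable_EFinP.
- move=> v _; rewrite !abse_EFin lee_fin !ger0_norm ?expR_ge0// /origin.
  case: ltP => v0; first exact: expR_ge0.
  rewrite (vnorm_le0 v0) -[leLHS]expR0 ler_expR /dotp big1 ?mulr0 ?oppr0// => i _.
  by rewrite tnth_nseq mul0r.
Qed.

(* The origin is a bounded scale-invariant set, hence null. *)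
Lemma integral_origin : \int[lebn n]_v origin v = 0.
Proof.
have := @ge0_integral_scalev R n 2 (fun v => (origin v)%:E) ltac:(by []).
move=> /(_ _ _)/wrap[]; [exact/measurable_EFinP|by move=> v; rewrite lee_fin|].
rewrite (eq_integral (fun v => (origin v)%:E)) => [|v _]; last first.
  by rewrite /origin vnorm_scalev gtr0_norm// pmulr_rgt0.
rewrite -[in X in X -> _](@fineK _ (\int[lebn n]_v (origin v)%:E)%E); last first.
  exact: integrable_fin_num.
rewrite -EFinM -/(Rintegral _ _ _) => -[] /eqP; rewrite -subr_eq0 -{1}[X in X - _]mul1r -mulrBl.
rewrite mulf_eq0 => /orP[|/eqP//]; rewrite subr_eq0 eq_sym.
have : (2 : R) ^- n < 1 by rewrite invf_lt1 ?exprn_gt0// exprn_egt1 ?ltr1n// -lt0n.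
by move=> /lt_eqF ->.
Qed.

Lemma cintegral_off_origin (f : V -> C) : cintegrable (lebn n) f ->
  cintegral (lebn n) (fun v => if 0 < vnorm v then f v else 0) = cintegral (lebn n) f.
Proof.
move=> fi; have co := cintegrable_real integrable_origin.
have -> : (fun v : V => if 0 < vnorm v then f v else 0) =
    (fun v => f v - f z0 * (origin v)%:C).
  apply/funext => v; rewrite /origin; case: ltP => v0; first by rewrite mulr0 subr0.
  by rewrite (vnorm_le0 v0) mulr1 subrr.
rewrite cintegralB//; last exact: cintegrableZ.
by rewrite cintegralZ// cintegral_real// integral_origin mulr0 subr0.
Qed.

(** The bridge between Gaussian and sphere integrals: for a function homogeneous along rays they
    differ by the radial factor [g], which in the applications is positive and can be estimated. *)
Lemma homog_polar (f : vec R n -> C) (j : nat) (s g : R) : sph_ok f ->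
  (forall v, 0 < vnorm v -> f v = (vnorm v ^+ j)%:C * f (unitv v)) ->
  cintegrable (lebn n) (fun v : V => f v * (expR (- (s * dotp v v)))%:C) ->
  haar (fun t => t `^ (j%:R + n%:R) * expR (- (s * t ^+ 2))) = g%:E ->
  cintegral (lebn n) (fun v : V => f v * (expR (- (s * dotp v v)))%:C) = g%:C * sint f.
Proof.
move=> okf hf fi hg; rewrite -cintegral_off_origin//.
have mg := @measurable_powR_gauss R (j%:R + n%:R) s.
have [] := sph_polar n0 okf mg _ hg.
  by move=> t; rewrite mulr_ge0 ?powR_ge0 ?expR_ge0.
move=> _ <-; apply: eq_cintegral => v; case: ifP => // v0.
rewrite (hf v v0) -vnorm_sqr powRD ?(gt_eqF v0) ?implybT// !powR_mulrn ?vnorm_ge0//.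
rewrite -[_ / vnorm v ^+ n](_ : vnorm v ^+ j * expR (- (s * vnorm v ^+ 2)) = _).
  by rewrite rcM; ring.
by field; rewrite expf_neq0 ?gt_eqF.
Qed.

Lemma cpoly_unitv j (H : cpol) v : homog j H -> 0 < vnorm v ->
  cpoly H v = (vnorm v ^+ j)%:C * cpoly H (unitv v).
Proof. by move=> hH v0; rewrite -{1}(scalev_unitv v0) (cpoly_scalev _ _ hH) rcX. Qed.

Lemma gfun0E s (H : cpol) v : gfun s z0 H v = cpoly H v * (expR (- (s * dotp v v)))%:C.
Proof.
rewrite /gfun (_ : dotp z0 v = 0) ?mulr0 ?oppr0 ?cexp0 ?mulr1//.
by rewrite /dotp big1// => i _; rewrite tnth_nseq mul0r.
Qed.

(** At frequency 0 [gintX] becomes the rule asked for by [functional_orthogonal]; the Gaussian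
    integral of the homogeneous product [p q] is then a positive multiple of the sphere integral. *)
Lemma sint_orthogonal j l (p q : cpol) : homog j p -> homog l q -> lap p = 0 -> lap q = 0 ->
  j != l -> sint (fun v => cpoly p v * cpoly q v) = 0.
Proof.
move=> hp hq lp lq jl.
have AX i r : gint 1 z0 (@mpolyX n C (mnm1 i) * r) = ((2 * 1)^-1)%:C * gint 1 z0 (mderiv i r).
  by rewrite gintX// tnth_nseq mulr0 mul0r addr0.
have A0 := functional_orthogonal (gintD z0 (@ltr01 R)) (gintZ z0 (@ltr01 R)) AX hp hq lp lq jl.
have hpq := homogM hp hq.
have x0 : 0 < (j + l)%:R + n%:R :> R by rewrite ltr_wpDl// ltr0n.
have [g g0 ge] := haar_gauss x0 (@ltr01 R).
have fi := cintegrable_gfun z0 (@ltr01 R) (p * q).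
have E : (fun v : V => cpoly (p * q) v * (expR (- (1 * dotp v v)))%:C) = gfun 1 z0 (p * q).
  by apply/funext => v; rewrite gfun0E.
have := @homog_polar (cpoly (p * q)) (j + l) 1 g (sph_ok_cpoly _).
rewrite E => /(_ _ fi ge)/wrap[].
  by move=> v v0; exact: cpoly_unitv.
rewrite -[cintegral _ _]/(gint 1 z0 (p * q)) A0 => /esym/eqP.
rewrite mulf_eq0 rc_eq0 gt_eqF//= => /eqP <-.
by congr sint; apply/funext => v; rewrite cpolyM.
Qed.

Lemma cRe_scale (a : R) (z : C) : complex.Re (a%:C * z) = a * complex.Re z.
Proof. by rewrite cReM /= mul0r subr0. Qed.

Definition rsint (h : vec R n -> R) : R := complex.Re (sint (fun v => (h v)%:C)).

Lemma le_rsint (h1 h2 : vec R n -> R) : sph_ok (fun v => (h1 v)%:C) -> sph_ok (fun v => (h2 v)%:C) ->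
  (forall u, vnorm u = 1 -> h1 u <= h2 u) -> rsint h1 <= rsint h2.
Proof.
move=> ok1 ok2 h12.
have E : (fun v => (h2 v)%:C - (h1 v)%:C) = (fun v => (h2 v - h1 v)%:C).
  by apply/funext => v; rewrite rcB.
have ok : sph_ok (fun v => (h2 v - h1 v)%:C) by rewrite -E; exact: sph_okB.
have [+ _] := sint_real_ge0 ok (fun u u1 => ltac:(by rewrite subr_ge0 h12)).
by rewrite -E sintB// cReB subr_ge0.
Qed.

Lemma sph_ok_cabs f : sph_ok f -> sph_ok (fun v : vec R n => (cabs (f v))%:C).
Proof.
move=> [mf [M fM]]; apply: (@sph_ok_real _ _ _ M); first exact: measurable_cabs.
by move=> u u1; rewrite ger0_norm ?cabs_ge0 ?fM.
Qed.

Lemma sph_ok_cabs2 f : sph_ok f -> sph_ok (fun v : vec R n => (cabs (f v) ^+ 2)%:C).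
Proof.
move=> okf; have := sph_okM (sph_ok_cabs okf) (sph_ok_cabs okf).
by rewrite (_ : (fun u => _) = (fun v => (cabs (f v) ^+ 2)%:C))//; apply/funext => v; rewrite expr2 rcM.
Qed.

(** Cauchy-Schwarz on the sphere in the pointwise form [|f| <= a |f|^2 + b] with [a = 1 / (2 M)] and
    [b = M / 2], where equality holds for [|f| = M]. *)
Lemma rsint_cabs_le f (M : R) : sph_ok f -> 0 < M ->
  rsint (fun v => cabs (f v) ^+ 2) <= M ^+ 2 * rsint (fun=> 1) ->
  rsint (fun v => cabs (f v)) <= M * rsint (fun=> 1).
Proof.
move=> okf M0 fM.
have ok1 := @sph_ok_cst R n 1.
pose a := (2 * M)^-1; pose b := M / 2.
have okg : sph_ok (fun v => (a * cabs (f v) ^+ 2 + b * 1)%:C).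
  rewrite (_ : (fun v => _) = (fun v => a%:C * (cabs (f v) ^+ 2)%:C + b%:C * 1%:C)).
    by apply: sph_okD; apply: sph_okZ => //; exact: sph_ok_cabs2.
  by apply/funext => v; rewrite rcD !rcM.
apply: (@le_trans _ _ (rsint (fun v => a * cabs (f v) ^+ 2 + b * 1))).
  apply: le_rsint => //; first exact: sph_ok_cabs.
  move=> u _; have -> : a * cabs (f u) ^+ 2 + b * 1 = cabs (f u) + a * (cabs (f u) - M) ^+ 2.
    by rewrite /a /b; field; rewrite gt_eqF.
  by rewrite lerDl mulr_ge0 ?sqr_ge0// invr_ge0 mulr_ge0 ?ltW.
rewrite [leLHS]/rsint (_ : (fun v => _) = (fun v => a%:C * (cabs (f v) ^+ 2)%:C + b%:C * 1%:C)); last first.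
  by apply/funext => v; rewrite rcD !rcM.
rewrite sintD; [|by apply: sph_okZ; exact: sph_ok_cabs2|exact: sph_okZ].
rewrite !sintZ//; last exact: sph_ok_cabs2.
rewrite cReD (cRe_scale a) (cRe_scale b) -/(rsint _) -/(rsint (fun=> 1)).
rewrite -lerBrDr; apply: (@le_trans _ _ (a * (M ^+ 2 * rsint (fun=> 1)))).
  by rewrite ler_wpM2l// invr_ge0 mulr_ge0 ?ltW.
rewrite le_eqVlt; apply/orP; left; apply/eqP.
by rewrite /a /b; field; rewrite gt_eqF.
Qed.

(** Substituting [J t] for [t], with [J = j + 1], brings out [J^(j + n)] and turns the exponent into
    [- J t^2 = - t^2 - j t^2]; the last term absorbs [t^j] since [t <= exp (t^2)]. *)
Lemma haar_gauss_le j (c : R) : haar (fun t => t `^ n%:R * expR (- (1 * t ^+ 2))) = c%:E ->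
  (haar (fun t : R => (t `^ (j%:R + n%:R) * expR (- (j.+1%:R^-1 * t ^+ 2)))%R) <=
   (j.+1%:R ^+ (j + n) * c)%:E)%E.
Proof.
move=> hc; set J : R := j.+1%:R; have J0 : 0 < J by rewrite ltr0n.
have mg x s := @measurable_powR_gauss R x s.
rewrite -(@haar_scale _ J (fun t : R => t `^ (j%:R + n%:R) * expR (- (J^-1 * t ^+ 2))))//; last first.
  by move=> t t0; rewrite mulr_ge0 ?powR_ge0 ?expR_ge0.
rewrite EFinM -hc -haarZ ?exprn_ge0 ?(ltW J0)//; last first.
  by move=> t t0; rewrite mulr_ge0 ?powR_ge0 ?expR_ge0.
apply: le_haar.
- apply: (measurableT_comp (mg _ _)); exact: measurable_funM.
- exact: measurable_funM.
move=> t t0; rewrite mulr_ge0 ?powR_ge0 ?expR_ge0//=.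
rewrite powRM ?(ltW J0) ?(ltW t0)// -natrD powR_mulrn ?(ltW J0)// -mulrA ler_wpM2l ?exprn_ge0 ?(ltW J0)//.
rewrite !powR_mulrn ?(ltW t0)// exprD -mulrA mulrCA ler_wpM2l ?exprn_ge0 ?(ltW t0)//.
have -> : - (J^-1 * (J * t) ^+ 2) = - (1 * t ^+ 2) - j%:R * t ^+ 2.
  by rewrite /J -natr1; field; rewrite natr1 gt_eqF.
rewrite expRD mulrCA ler_piMr ?expR_ge0// expRN -ler_pdivlMr ?invr_gt0 ?expR_gt0// invrK mul1r.
rewrite mulrC expRM_natr; apply: lerXn2r; rewrite ?nnegrE ?expR_ge0 ?(ltW t0)//.
apply: le_trans (expR_ge1Dx _); have := sqr_ge0 (t - 1); nra.
Qed.

(** Geometric growth in the degree, read off Bochner-Hecke at [x = u]: it expresses [cpoly H u] by a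
    Gaussian integral, which is bounded by the integral of [|H|] over the sphere and hence by [M].
    With Gaussian parameter [s = 1 / J], [J = j + 1], the powers [J^j] from [(2 s)^j] and from
    [haar_gauss_le] cancel. There remain [2^j], [exp (J / 4)] and [J^n <= n^n exp J], whence the
    base [2 exp (5 / 4)]. *)
Lemma sph_harm_sup : exists2 D : R, 0 < D & exists2 A : R, 1 <= A &
  forall j (H : cpol) (M : R), homog j H -> lap H = 0 -> 0 < M ->
  rsint (fun v => cabs (cpoly H v) ^+ 2) <= M ^+ 2 * rsint (fun=> 1) ->
  forall u, vnorm u = 1 -> cabs (cpoly H u) <= D * A ^+ j * M.
Proof.
have nn0 : 0 < n%:R :> R by rewrite ltr0n.
have [c c0 hc] := haar_gauss nn0 (@ltr01 R).
set w := rsint (fun=> 1).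
have w0 : 0 <= w by have [] := @sint_real_ge0 R n (fun=> 1) (sph_ok_cst 1) (fun _ _ => ler01).
(* The summand 1 makes the constant positive, as only [0 <= w] is at hand. *)
exists (2 * c * n%:R ^+ n * expR (5 / 4) * w + 1).
  by rewrite ltr_wpDl// !mulr_ge0 ?expR_ge0 ?exprn_ge0// ltW.
exists (2 * expR (5 / 4)).
  have := expR_ge1Dx (5 / 4 : R); lra.
move=> j H M hH lH M0 HM u u1.
set J : R := j.+1%:R; have J0 : 0 < J by rewrite ltr0n.
have J1 : 1 <= J by rewrite ler1n.
pose s := J^-1; have s0 : 0 < s by rewrite invr_gt0.
have okH := sph_ok_cpoly H.
have x0 : 0 < j%:R + n%:R :> R by rewrite ltr_wpDl.
have [g g0 hg] := haar_gauss x0 s0.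
have gle : g <= J ^+ (j + n) * c.
  by have := haar_gauss_le j hc; rewrite -/J -/s hg lee_fin.
have Hint : rsint (fun v => cabs (cpoly H v)) <= M * w by exact: rsint_cabs_le.
have B : cabs (gint s u H) <= 2 * (g * rsint (fun v => cabs (cpoly H v))).
  have gi := cintegrable_gfun u s0 H; have ga := cintegrable_cabs gi.
  have := cabs_cintegral_le gi ga (fun v => lexx _); rewrite -/(gint s u H).
  move=> h; apply: (le_trans h); rewrite ler_wpM2l// le_eqVlt; apply/orP; left; apply/eqP.
  have E : (fun v => (cabs (gfun s u H v))%:C) =
     (fun v : V => (cabs (cpoly H v))%:C * (expR (- (s * dotp v v)))%:C).
    by apply/funext => v; rewrite cabs_gfun rcM.
  have := @homog_polar (fun v => (cabs (cpoly H v))%:C) j s g (sph_ok_cabs okH).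
  rewrite -E => /(_ _ (cintegrable_real ga) hg)/wrap[].
    move=> v v0; rewrite (cpoly_unitv hH v0) cabsM cabs_real rcM ger0_norm//.
    by rewrite exprn_ge0// vnorm_ge0.
  by rewrite cintegral_real// => /(congr1 (@complex.Re R)); rewrite cRe_scale.
have := bochner_hecke u s0 hH lH; rewrite gint1// => /(congr1 (@cabs R)).
rewrite !cabsM cabsX cabsM cabsN [cabs 'i](_ : _ = 1); last first.
  by rewrite cabsE /= expr0n expr1n add0r sqrtr1.
rewrite mul1r !cabs_real -vnorm_sqr u1 expr1n.
set E := expR _; set S := Num.sqrt _.
have S1 : 1 <= S.
  rewrite -[leLHS]sqrtr1 ler_wsqrtr// /s invrK -[leLHS]mulr1 ler_pM//.
  by apply: le_trans (pi_ge2 R); rewrite ler1n.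
have S0 : 0 < S ^+ n by rewrite exprn_gt0// (lt_le_trans _ S1).
have E0 : 0 < E by exact: expR_gt0.
rewrite [`|_ * E|]gtr0_norm ?mulr_gt0// => e.
have s20 : 0 < 2 * s by rewrite mulr_gt0.
rewrite [`|(2 * s)^-1|]gtr0_norm ?invr_gt0// in e.
have -> : cabs (cpoly H u) = (2 * s) ^+ j / (S ^+ n * E) * cabs (gint s u H).
  rewrite e exprVn; field.
  by rewrite (gt_eqF E0) (gt_eqF S0) expf_neq0 ?gt_eqF.
have k0 : 0 <= (2 * s) ^+ j / (S ^+ n * E).
  by rewrite divr_ge0 ?exprn_ge0 ?(ltW s20)// mulr_ge0 ?ltW.
apply: (le_trans (ler_wpM2l k0 B)).
have K1 : (2 * s) ^+ j / (S ^+ n * E) <= (2 * s) ^+ j * expR (J / 4).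
  rewrite ler_wpM2l ?exprn_ge0 ?(ltW s20)// invfM.
  have -> : E^-1 = expR (J / 4).
    by rewrite /E expRN invrK /s; congr expR; field; rewrite gt_eqF.
  by rewrite ler_piMl ?expR_ge0// invf_le1// exprn_ege1.
have R0 : 0 <= rsint (fun v => cabs (cpoly H v)).
  by have [] := sint_real_ge0 (sph_ok_cabs okH) (fun u _ => cabs_ge0 _).
have K2 : g * rsint (fun v => cabs (cpoly H v)) <= J ^+ (j + n) * c * (M * w).
  by apply: ler_pM => //; exact: ltW.
have Mw0 : 0 <= M * w by rewrite mulr_ge0// ltW.
have Jn : J ^+ n <= n%:R ^+ n * expR J by exact: exprn_le_expR (ltW J0).
apply: (@le_trans _ _ ((2 * s) ^+ j * expR (J / 4) * (2 * (J ^+ (j + n) * c * (M * w))))).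
  by apply: ler_pM; [exact: k0|rewrite !mulr_ge0// ltW|exact: K1|rewrite ler_wpM2l].
have -> : (2 * s) ^+ j * expR (J / 4) * (2 * (J ^+ (j + n) * c * (M * w))) =
    J ^+ n * (2 ^+ j * expR (J / 4) * 2 * c * (M * w)).
  rewrite exprD exprMn /s exprVn; field.
  by rewrite expf_neq0 ?gt_eqF.
have Z0 : 0 <= 2 ^+ j * expR (J / 4) * 2 * c * (M * w).
  by rewrite mulr_ge0// !mulr_ge0 ?exprn_ge0 ?expR_ge0// ltW.
apply: (le_trans (ler_wpM2r Z0 Jn)).
have EJ : expR J * expR (J / 4) = expR (5 / 4) * expR (5 / 4) ^+ j.
  by rewrite -expRD -expRM_natr -expRD; congr expR; rewrite /J -natr1; field.
have -> : n%:R ^+ n * expR J * (2 ^+ j * expR (J / 4) * 2 * c * (M * w)) =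
   2 * c * n%:R ^+ n * expR (5 / 4) * w * (2 * expR (5 / 4)) ^+ j * M.
  rewrite exprMn.
  transitivity (n%:R ^+ n * (expR J * expR (J / 4)) * (2 ^+ j * 2 * c * (M * w))); first by ring.
  by rewrite EJ; ring.
rewrite ler_wpM2r ?(ltW M0)// ler_wpM2r ?exprn_ge0 ?mulr_ge0 ?expR_ge0//.
by rewrite lerDl.
Qed.

(** [proj] picks an unspecified projection, so uniqueness is at stake: the difference [Z] of two
    projections is a harmonic of degree [j] orthogonal to itself, and [sph_harm_sup] turns its zero
    mean square into pointwise vanishing on the sphere. The second conclusion is Bessel's
    inequality. *)
Lemma proj_component N (H : nat -> cpol) (f : vec R n -> C) :
  (forall j, homog j (H j)) -> (forall j, lap (H j) = 0) ->
  (forall u, vnorm u = 1 -> f u = \sum_(j < N.+1) cpoly (H j) u) ->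
  forall j, (j < N.+1)%N ->
  [/\ forall u, vnorm u = 1 -> Defs.proj j f u = cpoly (H j) u &
      rsint (fun v => cabs (cpoly (H j) v) ^+ 2) <= rsint (fun v => cabs (f v) ^+ 2)].
Proof.
move=> hH lH fH j jN.
pose g v := \sum_(l < N.+1 | l != Ordinal jN) cpoly (H l) v.
have okp (p : cpol) := sph_ok_cpoly p.
have okg : sph_ok g.
  rewrite /g (_ : (fun v => _) = (fun v => \sum_(l < N.+1) if l != Ordinal jN then cpoly (H l) v else 0)).
    by apply: sph_ok_sum => l; case: (l != Ordinal jN); [exact: okp|exact: sph_ok_cst].
  by apply/funext => v; rewrite -big_mkcond.
have fE u : vnorm u = 1 -> f u = cpoly (H j) u + g u.
  by move=> u1; rewrite fH// (bigD1 (Ordinal jN)).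
have orth (p : cpol) : homog j p -> lap p = 0 -> sint (fun v => g v * cpoly p v) = 0.
  move=> hp lp; rewrite (_ : (fun v => _) = (fun v => \sum_(l < N.+1)
       if l != Ordinal jN then cpoly (H l) v * cpoly p v else 0)).
    rewrite sint_sum => [|l]; last by case: (l != Ordinal jN); [exact: sph_okM|exact: sph_ok_cst].
    apply: big1 => l _; case lj : (l != Ordinal jN); last exact: sint0.
    by apply: (sint_orthogonal (hH l) hp (lH l) lp).
  by apply/funext => v; rewrite -big_mkcond /g mulr_suml.
have pr : is_proj j f (cpoly (H j)).
  split; first by apply/is_sph_harmP; exists (H j).
  move=> Y /is_sph_harmP[K [hK lK eK]].
  rewrite -(orth (poly_conj K) (homog_conj hK) (lap_conj lK)); apply: eq_sint => u u1.
  by rewrite fE// addrAC subrr add0r eK cpoly_conj.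
split.
  rewrite /Defs.proj; case: pselect => [e|]; last by case; exists (cpoly (H j)).
  case: (cid e) => h [/is_sph_harmP[K [hK lK eK]] hY] /= u u1.
  have [D D0 [A A1 sup]] := sph_harm_sup.
  pose Z := K - H j.
  have hZ : homog j Z by exact: homogB.
  have lZ : lap Z = 0 by rewrite lapB lK lH subrr.
  have Zv v : cpoly Z v = h v - cpoly (H j) v.
    by rewrite eK /Z -scaleN1r cpolyD cpolyZ mulN1r.
  have Z2 : sint (fun v => cpoly Z v * conjc (cpoly Z v)) = 0.
    have hZharm : is_sph_harm j (cpoly Z) by apply/is_sph_harmP; exists Z.
    have [_ hH2] := pr; have e1 := hY _ hZharm; have e2 := hH2 _ hZharm.
    have e3 : sint (fun v => (cpoly (H j) v + g v - h v) * conjc (cpoly Z v)) = 0.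
      by rewrite -e1; apply: eq_sint => v v1; rewrite fE.
    have e4 : sint (fun v => g v * conjc (cpoly Z v)) = 0.
      by rewrite -e2; apply: eq_sint => v v1; rewrite fE// addrAC subrr add0r.
    have okZ := sph_ok_conj (okp Z).
    have okh : sph_ok h by rewrite (_ : h = cpoly K); [exact: okp|apply/funext].
    have := sintB (f := fun v => g v * conjc (cpoly Z v))
       (g := fun v => (cpoly (H j) v + g v - h v) * conjc (cpoly Z v)).
    rewrite e3 e4 subrr => <-.
    - by congr sint; apply/funext => v; rewrite {1}Zv; ring.
    - exact: sph_okM.
    - by apply: sph_okM => //; apply: sph_okB => //; exact: sph_okD.
  have Z2' : rsint (fun v => cabs (cpoly Z v) ^+ 2) = 0.
    by rewrite /rsint (_ : (fun v => _) = (fun v => cpoly Z v * conjc (cpoly Z v))) ?Z2//;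
       apply/funext => v; rewrite cabs_sqr.
  have w0 : 0 <= rsint (fun=> 1) by have [] := @sint_real_ge0 R n (fun=> 1) (sph_ok_cst 1) (fun _ _ => ler01).
  suff : cabs (cpoly Z u) = 0 by move/cabs_eq0; rewrite Zv => /eqP; rewrite subr_eq0 => /eqP.
  (* [sph_harm_sup] takes a positive [M], so zero is reached through arbitrarily small ones. *)
  apply/eqP; rewrite eq_le cabs_ge0 andbT; apply/ler_addgt0Pr => e0 e00; rewrite add0r.
  have DA : 0 < D * A ^+ j by rewrite mulr_gt0// exprn_gt0// (lt_le_trans ltr01).
  have M0 : 0 < e0 / (D * A ^+ j) by rewrite divr_gt0.
  have := sup j Z _ hZ lZ M0 _ u u1.
  rewrite [D * _ * _]mulrC divfK ?gt_eqF//; apply.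
  by rewrite Z2' mulr_ge0// sqr_ge0.
have E h : (fun v => (cabs (h v) ^+ 2)%:C) = (fun v : vec R n => h v * conjc (h v)) :> (_ -> C).
  by apply/funext => v; rewrite cabs_sqr.
have ok1 := okp (H j); have ok1c := sph_ok_conj ok1; have okgc := sph_ok_conj okg.
have o1 : sint (fun v => g v * conjc (cpoly (H j) v)) = 0.
  by rewrite -(orth _ (homog_conj (hH j)) (lap_conj (lH j))); congr sint; apply/funext => v; rewrite cpoly_conj.
have o2 : sint (fun v => cpoly (H j) v * conjc (g v)) = 0.
  rewrite (_ : (fun v => _) = (fun v => \sum_(l < N.+1)
       if l != Ordinal jN then cpoly (H j) v * cpoly (poly_conj (H l)) v else 0)).
    rewrite sint_sum => [|l]; last by case: (l != Ordinal jN); [exact: sph_okM|exact: sph_ok_cst].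
    apply: big1 => l _; case lj : (l != Ordinal jN); last exact: sint0.
    apply: (sint_orthogonal (hH j) (homog_conj (hH l)) (lH j) (lap_conj (lH l))).
    by rewrite eq_sym.
  apply/funext => v; rewrite -big_mkcond /g (rmorph_sum conjc) mulr_sumr.
  by apply: eq_bigr => l _; rewrite -cpoly_conj.
have gg0 : 0 <= rsint (fun v => cabs (g v) ^+ 2).
  by have [] := sint_real_ge0 (sph_ok_cabs2 okg) (fun u _ => sqr_ge0 _).
rewrite {2}/rsint E (eq_sint (g := fun v => (cpoly (H j) v * conjc (cpoly (H j) v) + g v * conjc (g v))
   + (g v * conjc (cpoly (H j) v) + cpoly (H j) v * conjc (g v)))); last first.
  by move=> u u1; rewrite fE// rmorphD /=; ring.
rewrite sintD; [|by apply: sph_okD; exact: sph_okM..].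
rewrite sintD; [|exact: sph_okM..]; rewrite sintD; [|exact: sph_okM..].
by rewrite o1 o2 !addr0 cReD -!E lerDl.
Qed.

End spherical_harmonics.

(** * Regularised Fourier integrals of homogeneous functions *)

Section laguerre_moments.
Context {R : realType}.
Variables (m c : R).
Hypothesis m0 : 0 <= m.
Hypothesis c0 : 0 < c.
Implicit Types (p : R) (N : nat).

(** With respect to [dt / t], the radial integrand that Bochner-Hecke leaves once the regularisation
    is removed; [t] is the Gaussian parameter. *)
Definition lagmom N p (t : R) : R := t `^ (- p) * lag m N (c / t) * expR (- (c / t)).

Lemma measurable_lag N (h : R -> R) : measurable_fun setT h ->
  measurable_fun setT (fun t => lag m N (h t)).
Proof.
move=> mh; suff [] : measurable_fun setT (fun t => lag m N (h t)) /\
  measurable_fun setT (fun t => lag m N.+1 (h t)) by [].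
elim: N => [|N [IH1 IH2]]; first by split => //; apply: measurable_funB.
split => //; under eq_fun do rewrite lagSS.
apply: measurable_funB; apply: measurable_funM => //.
exact: measurable_funB.
Qed.

Lemma measurable_lagmom N p : measurable_fun setT (lagmom N p).
Proof.
have mV : measurable_fun setT (fun t : R => c / t).
  by apply: measurable_funM => //; exact: measurable_inv.
apply: measurable_funM; last by apply: measurableT_comp => //; exact: measurableT_comp.
apply: measurable_funM; first exact: measurable_powR.
exact: measurable_lag.
Qed.

Lemma lagmomSS N p t : 0 < t -> lagmom N.+2 p t =
  (2 * N.+1%:R + m) * lagmom N.+1 p t - c * lagmom N.+1 (p + 1) t
  - N.+1%:R * (N%:R + m) * lagmom N p t.
Proof.
move=> t0; rewrite /lagmom lagSS opprD powRD ?(gt_eqF t0) ?implybT// powR_inv1 ?(ltW t0)//.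
by field; rewrite gt_eqF.
Qed.

Lemma lagmom1 p t : 0 < t -> lagmom 1 p t = m * lagmom 0 p t - c * lagmom 0 (p + 1) t.
Proof.
move=> t0; rewrite /lagmom /= opprD powRD ?(gt_eqF t0) ?implybT// powR_inv1 ?(ltW t0)//.
by field; rewrite gt_eqF.
Qed.

Let A p := c `^ (- p) * Gamma p.

Let A_ge0 p : 0 <= A p. Proof. by rewrite mulr_ge0 ?powR_ge0 ?Gamma_ge0. Qed.

Let AS p : 0 < p -> c * A (p + 1) = p * A p.
Proof.
move=> p0; rewrite /A GammaS// opprD powRD ?(gt_eqF c0) ?implybT// powR_inv1 ?(ltW c0)//.
by field; rewrite gt_eqF.
Qed.


Let mabs N p : measurable_fun setT (fun t => `|lagmom N p t|).
Proof. by apply: measurableT_comp => //; exact: measurable_lagmom. Qed.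

Lemma haar_lagmom0 p : 0 < p -> haar (lagmom 0 p) = (A p)%:E.
Proof.
move=> p0; rewrite -(haar_powRN_expV p0 c0); apply: eq_haar => t t0.
by rewrite /lagmom /= mulr1.
Qed.

Let abs0 p : 0 < p -> haar (fun t => `|lagmom 0 p t|) = (A p)%:E.
Proof.
move=> p0; rewrite -haar_lagmom0//; apply: eq_haar => t t0.
by rewrite ger0_norm// /lagmom /= mulr1 mulr_ge0 ?powR_ge0 ?expR_ge0.
Qed.

(** Absolute values are taken in the recursion for [lag]. Lowering [N] by 1 may raise [p] by 1,
    which the 3 in [3 * N] pays for, so one [D] serves the whole induction; it is large enough for
    [(2 (N + 1) + m + q) D + (N + 1) (N + m) <= D^2] in the inductive step. *)
Lemma haar_abs_lagmom N p (D : R) : 0 < p -> 3 * N%:R + 2 * m + p <= D ->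
  (haar (fun t : R => `|lagmom N p t|%R) <= (c `^ (- p) * Gamma p * D ^+ N)%:E)%E.
Proof.
rewrite -/(A p).
suff key : forall q : R, 0 < q -> (3 * N%:R + 2 * m + q <= D ->
    (haar (fun t : R => `|lagmom N q t|%R) <= (A q * D ^+ N)%:E)%E) /\
  (3 * N.+1%:R + 2 * m + q <= D ->
    (haar (fun t : R => `|lagmom N.+1 q t|%R) <= (A q * D ^+ N.+1)%:E)%E).
  by move=> p0 pD; have [h _] := key p p0; exact: h.
elim: N => [|N IH] q q0.
  rewrite expr0 mulr1 abs0//; split=> // qD.
  apply: (@le_trans _ _ (haar (fun t => m * `|lagmom 0 q t| + c * `|lagmom 0 (q + 1) t|))).
    apply: le_haar => //; first by apply: measurable_funD; exact: measurable_funM.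
    move=> t t0; rewrite normr_ge0 /= lagmom1//; apply: (le_trans (ler_normB _ _)).
    by rewrite !normrM (ger0_norm m0) (gtr0_norm c0).
  have q10 : 0 < q + 1 by rewrite addr_gt0.
  rewrite haarD; [|exact: measurable_funM|exact: measurable_funM|
    by move=> t _; rewrite mulr_ge0|by move=> t _; rewrite mulr_ge0// ltW].
  rewrite !haarZ ?(ltW c0)// !abs0// -!EFinM -EFinD lee_fin AS// expr1 -mulrDl mulrC.
  rewrite ler_wpM2l ?A_ge0//; apply: le_trans qD.
  by rewrite lerD2r -[leLHS]add0r lerD ?mulr_ge0// -[leLHS]mul1r ler_wpM2r// ler1n.
have [_ IH2] := IH q q0; split=> // qD.
have q10 : 0 < q + 1 by rewrite addr_gt0.
have N0 : 0 <= N%:R :> R by [].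
have eN : N.+1%:R = N%:R + 1 :> R by rewrite -natr1.
have eN2 : N.+2%:R = N%:R + 2 :> R by rewrite -natr1 eN; ring.
have [IH1 _] := IH q q0; have [_ IH3] := IH (q + 1) q10.
have {}IH1 := IH1 ltac:(rewrite eN2 in qD; lra).
have {}IH2 := IH2 ltac:(rewrite eN2 in qD; rewrite eN; lra).
have {}IH3 := IH3 ltac:(rewrite eN2 in qD; rewrite eN; lra).
pose a1 := 2 * N.+1%:R + m; pose a2 := N.+1%:R * (N%:R + m).
have a10 : 0 <= a1 by rewrite addr_ge0// mulr_ge0.
have a20 : 0 <= a2 by rewrite mulr_ge0// addr_ge0.
apply: (@le_trans _ _ (haar (fun t => (a1 * `|lagmom N.+1 q t| + c * `|lagmom N.+1 (q + 1) t|)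
   + a2 * `|lagmom N q t|))).
  apply: le_haar => //.
    by apply: measurable_funD; [apply: measurable_funD|]; exact: measurable_funM.
  move=> t t0; rewrite normr_ge0 /= lagmomSS//; apply: (le_trans (ler_normB _ _)).
  rewrite [X in _ + X]normrM (ger0_norm a20) lerD2r; apply: (le_trans (ler_normB _ _)).
  by rewrite !normrM (ger0_norm a10) (gtr0_norm c0).
rewrite haarD; [|by apply: measurable_funD; exact: measurable_funM|exact: measurable_funM| |
    by move=> t _; rewrite mulr_ge0]; last first.
  by move=> t _; rewrite addr_ge0// mulr_ge0// ltW.
rewrite haarD; [|exact: measurable_funM|exact: measurable_funM|
    by move=> t _; rewrite mulr_ge0|by move=> t _; rewrite mulr_ge0// ltW].
rewrite !haarZ ?(ltW c0)//.
have m1 : 0 <= m := m0.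
have D0 : 0 <= D by rewrite eN2 in qD; lra.
apply: (@le_trans _ _ (a1%:E * (A q * D ^+ N.+1)%:E + c%:E * (A (q + 1) * D ^+ N.+1)%:E +
    a2%:E * (A q * D ^+ N)%:E)%E).
  by apply: leeD; [apply: leeD|]; apply: lee_wpmul2l; rewrite ?lee_fin ?(ltW c0).
rewrite -!EFinM -!EFinD lee_fin.
rewrite (_ : c * (A (q + 1) * D ^+ N.+1) = q * A q * D ^+ N.+1); last by rewrite mulrA AS.
rewrite !exprS.
rewrite (_ : _ + _ = A q * (D ^+ N * ((a1 + q) * D + a2))); last by ring.
rewrite ler_wpM2l ?A_ge0// [leRHS](_ : _ = D ^+ N * (D * D)) ?ler_wpM2l ?exprn_ge0//; last by ring.
rewrite /a1 /a2 eN; rewrite eN2 in qD; nra.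
Qed.

Lemma integrable_lagmom N p : 0 < p ->
  lebR.-integrable setT (fun t : R => (if (0 < t)%R then lagmom N p t / t else 0)%:E).
Proof.
move=> p0; apply: (@integrable_haar_fun _ _ (fun t => `|lagmom N p t|)) => //.
  exact: measurable_lagmom.
exact: le_lt_trans (haar_abs_lagmom p0 (lexx _)) (ltry _).
Qed.

(** Here signs are kept and the recursion sums exactly. In the application [m - p] is [(j - a) / 2],
    and the product is the numerator of [rGamma] at that point. *)
Lemma lagmom_integral N p : 0 < p ->
  \int[lebR]_t (if 0 < t then lagmom N p t / t else 0) =
  c `^ (- p) * Gamma p * \prod_(i < N) (m - p + i%:R).
Proof.
rewrite -/(A p).
suff key : forall q : R, 0 < q ->
  \int[lebR]_t (if 0 < t then lagmom N q t / t else 0) = A q * \prod_(i < N) (m - q + i%:R) /\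
  \int[lebR]_t (if 0 < t then lagmom N.+1 q t / t else 0) = A q * \prod_(i < N.+1) (m - q + i%:R).
  by move=> p0; have [] := key p p0.
have I0 q : 0 < q -> \int[lebR]_t (if 0 < t then lagmom 0 q t / t else 0) = A q.
  by move=> q0; exact: (congr1 fine (haar_lagmom0 q0)).
elim: N => [|N IH] q q0.
  have q10 : 0 < q + 1 by rewrite addr_gt0.
  rewrite big_ord0 mulr1 big_ord1 I0//; split=> //.
  transitivity (\int[lebR]_t (m * (if 0 < t then lagmom 0 q t / t else 0) +
     (- c) * (if 0 < t then lagmom 0 (q + 1) t / t else 0) + 0 * (if 0 < t then lagmom 0 q t / t else 0))).
    apply: eq_Rintegral => t _; case: ifP => t0; last by rewrite !mulr0 !addr0.
    by rewrite lagmom1//; ring.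
  have i1 := integrable_lagmom 0 q0; have i2 := integrable_lagmom 0 q10.
  have [_ ->] := integral_lin3 m (- c) 0 i1 i2 i1.
  by rewrite !I0// mulNr AS// addr0; ring.
have [IH1 IH2] := IH q q0; split=> //.
have q10 : 0 < q + 1 by rewrite addr_gt0.
have [_ IH3] := IH (q + 1) q10.
transitivity (\int[lebR]_t ((2 * N.+1%:R + m) * (if 0 < t then lagmom N.+1 q t / t else 0) +
   (- c) * (if 0 < t then lagmom N.+1 (q + 1) t / t else 0) +
   (- (N.+1%:R * (N%:R + m))) * (if 0 < t then lagmom N q t / t else 0))).
  apply: eq_Rintegral => t _; case: ifP => t0; last by rewrite !mulr0 !addr0.
  by rewrite lagmomSS//; ring.
have i1 := integrable_lagmom N.+1 q0; have i2 := integrable_lagmom N.+1 q10.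
have i3 := integrable_lagmom N q0.
have [_ ->] := integral_lin3 (2 * N.+1%:R + m) (- c) (- (N.+1%:R * (N%:R + m))) i1 i2 i3.
rewrite IH1 IH2 IH3 !big_ord_recr /=.
(* Raising the exponent by 1 shifts the product by one factor, so all three integrals share the
   product [Pi]. *)
rewrite (_ : \prod_(i < N) (m - (q + 1) + i%:R) * (m - (q + 1) + N%:R) =
   (m - (q + 1)) * \prod_(i < N) (m - q + i%:R)); last first.
  rewrite -[LHS](big_ord_recr N (fun i : 'I_N.+1 => m - (q + 1) + i%:R)).
  rewrite big_ord_recl addr0; congr (_ * _); apply: eq_bigr => i _.
  by rewrite lift0 -natr1; ring.
set Pi := \prod_(i < N) _.
have -> : - c * (A (q + 1) * ((m - (q + 1)) * Pi)) = - (q * A q * ((m - (q + 1)) * Pi)).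
  by rewrite -AS//; ring.
rewrite -!natr1; ring.
Qed.

End laguerre_moments.

Section shift.
Context {R : realType}.

Lemma integrable_shiftR (a : R) (f : R -> R) :
  lebR.-integrable setT (fun x => (f x)%:E) -> lebR.-integrable setT (fun x => (f (x + a))%:E).
Proof.
move=> itf; have mf := measurable_int _ itf; have [_ foo] := integrableP _ _ _ itf.
have mf' : measurable_fun setT f by apply/measurable_EFinP.
apply/integrableP; split.
  apply/measurable_EFinP; apply: (measurableT_comp mf'); exact: measurable_funD.
have := @ge0_integral_affine R 1 a ltr01 (fun x => `|(f x)%:E|%E).
rewrite invr1 mul1e => e.
rewrite (_ : (\int[lebR]_x `|(f (x + a)%R)%:E|)%E = (\int[lebR]_x `|(f (1 * x + a)%R)%:E|)%E); last first.
  by apply: eq_integral => x _; rewrite mul1r.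
by rewrite e//; exact: measurableT_comp.
Qed.

End shift.

Section radial_gauss.
Context {R : realType} {n : nat}.
Local Notation V := (n.-tuple R).

Lemma powR_gauss_le (a e : R) : 0 < a -> 0 < e -> exists2 D : R, 0 <= D &
  forall r, 0 <= r -> r `^ a * expR (- (e * r ^+ 2)) <= D * expR (- (e / 2 * r ^+ 2)).
Proof.
move=> a0 e0; exists ((2 * a) `^ a * expR (8^-1 / e)); first by rewrite mulr_ge0 ?powR_ge0 ?expR_ge0.
move=> r r0; apply: (le_trans (ler_wpM2r (expR_ge0 _) (powR_le_expR a0 r0))).
rewrite -!mulrA ler_wpM2l ?powR_ge0// -!expRD ler_expR.
have -> : 8^-1 / e - e * (2^-1 * r ^+ 2) = r / 2 - e * r ^+ 2 + e / 2 * (r - (2 * e)^-1) ^+ 2.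
  by field; rewrite gt_eqF.
by rewrite lerDl mulr_ge0 ?sqr_ge0// divr_ge0// ltW.
Qed.

Lemma integrable_powR_gaussn (a e : R) : 0 < a -> 0 < e ->
  (lebn n).-integrable setT (fun v : V => (vnorm v `^ a * expR (- (e * dotp v v)))%:E).
Proof.
move=> a0 e0; have [D D0 hD] := powR_gauss_le a0 e0.
apply: (@le_integrable _ _ _ _ _ _ _ (fun v : V => (D * expR (- (e / 2 * dotp v v)))%:E)) => //.
- apply/measurable_EFinP; apply: measurable_funM.
    exact: (measurableT_comp (measurable_powR a) (@measurable_vnorm R n)).
  apply: measurableT_comp => //; apply: measurableT_comp => //; apply: measurable_funM => //.
  exact: measurable_dotpp.
- move=> v _; rewrite !abse_EFin lee_fin !ger0_norm ?mulr_ge0 ?powR_ge0 ?expR_ge0//.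
  by rewrite -vnorm_sqr hD// vnorm_ge0.
- under eq_fun do rewrite EFinM; apply: integrableZl => //.
  by apply: integrable_gaussn; rewrite divr_gt0.
Qed.

End radial_gauss.

(** * Regularised Fourier integral of a single homogeneous function *)

Section radial_fourier.
Import -(notations) mpoly.
Context {R : realType} {n : nat}.
Local Notation C := R[i].
Local Notation V := (n.-tuple R).
Local Notation cpol := (mpoly.mpoly n R[i]).
Hypothesis n0 : (0 < n)%N.
Variables (x : vec R n) (j : nat) (H : cpol) (a : R) (N : nat).
Hypothesis x0 : 0 < vnorm x.
Hypothesis hH : homog j H.
Hypothesis lH : lap H = 0.
Hypothesis a0 : 0 < a.
Hypothesis hN : a / 2 + 1 < N%:R.

(** [b] is the exponent of the mixture: [|z|^a H(u_z)] is [|z|^(2 N) H(z)] times [|z|^(- 2 b)]. [Q]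
    is the power of the Gaussian parameter that Bochner-Hecke produces for [|z|^(2 N) H], and
    [p = Q - b] is what remains in the limit. [hN] ensures [1 <= b]. *)
Let m : R := j%:R + n%:R / 2.
Let p : R := (j%:R + a + n%:R) / 2.
Let c : R := dotp x x / 4.
Let b : R := (j%:R - a) / 2 + N%:R.
Let Q : R := N%:R + j%:R + n%:R / 2.

Let j0 : 0 <= j%:R :> R. Proof. by []. Qed.
Let nn0 : 0 < n%:R :> R. Proof. by rewrite ltr0n. Qed.
Let m0 : 0 <= m. Proof. by rewrite addr_ge0// divr_ge0. Qed.
Let p0 : 0 < p. Proof. by rewrite divr_gt0// ltr_wpDl// addr_ge0// ltW. Qed.
Let c0 : 0 < c. Proof. by rewrite divr_gt0// -vnorm_sqr exprn_gt0. Qed.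
Let b1 : 1 <= b. Proof. by rewrite /b; have := hN; have := j0; lra. Qed.
Let b0 : 0 < b. Proof. exact: lt_le_trans b1. Qed.
Let N0 : (0 < N)%N.
Proof. by rewrite -(ltr0n R); apply: lt_trans hN; rewrite addr_gt0// divr_gt0. Qed.

Definition rfun (e : R) (z : vec R n) : C :=
  (vnorm z `^ a)%:C * cpoly H (unitv z) *
  ((expR (- (e * dotp z z)))%:C * cexp (- ('i * (dotp x z)%:C))).

Let cabs_wave z : cabs (cexp (- ('i * (dotp x z)%:C))) = 1.
Proof.
by rewrite cabs_cexp cReN cReM [complex.Re 'i]/= [complex.Im _%:C]/= mul0r mulr0 subr0 oppr0 expR0.
Qed.

Lemma cmeasurable_wave : cmeasurable (fun z : V => cexp (- ('i * (dotp x z)%:C))).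
Proof.
apply: cmeasurable_cexp; apply: cmeasurableN; apply: cmeasurableM; first exact: cmeasurable_cst.
by apply: cmeasurable_real; exact: measurable_dotp.
Qed.

Lemma measurable_gaussn (e : R) : measurable_fun setT (fun z : V => expR (- (e * dotp z z))).
Proof.
apply: measurableT_comp => //; apply: measurableT_comp => //; apply: measurable_funM => //.
exact: measurable_dotpp.
Qed.

Lemma cmeasurable_rfun e : cmeasurable (rfun e : V -> C).
Proof.
apply: cmeasurableM.
  apply: cmeasurableM.
    apply: cmeasurable_real; exact: (measurableT_comp (measurable_powR a) (@measurable_vnorm R n)).
  by apply: cmeasurable_unitv; exact: cmeasurable_cpoly.
apply: cmeasurableM; last exact: cmeasurable_wave.
by apply: cmeasurable_real; exact: measurable_gaussn.
Qed.

Lemma cabs_rfun_le e (M : R) : 0 <= M -> sph_bounded M (cpoly H : vec R n -> C) ->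
  forall z, cabs (rfun e z) <= M * (vnorm z `^ a * expR (- (e * dotp z z))).
Proof.
move=> M0 HM z; rewrite /rfun !cabsM cabs_wave mulr1 !cabs_real !ger0_norm ?powR_ge0 ?expR_ge0//.
have [z0|z0] := ltP 0 (vnorm z); last first.
  have -> : vnorm z = 0 by apply/eqP; rewrite eq_le z0 vnorm_ge0.
  by rewrite powR0 ?gt_eqF// !mul0r mulr0.
rewrite [leRHS]mulrA ler_wpM2r ?expR_ge0// mulrC ler_wpM2r ?powR_ge0//.
by rewrite HM// vnorm_unitv.
Qed.

Lemma cintegrable_rfun e : 0 < e -> cintegrable (lebn n) (rfun e).
Proof.
move=> e0; have [_ [M HM]] := sph_ok_cpoly H.
have M0 : 0 <= Num.max M 0 by rewrite le_max lexx orbT.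
have HM' : sph_bounded (Num.max M 0) (cpoly H : vec R n -> C).
  by move=> u u1; rewrite le_max HM.
apply: (@le_cintegrable _ _ _ _ _ (fun z => Num.max M 0 * (vnorm z `^ a * expR (- (e * dotp z z))))).
- exact: cmeasurable_rfun.
- under eq_fun do rewrite EFinM; apply: integrableZl => //.
  exact: integrable_powR_gaussn.
- by move=> z; exact: cabs_rfun_le.
Qed.

Let S : cpol := sqn C n ^+ N * H.

Let cpoly_S z : cpoly S z = (dotp z z ^+ N)%:C * cpoly H z.
Proof. by rewrite cpolyM cpolyX_nat cpoly_sqn rcX. Qed.

Let rfun_power e z : 0 < vnorm z ->
  cpoly S z * ((expR (- (e * dotp z z)))%:C * cexp (- ('i * (dotp x z)%:C))) *
    (dotp z z `^ (- b))%:C = rfun e z.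
Proof.
move=> z0; rewrite /rfun cpoly_S (cpoly_unitv hH z0) -vnorm_sqr.
have -> : vnorm z `^ a = (vnorm z ^+ 2) ^+ N * vnorm z ^+ j * (vnorm z ^+ 2) `^ (- b).
  have z2 : vnorm z ^+ 2 = vnorm z `^ 2%:R by rewrite powR_mulrn// vnorm_ge0.
  rewrite {2}z2 -powRrM -exprM -exprD -powR_mulrn ?vnorm_ge0// -powRD ?(gt_eqF z0) ?implybT//.
  by congr (_ `^ _); rewrite /b natrD natrM; field.
by rewrite !rcM; ring.
Qed.

Let dotp_gt0 (z : vec R n) : 0 < vnorm z -> 0 < dotp z z.
Proof. by move=> z0; rewrite -vnorm_sqr exprn_gt0. Qed.

Let S_origin z : vnorm z <= 0 -> cpoly S z = 0.
Proof.
move=> z0; rewrite cpoly_S -vnorm_sqr (_ : vnorm z = 0); first by rewrite expr0n expr0n gtn_eqF// mul0r.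
by apply/eqP; rewrite eq_le z0 vnorm_ge0.
Qed.

Let F e (zs : V * measurableTypeR R) : C := if 0 < zs.2 then
  (zs.2 `^ b / zs.2)%:C * gfun (zs.2 + e) x S zs.1 else 0.

Let FE e z s : F e (z, s) =
  (cpoly S z * ((expR (- (e * dotp z z)))%:C * cexp (- ('i * (dotp x z)%:C)))) *
  (if 0 < s then s `^ b * expR (- (s * dotp z z)) / s else 0)%:C.
Proof.
rewrite /F /=; case: ifP => s0; last by rewrite mulr0.
by rewrite /gfun mulrDl opprD expRD !rcM; ring.
Qed.

Let mF e : cmeasurable (F e).
Proof.
apply: cmeasurable_if; last exact: cmeasurable_cst.
  by apply: measurable_fun_ltr => //; exact: measurable_snd.
apply: cmeasurableM.
  apply: cmeasurable_real; apply: measurable_funM.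
    exact: (measurableT_comp (measurable_powR _) measurable_snd).
  exact: (measurableT_comp (@measurable_inv R) measurable_snd).
apply: cmeasurableM; first exact: (cmeasurable_comp (cmeasurable_cpoly S) measurable_fst).
apply: cmeasurableM; last exact: (cmeasurable_comp cmeasurable_wave measurable_fst).
apply: cmeasurable_real; apply: measurableT_comp => //; apply: measurableT_comp => //.
apply: measurable_funM; last exact: (measurableT_comp (@measurable_dotpp R n) measurable_fst).
apply: measurable_funD => //; exact: measurable_snd.
Qed.

Let mexp (d : R) : measurable_fun setT (fun s : R => s `^ b * expR (- (s * d))).
Proof.
apply: measurable_funM; first exact: measurable_powR.
by apply: measurableT_comp => //; apply: measurableT_comp => //; exact: measurable_funM.
Qed.

Let iexp (d : R) : 0 < d -> lebR.-integrable setT (fun s : R =>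
   (if (0 < s)%R then s `^ b * expR (- (s * d)) / s else 0)%:E).
Proof.
move=> d0; apply: (@integrable_haar_fun _ _ (fun s => s `^ b * expR (- (s * d)))) => //.
  by rewrite haar_powR_expN// ltry.
by move=> t t0; rewrite ger0_norm// mulr_ge0 ?powR_ge0 ?expR_ge0.
Qed.

Let F_int e z : cintegral lebR (fun s => F e (z, s)) = (Gamma b)%:C * rfun e z.
Proof.
rewrite (eq_cintegral _ (FE e z)).
have [z0|z0] := ltP 0 (vnorm z).
  have ie := iexp (dotp_gt0 z0).
  rewrite cintegralZ; last exact: cintegrable_real.
  rewrite cintegral_real// (_ : Rintegral _ _ _ = dotp z z `^ (- b) * Gamma b); last first.
    exact: (congr1 fine (haar_powR_expN b0 (dotp_gt0 z0))).
  by rewrite -rfun_power// rcM; ring.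
rewrite (_ : (fun s => _) = (fun=> 0)); last by apply/funext => s; rewrite S_origin// !mul0r.
rewrite cintegral0 /rfun (_ : vnorm z = 0); last by apply/eqP; rewrite eq_le z0 vnorm_ge0.
by rewrite powR0 ?gt_eqF// !mul0r mulr0.
Qed.

Let F_abs e z : (\int[lebR]_s (cabs (F e (z, s)))%:E = (Gamma b * cabs (rfun e z))%:E)%E.
Proof.
have [z0|z0] := ltP 0 (vnorm z); last first.
  rewrite integral0_eq => [|s _]; last by rewrite FE S_origin// !mul0r cabs0.
  rewrite /rfun (_ : vnorm z = 0); last by apply/eqP; rewrite eq_le z0 vnorm_ge0.
  by rewrite powR0 ?gt_eqF// !mul0r cabs0 mulr0.
set A := cpoly S z * ((expR (- (e * dotp z z)))%:C * cexp (- ('i * (dotp x z)%:C))).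
transitivity (haar (fun s => cabs A * (s `^ b * expR (- (s * dotp z z))))).
  apply: eq_integral => s _; rewrite FE -/A cabsM cabs_real; congr EFin.
  case: ifP => s0; last by rewrite normr0 mulr0.
  by rewrite ger0_norm ?mulrA// !mulr_ge0 ?powR_ge0 ?expR_ge0 ?invr_ge0 ?(ltW s0).
rewrite haarZ ?cabs_ge0//; last by move=> s s0; rewrite mulr_ge0 ?powR_ge0 ?expR_ge0.
rewrite haar_powR_expN ?dotp_gt0// -EFinM -rfun_power// -/A cabsM cabs_real ger0_norm ?powR_ge0//.
by congr EFin; ring.
Qed.

(** [|z|^(- 2 b)] is [1 / Gamma b] times the integral of [s^(b - 1) exp (- s |z|^2)]; the mixing
    Gaussian merges with the regularising one into parameter [s + e]. *)
Lemma rfun_fubini e : 0 < e -> cintegral (lebn n) (rfun e) =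
  ((Gamma b)^-1)%:C * cintegral lebR (fun s => if 0 < s then (s `^ b / s)%:C * gint (s + e) x S else 0).
Proof.
move=> e0; have ir := cintegrable_rfun e0; have g0 := Gamma_gt0 b0.
have foo : (\int[lebn n]_z \int[lebR]_s (cabs (F e (z, s)))%:E < +oo)%E.
  rewrite (eq_integral (fun z => ((Gamma b)%:E * (cabs (rfun e z))%:E)%E)); last first.
    by move=> z _; rewrite F_abs EFinM.
  have := integrableZl measurableT (Gamma b) (cintegrable_cabs ir).
  move=> /integrable_lty; exact.
have := cFubini (mF e) foo; rewrite (eq_cintegral _ (F_int e)) cintegralZ// => h.
have gn : (Gamma b)%:C != 0 :> C by rewrite rc_eq0 gt_eqF.
apply: (mulfI gn); rewrite h mulrA -rcM mulfV ?gt_eqF// mul1r.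
apply: eq_cintegral => s; rewrite /F /=; case: ifP => s0; last exact: cintegral0.
rewrite cintegralZ//; exact: cintegrable_gfun (addr_gt0 s0 e0) _.
Qed.

(** The part of Bochner-Hecke that does not depend on the Gaussian parameter. *)
Definition wave_factor : C := (- 'i) ^+ j * (2^-1 ^+ j * Num.sqrt pi ^+ n)%:C * cpoly H x.

Lemma gint_S s : 0 < s -> gint s x S =
  wave_factor * (s `^ (- Q) * lag m N (c / s) * expR (- (c / s)))%:C.
Proof.
move=> s0; rewrite /S (gint_sqnX x N s0 hH lH) (bochner_hecke x s0 hH lH) gint1//.
rewrite -/m -/c /wave_factor (_ : dotp x x / (4 * s) = c / s); last by rewrite /c; field; rewrite gt_eqF.
have q0 : 0 < Num.sqrt s by rewrite sqrtr_gt0.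
have -> : s `^ (- Q) = s ^- N * s ^- j * Num.sqrt s ^- n.
  rewrite /Q powRN !powRD ?(gt_eqF s0) ?implybT// !powR_mulrn ?(ltW s0)//.
  rewrite [n%:R / 2]mulrC powRrM powR12_sqrt ?(ltW s0)// powR_mulrn ?(ltW q0)//.
  by rewrite !invfM.
have -> : ((- 'i * ((2 * s)^-1)%:C) ^+ j : C) = (- 'i) ^+ j * (2^-1 ^+ j * s^-1 ^+ j)%:C.
  by rewrite -exprMn -invfM rcX exprMn.
rewrite sqrtrM ?pi_ge0// sqrtrV ?(ltW s0)// [(Num.sqrt pi / Num.sqrt s) ^+ n]exprMn !exprVn.
rewrite !rcM; ring.
Qed.

Definition rint e : R := \int[lebR]_s (if 0 < s then
  s `^ b / s * ((s + e) `^ (- Q) * lag m N (c / (s + e)) * expR (- (c / (s + e)))) else 0).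

(** The integrand of [rint] with [s + e] renamed to [s]. Only [(s - e)^(b - 1)] still depends on
    [e], and by [1 <= b] it is at most [s^(b - 1)]; thus the modulus of the limit integrand is a
    majorant, uniformly in [e]. *)
Let G e (s : R) : R := if e < s then
  (s - e) `^ b / (s - e) * (s `^ (- Q) * lag m N (c / s) * expR (- (c / s))) else 0.

Let mG e : measurable_fun setT (G e).
Proof.
apply: measurable_fun_ifT; [exact: measurable_fun_ltr| |exact: measurable_cst].
have me : measurable_fun setT (fun s : R => s - e) by exact: measurable_funB.
have mc : measurable_fun setT (fun s : R => c / s).
  by apply: measurable_funM => //; exact: measurable_inv.
apply: measurable_funM; apply: measurable_funM.
- exact: (measurableT_comp (measurable_powR b) me).
- exact: (measurableT_comp (@measurable_inv R) me).
- by apply: measurable_funM; [exact: measurable_powR|exact: measurable_lag].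
- by apply: measurableT_comp => //; exact: measurableT_comp.
Qed.

Let Qp : b - 1 - Q = - p - 1.
Proof. by rewrite /b /Q /p; field. Qed.

Let lim_fun (s : R) : R := if 0 < s then lagmom m c N p s / s else 0.

Let lim_funE s : 0 < s -> lim_fun s =
  s `^ (b - 1) * (s `^ (- Q) * lag m N (c / s) * expR (- (c / s))).
Proof.
move=> s0; rewrite /lim_fun s0 /lagmom !mulrA -powRD ?(gt_eqF s0) ?implybT// Qp.
rewrite powRD ?(gt_eqF s0) ?implybT// powR_inv1 ?(ltW s0)//; ring.
Qed.

Let G_le e s : 0 < e -> `|G e s| <= `|lim_fun s|.
Proof.
move=> e0; rewrite /G; case: ltP => es; last by rewrite normr0.
have s0 : 0 < s by exact: lt_trans es.
have se : 0 < s - e by rewrite subr_gt0.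
rewrite lim_funE// -[(s - e)^-1]powR_inv1 ?(ltW se)// -powRD ?(gt_eqF se) ?implybT//.
rewrite normrM [leRHS]normrM ler_wpM2r// !ger0_norm ?powR_ge0//.
apply: ge0_ler_powR; rewrite ?nnegrE ?subr_ge0 ?(ltW se) ?(ltW s0)//.
  exact: ltW.
by rewrite lerBlDr lerDl ltW.
Qed.

Let ilim : lebR.-integrable setT (fun s => (lim_fun s)%:E).
Proof. exact: integrable_lagmom. Qed.

Let iG e : 0 < e -> lebR.-integrable setT (fun s => (G e s)%:E).
Proof.
move=> e0; apply: le_integrable ilim => //; first by apply/measurable_EFinP; exact: mG.
by move=> s _; rewrite !abse_EFin lee_fin G_le.
Qed.

Let rintG e : 0 < e -> rint e = \int[lebR]_s G e s.
Proof.
move=> e0; rewrite -(integral_shiftR e (iG e0)); apply: eq_Rintegral => s _.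
by rewrite /G ltrDr addrK.
Qed.

Lemma rint_le e : 0 < e ->
  `|rint e| <= c `^ (- p) * Gamma p * (3 * N%:R + 2 * m + p) ^+ N.
Proof.
move=> e0; rewrite rintG//; apply: (le_trans (le_normr_Rintegral _ (iG e0))) => //.
rewrite -lee_fin; apply: le_trans (haar_abs_lagmom m0 c0 p0 (lexx (3 * N%:R + 2 * m + p))).
rewrite fineK; last first.
  by apply: integrable_fin_num => //; exact: (integrable_abse (iG e0)).
apply: ge0_le_integral => //.
- by apply/measurable_EFinP; apply: measurableT_comp => //; exact: mG.
- apply/measurable_EFinP; apply: measurable_haar_fun; apply: measurableT_comp => //.
  exact: measurable_lagmom.
- move=> s _; rewrite lee_fin; apply: (le_trans (G_le s e0)).
  rewrite /lim_fun; case: ifP => s0; last by rewrite normr0.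
  by rewrite normrM [`|s^-1|]gtr0_norm ?invr_gt0.
Qed.

Lemma rfunE e : 0 < e ->
  cintegral (lebn n) (rfun e) = ((Gamma b)^-1)%:C * (wave_factor * (rint e)%:C).
Proof.
move=> e0; rewrite rfun_fubini//; congr (_ * _).
have ii : lebR.-integrable setT (fun s => (if (0 < s)%R then
  s `^ b / s * ((s + e) `^ (- Q) * lag m N (c / (s + e)) * expR (- (c / (s + e)))) else 0)%:E).
  have := integrable_shiftR e (iG e0); apply: eq_integrable => // s _.
  by rewrite /G ltrDr addrK.
rewrite /rint -cintegral_real// -cintegralZ; last exact: cintegrable_real.
apply: eq_cintegral => s; case: ifP => s0; last by rewrite mulr0.
by rewrite gint_S ?addr_gt0// rcM; ring.
Qed.

Let rint_lim := c `^ (- p) * Gamma p * \prod_(i < N) (m - p + i%:R).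

Let G_cvg (e : nat -> R) s : (forall k, 0 < e k) -> (e k @[k --> \oo] --> (0 : R)) ->
  G (e k) s @[k --> \oo] --> lim_fun s.
Proof.
move=> e0 ec; have [s0|s0] := ltP 0 s; last first.
  rewrite /lim_fun ltNge s0 /= (_ : (fun k => _) = (fun=> 0)); first exact: cvg_cst.
  by apply/funext => k; rewrite /G ltNge (le_trans s0 (ltW (e0 k))).
rewrite lim_funE//; set X := _ * expR _.
have cp : {for s, continuous (fun t : R => t `^ (b - 1))}.
  apply: differentiable_continuous; apply/derivable1_diffP.
  have d := is_derive1_powR (b - 1) s0.
  exact: (@ex_derive _ _ _ _ _ _ _ d).
have h : (s - e k) `^ (b - 1) * X @[k --> \oo] --> s `^ (b - 1) * X.
  apply: cvgM; last exact: cvg_cst.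
  apply: (@cvg_comp _ _ _ (fun k => s - e k) (fun t : R => t `^ (b - 1)) _ (nbhs s)); last exact: cp.
  have h0 : s - e k @[k --> \oo] --> s - 0 by apply: cvgB => //; exact: cvg_cst.
  by rewrite subr0 in h0; exact: h0.
apply: cvg_trans h; apply: near_eq_cvg; near=> k.
have ek : e k < s by near: k; exact: (cvgr_lt 0 ec).
have se : 0 < s - e k by rewrite subr_gt0.
rewrite /G ek -[(s - e k)^-1]powR_inv1 ?(ltW se)// -powRD ?(gt_eqF se) ?implybT//.
Unshelve. all: by end_near.
Qed.

Lemma rfun_cvg (e : nat -> R) : (forall k, 0 < e k) -> (e k @[k --> \oo] --> (0 : R)) ->
  cabs (cintegral (lebn n) (rfun (e k)) -
    ((Gamma b)^-1)%:C * (wave_factor * (c `^ (- p) * Gamma p * \prod_(i < N) (m - p + i%:R))%:C))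
  @[k --> \oo] --> (0 : R).
Proof.
move=> e0 ec; rewrite -/rint_lim.
have key : cabs ((rint (e k))%:C - rint_lim%:C) @[k --> \oo] --> (0 : R).
  have -> : (fun k => cabs ((rint (e k))%:C - rint_lim%:C)) =
     (fun k => cabs (cintegral lebR (fun s => (G (e k) s)%:C) - cintegral lebR (fun s => (lim_fun s)%:C))).
    apply/funext => k; rewrite !cintegral_real//; last exact: iG.
    by rewrite -rintG// /rint_lim -(lagmom_integral m0 c0 N p0).
  apply: (@cdominated_convergence _ _ R lebR _ _ (fun s => `|lim_fun s|)).
  - by move=> k; apply: cmeasurable_real; exact: mG.
  - apply: cmeasurable_real; apply: measurable_haar_fun; exact: measurable_lagmom.
  - move=> s; under eq_fun do rewrite -rcB cabs_real.
    have := @G_cvg e s e0 ec => /cvgrPdist_le h; apply/cvgrPdist_le => d d0.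
    by near=> k; rewrite sub0r normrN normr_id distrC; near: k; exact: h.
  - exact: (integrable_abse ilim).
  - by move=> k s; rewrite cabs_real; exact: G_le.
have -> : (fun k => cabs (cintegral (lebn n) (rfun (e k)) - ((Gamma b)^-1)%:C * (wave_factor * rint_lim%:C))) =
   (fun k => cabs (((Gamma b)^-1)%:C * wave_factor) * cabs ((rint (e k))%:C - rint_lim%:C)).
  by apply/funext => k; rewrite rfunE// -cabsM; congr cabs; ring.
rewrite -[X in _ --> X](mulr0 (cabs (((Gamma b)^-1)%:C * wave_factor))).
by apply: cvgM => //; exact: cvg_cst.
Unshelve. all: by end_near.
Qed.

Lemma rfun_le e : 0 < e -> cabs (cintegral (lebn n) (rfun e)) <=
  (Gamma b)^-1 * cabs wave_factor * (c `^ (- p) * Gamma p * (3 * N%:R + 2 * m + p) ^+ N).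
Proof.
move=> e0; rewrite rfunE// cabsM (cabsM wave_factor) !cabs_real gtr0_norm ?invr_gt0 ?Gamma_gt0//.
by rewrite mulrA ler_wpM2l ?rint_le// mulr_ge0 ?cabs_ge0 ?invr_ge0 ?Gamma_ge0.
Qed.

End radial_fourier.

(** * Comparison of powers with factorials *)

Section growth.
Context {R : realType}.

Lemma exprn_fact_le (y : R) k : 0 <= y -> y ^+ k / k`!%:R <= expR y.
Proof.
move=> y0; case: k => [|k]; first by rewrite expr0 divr1 -[leLHS]expR0 ler_expR.
by apply: le_trans (expR_ge1Dxn k y0); rewrite lerDr.
Qed.

Lemma exprn_fact_geometric (E : R) k : 0 <= E -> E ^+ k / k`!%:R <= expR (2 * E) * 2 ^- k.
Proof.
move=> E0; have := @exprn_fact_le (2 * E) k (mulr_ge0 (ler0n _ _) E0).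
by rewrite exprMn -mulrA mulrC -ler_pdivlMr ?exprn_gt0.
Qed.

Lemma powR_exprn (y c : R) k : 0 <= y -> (y ^+ k) `^ c = (y `^ c) ^+ k.
Proof.
move=> y0; rewrite -powR_mulrn// -powRrM [k%:R * c]mulrC powRrM powR_mulrn//.
exact: powR_ge0.
Qed.

(** From [k^k <= e^k k!] one gets [k^(k a) <= (e^k k!)^a], which leaves [E^k / (k!)^(1 - a)] up to
    the fixed power [k^C], itself absorbed by [e^k]. This is the power [1 - a] of [E2^k / k!], and
    [y^k / k! <= exp (2 y) 2^(- k)] gives the ratio [th = 2^(- (1 - a))]. *)
Lemma powR_fact_geometric (a G : R) (C : nat) : 0 < a < 1 -> 1 <= G ->
  exists2 K : R, 0 <= K & exists2 th : R, 0 < th < 1 &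
  forall k, (0 < k)%N -> G ^+ k * k%:R `^ (k%:R * a + C%:R) / k`!%:R <= K * th ^+ k.
Proof.
move=> /andP[a0 a1] G1; have b0 : 0 < 1 - a by rewrite subr_gt0.
have e1 : 1 <= expR 1 :> R by rewrite -[leLHS]expR0 ler_expR.
pose E := G * expR 1 * expR 1 `^ a.
have E0 : 0 <= E by rewrite !mulr_ge0 ?expR_ge0 ?powR_ge0// (le_trans ler01).
pose E2 := E `^ (1 - a)^-1; have E20 : 0 <= E2 by exact: powR_ge0.
have E2E : E2 `^ (1 - a) = E by rewrite -powRrM mulVf ?gt_eqF// powRr1.
exists (C%:R ^+ C * expR (2 * E2) `^ (1 - a)); first by rewrite mulr_ge0 ?exprn_ge0 ?powR_ge0.
exists (2^-1 `^ (1 - a)).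
  rewrite powR_gt0//=; have h1 : (1 : R) `^ (1 - a) = 1 by rewrite powR1.
  by rewrite -[ltRHS]h1; apply: gt0_ltr_powR; rewrite ?nnegrE// invf_lt1 ?ltr1n.
move=> k k0; have kR0 : 0 < k%:R :> R by rewrite ltr0n.
set f : R := k`!%:R; have f0 : 0 < f by rewrite ltr0n fact_gt0.
have ek : expR k%:R = expR 1 ^+ k :> R by rewrite -expRM_natr mul1r.
have kk : k%:R ^+ k <= expR 1 ^+ k * f.
  have := @exprn_fact_le k%:R k (ltW kR0); by rewrite ler_pdivrMr// -/f ek.
have kC : (k%:R : R) ^+ C <= C%:R ^+ C * expR 1 ^+ k.
  by have := @exprn_le_expR R k%:R C (ltW kR0); rewrite ek.
have ka : k%:R `^ (k%:R * a) <= (expR 1 ^+ k * f) `^ a.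
  rewrite powRrM powR_mulrn ?(ltW kR0)//; apply: ge0_ler_powR => //.
  - exact: ltW.
  - by rewrite nnegrE exprn_ge0.
  - by rewrite nnegrE mulr_ge0 ?exprn_ge0 ?expR_ge0// ltW.
rewrite powRD ?(gt_eqF kR0) ?implybT// powR_mulrn ?(ltW kR0)//.
apply: (@le_trans _ _ (G ^+ k * ((expR 1 ^+ k * f) `^ a * (C%:R ^+ C * expR 1 ^+ k)) / f)).
  rewrite ler_wpM2r ?invr_ge0 ?(ltW f0)// ler_wpM2l ?exprn_ge0 ?(le_trans ler01 G1)//.
  by apply: ler_pM; rewrite ?powR_ge0 ?exprn_ge0.
have -> : G ^+ k * ((expR 1 ^+ k * f) `^ a * (C%:R ^+ C * expR 1 ^+ k)) / f =
   C%:R ^+ C * (E2 ^+ k / f) `^ (1 - a).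
  have -> : (E2 ^+ k / f) `^ (1 - a) = E ^+ k * f `^ (a - 1).
    rewrite powRM ?exprn_ge0 ?invr_ge0 ?(ltW f0)// -{1}powR_inv1 ?(ltW f0)//.
    by rewrite -(powRrM f) mulN1r opprB powR_exprn// E2E.
  rewrite powRM ?exprn_ge0 ?expR_ge0 ?(ltW f0)// [f `^ (a - 1)]powRD ?(gt_eqF f0) ?implybT//.
  rewrite powR_inv1 ?(ltW f0)// /E !exprMn.
  have -> : (expR 1 ^+ k) `^ a = (expR 1 `^ a) ^+ k :> R.
    by rewrite powR_exprn ?expR_ge0.
  by ring.
rewrite -mulrA ler_wpM2l ?exprn_ge0//.
have -> : (2^-1 `^ (1 - a)) ^+ k = (2 ^- k) `^ (1 - a) :> R.
  by rewrite -exprVn powR_exprn.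
rewrite -powRM ?expR_ge0 ?invr_ge0 ?exprn_ge0//; apply: ge0_ler_powR => //.
- exact: ltW.
- by rewrite nnegrE mulr_ge0 ?exprn_ge0 ?invr_ge0 ?(ltW f0).
- by rewrite nnegrE mulr_ge0 ?expR_ge0 ?invr_ge0 ?exprn_ge0.
- exact: exprn_fact_geometric.
Qed.

End growth.

Section radial_bound.
Import -(notations) mpoly.
Context {R : realType} {n : nat}.
Local Notation C := R[i].
Local Notation cpol := (mpoly.mpoly n R[i]).
Hypothesis n2 : (2 <= n)%N.
Let n0 : (0 < n)%N. Proof. exact: leq_trans n2. Qed.

(** An integer above [a / 2 + 1] and at most [a / 2 + 2]: large enough for the mixture, small enough
    for the growth estimate. *)
Definition lag_order (a : R) : nat := (Num.truncn (a / 2)).+2.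

Lemma lag_order_gt (a : R) : 0 < a -> a / 2 + 1 < (lag_order a)%:R.
Proof.
move=> a0; rewrite /lag_order -[(Num.truncn (a / 2)).+2%:R]natr1 ltrD2r; exact: truncnS_gt.
Qed.

Lemma lag_order_le (a : R) : 0 < a -> (lag_order a)%:R <= a / 2 + 2.
Proof.
move=> a0; rewrite /lag_order -addn2 natrD lerD2r truncn_le divr_ge0//.
exact: ltW.
Qed.

(** The powers of [|x|] and of 2 with exponent [j] cancel against those in [wave_factor]; the
    Laguerre product and the reciprocal Gamma value combine by [rGammaE]. *)
Lemma rfun_limit_value (x : vec R n) j (H : cpol) (a : R) (N := lag_order a) :
  0 < vnorm x -> homog j H -> 0 < a ->
  ((Gamma ((j%:R - a) / 2 + N%:R))^-1)%:C * (wave_factor x j H *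
     ((dotp x x / 4) `^ (- ((j%:R + a + n%:R) / 2)) * Gamma ((j%:R + a + n%:R) / 2) *
      \prod_(i < N) (j%:R + n%:R / 2 - (j%:R + a + n%:R) / 2 + i%:R))%:C) =
  (pi `^ (n%:R / 2) * 2 `^ (a + n%:R) * vnorm x `^ (- (a + n%:R)) *
    (Gamma ((j%:R + a + n%:R) / 2) * rGamma ((j%:R - a) / 2)))%:C *
   ((- 'i) ^+ j * cpoly H (unitv x)).
Proof.
move=> x0 hH a0; have hN := lag_order_gt a0.
have -> : j%:R + n%:R / 2 - (j%:R + a + n%:R) / 2 = (j%:R - a) / 2 :> R by field.
have b0 : 0 < (j%:R - a) / 2 + N%:R.
  by rewrite /N; have : 0 <= j%:R :> R by []; lra.
rewrite (rGammaE b0) /wave_factor (cpoly_unitv hH x0).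
set p := (j%:R + a + n%:R) / 2.
have cE : (dotp x x / 4) `^ (- p) = vnorm x `^ (- (a + n%:R)) * vnorm x ^- j * (2 `^ (a + n%:R) * 2 ^+ j).
  have -> : dotp x x / 4 = (vnorm x / 2) `^ 2%:R.
    by rewrite powR_mulrn ?divr_ge0 ?vnorm_ge0// exprMn vnorm_sqr; field.
  rewrite -powRrM (_ : 2%:R * - p = - (a + n%:R) - j%:R); last by rewrite /p; field.
  rewrite powRM ?vnorm_ge0// -[2^-1]powR_inv1// -powRrM.
  rewrite (_ : -1 * (- (a + n%:R) - j%:R) = (a + n%:R) + j%:R); last by ring.
  rewrite !powRD ?(gt_eqF x0) ?(gt_eqF (@ltr0n R 2)) ?implybT ?pnatr_eq0//.
  by rewrite [vnorm x `^ (- j%:R)]powRN !powR_mulrn ?vnorm_ge0.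
have piE : Num.sqrt pi ^+ n = pi `^ (n%:R / 2) :> R.
  by rewrite -powR12_sqrt ?pi_ge0// -powR_mulrn ?powR_ge0// -powRrM mulrC.
rewrite cE piE !rcM !rcX.
have xn : (vnorm x)%:C != 0 :> C by rewrite rc_eq0 gt_eqF.
rewrite -!rcX; set G := Gamma p; set Pr := \prod_(i < N) _; set G' := (Gamma _)^-1.
have e1 : (vnorm x ^- j * vnorm x ^+ j) = 1 by rewrite mulVf// expf_neq0// gt_eqF.
have e2 : (2 ^+ j * 2^-1 ^+ j) = 1 :> R by rewrite -exprMn mulfV ?expr1n// pnatr_eq0.
transitivity ((pi `^ (n%:R / 2) * 2 `^ (a + n%:R) * vnorm x `^ (- (a + n%:R)) * (G * (Pr * G'))
   * (vnorm x ^- j * vnorm x ^+ j) * (2 ^+ j * 2^-1 ^+ j))%:C * ((- 'i) ^+ j * cpoly H (unitv x))).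
  by rewrite !rcM; ring.
by rewrite e1 e2 !mulr1 !rcM; ring.
Qed.

(** Two factors grow faster than geometrically, and each takes half of the exponent: with
    [a = k alpha], both [Gamma p / Gamma b] and the Laguerre bound [D^N] are at most [k^(a / 2)] up
    to geometric factors and fixed powers of [k]. The product is of a size that [k!] still beats for
    [alpha < 1]. *)
Lemma rfun_uniform_bound (alpha r : R) (q : nat) : 0 < alpha < 1 -> 0 < r ->
  exists2 K : R, 0 <= K & exists2 G : R, 1 <= G & exists E : nat,
  forall k j (H : cpol) (x : vec R n) (B e : R), (0 < k)%N -> (j <= k * q)%N ->
    homog j H -> lap H = 0 -> r <= vnorm x -> cabs (cpoly H (unitv x)) <= B -> 0 < e ->
    cabs (cintegral (lebn n) (rfun x H (k%:R * alpha) e)) <=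
    B * (K * G ^+ k * k%:R `^ (k%:R * alpha + E%:R)).
Proof.
move=> /andP[al0 al1] r0.
(* [r1] will bound [1 / |x|], [K1 * k] will bound [D], and [K2 * k] will bound [2 * Y]. *)
pose r1 := Num.max r^-1 1 : R.
have r11 : 1 <= r1 by rewrite le_max lexx orbT.
pose K1 : R := 2 + 3 * q%:R + 3 * n%:R + 6.
pose K2 : R := n%:R + 3.
have q0 : 0 <= q%:R :> R by []. have nn0 : 2 <= n%:R :> R by rewrite ler_nat.
have K11 : 1 <= K1 by rewrite /K1; lra.
have K21 : 1 <= K2 by rewrite /K2; lra.
pose S : R := Num.sqrt pi ^+ n.
have S0 : 0 <= S by rewrite exprn_ge0// sqrtr_ge0.
exists (S * (2 * r1) ^+ n * 2 ^+ 2 * K2 ^+ n.+1 * K1 ^+ 2).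
  by rewrite !mulr_ge0 ?exprn_ge0// ?mulr_ge0// (le_trans ler01).
exists (2 * r1 * 2 ^+ q * K2 * K1).
  by rewrite !mulr_ege1 ?ler1n// exprn_ege1// ler1n.
exists (n + 3)%N => k j H x B e k0 jk hH lH rx HB e0.
have x0 : 0 < vnorm x by exact: lt_le_trans rx.
have kR1 : 1 <= k%:R :> R by rewrite ler1n.
have kR0 : 0 < k%:R :> R by rewrite ltr0n.
set a := k%:R * alpha; have a0 : 0 < a by rewrite mulr_gt0.
have ak : a <= k%:R by rewrite ler_piMr// ltW.
have hN := lag_order_gt a0; have hN2 := lag_order_le a0.
have := rfun_le n0 x0 hH lH a0 hN e0.
set N := lag_order a; rewrite -/N in hN hN2.
set b := (j%:R - a) / 2 + N%:R; set p := (j%:R + a + n%:R) / 2; set m := j%:R + n%:R / 2.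
have jR : j%:R <= k%:R * q%:R :> R by rewrite -natrM ler_nat.
have j0 : 0 <= j%:R :> R by [].
have b1 : 1 <= b by rewrite /b; lra.
have b0 : 0 < b by exact: lt_le_trans b1.
have b2 : b <= j%:R / 2 + 2 by rewrite /b; lra.
have p1 : 1 <= p by rewrite /p; lra.
have p0 : 0 < p by exact: lt_le_trans p1.
(* The shift by 2 ensures [1 <= Y], by [n >= 2] and [N <= a / 2 + 2]; it costs two uses of [GammaS],
   whose factors [p] and [p + 1] are at least 1. *)
pose Y := p + 2 - b.
have Y1 : 1 <= Y by rewrite /Y /p /b; lra.
have Y0 : 0 < Y by exact: lt_le_trans Y1.
have Y2 : Y <= a / 2 + n%:R + 1 by rewrite /Y /p /b; lra.
have GpY : Gamma p / Gamma b <= (2 * Y) `^ Y * 2 `^ b.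
  rewrite ler_pdivrMr ?Gamma_gt0//; apply: le_trans (Gamma_add_le b0 Y0).
  have -> : b + Y = p + 1 + 1 by rewrite /Y; ring.
  rewrite !GammaS ?addr_gt0// mulrA ler_peMl ?Gamma_ge0//.
  by rewrite mulr_ege1// lerDr ltW.
set D := 3 * N%:R + 2 * m + p.
have D0 : 0 < D by rewrite /D /m; lra.
have DK : D <= K1 * k%:R.
  have h1 : q%:R <= k%:R * q%:R :> R by rewrite ler_peMl.
  have h2 : n%:R <= k%:R * n%:R :> R by rewrite ler_peMl.
  have : D <= 2 * k%:R + 3 * (k%:R * q%:R) + 3 * n%:R + 6 by rewrite /D /m /p; lra.
  move=> h; apply: (le_trans h); rewrite /K1; nra.
have YK : 2 * Y <= K2 * k%:R.
  have h2 : n%:R <= k%:R * n%:R :> R by rewrite ler_peMl.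
  rewrite /K2; have : Y <= k%:R / 2 + n%:R / 2 + 1 by rewrite /Y /p /b; lra.
  nra.
have HB0 : 0 <= B by exact: le_trans (cabs_ge0 _) HB.
have kpow (Z e' : R) (l : nat) : 1 <= Z -> e' <= l%:R -> (Z * k%:R) `^ e' <= Z ^+ l * k%:R `^ e'.
  move=> Z1 e'l; have Z0 : 0 <= Z by exact: le_trans Z1.
  rewrite powRM ?(ltW kR0)// ler_wpM2r ?powR_ge0// -powR_mulrn//.
  exact: ler_powR.
have X3 : (2 * Y) `^ Y <= K2 ^+ (k + n.+1) * k%:R `^ (a / 2 + n%:R + 1).
  have h1 : 1 <= K2 * k%:R by rewrite mulr_ege1.
  apply: (@le_trans _ _ ((K2 * k%:R) `^ (a / 2 + n%:R + 1))); last first.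
    by apply: kpow => //; rewrite natrD -[n.+1%:R]natr1; lra.
  apply: (@le_trans _ _ ((K2 * k%:R) `^ Y)); last exact: ler_powR.
  by apply: ge0_ler_powR; rewrite ?nnegrE ?mulr_ge0 ?(ltW Y0) ?(le_trans ler01 K21).
have X4 : D ^+ N <= K1 ^+ (k + 2) * k%:R `^ (a / 2 + 2).
  have h1 : 1 <= K1 * k%:R by rewrite mulr_ege1.
  apply: (@le_trans _ _ ((K1 * k%:R) `^ (a / 2 + 2))); last first.
    by apply: kpow => //; rewrite natrD; lra.
  apply: (@le_trans _ _ ((K1 * k%:R) `^ N%:R)); last exact: ler_powR.
  rewrite powR_mulrn ?(le_trans ler01 h1)//; apply: lerXn2r; rewrite ?nnegrE ?(ltW D0)//.
  exact: le_trans h1.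
have X2 : 2 `^ b <= 2 ^+ (k * q + 2) :> R.
  rewrite -powR_mulrn//; apply: ler_powR; first by rewrite ler1n.
  by rewrite natrD natrM; lra.
have X1 : 2 `^ (a + n%:R) * vnorm x `^ (- (a + n%:R)) <= (2 * r1) ^+ (k + n).
  have -> : vnorm x `^ (- (a + n%:R)) = (vnorm x)^-1 `^ (a + n%:R).
    by rewrite -powR_inv1 ?vnorm_ge0// -powRrM mulN1r.
  rewrite -powRM ?invr_ge0 ?vnorm_ge0//.
  apply: (@le_trans _ _ ((2 * r1) `^ (a + n%:R))).
    apply: ge0_ler_powR; rewrite ?nnegrE ?mulr_ge0 ?invr_ge0 ?vnorm_ge0 ?addr_ge0 ?(ltW a0) ?(le_trans ler01 r11)//.
    by rewrite ler_wpM2l// le_max lef_pV2 ?posrE ?rx.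
  rewrite -powR_mulrn ?mulr_ge0 ?(le_trans ler01 r11)//; apply: ler_powR.
    by rewrite mulr_ege1// ler1n.
  by rewrite natrD lerD2r.
have W : cabs (wave_factor x j H) * (dotp x x / 4) `^ (- p) =
   S * (2 `^ (a + n%:R) * vnorm x `^ (- (a + n%:R))) * cabs (cpoly H (unitv x)).
  rewrite /wave_factor !cabsM cabsX cabsN [cabs 'i](_ : _ = 1); last first.
    by rewrite cabsE /= expr0n expr1n add0r sqrtr1.
  rewrite expr1n mul1r cabs_real ger0_norm ?mulr_ge0 ?exprn_ge0 ?sqrtr_ge0//.
  rewrite (cpoly_unitv hH x0) cabsM cabs_real ger0_norm ?exprn_ge0 ?vnorm_ge0//.
  have -> : dotp x x / 4 = (vnorm x / 2) `^ 2%:R.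
    by rewrite powR_mulrn ?divr_ge0 ?vnorm_ge0// exprMn vnorm_sqr; field.
  rewrite -powRrM (_ : 2%:R * - p = - (a + n%:R) - j%:R); last by rewrite /p; field.
  rewrite powRM ?vnorm_ge0// -[2^-1 in X in _ * X]powR_inv1// -(powRrM 2 (-1)).
  rewrite (_ : -1 * (- (a + n%:R) - j%:R) = (a + n%:R) + j%:R); last by ring.
  rewrite !powRD ?(gt_eqF x0) ?pnatr_eq0 /= ?implybT//.
  rewrite powRN [vnorm x `^ (- j%:R)]powRN !powR_mulrn ?vnorm_ge0// exprVn -/S.
  by field; rewrite !expf_neq0 ?pnatr_eq0 ?gt_eqF ?powR_gt0.
move=> h; apply: (le_trans h).
have -> : (Gamma b)^-1 * cabs (wave_factor x j H) * ((dotp x x / 4) `^ (- p) * Gamma p * D ^+ N) =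
   (cabs (wave_factor x j H) * (dotp x x / 4) `^ (- p)) * (Gamma p / Gamma b) * D ^+ N by ring.
rewrite W.
apply: (@le_trans _ _ (S * (2 * r1) ^+ (k + n) * B *
    (K2 ^+ (k + n.+1) * k%:R `^ (a / 2 + n%:R + 1) * 2 ^+ (k * q + 2)) *
    (K1 ^+ (k + 2) * k%:R `^ (a / 2 + 2)))).
  apply: ler_pM => //.
  - by rewrite !mulr_ge0 ?powR_ge0 ?cabs_ge0 ?Gamma_ge0// invr_ge0 Gamma_ge0.
  - by rewrite exprn_ge0// ltW.
  apply: ler_pM => //.
  - by rewrite !mulr_ge0 ?powR_ge0 ?cabs_ge0.
  - by rewrite divr_ge0 ?Gamma_ge0.
  - apply: ler_pM => //; first by rewrite !mulr_ge0 ?powR_ge0.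
      exact: cabs_ge0.
    by rewrite ler_wpM2l.
  - by apply: (le_trans GpY); apply: ler_pM; rewrite ?powR_ge0.
rewrite natrD.
have -> : a + (n%:R + 3%:R) = (a / 2 + n%:R + 1) + (a / 2 + 2) by field.
rewrite [X in _ <= _ * (_ * X)]powRD ?(gt_eqF kR0) ?implybT//.
rewrite le_eqVlt; apply/orP; left; apply/eqP.
rewrite [(2 * r1) ^+ (k + n)]exprD [K2 ^+ (k + n.+1)]exprD [K1 ^+ _]exprD [2 ^+ (k * q + 2)]exprD.
rewrite mulnC [2 ^+ (q * k)]exprM !(exprMn k).
by ring.
Qed.

End radial_bound.

(** * The characteristic function *)

Section cexp_series.
Context {R : realType}.
Local Notation C := R[i].
Local Notation Re := (@complex.Re R).
Local Notation Im := (@complex.Im R).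

Definition cexp_part (m : nat) (w : C) : C := \sum_(k < m) (k`!%:R^-1)%:C * w ^+ k.

Lemma cabs_cexp_part m w : cabs (cexp_part m w) <= expR (cabs w).
Proof.
apply: (le_trans (cabs_sum _ _)).
under eq_bigr do rewrite cabsM cabs_real ger0_norm ?invr_ge0// cabsX.
have := @nondecreasing_cvgn_le R (fun m => \sum_(k < m) (k`!%:R^-1 * cabs w ^+ k)).
have c : (\sum_(k < m) (k`!%:R^-1 * cabs w ^+ k) @[m --> \oo]) --> expR (cabs w).
  rewrite (_ : (fun m => _) = series (exp_coeff (cabs w))); first exact: is_cvg_series_exp_coeff.
  by apply/funext => l; rewrite /series /= big_mkord; apply: eq_bigr => k _; rewrite exp_coeffE mulrC.
move=> /(_ _ _ m); rewrite (cvg_lim _ c)//; apply.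
- by apply/nondecreasing_seqP => l; rewrite big_ord_recr /= lerDl mulr_ge0 ?invr_ge0 ?exprn_ge0 ?cabs_ge0.
- exact: c.
Qed.

(* Comparison of derivatives, in place of the integral form of the Taylor remainder. *)
Lemma derive_bound (f f' g g' : R -> R) :
  (forall t : R, is_derive t (1 : R) f (f' t)) -> (forall t : R, is_derive t (1 : R) g (g' t)) ->
  f 0 = 0 -> g 0 = 0 -> (forall t, 0 <= t <= 1 -> `|f' t| <= g' t) ->
  forall t, 0 <= t <= 1 -> `|f t| <= g t.
Proof.
move=> df dg f0 g0 fg t /andP[t0 t1].
have key (h h' : R -> R) : (forall t : R, is_derive t (1 : R) h (h' t)) -> h 0 = 0 ->
    (forall t, 0 <= t <= 1 -> 0 <= h' t) -> 0 <= h t.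
  move=> dh h0 hp; have ch := continuous_is_derive dh.
  have [s st e] := MVT_segment t0 (fun x _ => dh x) (continuous_subspaceT ch).
  move: st; rewrite in_itv /= => /andP[s0 s1].
  move: e; rewrite h0 !subr0 => ->; by rewrite mulr_ge0// hp// s0 (le_trans s1).
rewrite ler_norml; apply/andP; split.
  rewrite -subr_ge0 opprK addrC; apply: (key (fun t => g t + f t) (fun t => g' t + f' t)).
  - by rewrite f0 g0 addr0.
  - by move=> s s01; have := fg s s01; rewrite ler_norml => /andP[+ _]; rewrite -lerBlDl sub0r.
rewrite -subr_ge0; apply: (key (fun t => g t - f t) (fun t => g' t - f' t)).
- by rewrite f0 g0 subr0.
- by move=> s s01; have := fg s s01; rewrite ler_norml subr_ge0 => /andP[].
Qed.

Section remainder.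
Variable w : C.
(** Taylor remainder along the segment from 0 to [w]; the real parameter [t] reduces matters to
    derivatives on the line, where [rem m.+1] has derivative [w * rem m]. *)
Let rem m (t : R) : C := cexp (t%:C * w) - \sum_(k < m) (k`!%:R^-1 * t ^+ k)%:C * w ^+ k.

Let Re_scale (a : R) (z : C) : Re (a%:C * z) = a * Re z.
Proof. by rewrite cReM /= mul0r subr0. Qed.
Let Im_scale (a : R) (z : C) : Im (a%:C * z) = a * Im z.
Proof. by rewrite cImM /= mul0r addr0. Qed.

Let is_derive_cexp (t : R) :
  is_derive t (1 : R) (fun t : R => Re (cexp (t%:C * w))) (Re (w * cexp (t%:C * w))) /\
  is_derive t (1 : R) (fun t : R => Im (cexp (t%:C * w))) (Im (w * cexp (t%:C * w))).
Proof.
have E : (fun t : R => Re (cexp (t%:C * w))) = (fun t => expR (Re w * t) * cos (Im w * t)).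
  by apply/funext => s; rewrite /cexp Re_scale Im_scale /= [s * Re w]mulrC [s * Im w]mulrC.
have E' : (fun t : R => Im (cexp (t%:C * w))) = (fun t => expR (Re w * t) * sin (Im w * t)).
  by apply/funext => s; rewrite /cexp Re_scale Im_scale /= [s * Re w]mulrC [s * Im w]mulrC.
have de : is_derive t (1 : R) (fun t : R => expR (Re w * t)) (Re w * expR (Re w * t)).
  have d1 : is_derive t (1 : R) (fun t : R => Re w * t) (Re w).
    have := is_deriveZ (Re w) (is_derive_id t (1 : R)); rewrite /GRing.scale /= mulr1.
    exact.
  have := @is_derive1_comp R (@expR R) (fun t => Re w * t) t _ _ (is_derive_expR _) d1.
  by rewrite mulrC.
rewrite E E'; split.
  apply: (is_derive_eq (is_derive_mul de (is_derive_cosM (Im w) t))).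
  by rewrite cReM /cexp Re_scale Im_scale /= [t * Re w]mulrC [t * Im w]mulrC; ring.
apply: (is_derive_eq (is_derive_mul de (is_derive_sinM (Im w) t))).
by rewrite cImM /cexp Re_scale Im_scale /= [t * Re w]mulrC [t * Im w]mulrC; ring.
Qed.

Let is_derive_poly (a : nat -> R) m (t : R) :
  is_derive t (1 : R) (fun t => \sum_(k < m) (k`!%:R^-1 * t ^+ k * a k))
    (\sum_(k < m.-1) (k`!%:R^-1 * t ^+ k * a k.+1)).
Proof.
elim: m => [|m IH] /=.
  rewrite big_ord0 (_ : (fun t => _) = cst 0); first exact: is_derive_cst.
  by apply/funext => s; rewrite big_ord0.
rewrite (_ : (fun t => _) = (fun t => \sum_(k < m) (k`!%:R^-1 * t ^+ k * a k) + (m`!%:R^-1 * a m) * t ^+ m)); last first.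
  by apply/funext => s; rewrite big_ord_recr /=; congr (_ + _); ring.
have d2 := is_deriveZ (m`!%:R^-1 * a m) (is_derive_powR_nat m t).
apply: (is_derive_eq (is_deriveD IH d2)); rewrite /GRing.scale /=.
case: m IH d2 => [|m] _ _ /=; first by rewrite mul0r mulr0 addr0.
rewrite big_ord_recr /=; congr (_ + _).
rewrite factS natrM invfM; field; rewrite nat1r !pnatr_eq0 -lt0n fact_gt0//.
Qed.

Let is_derive_rem m (t : R) :
  is_derive t (1 : R) (fun t => Re (rem m.+1 t)) (Re (w * rem m t)) /\
  is_derive t (1 : R) (fun t => Im (rem m.+1 t)) (Im (w * rem m t)).
Proof.
have [d1 d2] := is_derive_cexp t.
have sE (p : C -> R) (pD : forall z y, p (z - y) = p z - p y)
    (pS : forall (a : R) z, p (a%:C * z) = a * p z)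
    (psum : forall I (r : seq I) (F : I -> C), p (\sum_(i <- r) F i) = \sum_(i <- r) p (F i)) l s :
    p (rem l s) = p (cexp (s%:C * w)) - \sum_(k < l) (k`!%:R^-1 * s ^+ k * p (w ^+ k)).
  by rewrite /rem pD psum; congr (_ - _); apply: eq_bigr => k _; rewrite pS.
have wE (p : C -> R) (pD : forall z y, p (z - y) = p z - p y)
    (pS : forall (a : R) z, p (a%:C * z) = a * p z)
    (psum : forall I (r : seq I) (F : I -> C), p (\sum_(i <- r) F i) = \sum_(i <- r) p (F i)) :
    p (w * rem m t) = p (w * cexp (t%:C * w)) - \sum_(k < m) (k`!%:R^-1 * t ^+ k * p (w ^+ k.+1)).
  rewrite /rem mulrBr pD mulr_sumr psum; congr (_ - _); apply: eq_bigr => k _.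
  by rewrite mulrCA -exprS pS.
split.
  rewrite (_ : (fun t => _) = (fun s => Re (cexp (s%:C * w)) -
     \sum_(k < m.+1) (k`!%:R^-1 * s ^+ k * Re (w ^+ k)))); last first.
    by apply/funext => s; rewrite sE//; [exact: cReB|exact: cRe_sum].
  rewrite wE//; [|exact: cReB|exact: cRe_sum].
  exact: (is_deriveB d1 (is_derive_poly (fun k => Re (w ^+ k)) m.+1 t)).
rewrite (_ : (fun t => _) = (fun s => Im (cexp (s%:C * w)) -
   \sum_(k < m.+1) (k`!%:R^-1 * s ^+ k * Im (w ^+ k)))); last first.
  by apply/funext => s; rewrite sE//; [exact: cImB|exact: cIm_sum].
rewrite wE//; [|exact: cImB|exact: cIm_sum].
exact: (is_deriveB d2 (is_derive_poly (fun k => Im (w ^+ k)) m.+1 t)).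
Qed.

Let B := expR (cabs w).
(** The 2 in [(2 |w|)^m] pays, at each integration, for recovering the modulus from its real and
    imaginary parts. *)
Let bnd m (t : R) := B * (2 * cabs w) ^+ m / m`!%:R * t ^+ m.

Let rem_bound m t : 0 <= t <= 1 -> `|Re (rem m t)| <= bnd m t /\ `|Im (rem m t)| <= bnd m t.
Proof.
elim: m t => [|m IH] t t01.
  have h : cabs (rem 0 t) <= bnd 0 t.
    rewrite /rem big_ord0 subr0 cabs_cexp Re_scale /bnd expr0 expr0 divr1 !mulr1 ler_expR.
    have /andP[t0 t1] := t01; apply: (@le_trans _ _ (t * cabs w)).
      by rewrite ler_wpM2l// (le_trans (ler_norm _) (le_Re_cabs _)).
    by rewrite ler_piMl ?cabs_ge0.
  by split; apply: le_trans h; [exact: le_Re_cabs|exact: le_Im_cabs].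
have r0 : rem m.+1 0 = 0.
  rewrite /rem mul0r cexp0 big_ord_recl /= fact0 invr1 expr0 mulr1 big1 ?addr0; first by rewrite mul1r subrr.
  by move=> k _; rewrite /bump leq0n add1n [0 ^+ _]exprS mul0r mulr0 mul0r.
have db (s : R) : is_derive s (1 : R) (bnd m.+1) (2 * cabs w * bnd m s).
  have h := is_deriveZ (B * (2 * cabs w) ^+ m.+1 / m.+1`!%:R) (is_derive_powR_nat m.+1 s).
  apply: (is_derive_eq h); rewrite /GRing.scale /= /bnd exprS factS natrM; field.
  by rewrite nat1r !pnatr_eq0 -lt0n fact_gt0.
have b0 : bnd m.+1 0 = 0 by rewrite /bnd expr0n /= mulr0.
have wb (s : R) : 0 <= s <= 1 -> cabs (w * rem m s) <= 2 * cabs w * bnd m s.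
  move=> /IH[h1 h2]; rewrite cabsM -mulrA mulrCA ler_wpM2l ?cabs_ge0//.
  apply: (le_trans (cabs_le_ReIm _)); rewrite mulr_natl mulr2n.
  exact: lerD.
split.
  apply: (derive_bound (fun s => (is_derive_rem m s).1) db) => //; first by rewrite r0.
  by move=> s s01; apply: le_trans (wb s s01); exact: le_Re_cabs.
apply: (derive_bound (fun s => (is_derive_rem m s).2) db) => //; first by rewrite r0.
by move=> s s01; apply: le_trans (wb s s01); exact: le_Im_cabs.
Qed.

Lemma cexp_series_cvg : cabs (cexp_part m w - cexp w) @[m --> \oo] --> (0 : R).
Proof.
have h m : cabs (cexp_part m w - cexp w) <= 2 * B * expR (2 * (2 * cabs w)) * 2^-1 ^+ m.
  rewrite cabsB (_ : cexp w - cexp_part m w = rem m 1); last first.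
    rewrite /rem mul1r; congr (_ - _); apply: eq_bigr => k _.
    by rewrite expr1n mulr1.
  have [h1 h2] := @rem_bound m 1 ltac:(by rewrite ler01 lexx).
  apply: (le_trans (cabs_le_ReIm _)); apply: (le_trans (lerD h1 h2)).
  have -> : bnd m 1 + bnd m 1 = 2 * B * ((2 * cabs w) ^+ m / m`!%:R) by rewrite /bnd expr1n; ring.
  rewrite -[leRHS]mulrA ler_wpM2l ?mulr_ge0 ?expR_ge0// exprVn; apply: exprn_fact_geometric.
  by rewrite mulr_ge0 ?cabs_ge0.
apply: (squeeze_cvgr (f := fun=> 0) (h := fun m => 2 * B * expR (2 * (2 * cabs w)) * 2^-1 ^+ m)).
- by apply: nearW => m; rewrite cabs_ge0 h.
- exact: cvg_cst.
- rewrite -[X in _ --> X](mulr0 (2 * B * expR (2 * (2 * cabs w)))).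
  apply: cvgM; first exact: cvg_cst.
  by apply: cvg_expr; rewrite ger0_norm ?invr_ge0// invf_lt1// ltr1n.
Qed.

End remainder.
End cexp_series.

Section polynomial_continuity.
Import -(notations) mpoly.
Context {R : realType} {n : nat}.

Lemma cvg_polyfun (T : Type) (F : set_system T) {FF : Filter F} (p : mpoly.mpoly n R)
    (f : T -> vec R n) (v : vec R n) :
  (forall i, tnth (f t) i @[t --> F] --> tnth v i) -> polyfun p (f t) @[t --> F] --> polyfun p v.
Proof.
move=> fv; rewrite /polyfun (_ : (fun t => _) = (fun t => \sum_(m <- msupp p) mcoeff m p * \prod_i tnth (f t) i ^+ m i)).
  rewrite mevalE; elim: (msupp p) => [|m r IH].
    rewrite big_nil (_ : (fun t => _) = (fun=> 0)); first exact: cvg_cst.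
    by apply/funext => t; rewrite big_nil.
  rewrite big_cons (_ : (fun t => _) = (fun t => mcoeff m p * \prod_i tnth (f t) i ^+ m i +
    \sum_(m <- r) mcoeff m p * \prod_i tnth (f t) i ^+ m i)).
    apply: cvgD => //; apply: cvgM; first exact: cvg_cst.
    rewrite {IH}; elim: (index_enum _) => [|i s IH].
      rewrite big_nil (_ : (fun t => _) = (fun=> 1)); first exact: cvg_cst.
      by apply/funext => t; rewrite big_nil.
    rewrite big_cons (_ : (fun t => _) = (fun t => tnth (f t) i ^+ m i * \prod_(i <- s) tnth (f t) i ^+ m i)).
      apply: cvgM => //; elim: (m i) => [|k IHk].
        by rewrite expr0; exact: cvg_cst.
      by under eq_fun do rewrite exprS; rewrite exprS; apply: cvgM.
    by apply/funext => t; rewrite big_cons.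
  by apply/funext => t; rewrite big_cons.
by apply/funext => t; rewrite mevalE.
Qed.

(** The extreme value theorem, carried over to row vectors, where the sphere is a closed subset of a
    compact cube. *)
Lemma polyfun_min (p : mpoly.mpoly n R) : (0 < n)%N -> (forall u, vnorm u = 1 -> 0 < polyfun p u) ->
  exists2 k : R, 0 < k & forall u, vnorm u = 1 -> k <= polyfun p u.
Proof.
move=> n0 p0.
pose vv (M : 'rV[R]_n) : vec R n := [tuple M ord0 i | i < n].
pose A : set 'rV[R]_n := [set M | vnorm (vv M) = 1].
have cvv (i : 'I_n) : continuous (fun M : 'rV[R]_n => tnth (vv M) i).
  rewrite (_ : (fun M => _) = (fun M : 'rV[R]_n => M ord0 i)); first exact: coord_continuous.
  by apply/funext => M; rewrite tnth_mktuple.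
have cp (q : mpoly.mpoly n R) : continuous (fun M => polyfun q (vv M)).
  by move=> M; apply: (@cvg_polyfun _ (nbhs (M : 'rV[R]_n)) (nbhs_filter M)) => i; exact: cvv.
pose i0 : 'I_n := Ordinal n0.
have row_vv (u : vec R n) : vv (\row_i tnth u i) = u.
  by apply: eq_from_tnth => i; rewrite tnth_mktuple mxE.
have A0 : A !=set0.
  exists (\row_i (i == i0)%:R); rewrite /A /= /vnorm /dotp (bigD1 i0)//= big1 => [|i ii]; rewrite !tnth_mktuple !mxE.
    by rewrite eqxx mulr1 addr0 sqrtr1.
  by rewrite (negbTE ii) mul0r.
have AE : A = (fun M => polyfun (sqn R n) (vv M)) @^-1` [set 1].
  apply/seteqP; split => M /=.
    rewrite /A /= => M1; rewrite /polyfun meval_sqn.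
    have := vnorm_sqr (vv M); rewrite M1 expr1n => ->.
    by apply: eq_bigr => i _; rewrite expr2.
  rewrite /polyfun meval_sqn /A /= /vnorm => M1.
  by rewrite /dotp (_ : \sum_(i < n) _ = 1) ?sqrtr1// -M1; apply: eq_bigr => i _; rewrite expr2.
have cA : compact A.
  apply: (@subclosed_compact _ _ [set M : 'rV[R]_n | forall i, `[-1, 1]%classic (M ord0 i)]).
  - rewrite AE; apply: closed_comp; last exact: closed_eq.
    by move=> M _; exact: cp.
  - have := @rV_compact R^o n (fun _ : 'I_n => `[(-1 : R), 1]%classic).
    by apply => i; exact: segment_compact.
  - move=> M MA i /=; rewrite in_itv /= -ler_norml.
    by have := @tnth_sph R n (vv M) i MA; rewrite tnth_mktuple.
have [c] := EVT_min_rV A0 cA (continuous_subspaceT (cp p)).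
rewrite inE => Ac cmin; exists (polyfun p (vv c)); first exact: p0.
move=> u u1; have := cmin (\row_i tnth u i); rewrite row_vv; apply.
by rewrite inE /A /= row_vv.
Qed.

End polynomial_continuity.

(** * Positivity of the real part of the exponent *)

Section exponent_positivity.
Import -(notations) mpoly.
Context {R : realType} {n : nat}.
Local Notation C := R[i].
Local Notation rpol := (mpoly.mpoly n R).
Hypothesis n0 : (0 < n)%N.

Lemma Im_sint_real (h : vec R n -> R) : sph_ok (fun u => (h u)%:C) ->
  complex.Im (sint (fun u => (h u)%:C)) = 0.
Proof.
move=> okh; rewrite sph_ok_sintE// cImM /= mul0r addr0.
rewrite [X in _ * X](_ : _ = 0) ?mulr0// [X in Rintegral _ _ X](_ : _ = (fun=> 0)).
  by rewrite Rintegral_cst ?mul0r.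
by apply/funext => v; rewrite /ball_fun; case: ifP.
Qed.

Lemma sph_ok_polyfun (p : rpol) : sph_ok (fun u : vec R n => (polyfun p u)%:C).
Proof.
have := sph_ok_cpoly (complexify p).
by rewrite (_ : cpoly _ = (fun u => (polyfun p u)%:C))//; apply/funext => v; rewrite cpoly_complexify.
Qed.

Lemma dle_exists (p : mpoly.mpoly n C) : exists q, dle q p.
Proof.
exists (\max_(m <- msupp p) mdeg m)%N; apply/allP => m mp /=.
by rewrite (big_rem m mp) /= leq_maxl.
Qed.

(** A nonnegative [p] bounded by [M] satisfies [p^2 <= M p], so a zero integral makes its mean
    square zero. Bessel's inequality passes this to the harmonic components, which then vanish
    pointwise by [sph_harm_sup]. *)
Lemma polyfun_sphere_eq0 (p : rpol) : (forall u, vnorm u = 1 -> 0 <= polyfun p u) ->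
  rsint (polyfun p) = 0 -> forall u, vnorm u = 1 -> polyfun p u = 0.
Proof.
move=> p0 ip u u1.
have [q dq] := dle_exists (complexify p).
have [H [hH lH HP]] := sphere_decomposition n0 dq.
have fH v : vnorm v = 1 -> cpoly (complexify p) v = \sum_(j < q.+1) cpoly (H j) v.
  by move=> v1; exact: (HP _ (on_sphere_cvec v1)).
have okp := sph_ok_polyfun p.
have [_ [M0 hM0]] := okp.
pose M := Num.max M0 0.
have hM v : vnorm v = 1 -> polyfun p v <= M.
  move=> v1; have := hM0 v v1; rewrite cabs_real ger0_norm ?p0// => h.
  by rewrite le_max h.
have p2 : rsint (fun v => cabs (cpoly (complexify p) v) ^+ 2) <= 0.
  apply: (@le_trans _ _ (rsint (fun v => M * polyfun p v))).
    apply: le_rsint.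
    - by apply: sph_ok_cabs2; exact: sph_ok_cpoly.
    - have := sph_okZ M%:C okp.
      by rewrite (_ : (fun u => _) = (fun v => (M * polyfun p v)%:C))//; apply/funext => v; rewrite rcM.
    - move=> v v1; rewrite cpoly_complexify cabs_real ger0_norm ?p0// expr2.
      by rewrite ler_wpM2r ?p0 ?hM.
  rewrite /rsint (_ : (fun u => _) = (fun v => M%:C * (polyfun p v)%:C)); last first.
    by apply/funext => v; rewrite rcM.
  by rewrite sintZ// cRe_scale -/(rsint (polyfun p)) ip mulr0.
have [D D0 [A A1 sup]] := @sph_harm_sup R n n0.
have w0 : 0 <= rsint (fun _ : vec R n => 1) by have [] := @sint_real_ge0 R n (fun=> 1) (sph_ok_cst 1) (fun _ _ => ler01).
have Hz j : (j < q.+1)%N -> cpoly (H j) u = 0.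
  move=> jq; have [_ hle] := proj_component n0 hH lH fH jq.
  apply: cabs_eq0; apply/eqP; rewrite eq_le cabs_ge0 andbT; apply/ler_addgt0Pr => e0 e00; rewrite add0r.
  have DA : 0 < D * A ^+ j by rewrite mulr_gt0// exprn_gt0// (lt_le_trans ltr01).
  have m0 : 0 < e0 / (D * A ^+ j) by rewrite divr_gt0.
  have := sup j (H j) _ (hH j) (lH j) m0 _ u u1.
  rewrite [D * _ * _]mulrC divfK ?gt_eqF//; apply.
  by apply: (le_trans hle); apply: (le_trans p2); rewrite mulr_ge0// sqr_ge0.
have := fH u u1; rewrite cpoly_complexify big1 => [/eqP|j _]; last exact: Hz.
by rewrite rc_eq0 => /eqP.
Qed.

Definition addv (v w : vec R n) (t : R) : vec R n := [tuple tnth v i + t * tnth w i | i < n].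

Lemma dotp_addv (u v w : vec R n) t : dotp u (addv v w t) = dotp u v + t * dotp u w.
Proof.
rewrite /dotp mulr_sumr -big_split; apply: eq_bigr => i _; rewrite tnth_mktuple /=; ring.
Qed.

Lemma vnorm_addv (v w : vec R n) t : vnorm v = 1 -> vnorm w = 1 -> dotp w v = 0 ->
  vnorm (addv v w t) = Num.sqrt (1 + t ^+ 2).
Proof.
move=> v1 w1 wv; rewrite /vnorm dotp_addv ![dotp (addv _ _ _) _]dotpC !dotp_addv wv (dotpC v w) wv -!vnorm_sqr v1 w1.
by congr Num.sqrt; ring.
Qed.

Lemma cvg_unitv_addv (v w : vec R n) : vnorm v = 1 -> vnorm w = 1 -> dotp w v = 0 ->
  forall i, tnth (unitv (addv v w t)) i @[t --> (0 : R)] --> tnth v i.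
Proof.
move=> v1 w1 wv i.
have nE t := vnorm_addv t v1 w1 wv.
rewrite (_ : (fun t => _) = (fun t => (tnth v i + t * tnth w i) * (Num.sqrt (1 + t ^+ 2))^-1)); last first.
  by apply/funext => t; rewrite tnth_map nE tnth_mktuple.
have c1 : tnth v i + t * tnth w i @[t --> (0 : R)] --> tnth v i + 0 * tnth w i.
  by apply: cvgD; [exact: cvg_cst|apply: cvgM; [exact: cvg_id|exact: cvg_cst]].
have c2 : Num.sqrt (1 + t ^+ 2) @[t --> (0 : R)] --> Num.sqrt (1 + 0 ^+ 2 : R).
  apply: (@continuous_comp _ _ _ (fun t : R => 1 + t ^+ 2) (fun y : R => Num.sqrt y)); last exact: sqrt_continuous.
  by apply: cvgD; [exact: cvg_cst|rewrite expr2; apply: cvgM; exact: cvg_id].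
have := cvgM c1 (cvgV _ c2).
rewrite expr0n /= addr0 sqrtr1 mul0r addr0 invr1 mulr1; apply.
exact: oner_neq0.
Qed.

Lemma Re_Vexp_gt0 (alpha : R) (P : rpol) : 0 < alpha < 1 ->
  (forall u, vnorm u = 1 -> 0 <= polyfun P u) ->
  (exists u, vnorm u = 1 /\ polyfun P u != 0) ->
  forall u, vnorm u = 1 -> 0 < complex.Re (Vexp alpha (polyfun P) u).
Proof.
move=> alpha01 P0 [v0 [v01 Pv0]] u u1.
have a0 : 0 < alpha by case/andP: alpha01. have a1 : alpha < 1 by case/andP: alpha01.
have sgb (y : R) : `|Num.sg y| <= 1 by rewrite normr_sg; case: (y != 0).
have ok1 : sph_ok (fun v => (`|dotp u v| `^ alpha)%:C).
  rewrite (_ : (fun v => _) = (fun v => (`|dotp u v| `^ alpha * 1)%:C)); last first.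
    by apply/funext => v; rewrite mulr1.
  apply: (@sph_ok_kernel R n alpha alpha01 (fun=> 1)) => //.
  by move=> y; rewrite normr1.
have ok2 := @sph_ok_kernel R n alpha alpha01 Num.sg (measurable_sg R) sgb u u1.
have okP := sph_ok_polyfun P.
pose T := tan (pi * alpha / 2).
have okA : sph_ok (fun v => (`|dotp u v| `^ alpha * polyfun P v)%:C).
  have := sph_okM ok1 okP.
  by rewrite (_ : (fun v => _ * _) = (fun v => (`|dotp u v| `^ alpha * polyfun P v)%:C))//; apply/funext => v; rewrite rcM.
have okB : sph_ok (fun v => (T * (`|dotp u v| `^ alpha * Num.sg (dotp u v) * polyfun P v))%:C).
  have := sph_okZ T%:C (sph_okM ok2 okP).
  by rewrite (_ : (fun v => _ * _) = (fun v => (T * (`|dotp u v| `^ alpha * Num.sg (dotp u v) * polyfun P v))%:C))//; apply/funext => v; rewrite !rcM.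
have VE : complex.Re (Vexp alpha (polyfun P) u) = rsint (fun v => `|dotp u v| `^ alpha * polyfun P v).
  rewrite /Vexp (_ : (fun v => _) = (fun v => (`|dotp u v| `^ alpha * polyfun P v)%:C -
    'i * (T * (`|dotp u v| `^ alpha * Num.sg (dotp u v) * polyfun P v))%:C)); last first.
    by apply/funext => v; rewrite !rcM /T; ring.
  rewrite sintB//; last exact: sph_okZ.
  rewrite sintZ// cReB -/(rsint _) cReM [complex.Re 'i]/= [complex.Im 'i]/= mul0r mul1r.
  by rewrite Im_sint_real// sub0r opprK addr0.
pose L : rpol := \sum_(i < n) tnth u i *: mpolyX R (mnm1 i).
have LE v : polyfun L v = dotp u v.
  rewrite /polyfun /L raddf_sum; apply: eq_bigr => i _ /=.
  by rewrite mevalZ mevalXU.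
pose p2 := L ^+ 2 * P.
have p2E v : polyfun p2 v = dotp u v ^+ 2 * polyfun P v.
  by rewrite -LE /polyfun /p2 mevalM expr2 mevalM -expr2.
have p20 v : vnorm v = 1 -> 0 <= polyfun p2 v.
  by move=> v1; rewrite p2E mulr_ge0 ?sqr_ge0 ?P0.
(* On the sphere [|<u, v>| <= 1], so the square lies below the power [alpha]; the square has the
   merit of being a polynomial. *)
have le1 : rsint (polyfun p2) <= rsint (fun v => `|dotp u v| `^ alpha * polyfun P v).
  apply: le_rsint => //; first exact: sph_ok_polyfun.
  move=> v v1; rewrite p2E ler_wpM2r ?P0//.
  have := dotp_le_vnorm u v; rewrite u1 v1 mulr1; set y := `|dotp u v| => y1.
  have -> : dotp u v ^+ 2 = y `^ 2%:R by rewrite powR_mulrn ?normr_ge0// /y real_normK ?num_real.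
  have [->|y0] := eqVneq y 0; first by rewrite !powR0 ?pnatr_eq0 ?gt_eqF.
  have {}y0 : 0 < y by rewrite lt_neqAle eq_sym y0 normr_ge0.
  rewrite /powR (gt_eqF y0) ler_expR ler_wnM2r ?ln_le0//.
  by apply: (le_trans (ltW a1)); rewrite ler1n.
rewrite VE lt_neqAle; apply/andP; split; last first.
  by apply: le_trans le1; have [] := sint_real_ge0 (sph_ok_polyfun p2) p20.
apply/negP => /eqP V0.
have p2i : rsint (polyfun p2) = 0.
  apply/eqP; rewrite eq_le; apply/andP; split; first by rewrite V0.
  by have [] := sint_real_ge0 (sph_ok_polyfun p2) p20.
have z := polyfun_sphere_eq0 p20 p2i.
have uv0 : dotp u v0 = 0.
  have := z v0 v01; rewrite p2E => /eqP; rewrite mulf_eq0 (negbTE Pv0) orbF sqrf_eq0.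
  by move/eqP.
(* [P] could survive only where [<u, v> = 0]. Moving [v0] in the direction [u] leaves that
   hyperplane, and [P v0] is recovered as [t] tends to 0. *)
have Pz (t : R) : t != 0 -> polyfun P (unitv (addv v0 u t)) = 0.
  move=> t0; have nz : 0 < vnorm (addv v0 u t).
    by rewrite (vnorm_addv _ v01 u1 uv0) sqrtr_gt0 ltr_wpDr ?sqr_ge0.
  have := z _ (vnorm_unitv nz); rewrite p2E unitvE dotp_scaler dotp_addv uv0 -vnorm_sqr u1 expr1n add0r mulr1.
  move/eqP; rewrite mulf_eq0 sqrf_eq0 mulf_eq0 invr_eq0 (gt_eqF nz) (negbTE t0) /=.
  by move/eqP.
have c := @cvg_polyfun R n _ (nbhs (0 : R)) (nbhs_filter (0 : R)) P (fun t => unitv (addv v0 u t)) v0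
  (cvg_unitv_addv v01 u1 uv0).
have c' : polyfun P (unitv (addv v0 u (k.+1%:R^-1))) @[k --> \oo] --> polyfun P v0.
  exact: (cvg_comp (fun k : nat => k.+1%:R^-1 : R) (fun t => polyfun P (unitv (addv v0 u t))) (@cvg_harmonic R) c).
have : (fun k : nat => polyfun P (unitv (addv v0 u (k.+1%:R^-1)))) = (fun=> 0).
  by apply/funext => k; rewrite Pz// invr_eq0 pnatr_eq0.
move=> E; rewrite E in c'.
have := cvg_unique _ c' (cvg_cst (0 : R)); move/(_ (@Rhausdorff R)) => P00.
by rewrite P00 eqxx in Pv0.
Qed.

End exponent_positivity.

(** * Integrability of stretched exponentials *)

Section stretched_exponential.
Context {R : realType} {n : nat}.
Local Notation V := (n.-tuple R).
Hypothesis n0 : (0 < n)%N.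
Variables alpha kappa : R.
Hypothesis a0 : 0 < alpha.
Hypothesis k0 : 0 < kappa.

Let phi (t : R) := t `^ n%:R * expR (- (kappa * t `^ alpha)).

Let mstretched : measurable_fun setT (fun t : R => expR (- (kappa * t `^ alpha))).
Proof.
apply: measurableT_comp; first exact: measurable_expR.
apply: measurableT_comp; first exact: oppr_measurable.
apply: measurable_funM; first exact: measurable_cst.
exact: measurable_powR.
Qed.

Let mphi : measurable_fun setT phi.
Proof. by apply: measurable_funM => //; exact: measurable_powR. Qed.

Let phi_decay : exists2 D : R, 0 <= D & forall t, 0 < t -> phi t <= D * t `^ (- 1).
Proof.
(* Chosen so that [alpha * x = n + 1]: the exponential absorbs [t^n] and one power more. *)
pose x := (n%:R + 1) / alpha.
have x0 : 0 < x by rewrite divr_gt0// ltr_wpDl.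
exists ((2 * x) `^ x / (2 * kappa) `^ x); first by rewrite divr_ge0 ?powR_ge0.
move=> t t0; have tt : 0 <= t by exact: ltW.
have k2 : 0 < 2 * kappa by rewrite mulr_gt0.
have := @powR_le_expR R x (2 * kappa * t `^ alpha) x0.
move=> /(_ ltac:(by rewrite mulr_ge0 ?powR_ge0// ltW)).
rewrite powRM ?powR_ge0 ?(ltW k2)// -powRrM (_ : alpha * x = n%:R + 1); last first.
  by rewrite /x mulrC divfK// gt_eqF.
rewrite (_ : 2 * kappa * t `^ alpha / 2 = kappa * t `^ alpha); last by field.
move=> h; rewrite /phi.
have e0 := expR_gt0 (kappa * t `^ alpha).
have p0 : 0 < (2 * kappa) `^ x by rewrite powR_gt0.
move: h; rewrite powRD ?(gt_eqF t0) ?implybT// powRr1// => h.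
rewrite expRN powR_inv1// ler_pdivrMr//.
move: h p0 e0; move: (t `^ n%:R) ((2 * kappa) `^ x) ((2 * x) `^ x) (expR _) => y k b e h p0 e0.
have -> : b / k / t * e = (b * e) / (k * t) by rewrite invfM; ring.
by rewrite ler_pdivlMr ?mulr_gt0// mulrCA.
Qed.

Lemma integrable_stretched_exp :
  (lebn n).-integrable setT (fun v : V => (expR (- (kappa * vnorm v `^ alpha)))%:E).
Proof.
have nn : 0 < n%:R :> R by rewrite ltr0n.
have phi0 t : 0 <= phi t by rewrite mulr_ge0 ?powR_ge0 ?expR_ge0.
have [D D0 hD] := phi_decay.
have mle : measurable_fun setT (fun t : R => t <= 1).
  by apply: measurable_fun_ler; [exact: measurable_id|exact: measurable_cst].
have mge : measurable_fun setT (fun t : R => 1 <= t).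
  by apply: measurable_fun_ler; [exact: measurable_cst|exact: measurable_id].
pose h1 (t : R) := if t <= 1 then t `^ n%:R else 0.
pose h2 (t : R) := if 1 <= t then t `^ (- 1) else 0.
have mh1 : measurable_fun setT h1.
  by apply: measurable_fun_ifT => //; exact: measurable_powR.
have mh2 : measurable_fun setT h2.
  by apply: measurable_fun_ifT => //; exact: measurable_powR.
have h10 t : 0 <= h1 t by rewrite /h1; case: ifP => // _; rewrite powR_ge0.
have h20 t : 0 <= h2 t by rewrite /h2; case: ifP => // _; rewrite powR_ge0.
have fin : (haar phi < +oo)%E.
  apply: (@le_lt_trans _ _ (haar (fun t : R => (h1 t + D * h2 t)%R))).
    apply: le_haar => //.
      by apply: measurable_funD => //; apply: measurable_funM => //; exact: measurable_cst.
    move=> t t0; rewrite phi0 /=; rewrite /h1 /h2.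
    case: (leP t 1) => t1.
      apply: (@le_trans _ _ (t `^ n%:R)); last by rewrite lerDl mulr_ge0// -/(h2 t).
      by rewrite ler_piMr ?powR_ge0// -expR0 ler_expR oppr_le0 mulr_ge0 ?powR_ge0// ltW.
    by rewrite (ltW t1) add0r hD.
  rewrite haarD//; last 2 first.
  - by apply: measurable_funM => //; exact: measurable_cst.
  - by move=> t _; rewrite mulr_ge0.
  rewrite haarZ// haar_head// (haar_tail ltr01 ltr01).
  by rewrite -EFinM -EFinD ltry.
have [c c0 hc] := haar_lty_fin (fun t _ => phi0 t) fin.
have [ip _] := @ge0_integrable_polar R n n0 (fun=> 1) phi c 1 (measurable_cst _) (fun=> ler01)
  (fun _ _ => lexx _) mphi phi0 hc.
(* The polar integrand is set to 0 at the origin; the added Gaussian covers that point. *)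
have ig := @integrable_gaussn R n 1 ltr01.
apply: (le_integrable _ _ _ (integrableD measurableT ip ig)) => //.
  apply/measurable_EFinP; exact: (measurableT_comp mstretched (@measurable_vnorm R n)).
move=> v _; rewrite /= lee_fin ger0_norm ?expR_ge0//.
apply: le_trans (ler_norm _); case: ltP => v0.
  rewrite !mul1r /phi mulrAC powR_mulrn ?vnorm_ge0// divff ?expf_neq0 ?gt_eqF// mul1r.
  by rewrite lerDl expR_ge0.
have -> : vnorm v = 0 by apply/eqP; rewrite eq_le v0 vnorm_ge0.
rewrite powR0 ?gt_eqF// mulr0 oppr0 add0r ler_expR oppr_ge0 mul1r.
by rewrite -vnorm_sqr; have -> : vnorm v = 0; [apply/eqP; rewrite eq_le v0 vnorm_ge0|rewrite expr0n].
Qed.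

End stretched_exponential.

Section characteristic_function.
Import -(notations) mpoly.
Context {R : realType} {n : nat}.
Local Notation C := R[i].
Local Notation V := (n.-tuple R).
Local Notation cpol := (mpoly.mpoly n R[i]).
Hypothesis n0 : (0 < n)%N.
Variables (alpha : R) (P : mpoly.mpoly n R) (Q : cpol).
Hypothesis alpha01 : 0 < alpha < 1.
Hypothesis P0 : forall u, vnorm u = 1 -> 0 <= polyfun P u.
Hypothesis Pneq0 : exists u, vnorm u = 1 /\ polyfun P u != 0.
Hypothesis VQ : forall u, vnorm u = 1 -> Vexp alpha (polyfun P) u = cpoly Q u.
Let a0 : 0 < alpha. Proof. by case/andP: alpha01. Qed.
Lemma hatmuE z : hatmu alpha (polyfun P) z = cexp (- ((vnorm z `^ alpha)%:C * cpoly Q (unitv z))).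
Proof.
rewrite /hatmu; case: (ltP 0 (vnorm z)) => z0; first by rewrite VQ// vnorm_unitv.
have -> : vnorm z = 0 by apply/eqP; rewrite eq_le z0 vnorm_ge0.
by rewrite powR0 ?gt_eqF// !mul0r.
Qed.

Lemma cmeasurable_exponent :
  cmeasurable (fun z : V => (vnorm z `^ alpha)%:C * cpoly Q (unitv z)).
Proof.
apply: cmeasurableM; last exact: (cmeasurable_unitv (cmeasurable_cpoly Q)).
apply: cmeasurable_real; apply: (measurableT_comp (measurable_powR _)).
exact: measurable_vnorm.
Qed.

Lemma cmeasurable_hatmu : cmeasurable (hatmu alpha (polyfun P) : V -> C).
Proof.
rewrite (_ : hatmu _ _ = (fun z => cexp (- ((vnorm z `^ alpha)%:C * cpoly Q (unitv z))))).
  by apply: cmeasurable_cexp; apply: cmeasurableN; exact: cmeasurable_exponent.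
by apply/funext => z; exact: hatmuE.
Qed.

Lemma cabs_hatmu_le : exists2 kappa : R, 0 < kappa &
  forall z : V, cabs (hatmu alpha (polyfun P) z) <= expR (- (kappa * vnorm z `^ alpha)).
Proof.
have ReQ u : vnorm u = 1 -> 0 < polyfun (poly_re Q) u.
  move=> u1; have := Re_Vexp_gt0 n0 alpha01 P0 Pneq0 u1.
  by rewrite VQ// cpoly_split.
have [k k0 hk] := polyfun_min n0 ReQ.
exists k => // z; rewrite hatmuE cabs_cexp cReN cRe_scale ler_expR lerN2 mulrC.
case: (ltP 0 (vnorm z)) => z0.
  by rewrite ler_wpM2l ?powR_ge0// cpoly_split /= hk// vnorm_unitv.
have -> : vnorm z = 0 by apply/eqP; rewrite eq_le z0 vnorm_ge0.
by rewrite powR0 ?gt_eqF// !mul0r.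
Qed.

Lemma integrable_cabs_hatmu :
  (lebn n).-integrable setT (fun z : V => (cabs (hatmu alpha (polyfun P) z))%:E).
Proof.
have [k k0 hk] := cabs_hatmu_le.
apply: cintegrable_cabs; apply: le_cintegrable (integrable_stretched_exp n0 a0 k0) hk.
exact: cmeasurable_hatmu.
Qed.

Lemma iint_cabs_hatmu :
  (iint (fun z : vec R n => (cabs (hatmu alpha (polyfun P) z))%:E) < +oo)%E.
Proof.
have /integrableP[m] := integrable_cabs_hatmu.
rewrite ge0_iintE//; last by move=> v; rewrite lee_fin cabs_ge0.
by under eq_integral do rewrite gee0_abs ?lee_fin ?cabs_ge0//.
Qed.

End characteristic_function.

(** * The density series *)

Section complex_limits.
Context {R : realType}.
Local Notation C := R[i].
Implicit Types (u v : nat -> C) (l : C).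

Definition ccvg u l := cabs (u i - l) @[i --> \oo] --> (0 : R).

Lemma ccvg_squeeze u l (b : nat -> R) : (forall i, cabs (u i - l) <= b i) ->
  (b i @[i --> \oo] --> (0 : R)) -> ccvg u l.
Proof.
move=> h b0; apply: (squeeze_cvgr (f := fun=> 0) (h := b)) => //; last exact: cvg_cst.
by apply: nearW => i; rewrite cabs_ge0 h.
Qed.

Lemma ccvg_cst l : ccvg (fun=> l) l.
Proof. by rewrite /ccvg subrr cabs0; exact: cvg_cst. Qed.

Lemma ccvgD u v l1 l2 : ccvg u l1 -> ccvg v l2 -> ccvg (fun i => u i + v i) (l1 + l2).
Proof.
move=> h1 h2; apply: (@ccvg_squeeze _ _ (fun i => cabs (u i - l1) + cabs (v i - l2))).
  by move=> i; rewrite opprD addrACA cabsD.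
by rewrite -[X in _ --> X](addr0 0); exact: cvgD.
Qed.

Lemma ccvgZ u l (c : C) : ccvg u l -> ccvg (fun i => c * u i) (c * l).
Proof.
move=> h; apply: (@ccvg_squeeze _ _ (fun i => cabs c * cabs (u i - l))).
  by move=> i; rewrite -mulrBr cabsM.
by rewrite -[X in _ --> X](mulr0 (cabs c)); apply: cvgM => //; exact: cvg_cst.
Qed.

Lemma ccvgN u l : ccvg u l -> ccvg (fun i => - u i) (- l).
Proof. by move=> /(ccvgZ (-1)); rewrite mulN1r; under eq_fun do rewrite mulN1r. Qed.

Lemma ccvg_sum I (r : seq I) (F : I -> nat -> C) (l : I -> C) :
  (forall k, ccvg (F k) (l k)) -> ccvg (fun i => \sum_(k <- r) F k i) (\sum_(k <- r) l k).
Proof.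
move=> h; elim: r => [|k r IH].
  by rewrite big_nil; under eq_fun do rewrite big_nil; exact: ccvg_cst.
by rewrite big_cons; under eq_fun do rewrite big_cons; exact: ccvgD.
Qed.

Lemma ccvg_cabs_le u l (b : nat -> R) B : ccvg u l -> (b i @[i --> \oo] --> B) ->
  (forall i, cabs (u i) <= b i) -> cabs l <= B.
Proof.
move=> h hb le; rewrite -[B]addr0.
have hs : b i + cabs (u i - l) @[i --> \oo] --> B + 0 by exact: cvgD.
apply: (cvgr_to_ge hs).
apply: nearW => i; rewrite -[l in leLHS](subKr (u i)).
by apply: (le_trans (cabsD _ _)); rewrite cabsN lerD.
Qed.

Lemma geometric_sum_le (th : R) m k : 0 < th < 1 -> \sum_(m <= i < k) th ^+ i <= th ^+ m / (1 - th).
Proof.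
move=> /andP[t0 t1]; have t1' : 0 < 1 - th by rewrite subr_gt0.
rewrite ler_pdivlMr//; case: (leqP m k) => mk; last first.
  by rewrite big_geq ?(ltnW mk)// mul0r exprn_ge0// ltW.
suff -> : (\sum_(m <= i < k) th ^+ i) * (1 - th) = th ^+ m - th ^+ k by rewrite gerBl exprn_ge0// ltW.
rewrite -[RHS]opprB -(telescope_sumr _ mk) mulr_suml -sumrN; apply: eq_bigr => i _.
by rewrite exprS; ring.
Qed.

End complex_limits.

(** * Removal of the regularisation *)

Section inversion.
Import -(notations) mpoly.
Context {R : realType} {n : nat}.
Local Notation C := R[i].
Local Notation V := (n.-tuple R).
Local Notation cpol := (mpoly.mpoly n R[i]).
Hypothesis n2 : (2 <= n)%N.
Variables (alpha : R) (q : nat) (P : mpoly.mpoly n R) (Q : cpol).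
Hypothesis alpha01 : 0 < alpha < 1.
Hypothesis P0 : forall u, vnorm u = 1 -> 0 <= polyfun P u.
Hypothesis Pneq0 : exists u, vnorm u = 1 /\ polyfun P u != 0.
Hypothesis VQ : forall u, vnorm u = 1 -> Vexp alpha (polyfun P) u = cpoly Q u.
Hypothesis dQ : dle q Q.
Let a0 : 0 < alpha. Proof. by case/andP: alpha01. Qed.
Let n0 : (0 < n)%N. Proof. exact: leq_trans n2. Qed.

(** [w z] is the exponent [|z|^alpha V(u_z)] with [V] already replaced by the polynomial [Q].
    [regular] is the regularised Fourier integral of [hatmu], and [moment k] is the integral of the
    [k]-th power that its exponential series calls for. *)
Let w (z : V) : C := (vnorm z `^ alpha)%:C * cpoly Q (unitv z).
Let wave (x : vec R n) (e : R) (z : V) : C :=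
  (expR (- (e * dotp z z)))%:C * cexp (- ('i * (dotp x z)%:C)).
Let moment k x e : C := cintegral (lebn n) (fun z => w z ^+ k * wave x e z).
Let regular x e : C := cintegral (lebn n) (fun z => cexp (- w z) * wave x e z).

Let Qbound : exists2 M : R, 1 <= M & forall u : vec R n, vnorm u = 1 -> cabs (cpoly Q u) <= M.
Proof.
have [_ [M hM]] := sph_ok_cpoly Q; exists (Num.max M 1); first by rewrite le_max lexx orbT.
by move=> u /hM h; rewrite le_max h.
Qed.

Let cabs_wave x e z : cabs (wave x e z) = expR (- (e * dotp z z)).
Proof.
rewrite /wave cabsM cabs_real ger0_norm ?expR_ge0// cabs_cexp cReN cReM /=.
by rewrite mul0r mulr0 subr0 oppr0 expR0 mulr1.
Qed.

Let cmeasurable_wave' x e : cmeasurable (wave x e).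
Proof.
apply: cmeasurableM; last exact: cmeasurable_wave.
by apply: cmeasurable_real; exact: measurable_gaussn.
Qed.

Let cmeasurable_w : cmeasurable w.
Proof. exact: cmeasurable_exponent. Qed.

Let cabs_w_le (M : R) : (forall u : vec R n, vnorm u = 1 -> cabs (cpoly Q u) <= M) ->
  forall z, cabs (w z) <= M * vnorm z `^ alpha.
Proof.
move=> hM z; rewrite /w cabsM cabs_real ger0_norm ?powR_ge0// mulrC.
case: (ltP 0 (vnorm z)) => z0.
  by rewrite ler_wpM2r ?powR_ge0// hM// vnorm_unitv.
have -> : vnorm z = 0 by apply/eqP; rewrite eq_le z0 vnorm_ge0.
by rewrite powR0 ?gt_eqF// !mulr0.
Qed.

(** The exponent grows at most linearly, and completing the square absorbs a linear term in half of
    the Gaussian. This majorises all partial sums of the exponential series at once. *)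
Let exponent_gauss e : 0 < e -> exists2 D : R, 0 <= D &
  forall z, expR (cabs (w z)) * expR (- (e * dotp z z)) <= D * expR (- (e / 2 * dotp z z)).
Proof.
move=> e0; have [M M1 hM] := Qbound.
exists (expR (M + M ^+ 2 / (2 * e))); first exact: expR_ge0.
move=> z; rewrite -!expRD ler_expR.
have h1 := cabs_w_le hM z.
have r0 := vnorm_ge0 z; rewrite -vnorm_sqr.
have h2 : vnorm z `^ alpha <= 1 + vnorm z.
  case: (leP (vnorm z) 1) => r1.
    apply: (@le_trans _ _ 1); last by rewrite lerDl.
    have <- : 1 `^ alpha = 1 :> R by rewrite powR1.
    by rewrite ge0_ler_powR ?nnegrE// ltW.
  apply: (@le_trans _ _ (vnorm z)); last by rewrite lerDr.
  rewrite -[leRHS](powRr1 r0) ler_powR//; first exact: ltW.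
  by case/andP: alpha01 => _ /ltW.
have h3 : M * vnorm z `^ alpha <= M + M * vnorm z.
  by rewrite -[X in X + _]mulr1 -mulrDr ler_wpM2l// (le_trans ler01).
have h4 : M * vnorm z <= M ^+ 2 / (2 * e) + e / 2 * vnorm z ^+ 2.
  rewrite -subr_ge0 (_ : _ - _ = (M - e * vnorm z) ^+ 2 / (2 * e)).
    by rewrite divr_ge0 ?sqr_ge0// mulr_ge0// ltW.
  by field; rewrite gt_eqF.
have -> : - (e / 2 * vnorm z ^+ 2) = e / 2 * vnorm z ^+ 2 - e * vnorm z ^+ 2 by field.
rewrite addrA lerD2r; apply: (le_trans h1); apply: (le_trans h3).
by rewrite -addrA lerD2l.
Qed.

Let cintegrable_exponential (f : V -> C) (B e : R) x : 0 < e -> 0 <= B -> cmeasurable f ->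
  (forall z, cabs (f z) <= B * expR (cabs (w z))) -> cintegrable (lebn n) (fun z => f z * wave x e z).
Proof.
move=> e0 B0 mf hf; have [D D0 hD] := exponent_gauss e0.
have e2 : 0 < e / 2 by rewrite divr_gt0.
have ig := integrableZl measurableT (B * D) (integrable_gaussn (n := n) e2).
apply: (@le_cintegrable _ _ _ _ _ (fun z => B * D * expR (- (e / 2 * dotp z z))) _ ig).
  exact: cmeasurableM.
move=> z; rewrite cabsM cabs_wave -mulrA; apply: le_trans (ler_wpM2l B0 (hD z)).
by rewrite mulrA ler_wpM2r ?expR_ge0.
Qed.

Let cintegrable_moment k x e : 0 < e -> cintegrable (lebn n) (fun z => w z ^+ k * wave x e z).
Proof.
move=> e0; apply: (@cintegrable_exponential _ k`!%:R) => //; first exact: cmeasurableX.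
move=> z; rewrite cabsX mulrC -ler_pdivrMr ?ltr0n ?fact_gt0//.
by apply: exprn_fact_le; exact: cabs_ge0.
Qed.

Let coef k : C := ((-1) ^+ k / k`!%:R : R)%:C.

Let cexp_part_w m z : cexp_part m (- w z) = \sum_(k < m) coef k * w z ^+ k.
Proof.
apply: eq_bigr => k _; rewrite /coef [(- w z) ^+ k]exprNn mulrA; congr (_ * _).
by rewrite mulrC rcM rcX rcN.
Qed.

Lemma regular_series x e : 0 < e ->
  ccvg (fun m => \sum_(k < m) coef k * moment k x e) (regular x e).
Proof.
move=> e0; have [D D0 hD] := exponent_gauss e0.
have e2 : 0 < e / 2 by rewrite divr_gt0.
have ig := integrableZl measurableT D (integrable_gaussn (n := n) e2).
rewrite (_ : (fun m => \sum_(k < m) _) = (fun m => cintegral (lebn n) (fun z => cexp_part m (- w z) * wave x e z))).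
  rewrite /ccvg /regular.
  apply: (cdominated_convergence _ _ _ ig).
  - move=> m; apply: cmeasurableM => //; rewrite /cexp_part.
    by apply: cmeasurable_sum => k; apply: cmeasurableM; [exact: cmeasurable_cst|apply: cmeasurableX; exact: cmeasurableN].
  - by apply: cmeasurableM => //; apply: cmeasurable_cexp; exact: cmeasurableN.
  - move=> z; under eq_fun do rewrite -mulrBl mulrC.
    have := ccvgZ (wave x e z) (@cexp_series_cvg R (- w z)).
    by rewrite /ccvg; under eq_fun do rewrite -mulrBr.
  - move=> m z; rewrite cabsM cabs_wave; apply: le_trans (hD z).
    by rewrite ler_wpM2r ?expR_ge0// -[X in _ <= expR X](cabsN (w z)) cabs_cexp_part.
apply/funext => m.
rewrite (_ : (fun z => cexp_part m (- w z) * wave x e z) =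
  (fun z => \sum_(k < m) coef k * (w z ^+ k * wave x e z))).
  rewrite cintegral_sum => [|k]; last by apply: cintegrableZ; exact: cintegrable_moment.
  by apply: eq_bigr => k _; rewrite cintegralZ//; exact: cintegrable_moment.
by apply/funext => z; rewrite cexp_part_w mulr_suml; apply: eq_bigr => k _; rewrite mulrA.
Qed.

(** For [k = 0] the moment is the Fourier transform of the regularising Gaussian itself, which
    concentrates at the origin as [e] tends to 0 and disappears elsewhere. *)
Lemma moment0_cvg x : 0 < vnorm x -> ccvg (fun i => moment 0 x (i.+1%:R^-1)) 0.
Proof.
move=> x0.
have mE i : moment 0 x (i.+1%:R^-1) =
    ((Num.sqrt (pi / i.+1%:R^-1)) ^+ n * expR (- (dotp x x / (4 * i.+1%:R^-1))))%:C.
  rewrite -gint1 ?invr_gt0// /gint /moment; apply: eq_cintegral => z.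
  by rewrite expr0 /gfun cpoly1.
pose c := dotp x x / 4.
have c0 : 0 < c by rewrite divr_gt0// -vnorm_sqr exprn_gt0.
(* One power more than [I^n] is taken from the exponential, which leaves the rate [1 / I]. *)
pose K := Num.sqrt pi ^+ n * (n.+1%:R ^+ n.+1 / c ^+ n.+1) : R.
apply: (@ccvg_squeeze _ _ _ (fun i => K * i.+1%:R^-1)); last first.
  by rewrite -[X in _ --> X](mulr0 K); apply: cvgM; [exact: cvg_cst|exact: cvg_harmonic].
move=> i; rewrite subr0 mE cabs_real ger0_norm ?mulr_ge0 ?exprn_ge0 ?sqrtr_ge0 ?expR_ge0//.
rewrite invrK invfM invrK (mulrA (dotp x x)) -/c.
have I1 : 1 <= i.+1%:R :> R by rewrite ler1n.
move: (i.+1%:R : R) I1 => I I1; have I0 : 0 < I by exact: lt_le_trans I1.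
rewrite sqrtrM ?pi_ge0// exprMn /K -!(mulrA (Num.sqrt pi ^+ n)) ler_wpM2l ?exprn_ge0 ?sqrtr_ge0//.
apply: (@le_trans _ _ (I ^+ n * expR (- (c * I)))).
  rewrite ler_wpM2r ?expR_ge0// lerXn2r ?nnegrE ?sqrtr_ge0 ?(ltW I0)//.
  by rewrite -[leRHS]ger0_norm ?(ltW I0)// -sqrtr_sqr ler_sqrt ?sqr_ge0// expr2 ler_peMr// ltW.
have := @exprn_le_expR R (c * I) n.+1; rewrite mulr_ge0 ?(ltW c0) ?(ltW I0)// => /(_ isT).
rewrite exprMn => h.
rewrite expRN ler_pdivrMr ?expR_gt0//.
move: (expR_gt0 (c * I)) (exprn_gt0 n.+1 c0) h.
move: (expR _) (c ^+ _) (n.+1%:R ^+ _) => E y b E0 y0; rewrite [I ^+ n.+1]exprS => h.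
have -> : b / y / I * E = (b * E) / (y * I) by rewrite invfM; ring.
by rewrite ler_pdivlMr ?mulr_gt0// mulrC -mulrA.
Qed.

Section decomposition.
Variable H : nat -> nat -> cpol.
Hypothesis hH : forall k j, homog j (H k j).
Hypothesis lH : forall k j, lap (H k j) = 0.
Hypothesis fH : forall k u, vnorm u = 1 -> cpoly Q u ^+ k = \sum_(j < (k * q).+1) cpoly (H k j) u.

Let w_rfun k x e z : (0 < k)%N ->
  w z ^+ k * wave x e z = \sum_(j < (k * q).+1) rfun x (H k j) (k%:R * alpha) e z.
Proof.
move=> k0; rewrite /rfun -mulr_suml -mulr_sumr; congr (_ * _).
rewrite /w exprMn -rcX -powR_exprn ?vnorm_ge0//.
case: (ltP 0 (vnorm z)) => z0.
  rewrite fH ?vnorm_unitv//; congr (_%:C * _).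
  by rewrite -powR_mulrn ?vnorm_ge0// -powRrM.
have -> : vnorm z = 0 by apply/eqP; rewrite eq_le z0 vnorm_ge0.
by rewrite expr0n gtn_eqF// !powR0 ?gt_eqF ?mulr_gt0 ?ltr0n// !mul0r.
Qed.

Let momentE k x e : (0 < k)%N -> 0 < e -> moment k x e =
  \sum_(j < (k * q).+1) cintegral (lebn n) (rfun x (H k j) (k%:R * alpha) e).
Proof.
move=> k0 e0; rewrite -cintegral_sum => [|j].
  by apply: eq_cintegral => z; exact: w_rfun.
by apply: cintegrable_rfun => //; rewrite mulr_gt0 ?ltr0n.
Qed.

(** [Q^k] is at most [M^k] on the sphere, Bessel's inequality passes this to the components in mean
    square, and the sup bound costs [A^j] with [j <= k q]; so the growth stays geometric in [k]. *)
Let Hbound : exists2 B : R, 0 <= B & exists2 A : R, 1 <= A & forall k j u, (j <= k * q)%N ->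
  vnorm u = 1 -> cabs (cpoly (H k j) u) <= B * A ^+ k.
Proof.
have [M M1 hM] := Qbound.
have [D D0 [A A1 sup]] := @sph_harm_sup R n n0.
have M0 : 0 < M by exact: lt_le_trans M1.
exists D; first exact: ltW.
exists (A ^+ q * M); first by rewrite -[leLHS]mulr1 ler_pM// exprn_ege1.
move=> k j u jk u1; have jk' : (j < (k * q).+1)%N by [].
have [_ le2] := proj_component n0 (hH k) (lH k) (fH k) jk'.
apply: (@le_trans _ _ (D * A ^+ j * M ^+ k)).
  apply: sup => //; first by rewrite exprn_gt0.
  apply: (le_trans le2).
  have -> : (M ^+ k) ^+ 2 * rsint (fun _ : vec R n => 1) = rsint (fun _ : vec R n => (M ^+ k) ^+ 2).
    rewrite /rsint (_ : (fun _ : vec R n => ((M ^+ k) ^+ 2)%:C) = (fun _ => ((M ^+ k) ^+ 2)%:C * 1%:C)).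
      by rewrite sintZ ?cRe_scale//; exact: sph_ok_cst.
    by apply/funext => v; rewrite mulr1.
  apply: le_rsint; last 2 first.
  - exact: sph_ok_cst.
  - move=> v v1; rewrite cabsX lerXn2r ?nnegrE ?exprn_ge0 ?cabs_ge0 ?(ltW M0)//.
    by rewrite lerXn2r ?nnegrE ?cabs_ge0 ?(ltW M0)// hM.
  - by apply: sph_ok_cabs2; apply: sph_okX; exact: sph_ok_cpoly.
rewrite -mulrA ler_wpM2l ?(ltW D0)// exprMn ler_wpM2r ?exprn_ge0 ?(ltW M0)//.
by rewrite -exprM; apply: ler_weXn2l => //; rewrite mulnC.
Qed.

Let scale : C := ((2 * pi) `^ (- n%:R) : R)%:C.

Let term_bound r : 0 < r -> exists2 K : R, 0 <= K & exists2 th : R, 0 < th < 1 &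
  forall k x e, (0 < k)%N -> r <= vnorm x -> 0 < e ->
    cabs (scale * (coef k * moment k x e)) <= K * th ^+ k.
Proof.
move=> r0; have [B B0 [A A1 hB]] := Hbound.
have [K1 K10 [G G1 [E hE]]] := rfun_uniform_bound n2 q alpha01 r0.
have AG : 1 <= A * G by rewrite -[leLHS]mulr1 ler_pM.
(* [E.+1] because the number of components, [k q + 1], is at most [(q + 1) k] and so contributes one
   more power of [k]. *)
have [K K0 [th th01 hth]] := powR_fact_geometric E.+1 alpha01 AG.
have p0 : 0 <= (2 * pi) `^ (- n%:R) :> R by rewrite powR_ge0.
pose S := (2 * pi) `^ (- n%:R) * (q.+1%:R * B * K1) : R.
have S0 : 0 <= S by rewrite !mulr_ge0.
exists (S * K); first exact: mulr_ge0.
exists th => // k x e k0 rx e0.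
have x0 : 0 < vnorm x by exact: lt_le_trans rx.
have kf : 0 <= k`!%:R^-1 :> R by rewrite invr_ge0.
have Y0 : 0 <= K1 * G ^+ k * k%:R `^ (k%:R * alpha + E%:R).
  by rewrite !mulr_ge0 ?powR_ge0 ?exprn_ge0// (le_trans ler01).
have m : cabs (moment k x e) <= (k * q).+1%:R * (B * A ^+ k * (K1 * G ^+ k * k%:R `^ (k%:R * alpha + E%:R))).
  rewrite momentE//; apply: (le_trans (cabs_sum _ _)).
  set b := B * _ * _; apply: (@le_trans _ _ (\sum_(j < (k * q).+1) b)); last first.
    by rewrite sumr_const card_ord mulr_natl.
  apply: ler_sum => j _.
  have jq : (j <= k * q)%N by rewrite -ltnS; exact: ltn_ord.
  by apply: (hE k j _ x _ e k0 jq (hH k j) (lH k j) rx _ e0); apply: hB => //; rewrite vnorm_unitv.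
rewrite cabsM cabs_real ger0_norm// cabsM cabs_real normrM normrX normrN1 expr1n mul1r ger0_norm//.
apply: (@le_trans _ _ (S * ((A * G) ^+ k * k%:R `^ (k%:R * alpha + E.+1%:R) / k`!%:R))); last first.
  by rewrite -(mulrA S) ler_wpM2l// hth.
rewrite /S -[leRHS]mulrA ler_wpM2l//.
apply: (le_trans (ler_wpM2l kf m)).
have -> : k%:R `^ (k%:R * alpha + E.+1%:R) = k%:R * k%:R `^ (k%:R * alpha + E%:R) :> R.
  rewrite -natr1 addrA powRD; last by rewrite pnatr_eq0 gtn_eqF// implybT.
  by rewrite powRr1// mulrC.
have kq : (k * q).+1%:R <= q.+1%:R * k%:R :> R by rewrite -natrM ler_nat mulSn [(q * k)%N]mulnC -add1n leq_add2r.
rewrite exprMn; set Z := k%:R `^ _.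
have Z0 : 0 <= B * A ^+ k * (K1 * G ^+ k * Z) / k`!%:R.
  by rewrite (mulr_ge0 (mulr_ge0 (mulr_ge0 _ _) _))// exprn_ge0// (le_trans ler01).
apply: (@le_trans _ _ ((q.+1%:R * k%:R) * (B * A ^+ k * (K1 * G ^+ k * Z) / k`!%:R))).
  by rewrite [leLHS]mulrC -[leLHS]mulrA ler_wpM2r.
rewrite le_eqVlt; apply/orP; left; apply/eqP; ring.
Qed.

(** Brings together the constants of Fourier inversion, of the exponential series and of
    [rfun_limit_value], to give the one in [term]. *)
Let const_eq (y : R) k : 0 < y ->
  (2 * pi) `^ (- n%:R) * ((-1) ^+ k / k`!%:R *
   (pi `^ (n%:R / 2) * 2 `^ (k%:R * alpha + n%:R) * y `^ (- (k%:R * alpha + n%:R)))) =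
  (- 2 `^ alpha) ^+ k * pi `^ (- (n%:R / 2)) / (k`!%:R * y `^ (k%:R * alpha + n%:R)).
Proof.
move=> y0; have p0 := pi_gt0 R.
have h2 : (2 : R) != 0 by rewrite pnatr_eq0.
rewrite [(- (2 `^ alpha)) ^+ k]exprNn (_ : (2 `^ alpha) ^+ k = 2 `^ (k%:R * alpha)); last first.
  by rewrite -powR_exprn// -powR_mulrn// -powRrM.
rewrite powRM ?(ltW p0)// (_ : 2 `^ (k%:R * alpha + n%:R) = 2 `^ (k%:R * alpha) * 2 `^ n%:R); last first.
  by rewrite powRD// h2 implybT.
have e : pi `^ (- n%:R) * pi `^ (n%:R / 2) = pi `^ (- (n%:R / 2)) :> R.
  rewrite -powRD; last by rewrite (gt_eqF p0) implybT.
  by congr (_ `^ _); field.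
rewrite -e !(powRN _ n%:R) (powRN y).
have : 2 `^ n%:R != 0 :> R by rewrite gt_eqF// powR_gt0.
have : y `^ (k%:R * alpha + n%:R) != 0 by rewrite gt_eqF// powR_gt0.
have : pi `^ n%:R != 0 :> R by rewrite gt_eqF// powR_gt0.
have : k`!%:R != 0 :> R by rewrite pnatr_eq0 -lt0n fact_gt0.
move: (y `^ _) (2 `^ _) (2 `^ _) (pi `^ _) (pi `^ _) (k`!%:R : R) ((-1) ^+ k) => u v1 v2 s1 s2 f g.
by move=> f0 s0 u0 v0; field; rewrite f0 s0 u0 v0.
Qed.

Let term_cvg k x : (0 < k)%N -> 0 < vnorm x ->
  ccvg (fun i => scale * (coef k * moment k x (i.+1%:R^-1))) (term alpha q (polyfun P) k x).
Proof.
move=> k0 x0; have ka : 0 < k%:R * alpha by rewrite mulr_gt0 ?ltr0n.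
have fV u : vnorm u = 1 -> Vexp alpha (polyfun P) u ^+ k = \sum_(j < (k * q).+1) cpoly (H k j) u.
  by move=> u1; rewrite VQ// fH.
pose K := pi `^ (n%:R / 2) * 2 `^ (k%:R * alpha + n%:R) * vnorm x `^ (- (k%:R * alpha + n%:R)) : R.
pose g (j : nat) := Gamma ((j%:R + k%:R * alpha + n%:R) / 2) * rGamma ((j%:R - k%:R * alpha) / 2).
have -> : term alpha q (polyfun P) k x = scale * (coef k *
    (\sum_(j < (k * q).+1) (K * g j)%:C * ((- 'i) ^+ j * cpoly (H k j) (unitv x)))).
  have assoc (a b c s : C) : a * (b * c) * s = a * (b * (c * s)) by ring.
  rewrite /term -const_eq// -/K [(_ * (_ * K))%:C]rcM [(_ * K)%:C]rcM assoc; congr (_ * (_ * _)).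
  rewrite mulr_sumr; apply: eq_bigr => j _; rewrite (rcM K) -mulrA; congr (_ * (_ * _)).
  have jk : (j < (k * q).+1)%N by [].
  have [pE _] := proj_component n0 (hH k) (lH k) fV jk.
  by rewrite /Sjk pE ?vnorm_unitv.
do 2!apply: ccvgZ.
rewrite (_ : (fun i => _) = (fun i => \sum_(j < (k * q).+1)
    cintegral (lebn n) (rfun x (H k j) (k%:R * alpha) (i.+1%:R^-1)))); last first.
  by apply/funext => i; rewrite momentE// invr_gt0.
apply: ccvg_sum => j.
have := rfun_cvg n0 x0 (hH k j) (lH k j) ka (lag_order_gt ka) (fun i => _ : 0 < i.+1%:R^-1) (@cvg_harmonic R).
rewrite rfun_limit_value//; apply.
by move=> i; rewrite invr_gt0.
Qed.

Let ei i : R := i.+1%:R^-1.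
Let ei0 i : 0 < ei i. Proof. by rewrite invr_gt0. Qed.

Let cabs_term_le r : 0 < r -> exists2 K : R, 0 <= K & exists2 th : R, 0 < th < 1 &
  [/\ forall k x e, (0 < k)%N -> r <= vnorm x -> 0 < e ->
        cabs (scale * (coef k * moment k x e)) <= K * th ^+ k &
      forall k x, (0 < k)%N -> r <= vnorm x -> cabs (term alpha q (polyfun P) k x) <= K * th ^+ k].
Proof.
move=> r0; have [K K0 [th th01 h]] := term_bound r0.
exists K => //; exists th => //; split => // k x k0 rx.
have x0 : 0 < vnorm x by exact: lt_le_trans rx.
apply: (ccvg_cabs_le (term_cvg k0 x0) (cvg_cst _)) => i.
by apply: h => //; exact: ei0.
Qed.

(** The modulus of [hatmu] is itself the majorant under which the regularising factor tends to 1. *)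
Let density_cvg x : ccvg (fun i => scale * regular x (ei i)) (density alpha (polyfun P) x).
Proof.
rewrite /density; apply: ccvgZ.
have mh := cmeasurable_hatmu alpha01 VQ.
have ih := integrable_cabs_hatmu n0 alpha01 P0 Pneq0 VQ.
pose f (z : V) : C := cexp (- ('i * (dotp x z)%:C)) * hatmu alpha (polyfun P) z.
have cw z : cabs (cexp (- ('i * (dotp x z)%:C))) = 1.
  by rewrite cabs_cexp cReN cReM /= mul0r mulr0 subr0 oppr0 expR0.
have mf : cmeasurable f by apply: cmeasurableM => //; exact: cmeasurable_wave.
have [if1 if2] : cintegrable (lebn n) f.
  by apply: (le_cintegrable mf ih) => z; rewrite cabsM cw mul1r.
rewrite (_ : cint _ = cintegral (lebn n) f); last first.
  by rewrite /cint /cintegral /Rint /Rintegral -(iintE if1) -(iintE if2).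
rewrite /ccvg /regular; apply: (cdominated_convergence _ _ _ ih) => //.
- move=> i; apply: cmeasurableM => //.
  by apply: cmeasurable_cexp; apply: cmeasurableN.
- move=> z.
  have E i : cexp (- w z) * wave x (ei i) z = f z * (expR (- (ei i * dotp z z)))%:C.
    by rewrite /f /wave (hatmuE alpha01 VQ) -/(w z); ring.
  have c : ccvg (fun i => (expR (- (ei i * dotp z z)))%:C) 1.
    apply: (@ccvg_squeeze _ _ _ (fun i => ei i * dotp z z)).
      move=> i; rewrite -rcB cabs_real distrC ger0_norm.
        by rewrite lerBlDl -lerBlDr; exact: expR_ge1Dx.
      by rewrite subr_ge0 -[leRHS]expR0 ler_expR oppr_le0 mulr_ge0 ?dotp_ge0// ltW.
    rewrite -[X in _ --> X](mul0r (dotp z z)); apply: cvgM; last exact: cvg_cst.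
    exact: cvg_harmonic.
  by have := ccvgZ (f z) c; rewrite mulr1 /ccvg; under eq_fun do rewrite -E.
- move=> i z; rewrite cabsM cabs_wave (hatmuE alpha01 VQ) -/(w z) ler_piMr ?cabs_ge0//.
  by rewrite -[leRHS]expR0 ler_expR oppr_le0 mulr_ge0 ?dotp_ge0// ltW.
Qed.

(** One geometric bound, uniform in [|x| >= r], carries both convergence claims. The tail of the
    regularised series is bounded independently of [e], so the number of terms may go to infinity
    first and [e] to 0 afterwards. *)
Lemma density_partial_sum r : 0 < r -> exists2 K : R, 0 <= K & exists2 th : R, 0 < th < 1 &
  (forall k x, (0 < k)%N -> r <= vnorm x -> cabs (term alpha q (polyfun P) k x) <= K * th ^+ k) /\
  forall N x, r <= vnorm x -> cabs (density alpha (polyfun P) x -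
    \sum_(1 <= k < N.+1) term alpha q (polyfun P) k x) <= K * (th ^+ N.+1 / (1 - th)).
Proof.
move=> r0; have [K K0 [th th01 [h1 h2]]] := cabs_term_le r0.
exists K => //; exists th => //; split=> // N x rx.
have x0 : 0 < vnorm x by exact: lt_le_trans rx.
pose T k i := scale * (coef k * moment k x (ei i)).
have c1 : ccvg (fun i => scale * regular x (ei i) - \sum_(1 <= k < N.+1) T k i)
    (density alpha (polyfun P) x - \sum_(1 <= k < N.+1) term alpha q (polyfun P) k x).
  apply: ccvgD; first exact: density_cvg.
  apply: ccvgN; rewrite big_add1 /=.
  rewrite (_ : (fun i => _) = (fun i => \sum_(0 <= k < N) T k.+1 i)); last first.
    by apply/funext => i; rewrite big_add1.
  by apply: ccvg_sum => k; exact: term_cvg.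
have c0 : cabs (T 0 i) @[i --> \oo] --> (0 : R).
  have := ccvgZ scale (ccvgZ (coef 0) (moment0_cvg x0)).
  by rewrite !mulr0 /ccvg; under eq_fun do rewrite subr0.
have c2 : K * (th ^+ N.+1 / (1 - th)) + cabs (T 0 i) @[i --> \oo] --> K * (th ^+ N.+1 / (1 - th)) + 0.
  by apply: cvgD => //; exact: cvg_cst.
rewrite -[leRHS]addr0; apply: (ccvg_cabs_le c1 c2) => i.
(* The partial sums are shifted by [N + 1] so that each contains all terms up to [N]; subtracting
   the terms from 1 to [N] leaves the tail and the term of index 0. *)
have c3 : ccvg (fun m => \sum_(k < m + N.+1) T k i - \sum_(1 <= k < N.+1) T k i)
    (scale * regular x (ei i) - \sum_(1 <= k < N.+1) T k i).
  apply: ccvgD; last exact: ccvg_cst.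
  have := ccvgZ scale (regular_series x (ei0 i)).
  rewrite /ccvg -(cvg_shiftn N.+1).
  under eq_fun do rewrite mulr_sumr.
  exact.
apply: (ccvg_cabs_le c3 (cvg_cst _)) => m.
rewrite -(big_mkord xpredT (T^~ i)) (@big_cat_nat _ _ _ N.+1) ?leq_addl//=.
rewrite big_ltn// [_ + _ + _]addrAC addrK addrC.
apply: (le_trans (cabsD _ _)); rewrite lerD2r.
apply: (le_trans (cabs_sum _ _)).
apply: (@le_trans _ _ (\sum_(N.+1 <= k < m + N.+1) K * th ^+ k)).
  rewrite big_seq_cond [leRHS]big_seq_cond; apply: ler_sum => k; rewrite mem_index_iota andbT => /andP[Nk _].
  by apply: h1 => //; exact: leq_trans Nk.
by rewrite -mulr_sumr ler_wpM2l// geometric_sum_le.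
Qed.

End decomposition.
End inversion.

Section components.
Import -(notations) mpoly.
Context {R : realType} {n : nat}.

Lemma harmonic_components (q : nat) (Q : mpoly.mpoly n R[i]) : (0 < n)%N -> dle q Q ->
  exists H : nat -> nat -> mpoly.mpoly n R[i],
  [/\ forall k j, homog j (H k j), forall k j, lap (H k j) = 0 &
      forall k u, vnorm u = 1 -> cpoly Q u ^+ k = \sum_(j < (k * q).+1) cpoly (H k j) u].
Proof.
move=> n0 dQ.
have ex k : exists H : nat -> mpoly.mpoly n R[i], [/\ forall j, homog j (H j), forall j, lap (H j) = 0 &
    forall u, vnorm u = 1 -> cpoly Q u ^+ k = \sum_(j < (k * q).+1) cpoly (H j) u].
  have [H [h1 h2 h3]] := sphere_decomposition n0 (dleX k dQ); exists H; split => // u u1.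
  by rewrite -cpolyX_nat; exact: (h3 _ (on_sphere_cvec u1)).
have [H hH] := choice ex.
by exists H; split => [k|k|k]; have [] := hH k.
Qed.

End components.

Theorem theorem4p1 (R : realType) (d : nat) (alpha : R) (q : nat)
    (P : mpoly.mpoly d R) :
  (2 <= d)%N -> 0 < alpha < 1 ->
  (* P is (the restriction to the sphere of) a polynomial of degree <= q *)
  deg_le q P ->
  (* lambda = P omega is a (nonnegative) measure *)
  (forall u : vec R d, vnorm u = 1 -> 0 <= polyfun P u) ->
  (* P <> 0 as an element of P_{q,d} (i.e. on the sphere) *)
  (exists u : vec R d, vnorm u = 1 /\ polyfun P u != 0) ->
  [/\ (* hat mu is integrable on R^d *)
      (iint (fun z : vec R d => (cabs (hatmu alpha (polyfun P) z))%:E) < +oo)%E,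
      (* the series converges to the density at every x <> 0 *)
      (forall x : vec R d, x != [tuple of nseq d 0] ->
         (fun n : nat => cabs (density alpha (polyfun P) x -
              \sum_(1 <= k < n.+1) term alpha q (polyfun P) k x)) @ \oo --> (0 : R))
    & (* absolute and uniform convergence on {|x| >= r} *)
      (forall r : R, 0 < r -> forall eps : R, 0 < eps ->
         exists N : nat, forall m n : nat, (N <= m)%N ->
           forall x : vec R d, r <= vnorm x ->
             \sum_(m <= k < n) cabs (term alpha q (polyfun P) k x) <= eps)].
Proof.
move=> d2 alpha01 dP P0 Pneq0.
have d0 : (0 < d)%N by exact: leq_trans d2.
have [Q [dQ VQ]] := Vexp_polynomial d0 alpha01 dP.
have [H [hH lH fH]] := harmonic_components d0 dQ.
have main := density_partial_sum d2 alpha01 P0 Pneq0 VQ hH lH fH.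
have pow0 (K th : R) : 0 < th < 1 -> K * (th ^+ N / (1 - th)) @[N --> \oo] --> (0 : R).
  move=> /andP[t0 t1]; have -> : 0 = K * (0 / (1 - th)) by rewrite mul0r mulr0.
  apply: cvgM; first exact: cvg_cst.
  by apply: cvgM; [apply: cvg_expr; rewrite ger0_norm// ltW|exact: cvg_cst].
split.
- exact: (iint_cabs_hatmu d0 alpha01 P0 Pneq0 VQ).
- move=> x xn0.
  have x0 : 0 < vnorm x by rewrite ltNge; apply: contra xn0 => /vnorm_le0 ->.
  have [K K0 [th th01 [_ h]]] := main _ x0.
  apply: (squeeze_cvgr (f := fun=> 0) (h := fun N => K * (th ^+ N.+1 / (1 - th)))).
  + by apply: nearW => N; rewrite cabs_ge0 h.
  + exact: cvg_cst.
  + by rewrite (cvg_shiftS (fun N => K * (th ^+ N / (1 - th)))); exact: pow0.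
- move=> r r0 eps eps0; have [K K0 [th th01 [h _]]] := main _ r0.
  have /cvgrPdist_le/(_ _ eps0)[N0 _ hN] := pow0 K th th01.
  (* The successor keeps [m] positive, as the bound [h] on the terms starts at [k = 1]. *)
  exists N0.+1 => m n mN x rx.
  have m0 : (0 < m)%N by exact: leq_trans mN.
  apply: (@le_trans _ _ (\sum_(m <= k < n) K * th ^+ k)).
    rewrite big_seq_cond [leRHS]big_seq_cond; apply: ler_sum => k.
    by rewrite mem_index_iota andbT => /andP[mk _]; apply: h => //; exact: leq_trans mk.
  rewrite -mulr_sumr; apply: le_trans (ler_wpM2l K0 (geometric_sum_le m n th01)) _.
  have := hN m (ltnW mN); rewrite /= sub0r normrN; apply: le_trans.
  exact: ler_norm.
Qed.
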